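(* Let $d\in\mathbb N$, let $\Omega\subset\mathbb R^d$ be an open bounded Lipschitz domain and let $T>0$. Assume that: (1) $\rho\in C^1([0,T],L^\infty(\Omega))\cap C([0,T],H^1(\Omega))$ with $0<\underline\rho_0\le\rho(t,x)\le\underline\rho_1<\infty$ and $|\partial_t\rho(t,x)|\le\underline\rho_1'<\infty$; (2) $\eta\in C([0,T],L^\infty(\Omega))$ with $0<\underline\eta_0\le\eta(t,x)\le\underline\eta_1<\infty$; (3) $\kappa\in C^1([0,T],L^\infty(\Omega))$ with $0<\underline\kappa_0\le\kappa(t,x)\le\underline\kappa_1<\infty$ and $|\partial_t\kappa(t,x)|\le\underline\kappa_1'<\infty$; (4) $f:\mathbb R\to\mathbb R$ is Lipschitz continuous with constant $L_f$; (5) $\tilde u_0\in H^1_0(\Omega)$ and $\omega\in H^1_0(\Omega)$; (6) $p\in C([0,T],L^2(\Omega))$, and the function $\underline\omega(t):=\left(p(t),\frac{\omega}{\rho(t)}\right)$ satisfies $\underline\omega\in C([0,T])$ and $\underline\omega(t)\ne0$ for all $t\in[0,T]$; put $\underline\omega_m:=\min_{t\in[0,T]}|\underline\omega(t)|>0$; (7) $m\in H^1((0,T])$; (8) there is a positive constant $\zeta<1$ such that $$\|p\|_{\mathcal X}^2\,\frac{M^2\,\underline\eta_1^2}{4\,\underline\omega_m^2\,\underline\eta_0\,\underline\rho_0}<\zeta,\qquad M:=\sup_{t\in[0,T]}\left\|\nabla\left(\frac{\omega}{\rho(t)}\right)\right\|,\quad \mathcal X:=C([0,T],L^2(\Omega)).$$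 Then there exists a unique couple $\{u,h\}$ with $$u\in C([0,T],H^1_0(\Omega)),\qquad \partial_tu\in L^2((0,T),H^1_0(\Omega)),\qquad h\in L^2(0,T),$$ such that $u(0,\cdot)=\tilde u_0$ and, for a.a. $t\in(0,T)$, $$(\partial_t(\rho(t)u(t)),\varphi)+(\eta(t)\nabla\partial_tu(t),\nabla\varphi)+(\kappa(t)\nabla u(t),\nabla\varphi)=h(t)(p(t),\varphi)+(f(u(t)),\varphi)\quad\text{for all }\varphi\in H^1_0(\Omega),$$ with $$h(t)=\frac1{\underline\omega(t)}\left[m'(t)+\left(u(t),\frac{\omega\,\partial_t\rho(t)}{\rho(t)}\right)+\left(\eta(t)\nabla\partial_tu(t),\nabla\left(\frac{\omega}{\rho(t)}\right)\right)+\left(\kappa(t)\nabla u(t),\nabla\left(\frac{\omega}{\rho(t)}\right)\right)-\left(f(u(t)),\frac{\omega}{\rho(t)}\right)\right].$$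
   Context: $(\cdot,\cdot)$ is the $L^2(\Omega)$ inner product (for scalar or vector functions) and $\|\cdot\|$ the associated norm. The bounds $\underline\rho_0,\underline\rho_1,\underline\rho_1',\underline\eta_0,\underline\eta_1,\underline\kappa_0,\underline\kappa_1,\underline\kappa_1'$ are constants, and the pointwise bounds hold for all $t\in[0,T]$ and a.e. $x\in\Omega$. Condition (8) includes that $M<\infty$. $f(u(t))$ denotes the composition $x\mapsto f(u(t,x))$. This is the weak formulation of the inverse problem of finding $u,h$ with $\partial_t(\rho u)-\nabla\cdot(\eta\nabla\partial_tu)-\nabla\cdot(\kappa\nabla u)=f(u)+p\,h$ in $(0,T)\times\Omega$, $u=0$ on $(0,T)\times\partial\Omega$, $u(0)=\tilde u_0$, from the measurement $\int_\Omega u(t,x)\omega(x)\,dx=m(t)$. *)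

(* Defs.v *)
From HB Require Import structures.
From mathcomp Require Import all_boot all_order all_algebra.
From mathcomp Require Import all_classical all_reals all_analysis.

Set Implicit Arguments.
Unset Strict Implicit.
Unset Printing Implicit Defensive.

Import Order.TTheory GRing.Theory Num.Theory.
Import numFieldNormedType.Exports.

Local Open Scope classical_set_scope.
Local Open Scope ring_scope.

(* R^n is 'rV[R]_n; its sigma-algebra is generated by the coordinates, which
   is the Borel one. *)
Section measurable_rV.
Context {R : realType} (n : nat).

Definition rV_coord (i : 'I_n) (x : 'rV[R]_n) : R := x 0 i.

Let rV_set0 : g_sigma_preimage rV_coord set0.
Proof. exact: sigma_algebra0. Qed.

Let rV_setC A : g_sigma_preimage rV_coord A -> g_sigma_preimage rV_coord (~` A).
Proof. exact: sigma_algebraC. Qed.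

Let rV_bigcup (F : (set 'rV[R]_n)^nat) :
  (forall i, g_sigma_preimage rV_coord (F i)) ->
  g_sigma_preimage rV_coord (\bigcup_i (F i)).
Proof. exact: sigma_algebra_bigcup. Qed.

HB.instance Definition _ := @isMeasurable.Build default_measure_display
  'rV[R]_n (g_sigma_preimage rV_coord) rV_set0 rV_setC rV_bigcup.

Lemma measurable_rV_coord i : measurable_fun setT (rV_coord i).
Proof.
move=> _ Y mY; rewrite setTI; apply: sub_sigma_algebra => /=.
rewrite -bigcup_seq/=; exists i => /=; first by rewrite mem_index_enum.
by exists Y => //; rewrite setTI.
Qed.

Lemma measurable_fun_rVP d (T : measurableType d) (f : T -> 'rV[R]_n) :
  (forall i, measurable_fun setT (rV_coord i \o f)) -> measurable_fun setT f.
Proof.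
move=> mf _ A mA; rewrite setTI.
pose C := [set B | measurable (f @^-1` B)].
suff : g_sigma_preimage rV_coord `<=` C by apply.
apply: smallest_sub.
  split => [|B CB|F CF]; rewrite /C/=.
  - by rewrite preimage_set0; exact: measurable0.
  - by rewrite setTD -preimage_setC; exact: measurableC.
  - by rewrite preimage_bigcup; apply: bigcupT_measurable.
rewrite -bigcup_seq => B [i _ [D mD <-]]; rewrite /C /= setTI.
by rewrite -comp_preimage -[X in measurable X]setTI; exact: mf.
Qed.

End measurable_rV.

Section rV_cons.
Context {R : realType} (n : nat).

Definition rV_cons (p : R * 'rV[R]_n) : 'rV[R]_n.+1 :=
  row_mx (p.1%:M : 'rV[R]_1) p.2.

Definition rV_uncons (x : 'rV[R]_n.+1) : R * 'rV[R]_n :=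
  (x 0 0, rsubmx (x : 'rV[R]_(1 + n))).

Lemma rV_consK : cancel rV_cons rV_uncons.
Proof.
move=> [t x]; rewrite /rV_cons /rV_uncons/= row_mxKr; congr pair.
transitivity ((t%:M : 'rV[R]_1) 0 0); last by rewrite mxE eqxx mulr1n.
rewrite -[RHS](row_mxEl _ x); congr (fun_of_matrix _ _ _); exact/val_inj.
Qed.

Lemma measurable_rV_cons : measurable_fun setT rV_cons.
Proof.
apply: measurable_fun_rVP => i.
have [j ->|j ->] := split_ordP (i : 'I_(1 + n)).
  rewrite (_ : _ \o _ = fst) //; apply/funext => -[t x] /=.
  rewrite /rV_coord /rV_cons [LHS](row_mxEl _ (x : 'rV[R]_n)).
  by rewrite mxE (ord1 j) eqxx mulr1n.
rewrite (_ : _ \o _ = rV_coord j \o snd); last first.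
  by apply/funext => -[t x] /=; rewrite /rV_coord [LHS](row_mxEr _ (x : 'rV[R]_n)).
by apply: measurableT_comp => //; exact: measurable_rV_coord.
Qed.

Lemma measurable_rV_uncons : measurable_fun setT rV_uncons.
Proof.
apply: measurable_fun_pair => /=; first exact: measurable_rV_coord.
apply: measurable_fun_rVP => i.
rewrite (_ : _ \o _ = rV_coord (rshift 1 i)).
  exact: measurable_rV_coord.
by apply/funext => x; rewrite /= /rV_coord mxE.
Qed.

HB.instance Definition _ := isMeasurableFun.Build _ _ _ _
  rV_cons measurable_rV_cons.

Variable m : {sigma_finite_measure set 'rV[R]_n -> \bar R}.

Definition lebesgue_rVS : set 'rV[R]_n.+1 -> \bar R :=
  pushforward (lebesgue_measure \x m)%E rV_cons.

Let lebesgue_rVS0 : lebesgue_rVS set0 = 0%E.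
Proof. apply: measure0. exact: measurable_rV_cons. Qed.

Let lebesgue_rVS_ge0 A : (0 <= lebesgue_rVS A)%E.
Proof. by apply: measure_ge0; exact: measurable_rV_cons. Qed.

Let lebesgue_rVS_sigma_additive : semi_sigma_additive lebesgue_rVS.
Proof. by apply: measure_semi_sigma_additive; exact: measurable_rV_cons. Qed.

HB.instance Definition _ := isMeasure.Build _ _ _ lebesgue_rVS
  lebesgue_rVS0 lebesgue_rVS_ge0 lebesgue_rVS_sigma_additive.

Let lebesgue_rVS_sigma_finite : sigma_finite setT lebesgue_rVS.
Proof.
have /sigma_finiteP[F [TF ndF Foo]] := sigma_finiteT (@lebesgue_measure R).
have /sigma_finiteP[G [TG ndG Goo]] := sigma_finiteT m.
exists (fun k => rV_uncons @^-1` (F k `*` G k)) => [|k].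
  rewrite -preimage_bigcup (_ : \bigcup_k _ = setT) ?preimage_setT//.
  apply/seteqP; split => // -[t x] _.
  have [k _ Fkt] : (\bigcup_k F k) t by rewrite -TF.
  have [l _ Glx] : (\bigcup_k G k) x by rewrite -TG.
  exists (maxn k l) => //; split => /=.
  - by apply: (subsetPset _ _ (ndF _ _ (leq_maxl k l))).
  - by apply: (subsetPset _ _ (ndG _ _ (leq_maxr k l))).
have [mF Fkoo] := Foo k; have [mG Gkoo] := Goo k; split.
  rewrite -[X in measurable X]setTI; apply: measurable_rV_uncons => //.
  exact: measurableX.
rewrite /lebesgue_rVS /pushforward -comp_preimage.
rewrite (_ : _ \o _ = id); last by apply/funext => x; exact: rV_consK.
rewrite preimage_id product_measure1E//.
by rewrite lte_mul_pinfty// ge0_fin_numE.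
Qed.

HB.instance Definition _ := Measure_isSigmaFinite.Build _ _ _ lebesgue_rVS
  lebesgue_rVS_sigma_finite.

End rV_cons.

Fixpoint lebesgue_rV {R : realType} (n : nat) :
    {sigma_finite_measure set 'rV[R]_n -> \bar R} :=
  match n return {sigma_finite_measure set 'rV[R]_n -> \bar R} with
  | 0 => \d_(0 : 'rV[R]_0)
  | n'.+1 => lebesgue_rVS (lebesgue_rV n')
  end.

Lemma lebesgue_rV_box {R : realType} (n : nat) (a b : 'rV[R]_n) :
  (forall i, a 0 i <= b 0 i) ->
  lebesgue_rV n [set x | forall i, a 0 i < x 0 i <= b 0 i] =
  (\prod_(i < n) (b 0 i - a 0 i))%:E.
Proof.
elim: n a b => [|n IHn] a b ab.
  rewrite big_ord0 /= diracE (_ : _ \in _) //.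
  by rewrite inE /= => -[].
pose a' : 'rV[R]_n := \row_i a 0 (lift ord0 i).
pose b' : 'rV[R]_n := \row_i b 0 (lift ord0 i).
pose B := [set x : 'rV[R]_n | forall i, a' 0 i < x 0 i <= b' 0 i].
have cons0 (t : R) (x : 'rV[R]_n) : rV_cons (t, x) 0 ord0 = t.
  by have [] := rV_consK (t, x).
have consS (t : R) (x : 'rV[R]_n) i : rV_cons (t, x) 0 (lift ord0 i) = x 0 i.
  rewrite /rV_cons -[RHS](row_mxEr (t%:M : 'rV[R]_1) x).
  by congr (fun_of_matrix _ _ _); exact/val_inj.
have mB : measurable B.
  rewrite (_ : B = \bigcap_(i in [set: 'I_n])
      (rV_coord i @^-1` `]a' 0 i, b' 0 i]%classic)).
    apply: fin_bigcap_measurable => // i _.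
    by rewrite -[X in measurable X]setTI; exact: measurable_rV_coord.
  apply/seteqP; split => x /= Bx i; first by move=> _; rewrite /= in_itv/=.
  by have := Bx i Logic.I; rewrite /= in_itv.
rewrite /= /lebesgue_rVS /pushforward.
rewrite (_ : _ @^-1` _ = `]a 0 ord0, b 0 ord0]%classic `*` B); last first.
  apply/seteqP; split => -[t x] /=.
    move=> tx; split; first by have := tx ord0; rewrite cons0 in_itv.
    by move=> i; have := tx (lift ord0 i); rewrite consS /a' /b' !mxE.
  rewrite in_itv/= => -[tab xB] i.
  case: (unliftP ord0 i) => [j ->|->]; last by rewrite cons0.
  by rewrite consS; have := xB j; rewrite !mxE.
rewrite product_measure1E// [X in (_ * X)%E]IHn; last first.
  by move=> i; rewrite !mxE.
rewrite [X in (X * _)%E](lebesgue_measure_itv `]a 0 ord0, b 0 ord0])/= lte_fin.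
rewrite big_ord_recl EFinM.
rewrite (eq_bigr (fun i => b 0 (lift ord0 i) - a 0 (lift ord0 i))); last first.
  by move=> i _; rewrite !mxE.
have := ab ord0; rewrite le_eqVlt => /orP[/eqP ->|->]; last by rewrite EFinB.
by rewrite ltxx subrr.
Qed.

Section functions_on_domain.
Context {R : realType} {d : nat}.
Notation fct := ('rV[R]_d -> R).
Notation mu := (lebesgue_rV d).
Implicit Types (Omega : set 'rV[R]_d) (f g : fct) (G H : 'I_d -> fct).

(* Near each boundary point, after the rotation Q, Omega is the part of the
   space strictly above the graph of gamma in the direction of the axis j. *)
Definition lipschitz_domain Omega :=
  [/\ open Omega, bounded_set Omega, connected Omega, Omega !=set0 &
    forall x0, (closure Omega `\` Omega) x0 ->
    exists (r : R) (Q : 'M[R]_d) (j : 'I_d) (gamma : 'rV[R]_d.-1 -> R) (k : R),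
    [/\ 0 < r, Q *m Q^T = 1%:M, k.-lipschitz gamma &
      forall x, ball x0 r x ->
        (Omega x <-> gamma (col' j (x *m Q)) < (x *m Q) 0 j)]].

(* Functions are representatives: elements of L^p(Omega) and of the Sobolev
   spaces are real functions considered up to almost everywhere equality on
   Omega, so the norms below are seminorms. *)
Definition inner Omega f g : R := \int[mu]_(x in Omega) (f x * g x).

Definition innerv Omega G H : R :=
  \int[mu]_(x in Omega) \sum_(i < d) G i x * H i x.

End functions_on_domain.

Definition Lp_norm {R : realType} {disp} {T : measurableType disp}
    (mu : {measure set T -> \bar R}) (p : \bar R) (D : set T) (f : T -> R) :
    \bar R := 'N[mu]_p [EFin \o (f \_ D)].

Definition in_Lp {R : realType} {disp} {T : measurableType disp}
    (mu : {measure set T -> \bar R}) (p : \bar R) (D : set T) (f : T -> R) :=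
  measurable_fun D f /\ (Lp_norm mu p D f < +oo)%E.

(* Being differentiable everywhere, for all iterated directional derivatives,
   is being C^oo. *)
Definition smooth {R : realType} {V : normedModType R} (f : V -> R) :=
  forall (s : seq V) (x : V),
    differentiable (foldr (fun v g => 'D_v g) f s : V -> R) x.

Definition test_function {R : realType} {V : normedModType R} (D : set V)
    (phi : V -> R) :=
  [/\ smooth phi, compact (closure [set x | phi x != 0]) &
      closure [set x | phi x != 0] `<=` D].

Section sobolev.
Context {R : realType} {d : nat}.
Notation fct := ('rV[R]_d -> R).
Notation mu := (lebesgue_rV d).
Variable Omega : set 'rV[R]_d.
Implicit Types (f g : fct) (G : 'I_d -> fct).

Definition Lp_normv G : \bar R :=
  Lp_norm mu 2%:E Omega (fun x => Num.sqrt (\sum_(i < d) G i x ^+ 2)).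

Definition in_L1loc f := measurable_fun Omega f /\
  forall K, compact K -> K `<=` Omega -> mu.-integrable K (EFin \o f).

Definition weak_partial (i : 'I_d) f g :=
  [/\ in_L1loc f, in_L1loc g & forall phi, test_function Omega phi ->
    \int[mu]_(x in Omega) (f x * 'D_(delta_mx 0 i) phi x) =
    - \int[mu]_(x in Omega) (g x * phi x)].

(* Weak partial derivatives are unique up to almost everywhere equality on
   Omega, so the choice made here is immaterial; 0 is only a default value for
   functions that have no locally integrable weak derivative. *)
Definition grad f : 'I_d -> fct :=
  fun i => xget (cst 0) [set g | weak_partial i f g].

Definition in_H1 f := in_Lp mu 2%:E Omega f /\
  forall i, exists2 g, in_Lp mu 2%:E Omega g & weak_partial i f g.

Definition H1_norm f : \bar R := Lp_norm mu 2%:E Omega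
  (fun x => Num.sqrt (f x ^+ 2 + \sum_(i < d) grad f i x ^+ 2)).

Definition in_H10 f := in_H1 f /\
  exists phi : nat -> fct, (forall n, test_function Omega (phi n)) /\
    (fun n => H1_norm (f - phi n)) @ \oo --> 0%E.

End sobolev.

(* A seminormed space carried by a subset of E; snorm is only meaningful on
   scarrier. *)
Record snspace (R : realType) (E : lmodType R) :=
  SNSpace { scarrier : set E ; snorm : E -> \bar R }.

Section spaces.
Context {R : realType} {d : nat} (Omega : set 'rV[R]_d).
Notation mu := (lebesgue_rV d).

Definition L2_space : snspace ('rV[R]_d -> R) :=
  SNSpace (in_Lp mu 2%:E Omega) (Lp_norm mu 2%:E Omega).

Definition Loo_space : snspace ('rV[R]_d -> R) :=
  SNSpace (in_Lp mu +oo Omega) (Lp_norm mu +oo Omega).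

Definition H1_space : snspace ('rV[R]_d -> R) :=
  SNSpace (in_H1 Omega) (H1_norm Omega).

Definition H10_space : snspace ('rV[R]_d -> R) :=
  SNSpace (in_H10 Omega) (H1_norm Omega).

End spaces.

Section vector_valued.
Context {R : realType} {E : lmodType R} (T : R) (X : snspace E).
Notation leb := (@lebesgue_measure R).
Implicit Types (u v : R -> E) (J : E).

Definition in_C0 u := (forall t, t \in `[0, T] -> scarrier X (u t)) /\
  forall t, t \in `[0, T] ->
    snorm X (u s - u t) @[s --> within [set` `[0, T]] (nbhs t)] --> 0%E.

(* u is in C^1([0, T], X) with derivative u' (one-sided at 0 and T). *)
Definition in_C1 u u' := [/\ in_C0 u, in_C0 u' & forall t, t \in `[0, T] ->
  snorm X ((s - t)^-1 *: (u s - u t) - u' t)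
    @[s --> within ([set` `[0, T]] `\ t) (nbhs t)] --> 0%E].

Definition simple_with_integral u J :=
  exists (n : nat) (A : 'I_n -> set R) (c : 'I_n -> E),
  [/\ forall i, [/\ measurable (A i), A i `<=` `]0, T[ & scarrier X (c i)],
      u = (fun t => \sum_(i < n) \1_(A i) t *: c i) &
      J = \sum_(i < n) fine (leb (A i)) *: c i].

(* J is the Bochner integral in X of u over (0, T): u is a limit of simple
   functions s n, with integrals j n, both almost everywhere and in L^1. *)
Definition bochner_integral u J := scarrier X J /\
  exists (s : nat -> R -> E) (j : nat -> E),
  [/\ forall n, simple_with_integral (s n) (j n),
      {ae leb, forall t, t \in `]0, T[ -> scarrier X (u t) /\
        snorm X (u t - s n t) @[n --> \oo] --> 0%E},
      (\int[leb]_(t in `]0%R, T[) snorm X (u t - s n t))%E @[n --> \oo] --> 0%E &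
      snorm X (J - j n) @[n --> \oo] --> 0%E].

Definition in_L2_bochner u :=
  [/\ {ae leb, forall t, t \in `]0, T[ -> scarrier X (u t)},
      exists (s : nat -> R -> E) (j : nat -> E),
        (forall n, simple_with_integral (s n) (j n)) /\
        {ae leb, forall t, t \in `]0, T[ ->
          snorm X (u t - s n t) @[n --> \oo] --> 0%E} &
      (\int[leb]_(t in `]0%R, T[) (snorm X (u t) ^+ 2) < +oo)%E].

(* v is the distributional time derivative of u on (0, T), with values in X:
   both sides of the integration by parts formula are the same Bochner
   integral J. *)
Definition weak_time_derivative u v :=
  forall psi : R -> R, test_function [set` `]0, T[] psi -> exists J,
    bochner_integral (fun t => 'D_1 psi t *: u t) J /\
    bochner_integral (fun t => - psi t *: v t) J.

End vector_valued.

Definition in_H1_time {R : realType} (T : R) (m m' : R -> R) :=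
  [/\ in_Lp lebesgue_measure 2%:E [set` `]0, T[] m,
      in_Lp lebesgue_measure 2%:E [set` `]0, T[] m' &
      forall psi : R -> R, test_function [set` `]0, T[] psi ->
        \int[lebesgue_measure]_(t in `]0, T[) (m t * 'D_1 psi t) =
        - \int[lebesgue_measure]_(t in `]0, T[) (m' t * psi t)].

Section inverse_problem.
Context {R : realType} {d : nat} (Omega : set 'rV[R]_d) (T : R).
Notation mu := (lebesgue_rV d).
Notation fct := ('rV[R]_d -> R).

Definition weight (rho : R -> fct) (omega : fct) (t : R) : fct :=
  fun x => omega x / rho t x.

Definition pairing (p rho : R -> fct) (omega : fct) (t : R) : R :=
  inner Omega (p t) (weight rho omega t).

(* A minimum as soon as the pairing is continuous on [0, T]. *)
Definition min_abs_pairing (p rho : R -> fct) (omega : fct) : R :=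
  inf [set `|pairing p rho omega t| | t in [set` `[0, T]]].

(* The weak gradient of omega / rho(t) is only required to be locally
   integrable, so that its L^2 norm may a priori be infinite. *)
Definition sup_grad_weight (rho : R -> fct) (omega : fct) : \bar R :=
  ereal_sup [set Lp_normv Omega (grad Omega (weight rho omega t)) |
             t in [set` `[0, T]]].

Definition C0_L2_norm (p : R -> fct) : \bar R :=
  ereal_sup [set Lp_norm mu 2%:E Omega (p t) | t in [set` `[0, T]]].

(* The derivatives du and drhou of u and of rho u are determined up to almost
   everywhere equality by weak_time_derivative. *)
Definition weak_solution (rho rho' eta kappa : R -> fct) (f : R -> R)
    (u0 omega : fct) (p : R -> fct) (m' : R -> R)
    (u : R -> fct) (h : R -> R) :=
  [/\ in_C0 T (H10_space Omega) u,
      in_Lp lebesgue_measure 2%:E [set` `]0, T[] h,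
      {ae mu, forall x, Omega x -> u 0 x = u0 x} &
      exists du drhou : R -> fct,
      [/\ weak_time_derivative T (H10_space Omega) u du,
          in_L2_bochner T (H10_space Omega) du,
          weak_time_derivative T (L2_space Omega)
            (fun t x => rho t x * u t x) drhou &
          {ae lebesgue_measure, forall t, t \in `]0, T[ ->
            (forall phi, in_H10 Omega phi ->
              inner Omega (drhou t) phi
              + innerv Omega (fun i x => eta t x * grad Omega (du t) i x)
                             (grad Omega phi)
              + innerv Omega (fun i x => kappa t x * grad Omega (u t) i x)
                             (grad Omega phi)
              = h t * inner Omega (p t) phi + inner Omega (f \o u t) phi) /\
            h t = (pairing p rho omega t)^-1 *
              (m' t
               + inner Omega (u t) (fun x => omega x * rho' t x / rho t x)
               + innerv Omega (fun i x => eta t x * grad Omega (du t) i x)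
                              (grad Omega (weight rho omega t))
               + innerv Omega (fun i x => kappa t x * grad Omega (u t) i x)
                              (grad Omega (weight rho omega t))
               - inner Omega (f \o u t) (weight rho omega t))}]].

End inverse_problem.

(* Main.v *)
Require Import Defs.
From HB Require Import structures.
From mathcomp Require Import all_boot all_order all_algebra.
From mathcomp Require Import all_classical all_reals all_analysis.
From mathcomp Require Import ess_sup_inf measurable_realfun ring lra.

Set Implicit Arguments.
Unset Strict Implicit.
Unset Printing Implicit Defensive.

Import Order.TTheory GRing.Theory Num.Theory.
Import numFieldNormedType.Exports.

Local Open Scope classical_set_scope.
Local Open Scope ring_scope.

(* For a given u, the weak equation determines the time derivative as
   du = a_u + h b, where a_u(t) and b(t) solve the coercive problems
   A_t(a_u, phi) = (f(u) - rho' u, phi) - (kappa grad u, grad phi) and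
   A_t(b, phi) = (p, phi) for the form A_t(x, y) = (rho x, y) + (eta grad x, grad y).
   Substituted into the formula for h, this gives an affine scalar equation with
   slope theta(t) = (eta grad b, grad (omega / rho)) / (p, omega / rho). Testing the
   problem for b with b itself gives 4 rho_0 eta_0 |grad b|^2 <= |p|^2, so that
   the smallness condition is exactly theta^2 < zeta < 1 and h is a Lipschitz
   function h_u of u. The problem becomes the ordinary differential equation
   u' = a_u + h_u b in H^1_0, which is solved by a Picard iteration. For the
   uniqueness, the derivative of any solution is shown to be a_u + h b almost
   everywhere, by comparing the weak derivative of (rho u, phi) with the product
   rule, for phi in a countable family that tests the strongly measurable curves.
   The function t |-> grad (omega / rho(t)) is only weakly measurable. *)

(** * Smooth cut-off functions *)

(** Functions are representatives rather than classes. Inner products are therefore only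
    semidefinite, Riesz representers are unique only up to norm zero, and [grad], being a choice, is
    linear only almost everywhere. The argument is carried out for an abstract pair of spaces in
    which such identities are tested against vectors. Nothing makes grad (omega / rho(t)) strongly
    continuous in time, so h_u is merely measurable in t. This is harmless because the roughness
    stays in a scalar: a_u and b are continuous curves in H^1_0, and an integrable scalar times a
    continuous curve is a limit of simple functions, which supplies the strong measurability
    required of du. The eta term makes A_t coercive on all of H^1_0, not only on L^2; this is why
    the evolution is an ordinary differential equation with a Lipschitz right-hand side. For
    uniqueness, the null set of times on which the equation fails depends on the test function. The
    vectors taken by approximating simple functions form a countable family that is large enough for
    the curves at hand and stands in for a dense sequence of H^1_0. *)

Section smooth_basics.
Context {R : realType} {V : normedModType R}.
Implicit Types f g : V -> R.

(** Smoothness quantifies over all iterated directional derivatives, so it is proved by exhibiting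
    an invariant: a class of differentiable functions stable under every ['D_v]. *)
Lemma smooth_coind (P : (V -> R) -> Prop) :
  (forall f, P f -> forall x, differentiable f x) ->
  (forall f v, P f -> P ('D_v f)) -> forall f, P f -> smooth f.
Proof.
move=> Pd PD f Pf s; suff : P (foldr (fun v g => 'D_v g) f s) by move/Pd.
by elim: s => //= v s; exact: PD.
Qed.

Lemma smooth_differentiable f x : smooth f -> differentiable f x.
Proof. by move=> /(_ [::] x). Qed.

Lemma smooth_derive f v : smooth f -> smooth ('D_v f).
Proof.
by move=> sf s x; have := sf (rcons s v) x; rewrite -cats1 foldr_cat.
Qed.

Lemma smooth_derivable f x v : smooth f -> derivable f x v.
Proof. by move=> sf; apply/diff_derivable/smooth_differentiable. Qed.

Lemma smooth_continuous f : smooth f -> continuous f.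
Proof.
by move=> sf x; apply: differentiable_continuous; exact: smooth_differentiable.
Qed.

End smooth_basics.

Section smooth_closure.
Context {R : realType} {V : normedModType R}.
Implicit Types f g : V -> R.

(** The invariant for [smooth_coind]: Leibniz, quotient and chain rules stay inside this algebra.
    Composition is limited to inner maps with constant directional derivatives, so that the chain
    rule only produces a constant factor. *)
Inductive smooth_alg : (V -> R) -> Prop :=
| SmoothSm f of smooth f : smooth_alg f
| SmoothAdd f g of smooth_alg f & smooth_alg g : smooth_alg (f + g)
| SmoothMul f g of smooth_alg f & smooth_alg g : smooth_alg (f * g)
| SmoothInv f of smooth_alg f & (forall x, f x != 0) :
    smooth_alg (fun x => (f x)^-1)
| SmoothComp (g : R -> R) (l : V -> R) of smooth g &
    (forall x, differentiable l x) &
    (forall v, exists c, 'D_v l = cst c) : smooth_alg (g \o l).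

Lemma smooth_cst (c : R) : smooth (cst c : V -> R).
Proof.
apply: (@smooth_coind _ _ (fun f => exists c, f = cst c)); last by exists c.
  by move=> f [k ->] x.
by move=> f v [k ->]; exists 0; apply/funext => x; rewrite derive_cst.
Qed.

Lemma smooth_alg_smooth f : smooth_alg f -> smooth f.
Proof.
apply: smooth_coind => {}f.
  elim=> {f} [f sf|f g _ df _ dg|f g _ df _ dg|f _ df f0|g l sg dl _] x.
  - exact: smooth_differentiable.
  - exact: differentiableD.
  - exact: differentiableM.
  - exact: differentiableV.
  - by apply: differentiable_comp => //; exact: smooth_differentiable.
move=> v af.
suff [//] : (forall x, differentiable f x) /\ smooth_alg ('D_v f).
elim: af => {f} [f sf|f g _ [df af] _ [dg ag]|f g sf [df af] sg [dg ag]|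
    f sf [df af] f0|g l sg dl Dl].
- split; first by move=> x; exact: smooth_differentiable.
  by apply: SmoothSm; exact: smooth_derive.
- split; first by move=> x; exact: differentiableD.
  rewrite (_ : 'D_v (f + g) = 'D_v f + 'D_v g); first exact: SmoothAdd.
  by apply/funext => x; rewrite deriveD//; exact: diff_derivable.
- split; first by move=> x; exact: differentiableM.
  rewrite (_ : 'D_v (f * g) = f * 'D_v g + g * 'D_v f).
    by apply: SmoothAdd; apply: SmoothMul.
  by apply/funext => x; rewrite deriveM//; exact: diff_derivable.
- split; first by move=> x; exact: differentiableV.
  have si : smooth_alg (fun x => (f x)^-1) by exact: SmoothInv.
  rewrite (_ : 'D_v _ = (cst (-1) * 'D_v f) *
      ((fun x => (f x)^-1) * (fun x => (f x)^-1))).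
    apply: SmoothMul; last exact: SmoothMul.
    by apply: SmoothMul => //; apply: SmoothSm; exact: smooth_cst.
  apply/funext => x; rewrite deriveV//; last exact: diff_derivable.
  rewrite -[LHS]/(- (f x) ^- 2 * 'D_v f x).
  rewrite -[RHS]/((-1 * 'D_v f x) * ((f x)^-1 * (f x)^-1)) expr2 invfM; ring.
- split.
    by move=> x; apply: differentiable_comp => //; exact: smooth_differentiable.
  have [c Dc] := Dl v.
  rewrite (_ : 'D_v _ = cst c * ('D_1 g \o l)).
    apply: SmoothMul; first by apply: SmoothSm; exact: smooth_cst.
    by apply: SmoothComp => //; exact: smooth_derive.
  apply/funext => x; have dg := smooth_differentiable (l x) sg.
  rewrite deriveE; last exact: differentiable_comp.
  rewrite diff_comp//= (_ : 'd l x v = c); last first.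
    by rewrite -deriveE//; exact: (congr1 (@^~ x) Dc).
  by rewrite diff1E// derive1E.
Qed.

Lemma smoothD f g : smooth f -> smooth g -> smooth (f + g).
Proof.
by move=> sf sg; apply: smooth_alg_smooth; apply: SmoothAdd; apply: SmoothSm.
Qed.

Lemma smoothM f g : smooth f -> smooth g -> smooth (f * g).
Proof.
by move=> sf sg; apply: smooth_alg_smooth; apply: SmoothMul; apply: SmoothSm.
Qed.

Lemma smoothZ c f : smooth f -> smooth (c *: f).
Proof.
rewrite (_ : c *: f = cst c * f); last by apply/funext.
by apply: smoothM; exact: smooth_cst.
Qed.

Lemma smoothV f : smooth f -> (forall x, f x != 0) -> smooth (fun x => (f x)^-1).
Proof.
by move=> sf f0; apply: smooth_alg_smooth; apply: SmoothInv => //; apply: SmoothSm.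
Qed.

Lemma smooth_prod (I : Type) (r : seq I) (F : I -> V -> R) :
  (forall i, smooth (F i)) -> smooth (\prod_(i <- r) F i).
Proof.
move=> sF; elim/big_rec: _ => [|i f _]; first exact: (smooth_cst 1).
exact: smoothM.
Qed.

End smooth_closure.

Section smooth_step.
Context {R : realType}.
Implicit Types (p : {poly R}) (x : R).

Lemma smooth_affine (g : R -> R) (a b : R) :
  smooth g -> smooth (fun x => g (a * x + b)).
Proof.
move=> sg.
have dl x : is_derive x 1 (fun y => a * y + b) a.
  have := is_deriveD (is_deriveM (is_derive_cst a x (1:R)) (is_derive_id x (1:R))) (is_derive_cst b x (1:R)).
  by rewrite scaler0 !addr0 /GRing.scale/= mulr1.
apply: (@smooth_alg_smooth R R (g \o (fun x => a * x + b))).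
apply: SmoothComp => //.
move=> v; exists (v * a); apply/funext => x.
rewrite deriveE; last exact/derivable1_diffP.
by rewrite diff1E ?derive1E ?derive_val//; exact/derivable1_diffP.
Qed.

(* The derivative of [flat p] is [flat q] for another polynomial [q]. *)
Definition flat p x : R := if 0 < x then p.[x^-1] * expR (- x^-1) else 0.

(** With y = 1/x, the inequality y^(i+2) / (i+2)! <= e^y bounds each monomial y^i e^(-y) by (i+2)!
    x^2. The exponent 2 is what makes the difference quotient at 0 vanish. *)
Lemma flat_bound p : exists C, forall x, 0 < x -> `|flat p x| <= C * x ^+ 2.
Proof.
exists (\sum_(i < size p) `|p`_i| * (i.+2)`!%:R) => x x0; rewrite /flat x0.
rewrite horner_coef mulr_suml (le_trans (ler_norm_sum _ _ _))// mulr_suml.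
apply: ler_sum => i _; rewrite -mulrA normrM -mulrA ler_wpM2l//.
have y0 : 0 < x^-1 by rewrite invr_gt0.
rewrite ger0_norm ?mulr_ge0 ?exprn_ge0 ?expR_ge0 ?(ltW y0)//.
rewrite -[in leRHS](invrK x) [in leRHS]exprVn; set y := x^-1 in y0 *.
rewrite expRN ler_pdivrMr ?expR_gt0// mulrAC ler_pdivlMr ?exprn_gt0//.
rewrite -exprD addn2 -ler_pdivrMl ?ltr0n ?fact_gt0// mulrC.
by apply: le_trans (expR_ge1Dxn i.+1 (ltW y0)); rewrite lerDr.
Qed.

(** In the variable y = 1/x one has dy/dx = - y^2, and the derivative of p(y) e^(-y) in y is (p' -
    p)(y) e^(-y). At 0 only [flat_bound] is used. *)
Lemma is_derive_flat p x : is_derive x 1 (flat p) (flat ('X^2 * (p - p^`())) x).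
Proof.
case: (ltgtP x 0) => x0.
- apply: (@near_eq_is_derive _ _ _ (cst 0)) => //.
    near=> y; rewrite /flat ltNge; suff -> : y <= 0 by [].
    by apply/ltW; near: y; exact: lt_nbhsl.
  rewrite /flat ltNge (ltW x0) /=; exact: is_derive_cst.
- apply: (@near_eq_is_derive R R R (fun y : R => p.[y^-1] * expR (- y^-1))).
  + by near=> y; rewrite /flat; have -> : 0 < y by near: y; exact: lt_nbhsr.
  have xN0 : x != 0 by rewrite gt_eqF.
  have dV : is_derive x (1:R) (fun y : R => y^-1) (- x ^- 2).
    have := @is_deriveV _ id x _ _ xN0 (is_derive_id x (1:R)).
    by rewrite /GRing.scale/= mulr1.
  have d1 : is_derive x (1:R) (fun y : R => p.[y^-1]) (- x ^- 2 * p^`().[x^-1]).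
    have := @is_derive1_comp _ (horner p) (fun y => y^-1) x _ _ _ dV.
    by move=> /(_ _ (is_derive_poly p x^-1)); rewrite mulrC.
  have d2 : is_derive x (1:R) (fun y : R => expR (- y^-1)) (x ^- 2 * expR (- x^-1)).
    have dN : is_derive x (1:R) (fun y : R => - y^-1) (x ^- 2).
      by rewrite -[x ^- 2]opprK; exact: is_deriveN.
    have := @is_derive1_comp _ expR (fun y => - y^-1) x _ _ _ dN.
    by move=> /(_ _ (is_derive_expR _)); rewrite mulrC.
  have := is_deriveM d1 d2; congr is_derive.
  rewrite /flat x0 !hornerE /GRing.scale/= exprVn; ring.
- subst x; suff D : h^-1 *: (flat p (h *: (1 : R) + 0) - flat p 0) @[h --> 0^'] --> (0 : R).
    apply: DeriveDef; first by apply/cvg_ex; exists 0.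
    by rewrite [RHS]/flat ltxx; apply: cvg_lim.
  apply/cvgrPdist_le => /= e e0.
  have [C HC] := flat_bound p.
  have C0 : 0 < `|C| + 1 by rewrite ltr_wpDl.
  near=> h; rewrite sub0r normrN addr0 [flat p 0]/flat ltxx subr0.
  rewrite /GRing.scale /= mulr1.
  have hN0 : h != 0 by near: h; exact: nbhs_dnbhs_neq.
  have [h0|h0] := ltP 0 h; last first.
    by rewrite /flat ltNge h0 mulr0 normr0 ltW.
  rewrite normrM (le_trans (ler_wpM2l _ (HC h h0)))//.
  rewrite normfV (gtr0_norm h0) mulrCA expr2 mulKf//.
  rewrite (@le_trans _ _ ((`|C| + 1) * h))//.
    by rewrite ler_wpM2r ?(ltW h0)// ler_wpDr// ler_norm.
  rewrite -ler_pdivlMl// mulrC -(gtr0_norm h0).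
  near: h; apply: dnbhs0_le; rewrite mulr_gt0// ?invr_gt0//.
Unshelve. all: by end_near. Qed.

Lemma smooth_flat p : smooth (flat p).
Proof.
apply: (@smooth_coind _ _ (fun f => exists p, f = flat p)); last by exists p.
  by move=> f [q ->] x; apply/derivable1_diffP; exact: (@ex_derive _ _ _ _ _ _ _ (is_derive_flat q x)).
move=> f v [q ->]; exists (v *: ('X^2 * (q - q^`()))).
have dq y : derivable (flat q) y 1 by exact: (@ex_derive _ _ _ _ _ _ _ (is_derive_flat q y)).
apply/funext => x; rewrite deriveE; last exact/derivable1_diffP.
rewrite diff1E; last exact/derivable1_diffP.
rewrite derive1E (@derive_val _ _ _ _ _ _ _ (is_derive_flat q x)) /flat.
by case: ifP; rewrite ?scaler0// hornerZ => _; rewrite /GRing.scale/= mulrA.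
Qed.

Definition step x : R := flat 1 x / (flat 1 x + flat 1 (1 - x)).

Let flat1_ge0 x : 0 <= flat 1 x.
Proof. by rewrite /flat hornerC mul1r; case: ifP => // _; exact: expR_ge0. Qed.

Let flat1_gt0 x : 0 < x -> 0 < flat 1 x.
Proof. by rewrite /flat hornerC mul1r => ->; exact: expR_gt0. Qed.

Let step_den x : 0 < flat 1 x + flat 1 (1 - x).
Proof.
have [x0|x0] := ltP 0 x; first by rewrite ltr_pwDl// flat1_gt0.
by rewrite ltr_wpDl// flat1_gt0// subr_gt0 (le_lt_trans x0).
Qed.

Lemma smooth_step : smooth step.
Proof.
have s1 := smooth_flat 1.
rewrite (_ : step = flat 1 * (fun x => (flat 1 x + flat 1 (1 - x))^-1)) //.
apply: smoothM => //; apply: (@smoothV _ _ (flat 1 + (fun x => flat 1 (1 - x)))).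
  apply: smoothD => //.
  rewrite (_ : (fun x => _) = (fun x => flat 1 ((-1) * x + 1))).
    exact: smooth_affine.
  by apply/funext => x; congr flat; ring.
by move=> x; rewrite gt_eqF//; exact: step_den.
Qed.

Lemma step_eq0 x : x <= 0 -> step x = 0.
Proof. by rewrite /step {1}/flat ltNge => ->; rewrite mul0r. Qed.

Lemma step_eq1 x : 1 <= x -> step x = 1.
Proof.
move=> x1; rewrite /step [flat 1 (1 - x)]/flat subr_gt0 ltNge x1 addr0.
by rewrite divff// gt_eqF// flat1_gt0// (lt_le_trans _ x1).
Qed.

Lemma step_ge0 x : 0 <= step x.
Proof. by rewrite divr_ge0 ?addr_ge0. Qed.

Lemma step_le1 x : step x <= 1.
Proof. by rewrite ler_pdivrMr ?step_den// mul1r lerDl. Qed.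

End smooth_step.

(** * Boxes and Lebesgue measure on row vectors *)

Lemma ex_nat_gt {R : realType} (r : R) : exists k : nat, r < k%:R.
Proof. by exists (Num.bound `|r|); rewrite (le_lt_trans (ler_norm r))// archi_boundP. Qed.

Section boxes.
Context {R : realType} {d : nat}.
Notation E := 'rV[R]_d.
Notation mu := (lebesgue_rV d).
Implicit Types (a b x : E).

Definition box a b : set E := [set x | forall i, a 0 i < x 0 i <= b 0 i].
Definition cbox a b : set E := [set x | forall i, a 0 i <= x 0 i <= b 0 i].

Lemma boxI a b a' b' : box a b `&` box a' b' =
  box (\row_i Num.max (a 0 i) (a' 0 i)) (\row_i Num.min (b 0 i) (b' 0 i)).
Proof.
apply/seteqP; split => x /=.
  move=> [h h'] i; rewrite !mxE gt_max le_min.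
  by move: (h i) (h' i) => /andP[-> ->] /andP[-> ->].
move=> h; split => i; have := h i; rewrite !mxE gt_max le_min.
  by move=> /andP[/andP[-> _] /andP[-> _]].
by move=> /andP[/andP[_ ->] /andP[_ ->]].
Qed.

Lemma measurable_box a b : measurable (box a b).
Proof.
rewrite (_ : box a b = \bigcap_(i in [set: 'I_d])
    (rV_coord i @^-1` `]a 0 i, b 0 i]%classic)).
  apply: fin_bigcap_measurable => // i _.
  by rewrite -[X in measurable X]setTI; exact: measurable_rV_coord.
apply/seteqP; split => x /= Bx i; first by move=> _; rewrite /= in_itv/=.
by have := Bx i Logic.I; rewrite /= in_itv.
Qed.

Lemma measurable_cbox a b : measurable (cbox a b).
Proof.
rewrite (_ : cbox a b = \bigcap_(i in [set: 'I_d])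
    (rV_coord i @^-1` `[a 0 i, b 0 i]%classic)).
  apply: fin_bigcap_measurable => // i _.
  by rewrite -[X in measurable X]setTI; exact: measurable_rV_coord.
apply/seteqP; split => x /= Bx i; first by move=> _; rewrite /= in_itv/=.
by have := Bx i Logic.I; rewrite /= in_itv.
Qed.

Lemma sub_box_cbox a b : box a b `<=` cbox a b.
Proof. by move=> x h i; have /andP[/ltW -> ->] := h i. Qed.

Lemma cbox_compact a b : compact (cbox a b).
Proof.
have := @rV_compact R d (fun i => `[a 0 i, b 0 i]%classic) (fun i => @segment_compact R _ _).
by congr compact; apply/seteqP; split => x /= h i; have := h i; rewrite in_itv.
Qed.

Definition boxes : set (set E) := [set B | exists a b, B = box a b].

Lemma boxesI : setI_closed boxes.
Proof. by move=> _ _ [a [b ->]] [a' [b' ->]]; rewrite boxI; do 2!eexists. Qed.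

Definition cst_box (k : nat) : set E := box (const_mx (- k%:R)) (const_mx k%:R).

Lemma norm_coord_le x i : `|x 0 i| <= `|x|.
Proof. by have := mx_normrE x; rewrite [`|x|]/Num.norm/= => ->; exact: (le_bigmax _ _ (0, i)). Qed.

Lemma mem_cst_box x (k : nat) : `|x| < k%:R -> cst_box k x.
Proof.
move=> xk i; have := le_lt_trans (norm_coord_le x i) xk.
by rewrite !mxE ltr_norml => /andP[-> /ltW].
Qed.

Lemma bigcup_cst_box : \bigcup_k cst_box k = setT.
Proof.
apply/seteqP; split => // x _; have [k xk] := ex_nat_gt `|x|.
by exists k => //; exact: mem_cst_box.
Qed.

Lemma measurable_boxes : @measurable _ E = <<s boxes >>.
Proof.
apply/seteqP; split => A; last first.
  move=> bA; apply: bA; split; first exact: sigma_algebra_measurable.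
  by move=> _ [a [b ->]]; exact: measurable_box.
suff : g_sigma_preimage (@rV_coord R d) `<=` <<s boxes>> by apply.
apply: smallest_sub; first exact: smallest_sigma_algebra.
rewrite -bigcup_seq => B [i _ [D mD <-]]; rewrite setTI.
have : measurable_fun setT (rV_coord i : g_sigma_algebraType boxes -> R).
  apply: (measurability _ (RGenOInfty.measurableE R)) => _ [_ [p ->] <-].
  (* The half-space p < x_i is exhausted by boxes with lower side p in direction i and sides - k, k
     in the other directions. *)
  rewrite setTI (_ : _ @^-1` _ = \bigcup_k
    box (\row_j if j == i then p else - k%:R) (const_mx k%:R)).
    apply: bigcupT_measurable => k; apply: sub_sigma_algebra.
    by do 2!eexists.
  apply/seteqP; split => x /=; rewrite in_itv/= andbT.
    move=> px; have [k xk] := ex_nat_gt `|x|; exists k => // j.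
    have /andP[h1 h2] := mem_cst_box xk j.
    by move: h1 h2; rewrite !mxE => h1 ->; case: eqP => [->|_]; rewrite ?h1 ?px.
  by move=> [k _] /(_ i); rewrite !mxE eqxx => /andP[].
by move=> /(_ measurableT D mD); rewrite setTI.
Qed.

Lemma lebesgue_cst_box k : (mu (cst_box k) < +oo)%E.
Proof.
rewrite lebesgue_rV_box ?ltry// => i; rewrite !mxE.
by rewrite (@le_trans _ _ 0)// oppr_le0.
Qed.

(** Half-open boxes form a pi-system that generates the sigma-algebra, and the boxes [cst_box k]
    exhaust the space with finite measure. A box with a reversed side is empty, so ordered sides are
    enough. *)
Lemma lebesgue_rV_unique (m : {measure set E -> \bar R}) :
  (forall a b, (forall i, a 0 i <= b 0 i) -> m (box a b) = mu (box a b)) ->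
  forall A, measurable A -> m A = mu A.
Proof.
move=> mE; have mbox a b : m (box a b) = mu (box a b).
  have [ab|] := pselect (forall i, a 0 i <= b 0 i); first exact: mE.
  move=> /existsNP[i /negP]; rewrite -ltNge => ba.
  suff -> : box a b = set0 by rewrite !measure0.
  apply/seteqP; split => x //= /(_ i) /andP[ax xb].
  by have := lt_le_trans ax xb; rewrite ltNge (ltW ba).
apply: (measure_unique boxes cst_box) => //.
- exact: measurable_boxes.
- exact: boxesI.
- by move=> k; do 2!eexists.
- exact: bigcup_cst_box.
- by move=> _ [a [b ->]].
- by move=> k; rewrite mbox; exact: lebesgue_cst_box.
Qed.

Lemma bounded_set_cst_box (A : set E) : bounded_set A -> exists k, A `<=` cst_box k.
Proof.
move=> [M [_ MA]]; have [k Mk] := ex_nat_gt (M + 1).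
exists k => x Ax; apply: mem_cst_box; apply: le_lt_trans Mk.
by apply: MA => //; rewrite ltrDl.
Qed.

End boxes.

(** * Integrals and test functions *)

Section Rintegral_extra.
Context {disp} {T : measurableType disp} {R : realType}.
Variables (mu : {measure set T -> \bar R}) (D : set T).
Hypothesis mD : measurable D.
Implicit Types f g : T -> R.
Local Notation int f := (mu.-integrable D (EFin \o f)).

Lemma EFin_Rintegral f : int f ->
  (\int[mu]_(x in D) f x)%:E = (\int[mu]_(x in D) (f x)%:E)%E.
Proof. by move=> fi; rewrite /Rintegral fineK//; exact: integrable_fin_num. Qed.

Lemma integrable_measurable f : int f -> measurable_fun D f.
Proof. by move=> /measurable_int /measurable_EFinP. Qed.

Lemma integrable_le f g : measurable_fun D f -> int g ->
  (forall x, D x -> `|f x| <= g x) -> int f.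
Proof.
move=> mf ig fg; apply: le_integrable ig => //; first exact/measurable_EFinP.
by move=> x Dx; rewrite /= lee_fin (le_trans (fg _ Dx))// ler_norm.
Qed.

Lemma integrableD_fin f g : int f -> int g -> int (fun x => f x + g x).
Proof. by move=> fi gi; have := integrableD mD fi gi. Qed.

Lemma integrableZ_fin k f : int f -> int (fun x => k * f x).
Proof. by move=> fi; have := integrableZl mD k fi. Qed.

Lemma integrableN_fin f : int f -> int (fun x => - f x).
Proof. by move=> fi; have := integrableN fi. Qed.

Lemma integrable_norm_fin f : int f -> int (fun x => `|f x|).
Proof. by move=> fi; have := integrable_abse fi. Qed.

Lemma integrable_sum_fin (I : Type) (s : seq I) (F : I -> T -> R) :
  (forall i, int (F i)) -> int (fun x => \sum_(i <- s) F i x).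
Proof.
move=> Fi; elim: s => [|i s ih].
  under eq_fun do rewrite big_nil.
  exact: integrable0.
by under eq_fun do rewrite big_cons; apply: integrableD_fin.
Qed.

Lemma Rintegral_sum (I : Type) (s : seq I) (F : I -> T -> R) :
  (forall i, int (F i)) ->
  \int[mu]_(x in D) (\sum_(i <- s) F i x) = \sum_(i <- s) \int[mu]_(x in D) F i x.
Proof.
move=> Fi; elim: s => [|i s ih].
  under eq_Rintegral do rewrite big_nil.
  by rewrite big_nil /Rintegral integral0.
under eq_Rintegral do rewrite big_cons.
by rewrite big_cons RintegralD ?ih//; exact: integrable_sum_fin.
Qed.

Lemma ae_eq_Rintegral f g : measurable_fun D f -> measurable_fun D g ->
  {ae mu, forall x, D x -> f x = g x} ->
  \int[mu]_(x in D) f x = \int[mu]_(x in D) g x.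
Proof.
move=> mf mg fg; rewrite /Rintegral; congr fine; apply: ae_eq_integral => //.
- exact/measurable_EFinP.
- exact/measurable_EFinP.
- by apply: filterS fg => x /= h Dx; rewrite h.
Qed.

Lemma Rintegral_dominated (F : nat -> T -> R) f g :
  (forall n, measurable_fun D (F n)) -> measurable_fun D f ->
  {ae mu, forall x, D x -> F n x @[n --> \oo] --> f x} -> int g ->
  (forall n x, D x -> `|F n x| <= g x) ->
  int f /\ \int[mu]_(x in D) F n x @[n --> \oo] --> \int[mu]_(x in D) f x.
Proof.
move=> mF mf Ff gi Fg.
have [] := @dominated_convergence _ _ _ mu D mD (fun n => EFin \o F n)
  (EFin \o f) (EFin \o g).
- by move=> n; exact/measurable_EFinP.
- exact/measurable_EFinP.
- apply: filterS Ff => x /= Ffx Dx; apply: cvg_EFin; last exact: Ffx.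
  by apply: nearW.
- exact: gi.
- by apply: aeW => x /= n Dx; rewrite lee_fin Fg.
move=> fi _ Fcv; split => //; rewrite /Rintegral; apply: fine_cvg.
by rewrite fineK//; exact: integrable_fin_num.
Qed.

Lemma ge0_Rintegral_eq0 f : int f -> (forall x, D x -> 0 <= f x) ->
  \int[mu]_(x in D) f x = 0 -> {ae mu, forall x, D x -> f x = 0}.
Proof.
move=> fi f0 If0.
have /(ae_eq_integral_abs mu mD) [+ _] : measurable_fun D (EFin \o f).
  by case/integrableP : fi.
move=> /(_ _)[].
  rewrite -[RHS](congr1 EFin If0) EFin_Rintegral//; apply: eq_integral => x.
  by rewrite inE => Dx /=; rewrite ger0_norm ?f0.
move=> N [mN N0 h]; exists N; split => // x nfx; apply: h => /= h.
by apply: nfx => Dx; have /= [] := h Dx.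
Qed.

End Rintegral_extra.

Section test_functions.
Context {R : realType} {V : normedModType R}.
Variable Omega : set V.
Implicit Types phi psi : V -> R.

Lemma test_function_supp phi x : test_function Omega phi -> phi x != 0 -> Omega x.
Proof. by move=> [_ _ h] p0; apply: h; exact: subset_closure. Qed.

Lemma test_function_sub phi (C : set V) : smooth phi -> compact C -> closed C ->
  C `<=` Omega -> (forall x, ~ C x -> phi x = 0) -> test_function Omega phi.
Proof.
move=> sp cC clC CO p0.
have sC : closure [set x | phi x != 0] `<=` C.
  have /closure_id -> := clC; apply: closureS => x /=.
  by move=> px; apply: contrapT => nC; rewrite p0// eqxx in px.
split=> //; last exact: subset_trans sC CO.
by apply: subclosed_compact cC sC; exact: closed_closure.
Qed.

Lemma test_functionD phi psi : test_function Omega phi ->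
  test_function Omega psi -> test_function Omega (phi + psi).
Proof.
move=> [sp cp Op] [sq cq Oq].
apply: (@test_function_sub _ (closure [set x | phi x != 0] `|`
    closure [set x | psi x != 0])).
- exact: smoothD.
- exact: compactU.
- by apply: closedU; exact: closed_closure.
- by move=> x [/Op|/Oq].
- move=> x /not_orP[h1 h2]; rewrite -[LHS]/(phi x + psi x).
  rewrite (_ : phi x = 0); last first.
    by apply: contra_notP h1 => /eqP ?; exact: subset_closure.
  rewrite (_ : psi x = 0) ?addr0//.
  by apply: contra_notP h2 => /eqP ?; exact: subset_closure.
Qed.

Lemma test_functionM phi psi : test_function Omega phi -> smooth psi ->
  test_function Omega (phi * psi).
Proof.
move=> [sp cp Op] sq.
apply: (@test_function_sub _ (closure [set x | phi x != 0])) => //.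
- exact: smoothM.
- exact: closed_closure.
- move=> x h1; rewrite -[LHS]/(phi x * psi x).
  rewrite (_ : phi x = 0) ?mul0r//.
  by apply: contra_notP h1 => /eqP ?; exact: subset_closure.
Qed.

Lemma test_functionZ k phi : test_function Omega phi ->
  test_function Omega (k *: phi).
Proof.
move=> tp; rewrite (_ : k *: phi = phi * cst k).
  by apply: test_functionM => //; exact: smooth_cst.
by apply/funext => x; rewrite /GRing.scale/= /GRing.scale/= mulrC.
Qed.

Lemma test_function0 : test_function Omega 0.
Proof.
apply: (@test_function_sub _ set0) => //.
- exact: (smooth_cst 0).
- exact: compact0.
- exact: closed0.
Qed.

Lemma test_function_derive phi v : test_function Omega phi ->
  test_function Omega ('D_v phi).
Proof.
move=> [sp cp Op].
apply: (@test_function_sub _ (closure [set x | phi x != 0])) => //.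
- exact: smooth_derive.
- exact: closed_closure.
- move=> x nx.
  have : \forall y \near x, phi y = 0.
    have oC := closed_openC (@closed_closure _ [set x | phi x != 0]).
    have : nbhs x (~` closure [set x | phi x != 0]) by apply: open_nbhs_nbhs.
    apply: filterS => y ny; apply: contra_notP ny => /eqP ?.
    exact: subset_closure.
  move=> phi0.
  have -> : 'D_v phi x = 'D_v (cst 0 : V -> R) x.
    by apply: near_eq_derive; apply: filterS phi0 => y ->.
  exact: derive_cst.
Qed.

Lemma test_function_continuous phi : test_function Omega phi -> continuous phi.
Proof. by case=> sp _ _; exact: smooth_continuous. Qed.

End test_functions.

(** * Approximation of boxes by test functions *)

Section rV_measurable.
Context {R : realType} {d : nat}.
Notation E := 'rV[R]_d.
Notation mu := (lebesgue_rV d).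
Implicit Types (a b x : E) (U Omega : set E).

Definition ratrV (q : 'rV[rat]_d) : E := map_mx (ratr : rat -> R) q.

(** Rational corners make the cover of U countable. The margin e on the upper side leaves room for
    the support of [box_bump], which exceeds the box by 1/n there. *)
Lemma open_rat_box U x : open U -> U x -> exists q : 'rV[rat]_d * 'rV[rat]_d,
  box (ratrV q.1) (ratrV q.2) x /\
  exists2 e : R, 0 < e & cbox (ratrV q.1) (ratrV q.2 + const_mx e) `<=` U.
Proof.
move=> oU Ux; have /nbhs_ballP[e /= e0 xU] : nbhs x U by exact: open_nbhs_nbhs.
have e2 : 0 < e / 4 by rewrite divr_gt0.
have /choice[q1 q1P] : forall i, exists q : rat, ratr q \in `]x 0 i - e / 4, x 0 i[.
  by move=> i; apply: rat_in_itvoo; rewrite ltrBlDr ltrDl.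
have /choice[q2 q2P] : forall i, exists q : rat, ratr q \in `]x 0 i, x 0 i + e / 4[.
  by move=> i; apply: rat_in_itvoo; rewrite ltrDl.
exists (\row_i q1 i, \row_i q2 i); split.
  move=> i; rewrite !mxE; move: (q1P i) (q2P i); rewrite !in_itv/=.
  by move=> /andP[_ ->] /andP[/ltW -> _].
exists (e / 4) => // y yq; apply: xU; split => // i j; rewrite (ord1 i).
have := yq j; rewrite !mxE; move: (q1P j) (q2P j); rewrite !in_itv/=.
move=> /andP[h1 h2] /andP[h3 h4] /andP[h5 h6].
rewrite /ball/= ltr_norml; apply/andP; split; lra.
Qed.

Lemma measurable_open U : open U -> measurable U.
Proof.
move=> oU; rewrite (_ : U = \bigcup_(q : 'rV[rat]_d * 'rV[rat]_d)
    (if `[< cbox (ratrV q.1) (ratrV q.2) `<=` U >] then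
       box (ratrV q.1) (ratrV q.2) else set0)).
  apply: countable_bigcupT_measurable; first exact: countableP.
  by move=> q; case: ifP => // _; exact: measurable_box.
apply/seteqP; split => x.
  move=> Ux; have [q [qx [e e0 qU]]] := open_rat_box oU Ux.
  exists q => //; case: asboolP => // -[]; apply: subset_trans qU => y yq i.
  by move: (yq i); rewrite !mxE => /andP[-> h]; rewrite (le_trans h)// lerDl ltW.
by move=> [q _]; case: asboolP => // qU qx; apply: qU; exact: sub_box_cbox.
Qed.

Lemma measurable_closed U : closed U -> measurable U.
Proof. by move=> /closed_openC/measurable_open/measurableC; rewrite setCK. Qed.

Lemma measurable_compact U : compact U -> measurable U.
Proof.
by move=> cU; apply: measurable_closed; apply: compact_closed cU; exact: norm_hausdorff.
Qed.

Lemma continuous_rV_measurable (f : E -> R) : continuous f -> measurable_fun setT f.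
Proof.
move=> cf; apply: (measurability _ (RGenOpens.measurableE R)).
move=> _ [_ [a [b ->] <-]]; rewrite setTI; apply: measurable_open.
by move/continuousP : cf; apply; exact: interval_open.
Qed.

Lemma bounded_lebesgue_fin U : measurable U -> bounded_set U -> (mu U < +oo)%E.
Proof.
move=> mU bU; have [k Uk] := bounded_set_cst_box bU.
apply: le_lt_trans (lebesgue_cst_box k); apply: le_measure => //.
- by rewrite inE.
- by rewrite inE; exact: measurable_box.
Qed.

Lemma smooth_coord (g : R -> R) (i : 'I_d) (k c : R) : smooth g ->
  smooth (fun x : E => g (k * x 0 i + c)).
Proof.
move=> sg.
apply: (@smooth_alg_smooth R E ((fun y => g (k * y + c)) \o (fun x : E => x 0 i))).
apply: SmoothComp; first exact: smooth_affine.
  by move=> x; exact: differentiable_coord.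
move=> v; exists (v 0 i); apply/funext => x.
rewrite /derive/=; apply: cvg_lim => //; apply: cvg_near_cst.
near=> h; rewrite !mxE addrK /GRing.scale/= mulrA mulVf ?mul1r//.
by near: h; exact: nbhs_dnbhs_neq.
Unshelve. all: by end_near. Qed.

Lemma test_function_bounded Omega (phi : E -> R) : test_function Omega phi ->
  exists2 M, 0 < M & forall x, `|phi x| <= M.
Proof.
move=> tp; have [sp cp _] := tp.
have : compact (phi @` closure [set x | phi x != 0]).
  apply: continuous_compact => //; apply: continuous_subspaceT.
  exact: test_function_continuous tp.
move=> /compact_bounded[M [_ HM]]; exists (`|M| + 1); first by rewrite ltr_wpDl.
move=> x; have [p0|p0] := eqVneq (phi x) 0.
  by rewrite p0 normr0 addr_ge0.
apply: HM; first by rewrite (le_lt_trans (ler_norm M))// ltrDl.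
by exists x => //; exact: subset_closure.
Qed.

(* Tends to the indicator function of [box a b] as n goes to infinity. *)
Definition box_bump (n : nat) a b : E -> R :=
  \prod_(i < d) ((fun x : E => step (n%:R * x 0 i + - (n%:R * a 0 i))) *
                 (fun x : E => step (- n%:R * x 0 i + (n%:R * b 0 i + 1)))).

Lemma box_bumpE n a b x : box_bump n a b x = \prod_(i < d)
  (step (n%:R * (x 0 i - a 0 i)) * step (n%:R * (b 0 i - x 0 i) + 1)).
Proof.
rewrite /box_bump fct_prodE; apply: eq_bigr => i _ /=.
rewrite -[LHS]/(step _ * step _); congr (step _ * step _); ring.
Qed.

Lemma box_bump_ge0 n a b x : 0 <= box_bump n a b x.
Proof. by rewrite box_bumpE; apply: prodr_ge0 => i _; rewrite mulr_ge0// step_ge0. Qed.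

Lemma box_bump_le1 n a b x : box_bump n a b x <= 1.
Proof.
rewrite box_bumpE prodr_ile1// => i _; rewrite mulr_ge0 ?step_ge0//=.
by rewrite mulr_ile1 ?step_ge0 ?step_le1.
Qed.

Lemma box_bump_eq0 n a b x e : (0 < n)%N -> n%:R^-1 <= e ->
  ~ cbox a (b + const_mx e) x -> box_bump n a b x = 0.
Proof.
move=> n0 ne /existsNP[i /negP]; rewrite negb_and -!ltNge !mxE => xab.
have n0' : (0 : R) < n%:R by rewrite ltr0n.
rewrite box_bumpE (bigD1 i)//=; apply/eqP; rewrite mulf_eq0; apply/orP; left.
case/orP : xab => h.
  by rewrite step_eq0 ?mul0r// pmulr_rle0// subr_le0 ltW.
rewrite [X in _ * X]step_eq0 ?mulr0// -opprB mulrN addrC subr_le0.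
by rewrite -ler_pdivrMl// mulr1 (le_trans ne)// lerBrDl ltW.
Qed.

Lemma test_function_bump Omega n a b e : (0 < n)%N -> n%:R^-1 <= e ->
  cbox a (b + const_mx e) `<=` Omega -> test_function Omega (box_bump n a b).
Proof.
move=> n0 ne abO; apply: (@test_function_sub _ _ _ _ (cbox a (b + const_mx e))) => //.
- apply: smooth_prod => i; apply: smoothM; apply: smooth_coord;
  exact: smooth_step.
- exact: cbox_compact.
- by apply: compact_closed (@cbox_compact _ _ _ _); exact: norm_hausdorff.
- by move=> x; exact: box_bump_eq0.
Qed.

Lemma cvg_bump a b x : box_bump n a b x @[n --> \oo] --> (\1_(box a b) x : R).
Proof.
rewrite indicE; have [xab|xab] := boolP (x \in box a b).
  apply: cvg_near_cst; rewrite inE in xab.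
  have /choice[N NP] : forall i, exists N : nat, (x 0 i - a 0 i)^-1 < N%:R.
    by move=> i; exact: ex_nat_gt.
  exists (\max_(i < d) N i)%N => // n /= Nn; rewrite box_bumpE big1// => i _.
  have /andP[ax xb] := xab i.
  rewrite !step_eq1 ?mulr1//.
    by rewrite lerDr mulr_ge0// subr_ge0.
  rewrite -ler_pdivrMr ?subr_gt0// mul1r (le_trans (ltW (NP i)))// ler_nat.
  by apply: leq_trans Nn; exact: leq_bigmax.
rewrite notin_setE in xab; move/existsNP : xab => [i /negP].
rewrite negb_and -leNgt -ltNge => /orP[xa|bx].
  apply: cvg_near_cst; apply: nearW => n.
  rewrite box_bumpE (bigD1 i)//= step_eq0 ?mul0r//.
  by rewrite mulr_ge0_le0// subr_le0.
apply: cvg_near_cst; have [N HN] := ex_nat_gt (x 0 i - b 0 i)^-1.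
exists N => // n /= Nn; rewrite box_bumpE (bigD1 i)//=.
rewrite [X in _ * X * _]step_eq0 ?mulr0 ?mul0r// -opprB mulrN addrC subr_le0.
rewrite -ler_pdivrMr ?subr_gt0// mul1r (le_trans (ltW HN))// ler_nat.
by [].
Qed.

End rV_measurable.

(** * The fundamental lemma of the calculus of variations *)

Section restriction.
Context {disp} {T : measurableType disp} {R : realType}.
Variable mu : {measure set T -> \bar R}.
Variables (D K : set T) (f : T -> R).
Hypotheses (KD : K `<=` D) (f0 : forall x, D x -> ~ K x -> f x = 0).

Let patchE : (EFin \o f) \_ D = (EFin \o f) \_ K.
Proof.
apply/funext => x; rewrite !patchE; case: ifPn => xD; case: ifPn => xK //.
- by rewrite /= f0//; [exact: set_mem|rewrite notin_setE in xK].
- by rewrite notin_setE in xD; rewrite inE in xK; case: xD; exact: KD.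
Qed.

Lemma integrable_supp : measurable D -> measurable K ->
  mu.-integrable K (EFin \o f) -> mu.-integrable D (EFin \o f).
Proof. by move=> mD mK /(integrable_mkcond _ mK); rewrite -patchE => /(integrable_mkcond _ mD). Qed.

Lemma Rintegral_supp : \int[mu]_(x in D) f x = \int[mu]_(x in K) f x.
Proof. by rewrite /Rintegral integral_mkcond patchE -integral_mkcond. Qed.

End restriction.

Section fundamental_lemma.
Context {R : realType} {d : nat}.
Notation E := 'rV[R]_d.
Notation mu := (lebesgue_rV d).
Variable Omega : set E.
Hypothesis oO : open Omega.
Implicit Types (f g phi : E -> R) (a b x : E).

Lemma integrable_L1loc_test f phi : in_L1loc Omega f -> test_function Omega phi ->
  mu.-integrable Omega (EFin \o (fun x => f x * phi x)).
Proof.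
move=> [mf fK] tp; have [sp cp Op] := tp.
have mK := measurable_compact cp.
apply: (@integrable_supp _ _ _ _ _ (closure [set x | phi x != 0])) => //.
- move=> x _ nx; suff -> : phi x = 0 by rewrite mulr0.
  by apply: contra_notP nx => /eqP ?; exact: subset_closure.
- exact: measurable_open.
- have [M M0 HM] := test_function_bounded tp.
  have := @integrableMl _ _ _ mu _ mK (EFin \o f) phi (fK _ cp Op).
  apply; first by apply: measurable_funTS; apply: continuous_rV_measurable;
    exact: test_function_continuous tp.
  exists M; split; first exact: num_real.
  move=> r Mr x _ /=.
  by rewrite (le_trans (HM x))// ltW.
Qed.

Section box.
Variable f : E -> R.
Hypotheses (f1 : in_L1loc Omega f)
  (f0 : forall phi, test_function Omega phi -> \int[mu]_(x in Omega) (f x * phi x) = 0).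

Let integrable_cbox a b : cbox a b `<=` Omega -> mu.-integrable (cbox a b) (EFin \o f).
Proof. by move=> abO; apply: f1.2 => //; exact: cbox_compact. Qed.

(** The bumps are test functions supported in the enlarged box as soon as 1/n <= e. They tend to the
    indicator of the box and are dominated by 1, while f is integrable on the compact enlarged
    box. *)
Lemma integral_box0 a b e : 0 < e -> cbox a (b + const_mx e) `<=` Omega ->
  \int[mu]_(x in box a b) f x = 0.
Proof.
move=> e0 abO; set K := cbox a (b + const_mx e).
have [N eN] := ex_nat_gt e^-1.
have mK : measurable K by exact: measurable_cbox.
have bK : box a b `<=` K.
  move=> x xab i; have /andP[h1 h2] := xab i; rewrite !mxE (ltW h1)/=.
  by rewrite (le_trans h2)// lerDl ltW.
have nE n : (N < n)%N -> (n%:R : R)^-1 <= e.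
  move=> Nn; rewrite -[leRHS]invrK lef_pV2 ?posrE ?invr_gt0 ?ltr0n ?(leq_trans _ Nn)//.
  by rewrite (le_trans (ltW eN))// ler_nat ltnW.
have I0 n : (N < n)%N -> \int[mu]_(x in K) (f x * box_bump n a b x) = 0.
  move=> Nn; have n0 : (0 < n)%N by exact: leq_trans Nn.
  rewrite -(f0 (test_function_bump n0 (nE _ Nn) abO)); apply/esym.
  apply: Rintegral_supp => // x _ xK; rewrite (box_bump_eq0 n0 (nE _ Nn) xK) mulr0 //.
have mf : measurable_fun K f by exact: integrable_measurable (integrable_cbox abO).
have [] := @Rintegral_dominated _ _ _ mu K mK (fun n x => f x * box_bump n a b x)
    (fun x => f x * \1_(box a b) x) (fun x => `|f x|).
- move=> n; apply: measurable_funM => //; apply: measurable_funTS.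
  apply: continuous_rV_measurable; apply: smooth_continuous.
  by apply: smooth_prod => i; apply: smoothM; apply: smooth_coord; exact: smooth_step.
- by apply: measurable_funM => //; apply: measurable_indic; exact: measurable_box.
- by apply: aeW => x _; apply: cvgM; [exact: cvg_cst|exact: cvg_bump].
- by apply: integrable_norm_fin; exact: integrable_cbox.
- move=> n x _; rewrite normrM ler_piMr// ger0_norm ?box_bump_ge0 ?box_bump_le1//.
move=> _ cv; transitivity (\int[mu]_(x in K) (f x * \1_(box a b) x)).
  rewrite [RHS](@Rintegral_supp _ _ _ _ K (box a b))//; last first.
    by move=> x _ xab; rewrite indicE memNset// mulr0.
  by apply: eq_Rintegral => x xab; rewrite indicE xab mulr1.
apply: cvg_unique cv _ => //; apply: cvg_near_cst.
by exists N.+1 => // n /= Nn; rewrite I0.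
Qed.

(** The intersection of two boxes is again a box with the same margin, so the integral of f vanishes
    on a pi-system of subsets of Q; Dynkin's theorem extends this to all measurable subsets of Q,
    which forces f to vanish almost everywhere there. *)
Lemma L1loc_eq0_box a b e : 0 < e -> cbox a (b + const_mx e) `<=` Omega ->
  {ae mu, forall x, box a b x -> f x = 0}.
Proof.
move=> e0 abO; set Q := box a b; have mQ : measurable Q by exact: measurable_box.
have QO : Q `<=` cbox a (b + const_mx e).
  move=> x xab i; have /andP[h1 h2] := xab i; rewrite !mxE (ltW h1)/=.
  by rewrite (le_trans h2)// lerDl ltW.
have fQ : mu.-integrable Q (EFin \o f).
  by apply: integrableS (integrable_cbox abO) => //; exact: measurable_cbox.
have fQS S : measurable S -> mu.-integrable (S `&` Q) (EFin \o f).
  by move=> mS; apply: integrableS fQ => //; exact: measurableI.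
have IQ : \int[mu]_(x in Q) f x = 0 by exact: integral_box0 e0 abO.
have key S : measurable S -> \int[mu]_(x in S `&` Q) f x = 0.
  rewrite measurable_boxes; move: S.
  apply: (dynkin_induction measurable_boxes (@boxesI _ _)).
  - by rewrite setTI.
  - move=> _ [a' [b' ->]]; rewrite /Q boxI; apply: (integral_box0 e0).
    apply: subset_trans abO => x xab i; have := xab i; rewrite !mxE.
    by rewrite ge_max => /andP[/andP[_ ->]] h; rewrite (le_trans h)// lerD2r ge_min lexx orbT.
  - move=> S mS IS; move: IQ; rewrite -[in X in X -> _](setTI Q) -(setvU S) setIUl.
    rewrite Rintegral_setU ?IS ?addr0//.
    + by apply: measurableI => //; exact: measurableC.
    + exact: measurableI.
    + by rewrite -setIUl setvU; exact: fQS.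
    + by apply/disj_setPS => x [[nS _] [? _]]; exact: nS.
  - move=> F mF tF IF; rewrite /Rintegral setI_bigcupl integral_bigcup//.
    + rewrite eseries0 // => i _ _; have := congr1 EFin (IF i).
      by rewrite EFin_Rintegral//; [exact: measurableI|exact: fQS].
    + by apply: trivIset_setIr.
    + by move=> k; exact: measurableI.
    + by rewrite -setI_bigcupl; apply: fQS; exact: bigcup_measurable.
have : ae_eq mu Q (EFin \o f) (cst 0%E).
  apply: integral_ae_eq => //; move=> S SQ mS; rewrite integral0.
  have := congr1 EFin (key _ mS); rewrite (setIidl SQ) EFin_Rintegral//.
  by rewrite -(setIidl SQ); exact: fQS.
by apply: filterS => x /= h Qx; have [] := h Qx.
Qed.

Lemma L1loc_eq0 : {ae mu, forall x, Omega x -> f x = 0}.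
Proof.
pose P (q : 'rV[rat]_d * 'rV[rat]_d) :=
  exists2 e : R, 0 < e & cbox (ratrV q.1) (ratrV q.2 + const_mx e) `<=` Omega.
have ae q : {ae mu, forall x, P q -> box (ratrV q.1) (ratrV q.2) x -> f x = 0}.
  have [[e e0 qO]|nP] := pselect (P q); last by apply: aeW => x.
  by apply: filterS (L1loc_eq0_box e0 qO) => x + _.
have : {ae mu, forall x, forall n : nat, if unpickle n is Some q then
    P q -> box (ratrV q.1) (ratrV q.2) x -> f x = 0 else True}.
  apply/ae_foralln => n; case: unpickle => [q|]; [exact: ae|exact: aeW].
apply: filterS => x h Ox; have [q [qx Pq]] := open_rat_box oO Ox.
by have := h (pickle q); rewrite pickleK; apply.
Qed.

End box.
End fundamental_lemma.

(** * Integration by parts against test functions *)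

Section translation.
Context {R : realType} {d : nat}.
Notation E := 'rV[R]_d.
Notation mu := (lebesgue_rV d).
Implicit Types (f chi : E -> R) (v x : E).

Lemma measurable_translation v : measurable_fun setT (fun x : E => x + v).
Proof.
apply: measurable_fun_rVP => i.
rewrite (_ : _ \o _ = (fun x => rV_coord i x + v 0 i)).
  by apply: measurable_funD => //; exact: measurable_rV_coord.
by apply/funext => x; rewrite /rV_coord /= mxE.
Qed.

Lemma Rintegral_translation f v : measurable_fun setT f ->
  mu.-integrable setT (EFin \o f) ->
  mu.-integrable setT (EFin \o (fun x => f (x + v))) /\
  \int[mu]_x f (x + v) = \int[mu]_x f x.
Proof.
move=> mf fi; have mt := measurable_translation v.
pose t (x : E) := x + v.
have mt' : measurable_fun setT t by [].
pose m0 : {measure set E -> \bar R} := pushforward mu t.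
pose m := m0 mt'.
have mE A : measurable A -> m A = mu A.
  apply: lebesgue_rV_unique => a b ab.
  rewrite [LHS](_ : _ = mu (box (a - v) (b - v))); last first.
    rewrite /m /m0 /= /pushforward /t; congr (mu _); apply/seteqP; split => x /= h i;
    by have := h i; rewrite !mxE ltrBlDr lerBrDr.
  rewrite !lebesgue_rV_box//; last by move=> i; rewrite !mxE lerD2r.
  by congr EFin; apply: eq_bigr => i _; rewrite !mxE opprB addrA subrK.
have intE (g : E -> \bar R) : measurable_fun setT g -> (forall x, 0 <= g x)%E ->
    (\int[mu]_x g (x + v)%R = \int[mu]_x g x)%E.
  move=> mg g0; transitivity (\int[m]_x g x)%E; last first.
    by apply: eq_measure_integral => A mA _; exact: mE.
  by rewrite /m /m0 ge0_integral_pushforward.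
have mft : measurable_fun setT (fun x => f (x + v)).
  exact: (measurableT_comp mf mt).
have fti : mu.-integrable setT (EFin \o (fun x => f (x + v))).
  apply/integrableP; split; first exact/measurable_EFinP.
  have /integrableP[_] := fi; rewrite -(intE (fun x => `|(f x)%:E|%E))//.
  by apply: measurableT_comp => //; exact/measurable_EFinP.
split => //; rewrite /Rintegral integralE [in RHS]integralE.
have mfE : measurable_fun setT (EFin \o f) by exact/measurable_EFinP.
rewrite -(intE ((EFin \o f)^\+)%E)//; last exact: measurable_funepos.
rewrite -(intE ((EFin \o f)^\-)%E)//; last exact: measurable_funeneg.
congr (fine (_ - _)%E); apply: eq_integral => x _.
  by rewrite !funeposE.
by rewrite !funenegE.
Qed.

Lemma is_derive_line chi v x (s : R) : smooth chi ->
  is_derive s 1 (fun r : R => chi (r *: v + x)) ('D_v chi (s *: v + x)).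
Proof.
move=> sc; have /cvg_ex[l hl] : derivable chi (s *: v + x) v by exact: smooth_derivable.
have E1 : (fun h : R => h^-1 *: (chi ((h *: (1 : R) + s) *: v + x) - chi (s *: v + x))) =
    (fun h : R => h^-1 *: (chi (h *: v + (s *: v + x)) - chi (s *: v + x))).
  by apply/funext => h; rewrite scalerDl /GRing.scale/= mulr1 addrA.
apply: DeriveDef; first by rewrite /derivable/= E1; apply/cvg_ex; exists l.
by rewrite /derive /= E1.
Qed.

Lemma increment_bound chi v x (M h : R) : smooth chi -> 0 < h ->
  (forall y, `|'D_v chi y| <= M) -> `|chi (h *: v + x) - chi x| <= M * h.
Proof.
move=> sc h0 HM.
have dl (s : R) : is_derive s 1 (fun r : R => chi (r *: v + x)) ('D_v chi (s *: v + x)).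
  exact: is_derive_line.
have [|c _] := MVT h0 (fun s _ => dl s).
  by apply: derivable_within_continuous => s _; exact: ex_derive.
by rewrite scale0r add0r subr0 => ->; rewrite normrM (gtr0_norm h0) ler_wpM2r// ltW.
Qed.

Lemma test_function_cst_box chi : test_function setT chi ->
  exists k, forall x, ~ cst_box k x -> chi x = 0.
Proof.
move=> [_ cc _]; have [k kP] := bounded_set_cst_box (compact_bounded cc).
exists k => x nx; apply: contra_notP nx => /eqP ?; apply: kP.
exact: subset_closure.
Qed.

Lemma integrable_test chi : test_function setT chi ->
  mu.-integrable setT (EFin \o chi).
Proof.
move=> tc; have [k kP] := test_function_cst_box tc.
have mk : measurable (cst_box k : set E) by exact: measurable_box.
apply: (@integrable_supp _ _ _ _ _ (cst_box k)) => //.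
  by move=> x _; exact: kP.
apply: measurable_bounded_integrable => //.
- exact: lebesgue_cst_box.
- apply: measurable_funTS; apply: continuous_rV_measurable.
  exact: test_function_continuous tc.
- have [M M0 HM] := test_function_bounded tc.
  exists M; split; first exact: num_real.
  by move=> r Mr x _ /=; rewrite (le_trans (HM x))// ltW.
Qed.

(** Difference quotients in direction v have integral zero by translation invariance, and they
    converge boundedly to the derivative. Since |v| <= 1, the translated supports stay in the box
    [cst_box k.+1], which gives an integrable dominating function. *)
Lemma Rintegral_derive0 chi v : test_function setT chi -> `|v| <= 1 ->
  \int[mu]_x 'D_v chi x = 0.
Proof.
move=> tc v1; have [sc _ _] := tc; have td := test_function_derive v tc.
have [k kP] := test_function_cst_box tc.
have [M M0 HM] := test_function_bounded td.
have mc (g : E -> R) : continuous g -> measurable_fun setT g.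
  exact: continuous_rV_measurable.
have cc : continuous chi by exact: test_function_continuous tc.
pose F n x := n.+1%:R * (chi (x + n.+1%:R^-1 *: v) - chi x).
have mF n : measurable_fun setT (F n).
  apply: measurable_funM => //; apply: measurable_funB => //; last exact: mc.
  by apply: (measurableT_comp (mc _ cc)); exact: measurable_translation.
have [] := @Rintegral_dominated _ _ _ mu setT measurableT F ('D_v chi)
    (fun x => M * \1_(cst_box k.+1) x).
- exact: mF.
- by apply: mc; exact: test_function_continuous td.
- apply: aeW => x _.
  have /cvg_ex[l hl] : derivable chi x v by exact: smooth_derivable.
  have -> : 'D_v chi x = l by apply: cvg_lim hl.
  have /cvgr_dnbhsP/(_ (fun n => n.+1%:R^-1)) := hl.
  rewrite (_ : (fun n => F n x) = (fun n => n.+1%:R^-1^-1 *: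
      (chi (n.+1%:R^-1 *: v + x) - chi x))).
    by apply; split; [move=> n; rewrite invr_eq0|exact: cvg_harmonic].
  by apply/funext => n; rewrite /F invrK [_ *: v + x]addrC.
- apply: (@integrableZ_fin _ _ _ mu setT measurableT M (\1_(cst_box k.+1))).
  apply: (@integrable_supp _ _ _ _ _ (cst_box k.+1)) => //.
  + by move=> x _ xk; rewrite indicE memNset.
  + exact: measurable_box.
  apply: measurable_bounded_integrable => //.
  + exact: measurable_box.
  + exact: lebesgue_cst_box.
  + by apply: measurable_indic; exact: measurable_box.
  + exists 1; split; first exact: num_real.
    by move=> r r1 x _ /=; rewrite indicE ger0_norm//; case: (_ \in _); rewrite ?(le_trans _ (ltW r1)).
- move=> n x _; rewrite /F; have n0 : (0 : R) < n.+1%:R^-1 by rewrite invr_gt0.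
  rewrite normrM ger0_norm// indicE.
  have [xk|xk] := boolP (x \in cst_box k.+1).
    by rewrite mulr1 [x + _]addrC -ler_pdivlMl// [_^-1 * M]mulrC; exact: increment_bound.
  rewrite mulr0; rewrite notin_setE in xk.
  suff [-> ->] : chi (x + n.+1%:R^-1 *: v) = 0 /\ chi x = 0.
    by rewrite subrr normr0 mulr0.
  have vn i : `|n.+1%:R^-1 * v 0 i| <= 1.
    rewrite normrM mulr_ile1//; first by rewrite gtr0_norm// invf_le1// ler1n.
    exact: le_trans (norm_coord_le v i) v1.
  have aux (a b K : R) : `|a| <= 1 -> - K < b + a <= K -> - (K + 1) < b <= K + 1.
    by rewrite ler_norml => /andP[? ?] /andP[? ?]; apply/andP; split; lra.
  split; apply: kP => h; apply: xk => i; have := h i; rewrite !mxE -(@natr1 _ k).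
    exact: aux.
  by move=> xi; apply: (aux 0); rewrite ?normr0 ?addr0.
move=> _; have -> : (fun n => \int[mu]_x F n x) = (fun=> 0).
  apply/funext => n; have ic := integrable_test tc.
  have [it E1] := Rintegral_translation (n.+1%:R^-1 *: v) (mc _ cc) ic.
  rewrite RintegralZl//; last by have := integrableB measurableT it ic.
  by rewrite RintegralB// E1 subrr mulr0.
by move=> cv; apply: cvg_unique cv _ => //; exact: cvg_cst.
Qed.

End translation.

Section test_weak_partial.
Context {R : realType} {d : nat}.
Notation E := 'rV[R]_d.
Notation mu := (lebesgue_rV d).
Variable Omega : set E.
Hypothesis oO : open Omega.
Implicit Types (phi psi : E -> R).

Lemma test_functionT phi : test_function Omega phi -> test_function setT phi.
Proof. by move=> [? ? _]; split. Qed.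

Lemma test_L1loc phi : test_function Omega phi -> in_L1loc Omega phi.
Proof.
move=> tp; split.
  apply: measurable_funTS; apply: continuous_rV_measurable.
  exact: test_function_continuous tp.
move=> K cK KO; apply: integrableS (integrable_test (test_functionT tp)) => //.
exact: measurable_compact.
Qed.

Lemma Rintegral_test phi : test_function Omega phi ->
  \int[mu]_(x in Omega) phi x = \int[mu]_x phi x.
Proof.
move=> tp; apply/esym; apply: Rintegral_supp => // x _ nx.
by apply: contra_notP nx => /eqP ?; exact: (test_function_supp tp).
Qed.

Lemma test_weak_partial i phi : test_function Omega phi ->
  weak_partial Omega i phi ('D_(delta_mx 0 i) phi).
Proof.
move=> tp; set v := delta_mx 0 i.
have tdp := test_function_derive v tp.
split; [exact: test_L1loc|exact: test_L1loc|move=> psi tq].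
have tdq := test_function_derive v tq; have [sp _ _] := tp; have [sq _ _] := tq.
have mO := measurable_open oO.
have i1 := integrable_L1loc_test oO (test_L1loc tp) tdq.
have i2 := integrable_L1loc_test oO (test_L1loc tdp) tq.
apply/eqP; rewrite -subr_eq0 opprK -RintegralD//; apply/eqP.
have := Rintegral_derive0 (test_functionT (test_functionM tp sq)).
move=> /(_ v) H; rewrite -[RHS]H; last first.
  have -> : `|v| = mx_norm v by [].
  rewrite mx_normrE; apply: bigmax_le => // -[j k] _ /=; rewrite mxE.
  by case: (_ && _); rewrite ?normr1 ?normr0.
rewrite -Rintegral_test; last first.
  by apply: test_function_derive; exact: test_functionM.
apply: eq_Rintegral => x _; rewrite deriveM; [|exact: smooth_derivable..].
by rewrite /GRing.scale/= [psi x * _]mulrC.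
Qed.

End test_weak_partial.

(** * Complete semi-inner-product spaces *)

Section prehilbert_def.
Context {R : realType} {E : lmodType R}.
Variables (H : set E) (ip : E -> E -> R).

(** Definiteness is left out because distinct representatives of one class have distance zero.
    Equality is replaced throughout by a zero seminorm of the difference. *)
Record prehilbert : Prop := Prehilbert {
  ph_mem0 : H 0 ;
  ph_memD : forall x y, H x -> H y -> H (x + y) ;
  ph_memZ : forall k x, H x -> H (k *: x) ;
  ph_ipC : forall x y, H x -> H y -> ip x y = ip y x ;
  ph_ipDl : forall x y z, H x -> H y -> H z -> ip (x + y) z = ip x z + ip y z ;
  ph_ipZl : forall k x y, H x -> H y -> ip (k *: x) y = k * ip x y ;
  ph_ip_ge0 : forall x, H x -> 0 <= ip x x }.

Definition nrm (x : E) : R := Num.sqrt (ip x x).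

Definition nrm_complete := forall u : nat -> E, (forall n, H (u n)) ->
  (forall e, 0 < e -> exists N, forall m n, (N <= m)%N -> (N <= n)%N ->
    nrm (u m - u n) <= e) ->
  exists l, H l /\ forall e, 0 < e -> exists N, forall n, (N <= n)%N ->
    nrm (u n - l) <= e.

End prehilbert_def.

Section prehilbert_theory.
Context {R : realType} {E : lmodType R} (H : set E) (ip : E -> E -> R).
Hypothesis pH : prehilbert H ip.
Local Notation nrm := (nrm ip).
Implicit Types (x y z : E) (k : R).

Lemma phD x y : H x -> H y -> H (x + y). Proof. exact: ph_memD pH _ _. Qed.
Lemma phZ k x : H x -> H (k *: x). Proof. exact: ph_memZ pH _ _. Qed.
Lemma ph0 : H 0. Proof. exact: ph_mem0 pH. Qed.
Lemma phN x : H x -> H (- x). Proof. by rewrite -scaleN1r; exact: phZ. Qed.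
Lemma phB x y : H x -> H y -> H (x - y).
Proof. by move=> Hx Hy; apply: phD => //; exact: phN. Qed.
#[local] Hint Resolve phD phZ ph0 phN phB : core.

Lemma ph_sum (I : Type) (s : seq I) (F : I -> E) :
  (forall i, H (F i)) -> H (\sum_(i <- s) F i).
Proof. by move=> HF; elim/big_ind: _ => //; exact: phD. Qed.

Lemma ipC x y : H x -> H y -> ip x y = ip y x. Proof. exact: ph_ipC. Qed.

Lemma ipDl x y z : H x -> H y -> H z -> ip (x + y) z = ip x z + ip y z.
Proof. exact: ph_ipDl. Qed.

Lemma ipDr x y z : H x -> H y -> H z -> ip z (x + y) = ip z x + ip z y.
Proof. by move=> Hx Hy Hz; rewrite ipC ?ipDl ?(ipC Hz)//; exact: phD. Qed.

Lemma ipZl k x y : H x -> H y -> ip (k *: x) y = k * ip x y.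
Proof. exact: ph_ipZl. Qed.

Lemma ipZr k x y : H x -> H y -> ip x (k *: y) = k * ip x y.
Proof. by move=> Hx Hy; rewrite ipC ?ipZl ?(ipC Hx)//; exact: phZ. Qed.

Lemma ipNl x y : H x -> H y -> ip (- x) y = - ip x y.
Proof. by move=> Hx Hy; rewrite -scaleN1r ipZl// mulN1r. Qed.

Lemma ipNr x y : H x -> H y -> ip x (- y) = - ip x y.
Proof. by move=> Hx Hy; rewrite -scaleN1r ipZr// mulN1r. Qed.

Lemma ipBl x y z : H x -> H y -> H z -> ip (x - y) z = ip x z - ip y z.
Proof. by move=> Hx Hy Hz; rewrite ipDl ?ipNl//; exact: phN. Qed.

Lemma ipBr x y z : H x -> H y -> H z -> ip z (x - y) = ip z x - ip z y.
Proof. by move=> Hx Hy Hz; rewrite ipDr ?ipNr//; exact: phN. Qed.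

Lemma ip0l x : H x -> ip 0 x = 0.
Proof. by move=> Hx; rewrite -(scale0r 0) ipZl// mul0r. Qed.

Lemma ip_suml (I : Type) (s : seq I) (F : I -> E) y : (forall i, H (F i)) ->
  H y -> ip (\sum_(i <- s) F i) y = \sum_(i <- s) ip (F i) y.
Proof.
move=> HF Hy; elim: s => [|i s ih]; first by rewrite !big_nil ip0l.
by rewrite !big_cons ipDl ?ih//; exact: ph_sum.
Qed.

Lemma ip_ge0 x : H x -> 0 <= ip x x. Proof. exact: ph_ip_ge0. Qed.

Lemma nrm_ge0 x : 0 <= nrm x. Proof. exact: sqrtr_ge0. Qed.
#[local] Hint Resolve nrm_ge0 : core.

Lemma nrm_sqr x : H x -> nrm x ^+ 2 = ip x x.
Proof. by move=> Hx; rewrite sqr_sqrtr// ip_ge0. Qed.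

Lemma ip_sqr_le x y : H x -> H y -> ip x y ^+ 2 <= ip x x * ip y y.
Proof.
move=> Hx Hy.
have key s : 0 <= ip x x + 2 * s * ip x y + s ^+ 2 * ip y y.
  have Hs := phZ s Hy; have := ip_ge0 (phD Hx Hs).
  rewrite ipDl ?ipDr//; last exact: phD.
  rewrite !ipZl// !ipZr// (ipC Hy Hx); congr (_ <= _); ring.
have [y0|y0] := eqVneq (ip y y) 0.
  suff -> : ip x y = 0 by rewrite expr0n mulr_ge0// ip_ge0.
  apply/eqP/negPn/negP => xy0.
  (* When y is a null vector, the quadratic in s is affine; at this s it takes the value -1. *)
  have := key (- (ip x x + 1) / (2 * ip x y)).
  have -> : 2 * (- (ip x x + 1) / (2 * ip x y)) * ip x y = - (ip x x + 1).
    by field.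
  by rewrite y0 mulr0 addr0 opprD addrA subrr sub0r oppr_ge0 ler10.
have yp : 0 < ip y y by rewrite lt_neqAle eq_sym y0 ip_ge0.
have := mulr_ge0 (key (- ip x y / ip y y)) (ltW yp).
rewrite [X in 0 <= X](_ : _ = ip x x * ip y y - ip x y ^+ 2); last by field.
by rewrite subr_ge0.
Qed.

Lemma cauchy_schwarz x y : H x -> H y -> `|ip x y| <= nrm x * nrm y.
Proof.
move=> Hx Hy; rewrite -(@ler_pXn2r _ 2)// ?nnegrE ?mulr_ge0//.
by rewrite real_normK ?num_real// exprMn !nrm_sqr// ip_sqr_le.
Qed.

Lemma nrmZ k x : H x -> nrm (k *: x) = `|k| * nrm x.
Proof.
move=> Hx; rewrite /nrm ipZl ?ipZr//; last exact: phZ.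
by rewrite mulrA -expr2 sqrtrM ?sqr_ge0// sqrtr_sqr.
Qed.

Lemma nrm0 : nrm 0 = 0.
Proof. by rewrite -(scale0r 0) nrmZ// normr0 mul0r. Qed.

Lemma nrmN x : H x -> nrm (- x) = nrm x.
Proof. by move=> Hx; rewrite -scaleN1r nrmZ// normrN1 mul1r. Qed.

Lemma nrmBC x y : H x -> H y -> nrm (x - y) = nrm (y - x).
Proof. by move=> Hx Hy; rewrite -opprB nrmN//; exact: phB. Qed.

Lemma nrmD x y : H x -> H y -> nrm (x + y) <= nrm x + nrm y.
Proof.
move=> Hx Hy; rewrite -(@ler_pXn2r _ 2)// ?nnegrE ?addr_ge0//.
rewrite nrm_sqr; last exact: phD.
rewrite ipDl ?ipDr// ?(ipC Hy Hx); last exact: phD.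
rewrite sqrrD !nrm_sqr//.
have := le_trans (ler_norm _) (cauchy_schwarz Hx Hy); lra.
Qed.

Lemma nrmB x y : H x -> H y -> nrm (x - y) <= nrm x + nrm y.
Proof. by move=> Hx Hy; rewrite -(nrmN Hy) nrmD//; exact: phN. Qed.

Lemma nrmB_trans z x y : H x -> H y -> H z ->
  nrm (x - y) <= nrm (x - z) + nrm (z - y).
Proof.
by move=> Hx Hy Hz; rewrite -[x - y](subrKA z) nrmD//; exact: phB.
Qed.

Lemma nrm_dist x y : H x -> H y -> `|nrm x - nrm y| <= nrm (x - y).
Proof.
move=> Hx Hy; rewrite ler_norml; apply/andP; split.
  have := nrmD (phB Hy Hx) Hx; rewrite subrK nrmBC//; lra.
have := nrmD (phB Hx Hy) Hy; rewrite subrK; lra.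
Qed.

Lemma nrm_le_dual x C : H x -> 0 <= C ->
  (forall y, H y -> `|ip x y| <= C * nrm y) -> nrm x <= C.
Proof.
move=> Hx C0 /(_ x Hx) h; have [x0|x0] := eqVneq (nrm x) 0; first by rewrite x0.
have xp : 0 < nrm x by rewrite lt_neqAle eq_sym x0/=.
by rewrite -(ler_pM2r xp) -expr2 nrm_sqr// (le_trans (ler_norm _)).
Qed.

Lemma ip_eq0 x y : H x -> H y -> nrm x = 0 -> ip x y = 0.
Proof.
move=> Hx Hy x0; have := cauchy_schwarz Hx Hy.
by rewrite x0 mul0r normr_le0 => /eqP.
Qed.

End prehilbert_theory.

Section riesz.
Context {R : realType} {E : lmodType R} (H : set E) (ip : E -> E -> R).
Hypotheses (pH : prehilbert H ip) (cH : nrm_complete H ip).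
Local Notation nrm := (nrm ip).

(** The representer minimises the energy [J x = ip x x - 2 * F x], which is bounded below by - C^2.
    The parallelogram identity makes minimising sequences Cauchy, and the first variation at a
    minimiser is the claimed equation. This works verbatim for a semidefinite form. *)
Theorem riesz (F : E -> R) (C : R) :
  (forall x y, H x -> H y -> F (x + y) = F x + F y) ->
  (forall k x, H x -> F (k *: x) = k * F x) ->
  (forall x, H x -> `|F x| <= C * nrm x) ->
  exists x, H x /\ forall y, H y -> ip x y = F y.
Proof.
move=> FD FZ FC.
have [[HD HZ] HB] := (phD pH, phZ pH, phB pH).
pose J x := ip x x - 2 * F x.
have F0 : F 0 = 0 by rewrite -(scale0r (0 : E)) FZ ?mul0r//; exact: ph0 pH.
pose A := [set J x | x in H].
have Ainf : has_inf A.
  split; first by exists (J 0), 0 => //; exact: ph0 pH.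
  exists (- C ^+ 2) => _ [x Hx <-]; rewrite /J -(nrm_sqr pH Hx).
  have := le_trans (ler_norm _) (FC x Hx); have := sqr_ge0 (nrm x - C).
  rewrite sqrrB; nra.
pose m := inf A.
have mJ x : H x -> m <= J x by move=> Hx; apply: ge_inf; [case: Ainf|exists x].
have /choice[u uP] : forall n : nat, exists x, H x /\ J x < m + n.+1%:R^-1.
  move=> n; have n0 : (0 : R) < n.+1%:R^-1 by rewrite invr_gt0.
  by have [_ [x Hx <-] h] := inf_adherent n0 Ainf; exists x.
have Hu n : H (u n) by case: (uP n).
have Ju n : J (u n) < m + n.+1%:R^-1 by case: (uP n).
have para x y e1 e2 : H x -> H y -> J x < m + e1 -> J y < m + e2 ->
    nrm (x - y) ^+ 2 <= 2 * (e1 + e2).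
  move=> Hx Hy Jx Jy; have HxD := HD _ _ Hx Hy; have HxB := HB _ _ Hx Hy.
  have := mJ (2^-1 *: (x + y)) (HZ _ _ HxD).
  have -> : J (2^-1 *: (x + y)) =
      4^-1 * (ip x x + 2 * ip x y + ip y y) - (F x + F y).
    rewrite /J FZ// FD// (ipZl pH)//; last exact: HZ.
    by rewrite (ipZr pH)// (ipDl pH)// !(ipDr pH)// (ipC pH Hy Hx); field.
  have -> : nrm (x - y) ^+ 2 = ip x x - 2 * ip x y + ip y y.
    by rewrite (nrm_sqr pH)// (ipBl pH)// !(ipBr pH)// (ipC pH Hy Hx); ring.
  rewrite /J in Jx Jy *; lra.
have inv_small (e : R) : 0 < e ->
    exists N : nat, forall n : nat, (N <= n)%N -> n.+1%:R^-1 <= e.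
  move=> e0; have [N HN] := ex_nat_gt e^-1; exists N => n Nn.
  rewrite -[leRHS]invrK lef_pV2 ?posrE ?invr_gt0// (le_trans (ltW HN))// ler_nat.
  by rewrite (leq_trans Nn).
have [|x [Hx ux]] := cH Hu.
  move=> e e0; have [N HN] := inv_small (e ^+ 2 / 4) (divr_gt0 (exprn_gt0 _ e0) (ltr0Sn _ _)).
  exists N => i j Ni Nj; rewrite -(@ler_pXn2r _ 2)// ?nnegrE ?(nrm_ge0 _ _) ?(ltW e0)//.
  apply: le_trans (para _ _ _ _ (Hu i) (Hu j) (Ju i) (Ju j)) _.
  have := HN i Ni; have := HN j Nj.
  set a := i.+1%:R^-1; set b := j.+1%:R^-1; set c := e ^+ 2.
  lra.
exists x; split => //.
have Jx : J x <= m.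
  apply/ler_addgt0Pr => e e0.
  (* A Lipschitz constant of [J] at x on the ball of radius 1: the summand 1 bounds one factor of
     the quadratic term, which is why the minimum with 1 is taken below. *)
  pose K := 2 * nrm x + 1 + 2 * `|C|.
  have K0 : 0 < K by rewrite /K -addrA ltr_wpDl ?mulr_ge0 ?(nrm_ge0 _ _)// ltr_wpDr ?mulr_ge0.
  have e1 : 0 < Num.min 1 (e / (2 * K)).
    by rewrite lt_min ltr01 divr_gt0// mulr_gt0.
  have [N1 HN1] := ux _ e1; have [N2 HN2] := inv_small (e / 2) (divr_gt0 e0 (ltr0Sn _ _)).
  pose n := maxn N1 N2; have := HN1 n (leq_maxl _ _); have := HN2 n (leq_maxr _ _).
  rewrite le_min => Hn2 /andP[Hn0 Hn1]; have := Ju n.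
  have HB1 := HB _ _ (Hu n) Hx.
  have -> : J (u n) = J x + 2 * ip x (u n - x) + nrm (u n - x) ^+ 2 - 2 * F (u n - x).
    rewrite (nrm_sqr pH)// -[in LHS](subrK x (u n)).
    move: (u n - x) HB1 => z Hz; rewrite /J FD// (ipDl pH)//; last exact: HD.
    by rewrite (ipDr pH Hz Hx Hz) (ipDr pH Hz Hx Hx) (ipC pH Hz Hx); ring.
  have := FC _ HB1; have := cauchy_schwarz pH Hx HB1.
  rewrite !ler_norml => /andP[h1 _] /andP[_ h2].
  have h3 := ler_wpM2r (nrm_ge0 ip (u n - x)) (ler_norm C).
  have h4 : K * nrm (u n - x) <= e / 2.
    rewrite -ler_pdivlMl// (le_trans Hn1)// le_eqVlt; apply/orP; left; apply/eqP; field.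
    by rewrite gt_eqF.
  have h5 := sqr_ge0 (nrm (u n - x)); have h6 := nrm_ge0 ip (u n - x).
  move: Hn2 h1 h2 h3 h4 h5 h6; rewrite /K.
  move: (nrm (u n - x)) (ip x (u n - x)) (F (u n - x)) (J x) (nrm x) `|C| (n.+1%:R^-1).
  clear; move=> *; lra.
move=> y Hy; apply/eqP; rewrite -subr_eq0; apply/negPn/negP => D0.
set D := ip x y - F y in D0.
have key s : 0 <= 2 * s * D + s ^+ 2 * ip y y.
  have := le_trans Jx (mJ _ (HD _ _ Hx (HZ s _ Hy))); rewrite /J FD ?FZ//; last exact: HZ.
  have Hs := HZ s _ Hy; rewrite (ipDl pH) ?(ipDr pH)//; last exact: HD.
  rewrite !(ipZl pH)// !(ipZr pH)// (ipC pH Hy Hx) /D; lra.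
have y0 := ip_ge0 pH Hy.
(* Nearly the minimiser in s of the quadratic of [key]; the added 1 covers the case [ip y y = 0].
   The value found is negative unless D = 0. *)
have := key (- D / (ip y y + 1)).
rewrite (_ : _ + _ = - (D ^+ 2 * (ip y y + 2) / (ip y y + 1) ^+ 2)); last first.
  by field; rewrite gt_eqF// ltr_wpDl.
rewrite oppr_ge0 leNgt divr_gt0// ?exprn_gt0 ?ltr_wpDl//.
by rewrite mulr_gt0 ?ltr_wpDl// exprn_even_gt0.
Qed.

End riesz.

(** * The space of square integrable functions *)

Section L2.
Context {disp} {T : measurableType disp} {R : realType}.
Variables (mu : {measure set T -> \bar R}) (D : set T).
Hypothesis mD : measurable D.
Implicit Types f g : T -> R.
Local Notation int f := (mu.-integrable D (EFin \o f)).
Local Notation L2 := (in_Lp mu 2%:E D).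

Definition L2ip f g : R := \int[mu]_(x in D) (f x * g x).

Lemma Lp_norm2E f :
  Lp_norm mu 2%:E D f = ((\int[mu]_(x in D) (f x ^+ 2)%:E) `^ 2^-1)%E.
Proof.
rewrite /Lp_norm unlock [in RHS]integral_mkcond; congr (_ `^ _)%E.
apply: eq_integral => x _; rewrite /= !patchE; case: ifPn => _ /=.
  by congr EFin; rewrite powR_mulrn// real_normK// num_real.
by rewrite (_ : point = 0 :> R)// normr0 powR_mulrn// expr0n.
Qed.

Lemma L2P f : L2 f <-> measurable_fun D f /\ int (fun x => f x ^+ 2).
Proof.
rewrite /in_Lp Lp_norm2E; split => -[mf fi]; split => //.
  apply/integrableP; split.
    by apply/measurable_EFinP; apply: measurable_funX.
  rewrite [ltLHS](_ : _ = \int[mu]_(x in D) (f x ^+ 2)%:E)%E; last first.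
    by apply: eq_integral => x _; rewrite /= ger0_norm// sqr_ge0.
  by rewrite ltNge leye_eq; apply: contraTN fi => /eqP ->; rewrite poweRyr ?gt_eqF ?invr_gt0// ltxx.
have := EFin_Rintegral mD fi; rewrite /= => <-.
by rewrite poweR_EFin ltry.
Qed.

Lemma L2_measurable f : L2 f -> measurable_fun D f. Proof. by case. Qed.

Lemma L2_int f g : L2 f -> L2 g -> int (fun x => f x * g x).
Proof.
move=> /L2P[mf fi] /L2P[mg gi].
apply: (@integrable_le _ _ _ _ _ mD _ (fun x => f x ^+ 2 + g x ^+ 2)).
- exact: measurable_funM.
- exact: integrableD_fin.
- move=> x _; rewrite normrM -[f x ^+ 2]real_normK ?num_real// -[g x ^+ 2]real_normK ?num_real//.
  have := sqr_ge0 (`|f x| - `|g x|); have := normr_ge0 (f x); have := normr_ge0 (g x).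
  move: `|f x| `|g x| => a b; nra.
Qed.

Lemma L2_norm f : L2 f -> Lp_norm mu 2%:E D f = (nrm L2ip f)%:E.
Proof.
move=> f2; have [mf fi] := (L2P f).1 f2.
rewrite Lp_norm2E -(EFin_Rintegral mD fi) poweR_EFin powR12_sqrt//.
by apply: Rintegral_ge0 => x _; exact: sqr_ge0.
Qed.

Lemma L2_prehilbert : prehilbert L2 L2ip.
Proof.
have LD f g : L2 f -> L2 g -> L2 (f + g).
  move=> f2 g2; have [mf fi] := (L2P f).1 f2; have [mg gi] := (L2P g).1 g2.
  apply/L2P; split; first exact: measurable_funD.
  have i2 := integrableZ_fin mD 2 (L2_int f2 g2).
  have := integrableD_fin mD (integrableD_fin mD fi gi) i2.
  congr (mu.-integrable _ (EFin \o _)); apply/funext => x.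
  by rewrite -[(f + g) x]/(f x + g x) sqrrD -mulr_natl; ring.
have LZ k f : L2 f -> L2 (k *: f).
  move=> f2; have [mf fi] := (L2P f).1 f2; apply/L2P; split.
    by apply: measurable_funM.
  have := integrableZ_fin mD (k ^+ 2) fi; congr (mu.-integrable _ (EFin \o _)).
  by apply/funext => x; rewrite exprMn.
split => //.
- apply/L2P; split; first exact: measurable_cst.
  rewrite (_ : _ \o _ = cst 0%E); first exact: integrable0.
  by apply/funext => x /=; rewrite expr0n.
- by move=> f g _ _; apply: eq_Rintegral => x _; rewrite mulrC.
- move=> f g h f2 g2 h2; rewrite /L2ip -RintegralD//; try exact: L2_int.
  by apply: eq_Rintegral => x _; rewrite -mulrDl.
- move=> k f g f2 g2; rewrite /L2ip -RintegralZl//; try exact: L2_int.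
  by apply: eq_Rintegral => x _; rewrite mulrA.
- by move=> f _; apply: Rintegral_ge0 => x _; rewrite -expr2 sqr_ge0.
Qed.

Lemma L2_nrm_ae f g : L2 f -> measurable_fun D g ->
  {ae mu, forall x, D x -> f x = g x} -> L2 g.
Proof.
move=> /L2P[mf fi] mg fg; apply/L2P; split => //.
apply/integrableP; split; first by apply/measurable_EFinP; exact: measurable_funX.
have /integrableP[_] := fi; rewrite (@ae_eq_integral _ _ _ mu D (fun x => `|(g x ^+ 2)%:E|%E))//.
- by apply/measurable_EFinP; apply: measurableT_comp => //; exact: measurable_funX.
- by apply/measurable_EFinP; apply: measurableT_comp => //; exact: measurable_funX.
- by apply: filterS fg => x /= h Dx; rewrite h.
Qed.

Lemma L2ip_ae f f' g g' : measurable_fun D f -> measurable_fun D f' ->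
  measurable_fun D g -> measurable_fun D g' ->
  {ae mu, forall x, D x -> f x = f' x} -> {ae mu, forall x, D x -> g x = g' x} ->
  L2ip f g = L2ip f' g'.
Proof.
move=> mf mf' mg mg' ff' gg'; apply: ae_eq_Rintegral => //.
- exact: measurable_funM.
- exact: measurable_funM.
- by apply: filterS2 ff' gg' => x h h' Dx; rewrite h ?h'.
Qed.

Lemma L2_nrm_eq0 f : L2 f -> nrm L2ip f = 0 -> {ae mu, forall x, D x -> f x = 0}.
Proof.
move=> f2 f0; have [mf fi] := (L2P f).1 f2.
have : L2ip f f = 0 by rewrite -(nrm_sqr L2_prehilbert)// f0 expr0n.
move=> /(ge0_Rintegral_eq0 mD fi) h.
apply: filterS (h _) => [x h' Dx|x _]; last exact: sqr_ge0.
by have /eqP := h' Dx; rewrite expf_eq0/= => /eqP.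
Qed.

Hypothesis finD : (mu D < +oo)%E.

Lemma L2_cst k : L2 (cst k).
Proof.
apply/L2P; split; first exact: measurable_cst.
apply: measurable_bounded_integrable => //; first exact: (measurable_cst (k ^+ 2)).
exists (k ^+ 2); split; first exact: num_real.
by move=> r r1 x _ /=; rewrite ger0_norm ?sqr_ge0// ltW.
Qed.

Lemma L2_int1 f : L2 f -> int f.
Proof.
move=> f2; have := L2_int f2 (L2_cst 1).
by congr (mu.-integrable _ (EFin \o _)); apply/funext => x; rewrite mulr1.
Qed.

Lemma L2_norm_fun f : L2 f -> L2 (fun x => `|f x|).
Proof.
move=> /L2P[mf fi]; apply/L2P; split; first exact: measurableT_comp.
move: fi; congr (mu.-integrable _ (EFin \o _)); apply/funext => x.
by rewrite real_normK// num_real.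
Qed.

Lemma L1_le_L2 f : L2 f ->
  \int[mu]_(x in D) `|f x| <= nrm L2ip f * nrm L2ip (cst 1).
Proof.
move=> f2; have := cauchy_schwarz L2_prehilbert (L2_norm_fun f2) (L2_cst 1).
rewrite /L2ip (_ : nrm _ (fun x => `|f x|) = nrm L2ip f); last first.
  by rewrite /nrm/L2ip; congr Num.sqrt; apply: eq_Rintegral => x _;
    rewrite -expr2 real_normK ?num_real.
apply: le_trans; apply: le_trans (ler_norm _); rewrite le_eqVlt; apply/orP; left.
by apply/eqP; apply: eq_Rintegral => x _; rewrite mulr1.
Qed.

(** The Riesz-Fischer argument: along a subsequence with geometrically small increments the sum of
    the absolute increments is integrable, hence finite almost everywhere, so the subsequence
    converges pointwise; Fatou's lemma turns this into convergence in norm. *)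
Lemma L2_complete : nrm_complete L2 L2ip.
Proof.
move=> u u2 Cu; have pH := L2_prehilbert.
have /choice[N NP] : forall k : nat, exists N, forall m n, (N <= m)%N -> (N <= n)%N ->
    nrm L2ip (u m - u n) <= 2^-1 ^+ k.
  by move=> k; apply: Cu; rewrite exprn_gt0// invr_gt0.
(* The maximum makes the indices monotone; adding k makes them tend to infinity even if [N] is
   bounded. *)
pose idx k := (\max_(j < k.+1) N j + k)%N.
have Nidx k : (N k <= idx k)%N by apply: leq_trans (leq_addr _ _); exact: (@leq_bigmax _ (fun j : 'I_k.+1 => N j) ord_max).
have idxS k : (idx k <= idx k.+1)%N by rewrite /idx [X in (_ <= X + _)%N]big_ord_recr/= leq_add// leq_maxl.
pose v k := u (idx k).
have v2 k : L2 (v k) by exact: u2.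
pose g k x := `|v k.+1 x - v k x|.
have vB2 k : L2 (v k.+1 - v k) by exact: (phB pH).
have ig k : int (g k) by have := L2_int1 (L2_norm_fun (vB2 k)).
have mg k : measurable_fun D (EFin \o g k) by case/integrableP : (ig k).
pose c := nrm L2ip (cst 1).
have Ig k : \int[mu]_(x in D) g k x <= 2^-1 ^+ k * c.
  apply: le_trans (L1_le_L2 (vB2 k)) _; rewrite ler_wpM2r ?nrm_ge0//.
  by apply: NP; [exact: leq_trans (Nidx _) (idxS _)|exact: Nidx].
pose S x := (\sum_(0 <= k <oo) (g k x)%:E)%E.
have mS : measurable_fun D S by apply: ge0_emeasurable_sum; [move=> k x *; rewrite lee_fin /g|move=> k _; exact: mg].
have iS : mu.-integrable D S.
  apply/integrableP; split => //.
  rewrite [ltLHS](_ : _ = \int[mu]_(x in D) S x)%E; last first.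
    apply: eq_integral => x _; rewrite gee0_abs//.
    by apply: nneseries_ge0 => k _ _; rewrite lee_fin /g.
  rewrite integral_nneseries//; last by move=> k x _; rewrite lee_fin /g.
  apply: (@le_lt_trans _ _ (2 * c)%:E); last exact: ltry.
  apply: lime_le.
    by apply: is_cvg_nneseries => k _ _; apply: integral_ge0 => x _; rewrite lee_fin /g.
  apply: nearW => n; apply: (@le_trans _ _ (\sum_(0 <= k < n) (2^-1 ^+ k * c)%:E)%E).
    by apply: lee_sum => k _; have := Ig k; rewrite -lee_fin EFin_Rintegral.
  rewrite sumEFin lee_fin -mulr_suml ler_wpM2r ?nrm_ge0//.
  case: n => [|n]; first by rewrite big_nil.
  have -> : \sum_(0 <= k < n.+1) 2^-1 ^+ k = 2 - 2^-1 ^+ n :> R.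
    elim: n => [|n ih]; first by rewrite big_nat1 expr0 -[2]/(1 + 1) addrK.
    by rewrite big_nat_recr//= ih exprS; field.
  by rewrite gerBl exprn_ge0// invr_ge0.
pose G := D `&` [set x | S x \is a fin_num].
have mG : measurable G by exact: emeasurable_fin_num.
have Gae : {ae mu, forall x, D x -> G x}.
  have := integrable_ae mD iS; by apply: filterS => x h Dx; split => //; exact: h.
have Gcv x : G x -> cvgn (v ^~ x).
  move=> [Dx Sx].
  have : cvgn (series (telescope (v ^~ x))).
    apply: normed_cvg; apply: nondecreasing_is_cvgn.
      by apply: nondecreasing_series => k _ _ /=.
    exists (fine (S x)) => _ [n _ <-]; rewrite -lee_fin fineK// /series/= -sumEFin.
    exact: (@nneseries_lim_ge _ _ xpredT).
  rewrite telescopeK /= => /cvg_ex[l hl]; apply/cvg_ex; exists (l + v 0%N x).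
  rewrite (_ : v^~ x = (fun n => [sequence v n x - v 0%N x]_n n + v 0%N x)).
    by apply: cvgD => //; exact: cvg_cst.
  by apply/funext => n /=; rewrite subrK.
(* Cutting off outside the convergence set G makes the sequence converge everywhere, so that its
   limit is measurable. *)
pose w k x := v k x * \1_G x.
have wcv x : cvgn (w ^~ x).
  rewrite /w indicE; have [xG|xG] := boolP (x \in G).
    under eq_fun do rewrite mulr1.
    by apply: Gcv; rewrite inE in xG.
  under eq_fun do rewrite mulr0.
  exact: is_cvg_cst.
pose l x := limn (w ^~ x).
have mw k : measurable_fun D (w k).
  by apply: measurable_funM; [exact: L2_measurable|exact: measurable_indic].
have ml : measurable_fun D l.
  by apply: (measurable_fun_cvg mw) => x _; exact: wcv.
have vw k : {ae mu, forall x, D x -> v k x = w k x}.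
  by apply: filterS Gae => x h Dx; rewrite /w indicE mem_set ?mulr1//; exact: h.
have w2 k : L2 (w k) by exact: L2_nrm_ae (v2 k) (mw k) (vw k).
(* Fatou's lemma for the squares of w_(K+k) - u_n. The conclusion is stated for the extended
   integral because [l] is not yet known to be in L^2. *)
have key e n : (exists K, forall j, (K <= j)%N -> nrm L2ip (v j - u n) <= e) ->
    (\int[mu]_(x in D) ((l x - u n x) ^+ 2)%:E <= (e ^+ 2)%:E)%E.
  move=> [K HK]; have e0 : 0 <= e by exact: le_trans (nrm_ge0 _ _) (HK K (leqnn _)).
  have mwu k : measurable_fun D (fun x => ((w (K + k)%N x - u n x) ^+ 2)%:E).
    apply/measurable_EFinP/measurable_funX/measurable_funB => //.
    exact: L2_measurable.
  have h0 k x : D x -> (0 <= ((w (K + k)%N x - u n x) ^+ 2)%:E)%E.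
    by move=> _; rewrite lee_fin sqr_ge0.
  have := fatou mu mD mwu h0.
  rewrite (_ : (fun x => limn_einf _) = (fun x => ((l x - u n x) ^+ 2)%:E)); last first.
    apply/funext => x; apply: (cvg_limn_einf_sup _).1.
    apply: cvg_EFin; first exact: nearW.
    have wl : w (K + k)%N x @[k --> \oo] --> l x.
      rewrite (_ : (fun k => _) = (fun k => w (k + K)%N x)).
        by rewrite (cvg_shiftn K (w ^~ x)); exact: wcv.
      by apply/funext => k; rewrite addnC.
    by apply: cvgM; apply: cvgB => //; exact: cvg_cst.
  move=> /le_trans; apply; rewrite limn_einf_lim.
  apply: lime_le; first exact: is_cvg_einfs.
  apply: nearW => k; apply: ge_ereal_inf; eexists; first by exists k => //=.
  have wu2 := phB pH (w2 (K + k)%N) (u2 n).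
  have := EFin_Rintegral mD ((L2P _).1 wu2).2; rewrite /= => <-; rewrite lee_fin.
  rewrite -[leLHS]/(L2ip (w (K + k)%N - u n) (w (K + k)%N - u n)).
  have -> : L2ip (w (K + k)%N - u n) (w (K + k)%N - u n) =
            L2ip (v (K + k)%N - u n) (v (K + k)%N - u n).
    have mwu' := L2_measurable wu2.
    have mvu := L2_measurable (phB pH (v2 (K + k)%N) (u2 n)).
    by apply: L2ip_ae => //; apply: filterS (vw (K + k)%N) => x h Dx;
      rewrite -[LHS]/(_ - _) -h.
  rewrite -(nrm_sqr pH); last exact: (phB pH).
  by rewrite lerXn2r ?nnegrE ?nrm_ge0// HK// leq_addr.
have small e : 0 < e -> exists M, forall n, (M <= n)%N ->
    exists K, forall j, (K <= j)%N -> nrm L2ip (v j - u n) <= e.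
  move=> e0; have [M HM] := Cu _ e0; exists M => n Mn.
  exists M => j Mj; apply: HM => //.
  by rewrite (leq_trans Mj)// /idx leq_addl.
have ul2 n : (exists K, forall j, (K <= j)%N -> nrm L2ip (v j - u n) <= 1) -> L2 (u n - l).
  move=> /key h; apply/L2P.
  have mul : measurable_fun D (u n - l).
    by apply: measurable_funB => //; exact: L2_measurable.
  split => //; apply/integrableP; split.
    by apply/measurable_EFinP; exact: measurable_funX.
  apply: le_lt_trans (ltry (1 ^+ 2)); apply: le_trans h; rewrite le_eqVlt; apply/orP; left.
  apply/eqP; apply: eq_integral => x _; rewrite /= ger0_norm ?sqr_ge0//.
  by rewrite -[(u n - l) x]/(u n x - l x) -opprB sqrrN.
have [M1 HM1] := small 1 ltr01.
have l2 : L2 l.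
  have := phB pH (u2 M1) (ul2 _ (HM1 M1 (leqnn _))).
  by rewrite opprB addrC subrK.
exists l; split => // e e0; have [M HM] := small e e0; exists M => n Mn.
have uln := phB pH (u2 n) l2.
rewrite -(@ler_pXn2r _ 2)// ?nnegrE ?nrm_ge0 ?(ltW e0)// (nrm_sqr pH)//.
have := key e n (HM n Mn); rewrite -lee_fin; congr (_ <= _)%E.
rewrite /L2ip EFin_Rintegral//; last exact: L2_int.
apply: eq_integral => x _; rewrite -[(u n - l) x]/(u n x - l x); congr EFin; ring.
Qed.

End L2.

(** * Sobolev spaces *)

Section H1.
Context {R : realType} {d : nat}.
Notation E := 'rV[R]_d.
Notation mu := (lebesgue_rV d).
Variable Omega : set E.
Hypotheses (oO : open Omega) (bO : bounded_set Omega).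
Implicit Types (f g phi : E -> R) (i : 'I_d).
Notation L2 := (in_Lp mu 2%:E Omega).
Notation ip := (L2ip mu Omega).
Notation "f =ae g" := ({ae mu, forall x, Omega x -> f x = g x}) (at level 70).

Let mO : measurable Omega. Proof. exact: measurable_open. Qed.
Let finO : (mu Omega < +oo)%E. Proof. exact: bounded_lebesgue_fin. Qed.
Let pL2 : prehilbert L2 ip. Proof. exact: L2_prehilbert. Qed.

Lemma L2_L1loc f : L2 f -> in_L1loc Omega f.
Proof.
move=> f2; split; first exact: L2_measurable f2.
move=> K cK KO; apply: integrableS (L2_int1 mO finO f2) => //.
exact: measurable_compact.
Qed.

Lemma test_L2 phi : test_function Omega phi -> L2 phi.
Proof.
move=> tp; apply/(L2P _ mO); split; first by case: (test_L1loc tp).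
apply: measurable_bounded_integrable => //.
  by apply: measurable_funX; case: (test_L1loc tp).
have [M M0 HM] := test_function_bounded tp.
exists (M ^+ 2); split; first exact: num_real.
move=> r Mr x _ /=; rewrite ger0_norm ?sqr_ge0// (le_trans _ (ltW Mr))//.
by rewrite -[_ ^+ 2]real_normK ?num_real// lerXn2r ?nnegrE// ltW.
Qed.

Lemma L1locB f g : in_L1loc Omega f -> in_L1loc Omega g -> in_L1loc Omega (f - g).
Proof.
move=> [mf fi] [mg gi]; split; first exact: measurable_funB.
move=> K cK KO; have mK := measurable_compact cK.
by have := integrableB mK (fi K cK KO) (gi K cK KO).
Qed.

Lemma weak_partial_uniq i f f' g g' : f =ae f' ->
  weak_partial Omega i f g -> weak_partial Omega i f' g' -> g =ae g'.
Proof.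
move=> ff' [f1 g1 h] [f'1 g'1 h'].
have : (g - g') =ae cst 0.
  apply: (L1loc_eq0 oO (L1locB g1 g'1)) => phi tp.
  have tD := test_function_derive (delta_mx 0 i) tp.
  transitivity (\int[mu]_(x in Omega) (g x * phi x) -
                \int[mu]_(x in Omega) (g' x * phi x)).
    rewrite -RintegralB//; try exact: integrable_L1loc_test.
    by apply: eq_Rintegral => x _; rewrite -mulrBl.
  apply/eqP; rewrite subr_eq0 -eqr_opp -h// -h'//; apply/eqP.
  apply: ae_eq_Rintegral => //.
  - by apply: integrable_measurable; apply: integrable_L1loc_test.
  - by apply: integrable_measurable; apply: integrable_L1loc_test.
  - by apply: filterS ff' => x e Ox; rewrite e.
by apply: filterS => x e Ox; apply/eqP; rewrite -subr_eq0; apply/eqP; exact: e.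
Qed.

Lemma weak_partial_lin i k f f' g g' : L2 f -> L2 g -> L2 f' -> L2 g' ->
  weak_partial Omega i f g -> weak_partial Omega i f' g' ->
  weak_partial Omega i (k *: f + f') (k *: g + g').
Proof.
move=> f2 g2 f'2 g'2 [f1 g1 h] [f'1 g'1 h'].
have LL a b : L2 a -> L2 b -> L2 (k *: a + b).
  by move=> a2 b2; apply: (phD pL2) => //; exact: (phZ pL2).
split=> [||phi tp]; try by apply: L2_L1loc; exact: LL.
have tD := test_function_derive (delta_mx 0 i) tp.
have p2 := test_L2 tp; have pD2 := test_L2 tD.
have lin a b c : L2 a -> L2 b -> L2 c -> \int[mu]_(x in Omega) ((k *: a + b) x * c x) =
    k * \int[mu]_(x in Omega) (a x * c x) + \int[mu]_(x in Omega) (b x * c x).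
  move=> a2 b2 c2; have := @ipDl _ _ _ _ pL2 (k *: a) b c (phZ pL2 k a2) b2 c2.
  by rewrite (ipZl pL2).
by rewrite !lin// h// h'// mulrN opprD.
Qed.

Lemma grad_weak_partial i f g : weak_partial Omega i f g ->
  weak_partial Omega i f (grad Omega f i).
Proof. by move=> fg; rewrite /grad; exact: (@xgetPex _ (cst 0) [set g | weak_partial Omega i f g] (ex_intro _ g fg)). Qed.

Lemma grad_ae i f g : weak_partial Omega i f g -> grad Omega f i =ae g.
Proof.
move=> fg; apply: (@weak_partial_uniq i f f) => //; first exact: aeW.
exact: grad_weak_partial fg.
Qed.

Lemma H1_grad f i : in_H1 Omega f ->
  L2 (grad Omega f i) /\ weak_partial Omega i f (grad Omega f i).
Proof.
move=> [f2 /(_ i)[g g2 fg]]; have gg := grad_weak_partial fg; split => //.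
apply: (L2_nrm_ae mO g2); first by have [_ [] ] := gg.
by have := grad_ae fg; apply: filterS => x h Ox; rewrite h.
Qed.

Lemma H1_L2 f : in_H1 Omega f -> L2 f. Proof. by case. Qed.

Lemma H1_intro f (G : 'I_d -> E -> R) : L2 f -> (forall i, L2 (G i)) ->
  (forall i, weak_partial Omega i f (G i)) -> in_H1 Omega f.
Proof. by move=> f2 G2 fG; split => // i; exists (G i). Qed.

Lemma test_H1 phi : test_function Omega phi -> in_H1 Omega phi.
Proof.
move=> tp; apply: (@H1_intro _ (fun i => 'D_(delta_mx 0 i) phi)).
- exact: test_L2.
- by move=> i; apply: test_L2; exact: test_function_derive.
- by move=> i; exact: test_weak_partial.
Qed.

Lemma H1_lin k f g : in_H1 Omega f -> in_H1 Omega g -> in_H1 Omega (k *: f + g) /\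
  forall i, grad Omega (k *: f + g) i =ae (k *: grad Omega f i + grad Omega g i).
Proof.
move=> f1 g1; have f2 := H1_L2 f1; have g2 := H1_L2 g1.
have W i := weak_partial_lin k f2 (H1_grad i f1).1 g2 (H1_grad i g1).1
              (H1_grad i f1).2 (H1_grad i g1).2.
split; last by move=> i; exact: grad_ae (W i).
apply: H1_intro W; first by apply: (phD pL2) => //; exact: (phZ pL2).
move=> i; apply: (phD pL2); last exact: (H1_grad i g1).1.
by apply: (phZ pL2); exact: (H1_grad i f1).1.
Qed.

Lemma H1_ae f g : in_H1 Omega f -> measurable_fun Omega g -> f =ae g ->
  in_H1 Omega g /\ forall i, grad Omega g i =ae grad Omega f i.
Proof.
move=> f1 mg fg; have f2 := H1_L2 f1; have g2 := L2_nrm_ae mO f2 mg fg.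
have W i : weak_partial Omega i g (grad Omega f i).
  have [_ [_ G1 h]] := H1_grad i f1; split => //; first exact: L2_L1loc.
  move=> phi tp; rewrite -h//.
  have pD2 := test_L2 (test_function_derive (delta_mx 0 i) tp).
  apply: (L2ip_ae mO mg (L2_measurable f2) (L2_measurable pD2) (L2_measurable pD2)).
    by apply: filterS fg => x e Ox; rewrite e.
  exact: aeW.
split; last by move=> i; exact: grad_ae.
by apply: (H1_intro g2 _ W) => i; exact: (H1_grad i f1).1.
Qed.

Definition h1ip f g : R :=
  ip f g + \sum_(i < d) ip (grad Omega f i) (grad Omega g i).

Lemma h1ipE f g : h1ip f g =
  ip f g + \sum_(i < d) ip (grad Omega f i) (grad Omega g i).
Proof. by []. Qed.

Local Notation H1 := (in_H1 Omega).

Lemma grad_ip_lin k f g h i : H1 f -> H1 g -> H1 h ->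
  ip (grad Omega (k *: f + g) i) (grad Omega h i) =
  k * ip (grad Omega f i) (grad Omega h i) + ip (grad Omega g i) (grad Omega h i).
Proof.
move=> f1 g1 h1; have [l1 le] := H1_lin k f1 g1.
have gf := (H1_grad i f1).1; have gg := (H1_grad i g1).1; have gh := (H1_grad i h1).1.
rewrite -(ipZl pL2 k gf gh) -(ipDl pL2 (phZ pL2 k gf) gg gh).
apply: L2ip_ae => //; try exact: (L2_measurable gh).
- by apply: L2_measurable; exact: (H1_grad i l1).1.
- by apply: L2_measurable; apply: (phD pL2) => //; exact: (phZ pL2).
- exact: aeW.
Qed.

Lemma H1_0 : H1 0.
Proof. by apply: test_H1; exact: test_function0. Qed.

Lemma h1ip_lin k f g h : H1 f -> H1 g -> H1 h ->
  h1ip (k *: f + g) h = k * h1ip f h + h1ip g h.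
Proof.
move=> f1 g1 h1; have f2 := H1_L2 f1; have g2 := H1_L2 g1; have h2 := H1_L2 h1.
have S : \sum_(i < d) ip (grad Omega (k *: f + g) i) (grad Omega h i) =
    k * \sum_(i < d) ip (grad Omega f i) (grad Omega h i) +
    \sum_(i < d) ip (grad Omega g i) (grad Omega h i).
  rewrite mulr_sumr -big_split/=; apply: eq_bigr => i _; exact: grad_ip_lin.
have S0 : ip (k *: f + g) h = k * ip f h + ip g h.
  by rewrite (ipDl pL2 (phZ pL2 k f2) g2 h2) (ipZl pL2 k f2 h2).
by apply: etrans (congr2 +%R S0 S) _; rewrite /h1ip mulrDr addrACA.
Qed.

Lemma H1_prehilbert : prehilbert H1 h1ip.
Proof.
have z1 := H1_0.
have Z k f : H1 f -> H1 (k *: f).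
  by move=> f1; rewrite -[_ *: _]addr0; exact: (H1_lin k f1 z1).1.
have ip0 h : H1 h -> h1ip 0 h = 0.
  move=> h1; have := h1ip_lin 1 z1 z1 h1; rewrite scale1r addr0 mul1r => /eqP.
  by rewrite -subr_eq0 opprD addrA subrr sub0r oppr_eq0 => /eqP.
split.
- exact: z1.
- by move=> f g f1 g1; rewrite -[f]scale1r; exact: (H1_lin 1 f1 g1).1.
- exact: Z.
- move=> f g f1 g1; rewrite /h1ip; apply: (congr2 +%R).
    exact: (ipC pL2 (H1_L2 f1) (H1_L2 g1)).
  apply: eq_bigr => i _.
  exact: (ipC pL2 (H1_grad i f1).1 (H1_grad i g1).1).
- by move=> f g h f1 g1 h1; rewrite -{1}[f]scale1r h1ip_lin// mul1r.
- by move=> k f g f1 g1; rewrite -{1}[k *: f]addr0 (h1ip_lin k f1 z1 g1) (ip0 _ g1) addr0.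
- move=> f f1; apply: addr_ge0; first exact: (ip_ge0 pL2 (H1_L2 f1)).
  by apply: sumr_ge0 => i _; exact: (ip_ge0 pL2 (H1_grad i f1).1).
Qed.

Lemma H1_normE f : H1 f -> H1_norm Omega f = (nrm h1ip f)%:E.
Proof.
move=> f1; have [mf fi] := (L2P _ mO f).1 (H1_L2 f1).
have G i := (L2P _ mO _).1 (H1_grad i f1).1.
have Gi : mu.-integrable Omega (EFin \o (fun x => \sum_(i < d) grad Omega f i x ^+ 2)).
  by apply: integrable_sum_fin => // i; case: (G i).
rewrite /H1_norm Lp_norm2E//.
rewrite (eq_integral (fun x => (f x ^+ 2 + \sum_(i < d) grad Omega f i x ^+ 2)%:E)); last first.
  move=> x _; rewrite sqr_sqrtr// addr_ge0 ?sqr_ge0// sumr_ge0// => i _.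
  exact: sqr_ge0.
have := EFin_Rintegral mO (integrableD_fin mO fi Gi); rewrite /= => <-.
rewrite poweR_EFin powR12_sqrt; last first.
  by apply: Rintegral_ge0 => x _; rewrite addr_ge0 ?sqr_ge0// sumr_ge0// => i _; rewrite sqr_ge0.
rewrite RintegralD// Rintegral_sum//; last by move=> i; case: (G i).
Qed.

Lemma nrm_L2_le_H1 f : H1 f -> nrm ip f <= nrm h1ip f.
Proof.
move=> f1; rewrite /nrm ler_wsqrtr// lerDl sumr_ge0// => i _.
by rewrite (ip_ge0 pL2)//; exact: (H1_grad i _).1.
Qed.

Lemma nrm_grad_le_H1 f i : H1 f -> nrm ip (grad Omega f i) <= nrm h1ip f.
Proof.
move=> f1; rewrite /nrm ler_wsqrtr// /h1ip (bigD1 i)//= addrCA lerDl.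
rewrite addr_ge0 ?(ip_ge0 pL2)//; first exact: H1_L2.
by rewrite sumr_ge0// => j _; rewrite (ip_ge0 pL2)//; exact: (H1_grad j _).1.
Qed.

End H1.

Opaque grad h1ip.

Section prehilbert_cvg.
Context {R : realType} {E : lmodType R} (H : set E) (ip : E -> E -> R).
Hypothesis pH : prehilbert H ip.

Lemma cvg_nrm_ip (u : nat -> E) l y : (forall n, H (u n)) -> H l -> H y ->
  (forall e, 0 < e -> exists N, forall n, (N <= n)%N -> nrm ip (u n - l) <= e) ->
  ip (u n) y @[n --> \oo] --> ip l y.
Proof.
move=> Hu Hl Hy ul; apply/cvgrPdist_le => e e0.
have C0 : 0 < nrm ip y + 1 by rewrite ltr_wpDl ?nrm_ge0.
have [N HN] := ul _ (divr_gt0 e0 C0).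
exists N => // n /= Nn; rewrite distrC -(ipBl pH)//.
apply: le_trans (cauchy_schwarz pH (phB pH (Hu n) Hl) Hy) _.
rewrite (le_trans (ler_wpM2r (nrm_ge0 _ _) (HN n Nn)))//.
rewrite -mulrA ger_pMr// ler_pdivrMl// mulr1; lra.
Qed.

Lemma sub_prehilbert (V : set E) : V `<=` H -> V 0 ->
  (forall k x y, V x -> V y -> V (k *: x + y)) -> prehilbert V ip.
Proof.
move=> VH V0 VL; split => //.
- by move=> x y Vx Vy; rewrite -[x]scale1r; exact: VL.
- by move=> k x Vx; rewrite -[_ *: _]addr0; exact: VL.
- by move=> x y /VH ? /VH ?; exact: (ipC pH).
- by move=> x y z /VH ? /VH ? /VH ?; exact: (ipDl pH).
- by move=> k x y /VH ? /VH ?; exact: (ipZl pH).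
- by move=> x /VH ?; exact: (ip_ge0 pH).
Qed.

Lemma sub_complete (V : set E) : V `<=` H -> nrm_complete H ip ->
  (forall l, H l -> (forall e, 0 < e -> exists v, V v /\ nrm ip (v - l) <= e) -> V l) ->
  nrm_complete V ip.
Proof.
move=> VH cH clV u Vu Cu; have [l [Hl ul]] := cH u (fun n => VH _ (Vu n)) Cu.
exists l; split => //; apply: clV => // e e0; have [N HN] := ul e e0.
by exists (u N); split => //; exact: HN.
Qed.

End prehilbert_cvg.

(** The bridge between the extended-real convergences in the definitions of the function spaces and
    the epsilon estimates on real seminorms used in the proof. *)
Lemma cvg_EFin0 {R : realType} {T : Type} (F : set_system T) {FF : Filter F}
    (f : T -> \bar R) (g : T -> R) : (\forall t \near F, f t = (g t)%:E) ->
  f @ F --> 0%E <-> (forall e, 0 < e -> \forall t \near F, `|g t| <= e).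
Proof.
move=> fg; split=> [f0 e e0|g0].
  have /fine_cvgP[_] := f0; rewrite /= => /cvgrPdist_le /(_ _ e0).
  by apply: filterS2 fg => t /= ->; rewrite sub0r normrN.
apply/fine_cvgP; split; first by apply: filterS fg => t ->.
apply/cvgrPdist_le => e e0; apply: filterS2 fg (g0 e e0) => t /= ->.
by rewrite sub0r normrN.
Qed.

Section H1_complete.
Context {R : realType} {d : nat}.
Notation E := 'rV[R]_d.
Notation mu := (lebesgue_rV d).
Variable Omega : set E.
Hypotheses (oO : open Omega) (bO : bounded_set Omega).
Implicit Types (f g phi : E -> R) (i : 'I_d).
Notation L2 := (in_Lp mu 2%:E Omega).
Notation ip := (L2ip mu Omega).
Notation H1 := (in_H1 Omega).
Notation hip := (h1ip Omega).

Let mO : measurable Omega. Proof. exact: measurable_open. Qed.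
Let finO : (mu Omega < +oo)%E. Proof. exact: bounded_lebesgue_fin. Qed.
Let pL2 : prehilbert L2 ip. Proof. exact: L2_prehilbert. Qed.
Let pH1 : prehilbert H1 hip. Proof. exact: H1_prehilbert. Qed.

Lemma H1_lin1 k f g : H1 f -> H1 g -> H1 (k *: f + g).
Proof. by move=> f1 g1; have [] := H1_lin oO bO k f1 g1. Qed.

Lemma gradB_ae i f g : H1 f -> H1 g -> {ae mu, forall x, Omega x ->
  grad Omega (f - g) i x = (grad Omega f i - grad Omega g i) x}.
Proof.
move=> f1 g1; have [_ /(_ i)] := H1_lin oO bO (-1) g1 f1.
rewrite scaleN1r addrC; apply: filterS => x h Ox; rewrite h// scaleN1r addrC.
by [].
Qed.

Lemma nrm_L2_ae f g : L2 f -> L2 g -> {ae mu, forall x, Omega x -> f x = g x} ->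
  nrm ip f = nrm ip g.
Proof.
move=> f2 g2 fg; congr Num.sqrt.
have mf := L2_measurable f2; have mg := L2_measurable g2.
exact: (L2ip_ae mO mf mg mf mg fg fg).
Qed.

Lemma nrm_gradB i f g : H1 f -> H1 g ->
  nrm ip (grad Omega f i - grad Omega g i) = nrm ip (grad Omega (f - g) i).
Proof.
move=> f1 g1; have gf := (H1_grad oO i f1).1; have gg := (H1_grad oO i g1).1.
apply: nrm_L2_ae; first exact: (phB pL2).
  exact: (H1_grad oO i (phB pH1 f1 g1)).1.
by apply: filterS (gradB_ae i f1 g1) => x h Ox; rewrite h.
Qed.

Lemma nrm_H1_le f e : H1 f -> 0 <= e -> nrm ip f <= e ->
  (forall i, nrm ip (grad Omega f i) <= e) -> nrm hip f <= d.+1%:R * e.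
Proof.
move=> f1 e0 fe ge; rewrite -(@ler_pXn2r _ 2)// ?nnegrE ?nrm_ge0 ?mulr_ge0//.
rewrite (nrm_sqr pH1)// h1ipE.
have le2 g : L2 g -> nrm ip g <= e -> ip g g <= e ^+ 2.
  by move=> g2 h; rewrite -(nrm_sqr pL2)// lerXn2r ?nnegrE ?nrm_ge0.
apply: (@le_trans _ _ (d.+1%:R * e ^+ 2)).
  rewrite -natr1 mulrDl mul1r addrC lerD//; last exact: le2 (H1_L2 f1) fe.
  rewrite -[in leRHS](card_ord d) -sum1_card natr_sum mulr_suml.
  by apply: ler_sum => i _; rewrite mul1r; exact: le2 (H1_grad oO i f1).1 (ge i).
rewrite exprMn ler_wpM2r ?sqr_ge0// expr2 ler_peMl// ler1n.
by [].
Qed.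

(** The functions and each of their partial derivatives converge in L^2. The integration by parts
    formula is a continuous linear relation between them for a fixed test function, so the limits of
    the derivatives are the weak derivatives of the limit. *)
Lemma H1_complete : nrm_complete H1 hip.
Proof.
move=> u u1 Cu; have u2 n := H1_L2 (u1 n).
have G2 i n := (H1_grad oO i (u1 n)).1.
have [|l [l2 ul]] := L2_complete mO finO u2.
  move=> e e0; have [N HN] := Cu e e0; exists N => m n Nm Nn.
  apply: le_trans (HN m n Nm Nn); apply: nrm_L2_le_H1 => //.
  exact: (phB pH1).
have /choice[G GP] : forall i, exists g, L2 g /\ forall e, 0 < e ->
    exists N, forall n, (N <= n)%N -> nrm ip (grad Omega (u n) i - g) <= e.
  move=> i; apply: (L2_complete mO finO (G2 i)) => e e0.
  have [N HN] := Cu e e0; exists N => m n Nm Nn.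
  apply: le_trans (HN m n Nm Nn); rewrite nrm_gradB//.
  by apply: nrm_grad_le_H1 => //; exact: (phB pH1).
have W i : weak_partial Omega i l (G i).
  split; [exact: L2_L1loc|by apply: L2_L1loc => //; case: (GP i)|move=> phi tp].
  have p2 := test_L2 oO bO tp; have D2 := test_L2 oO bO (test_function_derive (delta_mx 0 i) tp).
  have A := cvg_nrm_ip pL2 u2 l2 D2 ul.
  have B := cvgN (cvg_nrm_ip pL2 (G2 i) (GP i).1 p2 (GP i).2).
  rewrite (_ : (fun n => ip (u n) _) = - (fun n => ip (grad Omega (u n) i) phi)) in A.
    exact: (cvg_unique (@Rhausdorff R) A (B _)).
  by apply/funext => n; have [_ [_ _ ]] := H1_grad oO i (u1 n); apply.
have l1 : H1 l.
  by apply: (H1_intro l2 _ W) => i; case: (GP i).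
exists l; split => // e e0.
have c0 : 0 < e / d.+1%:R by rewrite divr_gt0.
have [N0 HN0] := ul _ c0.
have /choice[N HN] : forall i, exists N, forall n, (N <= n)%N ->
    nrm ip (grad Omega (u n) i - G i) <= e / d.+1%:R by move=> i; exact: (GP i).2.
exists (maxn N0 (\max_i N i)) => n; rewrite geq_max => /andP[h0 h1].
have ul1 := phB pH1 (u1 n) l1.
rewrite -[leRHS](@mulfVK _ d.+1%:R)// mulrC; apply: nrm_H1_le => //.
- exact: ltW.
- exact: HN0.
move=> i; apply: le_trans (HN i n _); last exact: leq_trans (leq_bigmax i) h1.
rewrite le_eqVlt; apply/orP; left; apply/eqP; apply: nrm_L2_ae.
- exact: (H1_grad oO i ul1).1.
- by apply: (phB pL2) => //; exact: (GP i).1.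
have := grad_ae oO (W i); apply: filterS2 (gradB_ae i (u1 n) l1) => x h h' Ox.
by rewrite h// -[LHS]/(_ - _) h'.
Qed.

Lemma H10P f : in_H10 Omega f <-> H1 f /\
  forall e, 0 < e -> exists phi, test_function Omega phi /\ nrm hip (phi - f) <= e.
Proof.
have B g h : H1 g -> test_function Omega h ->
    H1_norm Omega (g - h) = (nrm hip (h - g))%:E.
  move=> g1 th; have h1 := test_H1 oO bO th.
  by rewrite (nrmBC pH1)// H1_normE//; exact: (phB pH1).
split=> [[f1 [phi [tp fp]]]|[f1 fp]]; split => //.
  move=> e e0.
  have [|N _ HN] := (@cvg_EFin0 _ _ \oo _ _ (fun n => nrm hip (phi n - f)) _).1 fp e e0.
    by apply: nearW => n; exact: B.
  exists (phi N); split => //.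
  by apply: le_trans (ler_norm _) (HN N (leqnn _)).
have /choice[phi phiP] : forall n : nat, exists phi, test_function Omega phi /\
    nrm hip (phi - f) <= n.+1%:R^-1 by move=> n; exact: fp.
exists phi; split; first by move=> n; case: (phiP n).
apply/(@cvg_EFin0 _ _ _ _ _ (fun n => nrm hip (phi n - f))).
  by apply: nearW => n; apply: B => //; case: (phiP n).
move=> e e0; have := near_infty_natSinv_lt (PosNum e0); apply: filterS => n /= h.
by rewrite ger0_norm ?nrm_ge0// (le_trans (phiP n).2)// ltW.
Qed.

Lemma H10_H1 f : in_H10 Omega f -> H1 f. Proof. by case. Qed.
Lemma H10_prehilbert : prehilbert (in_H10 Omega) hip.
Proof.
apply: (sub_prehilbert pH1); first exact: H10_H1.
  apply/H10P; split; first exact: (ph0 pH1).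
  move=> e e0; exists 0; split; first exact: test_function0.
  by rewrite subr0 (nrm0 pH1) ltW.
move=> k f g /H10P[f1 fa] /H10P[g1 ga]; apply/H10P; split; first exact: H1_lin1.
move=> e e0; have C0 : 0 < `|k| + 1 by rewrite ltr_wpDl.
have [p [tp hp]] := fa (e / (`|k| + 1) / 2) (divr_gt0 (divr_gt0 e0 C0) (ltr0Sn _ _)).
have [q [tq hq]] := ga (e / 2) (divr_gt0 e0 (ltr0Sn _ _)).
exists (k *: p + q); split.
  by apply: test_functionD => //; exact: test_functionZ.
have p1 := test_H1 oO bO tp; have q1 := test_H1 oO bO tq.
rewrite (_ : _ - _ = k *: (p - f) + (q - g)); last by rewrite scalerBr opprD addrACA.
have pf := phB pH1 p1 f1; have qg := phB pH1 q1 g1.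
apply: le_trans (nrmD pH1 (phZ pH1 k pf) qg) _; rewrite (nrmZ pH1)//.
have : `|k| * nrm hip (p - f) <= e / 2.
  apply: le_trans (ler_wpM2l (normr_ge0 k) hp) _.
  rewrite !mulrA ler_pM2r ?invr_gt0// ler_pdivrMr// mulrDr mulr1.
  by rewrite [_ * e]mulrC lerDl ltW.
by move: hq; move: (`|k| * _) (nrm hip (q - g)) => a b; lra.
Qed.

Lemma H10_complete : nrm_complete (in_H10 Omega) hip.
Proof.
apply: (sub_complete _ H1_complete); first exact: H10_H1.
move=> l l1 al; apply/H10P; split => // e e0.
have e2 : 0 < e / 2 by rewrite divr_gt0.
have [v [/H10P[v1 va] vl]] := al _ e2; have [p [tp pv]] := va _ e2.
exists p; split => //; have p1 := test_H1 oO bO tp.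
apply: le_trans (nrmB_trans pH1 p1 l1 v1) _.
by move: vl pv; move: (nrm _ _) (nrm _ _) => a b; lra.
Qed.

(** The initial condition is an almost everywhere equality; this turns it into distance zero in H^1,
    the form in which uniqueness for the differential equation consumes it. *)
Lemma H10_ae f g : in_H10 Omega f -> measurable_fun Omega g ->
  {ae mu, forall x, Omega x -> f x = g x} -> in_H10 Omega g /\ nrm hip (f - g) = 0.
Proof.
move=> /H10P[f1 fa] mg fg; have [g1 gg] := H1_ae oO bO f1 mg fg.
have fg1 := phB pH1 f1 g1.
have D0 : nrm hip (f - g) = 0.
  apply/eqP; rewrite eq_le nrm_ge0 andbT.
  rewrite -(mulr0 d.+1%:R); apply: nrm_H1_le => //.
    rewrite -(nrm0 pL2) le_eqVlt; apply/orP; left; apply/eqP; apply: nrm_L2_ae.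
    - exact: (H1_L2 fg1).
    - exact: (ph0 pL2).
    - by apply: filterS fg => x h Ox; rewrite -[LHS]/(f x - g x) h// subrr.
  move=> i; rewrite -(nrm0 pL2) le_eqVlt; apply/orP; left; apply/eqP; apply: nrm_L2_ae.
  - exact: (H1_grad oO i fg1).1.
  - exact: (ph0 pL2).
  - apply: filterS2 (gradB_ae i f1 g1) (gg i) => x h h' Ox.
    by rewrite h// -[LHS]/(_ - _) h'// subrr.
split; last exact: D0.
apply/H10P; split; first exact: g1.
move=> e e0; have [p [tp pf]] := fa e e0.
exists p; split; first exact: tp.
have p1 := test_H1 oO bO tp.
apply: le_trans (nrmB_trans pH1 p1 g1 f1) _.
by move: pf; move: (nrm hip (p - f)) => a; rewrite D0 addr0.
Qed.

End H1_complete.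

(** * Integrals over subintervals of [0, T] *)

Section time_scalar.
Context {R : realType}.
Variable T : R.
Hypothesis T0 : 0 < T.
Notation leb := (@lebesgue_measure R).
Notation I01 := (`[0, T]%classic : set R).
Implicit Types (f g F : R -> R) (s t r : R).
Local Notation int f := (leb.-integrable `[0, T] (EFin \o f)).
Local Notation I s t f := (\int[leb]_(x in `]s, t]) f x).

Lemma int_sub f s t : int f -> 0 <= s -> t <= T ->
  leb.-integrable `]s, t] (EFin \o f).
Proof.
move=> fi s0 tT; apply: integrableS fi => //.
by apply: subset_itv; rewrite bnd_simp.
Qed.

Lemma I_add f r s t : int f -> 0 <= r -> r <= s -> s <= t -> t <= T ->
  I r t f = I r s f + I s t f.
Proof.
move=> fi r0 rs st tT.
by rewrite -(@Rintegral_itvB _ _ _ _ s (int_sub fi r0 tT)) ?bnd_simp// addrC subrK.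
Qed.

Lemma I_le f g s t : int f -> int g -> 0 <= s -> t <= T ->
  (forall x, s < x -> x <= t -> f x <= g x) -> I s t f <= I s t g.
Proof.
move=> fi gi s0 tT fg; apply: le_Rintegral => //; [exact: int_sub|exact: int_sub|].
by move=> x /=; rewrite in_itv/= => /andP[sx xt]; exact: fg.
Qed.

Lemma I_norm_le f g s t : int f -> int g -> 0 <= s -> t <= T ->
  (forall x, s < x -> x <= t -> `|f x| <= g x) -> `|I s t f| <= I s t g.
Proof.
move=> fi gi s0 tT fg; apply: le_trans (le_normr_Rintegral _ _) _ => //.
  exact: int_sub.
by apply: I_le => //; exact: integrable_norm_fin.
Qed.

Lemma I_ge0 f s t : 0 <= s -> t <= T -> (forall x, s < x -> x <= t -> 0 <= f x) ->
  0 <= I s t f.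
Proof.
move=> s0 tT f0; apply: Rintegral_ge0 => x /=.
by rewrite in_itv/= => /andP[sx xt]; exact: f0.
Qed.

Lemma I_subD f g s t : int f -> int g -> 0 <= s -> t <= T ->
  I s t (fun x => f x + g x) = I s t f + I s t g.
Proof. by move=> fi gi s0 tT; rewrite RintegralD//; exact: int_sub. Qed.

Lemma I_subB f g s t : int f -> int g -> 0 <= s -> t <= T ->
  I s t (fun x => f x - g x) = I s t f - I s t g.
Proof. by move=> fi gi s0 tT; rewrite RintegralB//; exact: int_sub. Qed.

Lemma I_Zl k f s t : int f -> 0 <= s -> t <= T ->
  I s t (fun x => k * f x) = k * I s t f.
Proof. by move=> fi s0 tT; rewrite RintegralZl//; exact: int_sub. Qed.

Lemma I_eq f g s t : 0 <= s -> t <= T -> (forall x, 0 <= x <= T -> f x = g x) ->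
  I s t f = I s t g.
Proof.
move=> s0 tT fg; apply: eq_Rintegral => x; rewrite inE/= in_itv/= => /andP[sx xt].
by apply: fg; rewrite (le_trans s0 (ltW sx)) (le_trans xt tT).
Qed.

Lemma I_set0 f s : I s s f = 0.
Proof. by rewrite set_itvoc0 Rintegral_set0. Qed.

Lemma I_cst k s t : s <= t -> I s t (fun=> k) = k * (t - s).
Proof.
move=> st; rewrite Rintegral_cst//; congr (_ * _).
apply: etrans (congr1 fine (lebesgue_measure_itv `]s, t])) _; rewrite /= lte_fin; case: ltP => //= ts.
by apply/esym/eqP; rewrite subr_eq0 eq_le ts st.
Qed.

Lemma continuous_int f : {within I01, continuous f} -> int f.
Proof. by move=> cf; apply: continuous_compact_integrable => //; exact: segment_compact. Qed.

Lemma continuous_epsP f : {within I01, continuous f} <->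
  forall t, t \in `[0, T] -> forall e, 0 < e -> exists2 D, 0 < D &
    forall s, s \in `[0, T] -> `|s - t| < D -> `|f s - f t| <= e.
Proof.
split=> [/subspace_continuousP cf t tT e e0|cf].
  have /cvgrPdist_le/(_ e e0) := cf t tT.
  move=> /nbhs_ballP[D /= D0 HD]; exists D => // s sT st.
  by rewrite distrC; apply: HD => //; rewrite /ball/= distrC.
apply/subspace_continuousP => t tT; apply/cvgrPdist_le => e e0.
have [D D0 HD] := cf t tT e e0; apply/nbhs_ballP; exists D => //= s ts sT.
by rewrite distrC; apply: HD => //; rewrite distrC.
Qed.

Lemma continuous_bounded f : {within I01, continuous f} ->
  exists2 B, 0 < B & forall t, t \in `[0, T] -> `|f t| <= B.
Proof.
move=> /continuous_compact/(_ (@segment_compact R 0 T))/compact_bounded[M [_ HM]].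
exists (`|M| + 1); first by rewrite ltr_wpDl.
move=> t tT; apply: HM; last by exists t.
by rewrite (le_lt_trans (ler_norm M))// ltrDl.
Qed.

Lemma I_continuous f : int f -> {within I01, continuous (fun t => I 0 t f)}.
Proof.
move=> fi; have := parameterized_integral_continuous (ltW T0) fi.
move=> /continuous_epsP c; apply/continuous_epsP => t tT e e0.
have [D D0 HD] := c t tT e e0; exists D => // s sT st.
have E x : x \in `[0, T] -> I 0 x f = parameterized_integral leb 0 x f.
  rewrite in_itv/= => /andP[x0 xT]; apply: Rintegral_itv_obnd_cbnd.
  exact: int_sub fi _ xT.
by rewrite !E//; exact: HD.
Qed.

(* One-sided difference quotients at the end points. *)
Definition deriv_within F f := forall t, t \in `[0, T] -> forall e, 0 < e ->
  exists2 D, 0 < D & forall s, s \in `[0, T] -> s != t -> `|s - t| < D ->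
    `|(s - t)^-1 * (F s - F t) - f t| <= e.

Lemma deriv_within_continuous F f : deriv_within F f -> {within I01, continuous F}.
Proof.
move=> dF; apply/continuous_epsP => t tT e e0.
have [D D0 HD] := dF t tT 1 ltr01.
have C0 : 0 < `|f t| + 1 by rewrite ltr_wpDl.
exists (Num.min D (e / (`|f t| + 1))); first by rewrite lt_min D0 divr_gt0.
move=> s sT; rewrite lt_min => /andP[sD se].
have [->|st] := eqVneq s t; first by rewrite subrr normr0 ltW.
have st0 : s - t != 0 by rewrite subr_eq0.
have := HD s sT st sD; set q := (s - t)^-1 * _ => hq.
have -> : F s - F t = (s - t) * q by rewrite mulVKf.
rewrite normrM.
have q1 : `|q| <= `|f t| + 1.
  by rewrite -[q](subrK (f t)) addrC (le_trans (ler_normD _ _))// lerD2l.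
rewrite (le_trans (ler_wpM2l (normr_ge0 _) q1))//.
by rewrite -ler_pdivlMr// ltW.
Qed.

Lemma I_FTC F f s t : deriv_within F f -> {within I01, continuous f} ->
  0 <= s -> s <= t -> t <= T -> I s t f = F t - F s.
Proof.
move=> dF cf s0; rewrite le_eqVlt => /orP[/eqP->|st] tT.
  by rewrite I_set0 subrr.
have sub : `[s, t]%classic `<=` I01.
  by apply: subset_itv; rewrite bnd_simp.
have cfst : {within `[s, t], continuous f} by exact: continuous_subspaceW cf.
have cFst : {within `[s, t], continuous F}.
  by apply: continuous_subspaceW (deriv_within_continuous dF).
have [_ F1 F2] := (continuous_within_itvP F st).1 cFst.
have dFx x : x \in `]s, t[ -> is_derive x 1 F (f x).
  rewrite in_itv/= => /andP[sx xt].
  have cv : (h^-1 *: (F (h *: (1 : R) + x) - F x)) @[h --> 0^'] --> f x.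
    apply/cvgrPdist_le => e e0.
    have xT : x \in `[0, T].
      by rewrite in_itv/= (le_trans s0 (ltW sx)) (le_trans (ltW xt) tT).
    have [D D0 HD] := dF x xT e e0.
    near=> h; rewrite /GRing.scale/= mulr1 distrC.
    have h0 : h != 0 by near: h; exact: nbhs_dnbhs_neq.
    have hs : `|h| < Num.min D (Num.min (x - s) (t - x)).
      by near: h; apply: dnbhs0_lt; rewrite !lt_min D0 !subr_gt0 sx xt.
    move: hs; rewrite !lt_min => /and3P[hD hxs htx].
    have := HD (h + x); rewrite addrK; apply => //.
      rewrite in_itv/=; move: hxs htx; rewrite !ltr_norml => /andP[? ?] /andP[? ?].
      by apply/andP; split; lra.
    by rewrite -subr_eq0 addrK.
  by apply: DeriveDef; [apply/cvg_ex; exists (f x)|exact: cvg_lim].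
have := @continuous_FTC2 _ f F s t st cfst.
move=> /(_ _ _)/(congr1 fine) /=; rewrite -/(Rintegral _ _ _) => <-.
- apply: Rintegral_itv_obnd_cbnd; exact: int_sub (continuous_int cf) s0 tT.
- by split => // x /dFx dx; exact: (@ex_derive _ _ _ _ _ _ _ dx).
- by move=> x /dFx dx; rewrite derive1E (@derive_val _ _ _ _ _ _ _ dx).
Unshelve. all: by end_near. Qed.

(** Comparison over distances less than a uniform D chains to the whole interval in steps of length
    D / 2. *)
Lemma local_nonincreasing F D : 0 < D ->
  (forall s t, 0 <= s -> s <= t -> t <= T -> t - s < D -> F t <= F s) ->
  forall s t, 0 <= s -> s <= t -> t <= T -> F t <= F s.
Proof.
move=> D0 loc s t s0 st tT; have [n] := ex_nat_gt ((t - s) / (D / 2)).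
rewrite ltr_pdivrMr ?divr_gt0// => tsn.
elim: n s s0 st tsn => [|n ih] s s0 st tsn.
  by move: tsn; rewrite mul0r ltNge subr_ge0 st.
have [tD|tD] := ltP (t - s) D; first exact: loc.
have D2 : 0 < D / 2 by rewrite divr_gt0.
have sD : s + D / 2 <= t by lra.
apply: (@le_trans _ _ (F (s + D / 2))).
  apply: ih => //; first by rewrite addr_ge0 ?(ltW D2).
  by move: tsn; rewrite -natr1 mulrDl mul1r; move: (n%:R * _) => a; lra.
by apply: loc => //; lra.
Qed.

End time_scalar.

(** * Curves in a semi-inner-product space *)

Section curves.
Context {R : realType} {E : lmodType R}.
Variables (T : R) (H : set E) (ip : E -> E -> R).
Notation leb := (@lebesgue_measure R).
Notation I01 := (`[0, T]%classic : set R).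
Implicit Types (u v w b : R -> E) (g : R -> R) (s t r : R).
Local Notation int f := (leb.-integrable `[0, T] (EFin \o f)).
Local Notation I s t f := (\int[leb]_(x in `]s, t]) f x).
Local Notation nrm := (nrm ip).

Definition ccont u := (forall t, t \in `[0, T] -> H (u t)) /\
  forall t, t \in `[0, T] -> forall e, 0 < e -> exists2 D, 0 < D &
    forall s, s \in `[0, T] -> `|s - t| < D -> nrm (u s - u t) <= e.

Definition cderiv u u' := [/\ ccont u, ccont u' & forall t, t \in `[0, T] ->
  forall e, 0 < e -> exists2 D, 0 < D & forall s, s \in `[0, T] -> s != t ->
    `|s - t| < D -> nrm ((s - t)^-1 *: (u s - u t) - u' t) <= e].

(* Weak measurability is tested against continuous curves rather than fixed
   vectors, so that it is stable under time dependent multipliers. *)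
Definition wmeas w := (forall t, t \in `[0, T] -> H (w t)) /\
  forall b, ccont b -> measurable_fun `[0, T] (fun t => ip (w t) (b t)).

(** An integrable majorant is carried along, since the norm of a weakly measurable curve need not be
    measurable. *)
Definition wint w g := [/\ wmeas w, int g &
  forall t, t \in `[0, T] -> nrm (w t) <= g t].

(** Absolute continuity of u with derivative w, in the sense of Pettis: only scalar integrals
    occur. *)
Definition primitive u w := forall phi s t, H phi -> 0 <= s -> s <= t -> t <= T ->
  ip (u t) phi - ip (u s) phi = I s t (fun r => ip (w r) phi).

Hypothesis T0 : 0 < T.
Hypothesis pH : prehilbert H ip.

Let HD := phD pH.
Let HB := phB pH.
Let HZ := phZ pH.

Lemma ccont_mem u t : ccont u -> t \in `[0, T] -> H (u t).
Proof. by case=> + _; exact. Qed.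

Lemma ccont_cst x : H x -> ccont (fun=> x).
Proof.
move=> Hx; split => // t _ e e0; exists 1 => // s _ _.
by rewrite subrr (nrm0 pH) ltW.
Qed.

Lemma ccontD u v : ccont u -> ccont v -> ccont (fun t => u t + v t).
Proof.
move=> [Hu cu] [Hv cv]; split => [t tT|t tT e e0].
  by apply: HD; [exact: Hu|exact: Hv].
have e2 : 0 < e / 2 by rewrite divr_gt0.
have [D1 D10 h1] := cu t tT _ e2; have [D2 D20 h2] := cv t tT _ e2.
exists (Num.min D1 D2); first by rewrite lt_min D10.
move=> s sT; rewrite lt_min => /andP[s1 s2].
rewrite opprD addrACA (splitr e).
apply: le_trans (nrmD pH (HB (Hu _ sT) (Hu _ tT)) (HB (Hv _ sT) (Hv _ tT))) _.
by rewrite lerD ?h1 ?h2.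
Qed.

Lemma ccont_bound u : ccont u ->
  exists2 B, 0 < B & forall t, t \in `[0, T] -> nrm (u t) <= B.
Proof.
move=> [Hu cu]; have : {within I01, continuous (fun t => nrm (u t))}.
  apply/continuous_epsP => t tT e e0; have [D D0 h] := cu t tT e e0.
  exists D => // s sT st; apply: le_trans (h s sT st).
  by apply: (nrm_dist pH); exact: Hu.
move=> /continuous_bounded[B B0 h]; exists B => // t tT.
by rewrite (le_trans _ (h t tT))// ler_norm.
Qed.

Lemma ccontZ (a : R -> R) u : {within I01, continuous a} -> ccont u ->
  ccont (fun t => a t *: u t).
Proof.
move=> /continuous_epsP ca uc; have [Hu cu] := uc.
split => [t tT|t tT e e0]; first exact/HZ/Hu.
have a0 : 0 < `|a t| + 1 by rewrite ltr_wpDl.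
have n0 : 0 < nrm (u t) + 1 by rewrite ltr_wpDl ?nrm_ge0.
have [D1 D10 h1] := ca t tT _ (divr_gt0 (divr_gt0 e0 (ltr0Sn R 1)) n0).
have [D2 D20 h2] := cu t tT _ (divr_gt0 (divr_gt0 e0 (ltr0Sn R 1)) a0).
have [D3 D30 h3] := ca t tT _ ltr01.
exists (Num.min D1 (Num.min D2 D3)); first by rewrite !lt_min D10 D20.
move=> s sT; rewrite !lt_min => /and3P[s1 s2 s3].
have -> : a s *: u s - a t *: u t = a s *: (u s - u t) + (a s - a t) *: u t.
  by rewrite scalerBr scalerBl addrA subrK.
have Hus := Hu _ sT; have Hut := Hu _ tT.
apply: le_trans (nrmD pH (HZ _ (HB Hus Hut)) (HZ _ Hut)) _.
rewrite !(nrmZ pH)//; last exact: HB.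
have := h1 _ sT s1; have := h2 _ sT s2; have := h3 _ sT s3.
have as1 : `|a s| <= `|a s - a t| + `|a t| by rewrite -{1}(subrK (a t) (a s)) ler_normD.
have := nrm_ge0 ip (u s - u t); have := nrm_ge0 ip (u t).
move: n0 a0 as1; move: (nrm (u s - u t)) (nrm (u t)) `|a s| `|a s - a t| `|a t|.
move=> x y p q r y0 r0 pr y0' x0 q1; rewrite !ler_pdivlMr// => hx hq.
have : p * x <= (r + 1) * x by rewrite ler_wpM2r//; lra.
have : q * y <= q * (y + 1) \/ q < 0 by case: (ltP q 0) => ?; [right|left; rewrite ler_wpM2l// lerDl].
case=> [|]; nra.
Qed.

Lemma ccontN u : ccont u -> ccont (fun t => - u t).
Proof.
move=> uc; rewrite (_ : (fun t => - u t) = (fun t => (cst (-1) t : R) *: u t)).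
  by apply: ccontZ => //; apply: continuous_subspaceT => x; exact: cvg_cst.
by apply/funext => t; rewrite scaleN1r.
Qed.

Lemma ccontB u v : ccont u -> ccont v -> ccont (fun t => u t - v t).
Proof. by move=> uc vc; apply: ccontD => //; exact: ccontN. Qed.

Lemma ccont_ip u v : ccont u -> ccont v ->
  {within I01, continuous (fun t => ip (u t) (v t))}.
Proof.
move=> uc vc; have [Hu cu] := uc; have [Hv cv] := vc.
have [B B0 HBv] := ccont_bound vc; apply/continuous_epsP => t tT e e0.
have n0 : 0 < nrm (u t) + 1 by rewrite ltr_wpDl ?nrm_ge0.
have [D1 D10 h1] := cu t tT _ (divr_gt0 (divr_gt0 e0 (ltr0Sn R 1)) B0).
have [D2 D20 h2] := cv t tT _ (divr_gt0 (divr_gt0 e0 (ltr0Sn R 1)) n0).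
exists (Num.min D1 D2); first by rewrite lt_min D10.
move=> s sT; rewrite lt_min => /andP[s1 s2].
have [Hus [Hut [Hvs Hvt]]] := (Hu _ sT, (Hu _ tT, (Hv _ sT, Hv _ tT))).
have -> : ip (u s) (v s) - ip (u t) (v t) = ip (u s - u t) (v s) + ip (u t) (v s - v t).
  by rewrite (ipBl pH)// (ipBr pH)// addrA subrK.
apply: le_trans (ler_normD _ _) _; rewrite (splitr e); apply: lerD.
  apply: le_trans (cauchy_schwarz pH (HB Hus Hut) Hvs) _.
  rewrite (le_trans (ler_wpM2l (nrm_ge0 _ _) (HBv _ sT)))// -ler_pdivlMr//.
  exact: h1.
apply: le_trans (cauchy_schwarz pH Hut (HB Hvs Hvt)) _.
have := h2 _ sT s2; rewrite ler_pdivlMr//.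
have := nrm_ge0 ip (v s - v t); move: (nrm (v s - v t)) (nrm (u t)) => x y; nra.
Qed.

Lemma ccont_unif u : ccont u -> forall e, 0 < e -> exists2 D, 0 < D &
  forall s t, s \in `[0, T] -> t \in `[0, T] -> `|s - t| < D -> nrm (u s - u t) <= e.
Proof.
move=> [Hu cu] e e0.
pose P (D : R) (t : R) := forall s, s \in `[0, T] -> t \in `[0, T] ->
  `|s - t| < D -> nrm (u s - u t) <= e.
have /compact_near_coveringP cK := @segment_compact R 0 T.
have : \forall D \near 0^'+, I01 `<=` P D.
  apply: cK => x xT; have e2 : 0 < e / 2 by rewrite divr_gt0.
  have [D D0 h] := cu x xT _ e2; have D2 : 0 < D / 2 by rewrite divr_gt0.
  exists (ball x (D / 2), [set r | r < D / 2]).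
    by split; [exact: nbhsx_ballx|exact: nbhs_right_lt].
  move=> [t r] [/= xt rD] s sT tT st.
  have xt' : `|t - x| < D / 2 by rewrite distrC.
  have sx : `|s - x| < D.
    rewrite (splitr D) -[s - x](subrKA t) (le_lt_trans (ler_normD _ _))//.
    by rewrite ltrD// (lt_trans st).
  rewrite (splitr e); apply: le_trans (nrmB_trans pH (Hu _ sT) (Hu _ tT) (Hu _ xT)) _.
  apply: lerD; first exact: h.
  rewrite (nrmBC pH (Hu _ xT) (Hu _ tT)); apply: h => //.
  by rewrite (lt_trans xt')// ltr_pdivrMr// ltr_pMr// ltr1n.
move=> near0; have : \forall D \near 0^'+, 0 < D /\ I01 `<=` P D.
  by apply: filterS2 near0 (nbhs_right_gt 0).
by move=> /filter_ex[D [D0 h]]; exists D => // s t sT tT; exact: h.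
Qed.

Lemma wint_int w g b : wint w g -> ccont b -> int (fun t => ip (w t) (b t)).
Proof.
move=> [[Hw mw] gi wg] bc; have [B B0 HBb] := ccont_bound bc.
apply: (@integrable_le _ _ _ leb `[0, T] _ _ (fun t => B * g t)) => //.
- exact: mw.
- exact: integrableZ_fin.
- move=> t tT; apply: le_trans (cauchy_schwarz pH (Hw _ tT) (ccont_mem bc tT)) _.
  have := wg t tT; have := HBb t tT.
  have := nrm_ge0 ip (w t); have := nrm_ge0 ip (b t).
  by rewrite mulrC => *; apply: ler_pM.
Qed.

Lemma wint_ge0 w g t : wint w g -> t \in `[0, T] -> 0 <= g t.
Proof. by move=> [_ _ h] /h; apply: le_trans; exact: nrm_ge0. Qed.

Lemma ccont_wmeas u : ccont u -> wmeas u.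
Proof.
move=> uc; split; first by case: uc.
by move=> b bc; exact: (integrable_measurable (continuous_int (ccont_ip uc bc))).
Qed.

Lemma mem01 s t r : 0 <= s -> t <= T -> s < r -> r <= t -> r \in `[0, T].
Proof. by move=> s0 tT sr rt; rewrite in_itv/= (le_trans s0 (ltW sr)) (le_trans rt). Qed.

Lemma primitive_norm u w g s t : wint w g -> primitive u w ->
  (forall t, t \in `[0, T] -> H (u t)) -> 0 <= s -> s <= t -> t <= T ->
  nrm (u t - u s) <= I s t g.
Proof.
move=> wi pu Hu s0 st tT.
have sT : s \in `[0, T] by rewrite in_itv/= s0 (le_trans st).
have tT' : t \in `[0, T] by rewrite in_itv/= tT (le_trans s0).
have gi : int g by case: wi.
have := HB (Hu _ tT') (Hu _ sT) => Hts.
apply: (nrm_le_dual pH Hts).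
  by apply: I_ge0 => // r sr rt; apply: (wint_ge0 wi); exact: mem01 sr rt.
move=> y Hy; rewrite (ipBl pH (Hu _ tT') (Hu _ sT) Hy) pu// mulrC -(I_Zl _ gi)//.
have iw := wint_int wi (ccont_cst Hy).
apply: (I_norm_le iw) => //; first exact: integrableZ_fin.
move=> r sr rt; have rT := mem01 s0 tT sr rt.
have [[Hw _] _ wg] := wi; apply: le_trans (cauchy_schwarz pH (Hw _ rT) Hy) _.
by rewrite mulrC ler_wpM2l ?nrm_ge0// wg.
Qed.

Lemma primitive_ccont u w g : wint w g -> primitive u w ->
  (forall t, t \in `[0, T] -> H (u t)) -> ccont u.
Proof.
move=> wi pu Hu; split => // t tT e e0; have gi : int g by case: wi.
have /continuous_epsP/(_ t tT e e0)[D D0 h] := I_continuous T0 gi.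
exists D => // s sT st; apply: le_trans (h s sT st).
move: (sT) (tT); rewrite !in_itv/= => /andP[s0 sT'] /andP[t0 tT'].
have [ts|ts] := leP t s.
  rewrite (I_add gi (lexx 0) t0 ts sT') addrAC subrr add0r.
  by apply: le_trans (ler_norm _); exact: (primitive_norm wi pu Hu t0 ts sT').
rewrite (nrmBC pH (Hu _ sT) (Hu _ tT)) distrC (I_add gi (lexx 0) s0 (ltW ts) tT').
rewrite addrAC subrr add0r; apply: le_trans (ler_norm _).
exact: (primitive_norm wi pu Hu s0 (ltW ts) tT').
Qed.

End curves.

(** * Absolutely continuous curves and ordinary differential equations *)

Lemma half_pow_lt {R : realType} (K e : R) : 0 < e ->
  exists N : nat, forall n, (N <= n)%N -> K * 2^-1 ^+ n <= e.
Proof.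
move=> e0; have K0 : 0 < `|K| + 1 by rewrite ltr_wpDl.
have : (2^-1 : R) ^+ n @[n --> \oo] --> (0 : R).
  by apply: cvg_expr; rewrite ger0_norm ?invr_ge0// invf_lt1// ltr1n.
move=> /cvgrPdist_le/(_ (e / (`|K| + 1)) (divr_gt0 e0 K0))[N _ hN].
exists N => n Nn; have := hN n Nn.
rewrite /= sub0r normrN ger0_norm ?exprn_ge0 ?invr_ge0// ler_pdivlMr//.
apply: le_trans; rewrite mulrC ler_wpM2l ?exprn_ge0 ?invr_ge0//.
by rewrite (le_trans (ler_norm K))// lerDl.
Qed.

Lemma half_pow_le0 {R : realType} (a K : R) :
  (forall n : nat, a <= K * 2^-1 ^+ n) -> a <= 0.
Proof.
move=> h; apply/ler_addgt0Pr => e e0; rewrite add0r.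
by have [N hN] := half_pow_lt K e0; exact: le_trans (h N) (hN N (leqnn N)).
Qed.

Section primitives.
Context {R : realType} {E : lmodType R}.
Variables (T : R) (H : set E) (ip : E -> E -> R).
Notation leb := (@lebesgue_measure R).
Notation I01 := (`[0, T]%classic : set R).
Implicit Types (u v w b : R -> E) (g : R -> R) (s t r : R).
Local Notation int f := (leb.-integrable `[0, T] (EFin \o f)).
Local Notation I s t f := (\int[leb]_(x in `]s, t]) f x).
Local Notation nrm := (nrm ip).
Local Notation ccont := (ccont T H ip).
Local Notation wint := (wint T H ip).
Local Notation primitive := (primitive T H ip).
Local Notation cderiv := (cderiv T H ip).

Hypothesis T0 : 0 < T.
Hypothesis pH : prehilbert H ip.

Let HD := phD pH.
Let HB := phB pH.
Let HZ := phZ pH.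

Lemma cderiv_deriv_within u u' x : cderiv u u' -> H x ->
  deriv_within T (fun t => ip x (u t)) (fun t => ip x (u' t)).
Proof.
move=> [[Hu _] [Hu' _] du] Hx t tT e e0.
have n0 : 0 < nrm x + 1 by rewrite ltr_wpDl ?nrm_ge0.
have [D D0 h] := du t tT _ (divr_gt0 e0 n0); exists D => // s sT st sD.
have Hd := HB (Hu _ sT) (Hu _ tT).
rewrite -(ipBr pH (Hu _ sT) (Hu _ tT) Hx) -(ipZr pH _ Hx Hd) -(ipBr pH (HZ _ Hd) (Hu' _ tT) Hx).
apply: le_trans (cauchy_schwarz pH Hx (HB (HZ _ Hd) (Hu' _ tT))) _.
have := h s sT st sD; rewrite ler_pdivlMr//.
have := nrm_ge0 ip ((s - t)^-1 *: (u s - u t) - u' t).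
move: (nrm _) (nrm x) => a c; nra.
Qed.

(* On small intervals the two sides differ by an arbitrarily small multiple of
   the increment of a fixed integral. *)
Lemma primitive_product u w g b b' s t : wint w g -> ccont u -> primitive u w ->
  cderiv b b' -> 0 <= s -> s <= t -> t <= T ->
  ip (u t) (b t) - ip (u s) (b s) =
  I s t (fun r => ip (w r) (b r) + ip (u r) (b' r)).
Proof.
move=> wi uc pu db; have [bc b'c _] := db.
have [[Hw mw] gi wg] := wi; have [Hu _] := uc; have [Hb _] := bc; have [Hb' _] := b'c.
have [B B0 HBb] := ccont_bound pH b'c.
have iwb := wint_int pH wi bc.
have iub := continuous_int (ccont_ip pH uc b'c).
have iK : int (fun r => ip (w r) (b r) + ip (u r) (b' r)) by exact: integrableD_fin.
pose P r := ip (u r) (b r) - I 0 r (fun r => ip (w r) (b r) + ip (u r) (b' r)).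
have iQ : int (fun r => g r + B).
  apply: integrableD_fin => //; apply: continuous_int.
  by apply: continuous_subspaceT => x; exact: cvg_cst.
pose Q r := I 0 r (fun r => g r + B).
have mem x : 0 <= x -> x <= T -> x \in `[0, T] by move=> ? ?; rewrite in_itv/=; apply/andP.
have key e : 0 < e -> exists2 D, 0 < D & forall s t, 0 <= s -> s <= t -> t <= T ->
    t - s < D -> `|P t - P s| <= e * (Q t - Q s).
  move=> e0; have [D1 D10 h1] := ccont_unif pH uc e0.
  have [D2 D20 h2] := ccont_unif pH bc e0.
  exists (Num.min D1 D2); first by rewrite lt_min D10.
  move=> {}s {}t s0 st tT; rewrite lt_min => /andP[t1 t2].
  have sT := le_trans st tT; have t0 := le_trans s0 st.
  have [Hus Hut] := (Hu _ (mem _ s0 sT), Hu _ (mem _ t0 tT)).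
  have [Hbs Hbt] := (Hb _ (mem _ s0 sT), Hb _ (mem _ t0 tT)).
  rewrite /P /Q (I_add iK (lexx 0) s0 st tT) (I_add iQ (lexx 0) s0 st tT).
  rewrite [X in e * X]addrAC subrr add0r.
  have iwt := wint_int pH wi (ccont_cst T pH Hbt).
  have isb := continuous_int (ccont_ip pH (ccont_cst T pH Hus) b'c).
  have i1 : int (fun r => ip (w r) (b t) + ip (u s) (b' r)) by exact: integrableD_fin.
  (* The increment is (u(t) - u(s), b(t)) + (u(s), b(t) - b(s)). Freezing b at t and u at s leaves
     only pairings with a fixed vector, to which the definition of [primitive] and the fundamental
     theorem of calculus apply. *)
  have E1 : ip (u t) (b t) - ip (u s) (b s) =
      I s t (fun r => ip (w r) (b t) + ip (u s) (b' r)).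
    rewrite (I_subD iwt isb s0 tT) -(pu _ _ _ Hbt s0 st tT).
    rewrite (I_FTC (cderiv_deriv_within db Hus) (ccont_ip pH (ccont_cst T pH Hus) b'c) s0 st tT).
    by rewrite addrA subrK.
  have -> : ip (u t) (b t) -
      (I 0 s (fun r => ip (w r) (b r) + ip (u r) (b' r)) +
       I s t (fun r => ip (w r) (b r) + ip (u r) (b' r))) -
      (ip (u s) (b s) - I 0 s (fun r => ip (w r) (b r) + ip (u r) (b' r))) =
      I s t (fun r => (ip (w r) (b t) + ip (u s) (b' r)) -
                      (ip (w r) (b r) + ip (u r) (b' r))).
    rewrite (I_subB i1 iK s0 tT) -E1; ring.
  rewrite -(I_Zl _ iQ s0 tT); apply: (I_norm_le _ _ s0 tT).
  - by apply: integrableD_fin => //; exact: integrableN_fin.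
  - exact: integrableZ_fin.
  move=> r sr rt; have rT := mem01 s0 tT sr rt.
  have [Hur Hwr] := (Hu _ rT, Hw _ rT); have [Hbr Hb'r] := (Hb _ rT, Hb' _ rT).
  have -> : ip (w r) (b t) + ip (u s) (b' r) - (ip (w r) (b r) + ip (u r) (b' r)) =
      ip (w r) (b t - b r) + ip (u s - u r) (b' r).
    by rewrite (ipBr pH)// (ipBl pH)//; ring.
  apply: le_trans (ler_normD _ _) _; rewrite mulrDr; apply: lerD.
    apply: le_trans (cauchy_schwarz pH Hwr (HB Hbt Hbr)) _.
    rewrite mulrC; apply: ler_pM; rewrite ?nrm_ge0 ?wg//.
    apply: h2 => //; first exact: mem.
    by apply: le_lt_trans t2; rewrite ger0_norm ?subr_ge0// lerD2l lerN2 ltW.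
  apply: le_trans (cauchy_schwarz pH (HB Hus Hur) Hb'r) _.
  apply: ler_pM; rewrite ?nrm_ge0 ?HBb//.
  apply: h1 => //; first exact: mem.
  apply: le_lt_trans t1; rewrite distrC ger0_norm ?subr_ge0 ?(ltW sr)//.
  by rewrite lerD2r.
have Qmono x y : 0 <= x -> x <= y -> y <= T -> 0 <= Q y - Q x.
  move=> x0 xy yT; rewrite /Q (I_add iQ (lexx 0) x0 xy yT) addrAC subrr add0r.
  apply: I_ge0 => // r xr ry; rewrite addr_ge0 ?(ltW B0)//.
  by apply: (wint_ge0 wi); exact: mem01 xr ry.
move=> s0 st tT.
(* By [key], both P - c Q and - P - c Q are locally nonincreasing for every c > 0; letting c tend to
   0 shows that P is constant. *)
have PE sg : `|sg| = 1 -> sg * (P t - P s) <= 0.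
  move=> sg1; apply/ler_addgt0Pr => e e0; rewrite add0r.
  have C0 : 0 < Q t - Q s + 1 by rewrite ltr_wpDl ?Qmono.
  have ec : 0 < e / (Q t - Q s + 1) by rewrite divr_gt0.
  have [D D0 hD] := key _ ec; set c := e / _ in ec hD.
  have : sg * P t - c * Q t <= sg * P s - c * Q s.
    apply: (@local_nonincreasing R T (fun r => sg * P r - c * Q r) D D0 _ s t s0 st tT).
    move=> x y x0 xy yT yx.
    have := hD x y x0 xy yT yx; rewrite -[X in X <= _]mul1r -sg1 -normrM.
    move=> /(le_trans (ler_norm _)); rewrite !mulrBr.
    by move: (sg * _) (sg * _) (c * _) (c * _) => *; lra.
  have cQ : c * (Q t - Q s) <= e.
    rewrite /c mulrAC ler_pdivrMr// ler_wpM2l ?(ltW e0)// lerDl ler01//.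
  move: cQ; rewrite !mulrBr; move: (sg * _) (sg * _) (c * _) (c * _) => *; lra.
have PP : P t = P s.
  have := PE 1 (normr1 _); have := PE (-1) (normrN1 _); rewrite mul1r mulN1r.
  by move: (P t) (P s) => *; lra.
move: PP; rewrite /P (I_add iK (lexx 0) s0 st tT).
move: (ip (u t) (b t)) (ip (u s) (b s)) (I 0 s (fun r => ip (w r) (b r) + ip (u r) (b' r))).
by move: (I s t (fun r => ip (w r) (b r) + ip (u r) (b' r))) => *; lra.
Qed.

Hypothesis cH : nrm_complete H ip.

(** For each t the functional x |-> int_0^t (w, x) is bounded by the integral of g, so Riesz's
    theorem gives the value of the indefinite integral at t. Its continuity in t follows from that
    of the integral of g. *)
Lemma pettis w g x0 : wint w g -> H x0 -> exists u,
  [/\ ccont u, u 0 = x0 & primitive u w].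
Proof.
move=> wi Hx0; have [[Hw mw] gi wg] := wi.
have iw x : H x -> int (fun r => ip (w r) x).
  by move=> Hx; have := wint_int pH wi (ccont_cst T pH Hx).
have /choice[J JP] : forall t, exists J, H J /\ (t \in `[0, T] -> forall x, H x ->
    ip J x = I 0 t (fun r => ip (w r) x)).
  move=> t; have [tT|tT] := boolP (t \in `[0, T]); last first.
    by exists 0; split => //; exact: ph0 pH.
  have /andP[t0 tT'] : 0 <= t <= T by move: tT; rewrite in_itv.
  have [|||J [HJ JE]] := @riesz _ _ _ _ pH cH (fun x => I 0 t (fun r => ip (w r) x)) (I 0 t g).
  - move=> x y Hx Hy; rewrite -(I_subD (iw x Hx) (iw y Hy) (lexx 0) tT').
    apply: eq_Rintegral => r; rewrite inE/= in_itv/= => /andP[r0 rt].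
    by rewrite (ipDr pH)//; apply: Hw; exact: (mem01 (lexx 0) tT').
  - move=> k x Hx; rewrite -(I_Zl _ (iw x Hx) (lexx 0) tT').
    apply: eq_Rintegral => r; rewrite inE/= in_itv/= => /andP[r0 rt].
    by rewrite (ipZr pH)//; apply: Hw; exact: (mem01 (lexx 0) tT').
  - move=> x Hx; rewrite mulrC -(I_Zl _ gi (lexx 0) tT').
    apply: (I_norm_le (iw x Hx) _ (lexx 0) tT'); first exact: integrableZ_fin.
    move=> r r0 rt; have rT := mem01 (lexx 0) tT' r0 rt.
    apply: le_trans (cauchy_schwarz pH (Hw _ rT) Hx) _.
    by rewrite mulrC ler_wpM2l ?nrm_ge0// wg.
  by exists J; split => // _; exact: JE.
(* [J 0] is only known to have norm zero; the case distinction gives [u 0 = x0] on the nose. *)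
pose u t := if t == 0 then x0 else x0 + J t.
have HJ t : H (J t) by case: (JP t).
have Hu t : H (u t) by rewrite /u; case: ifP => // _; exact: HD.
have uE t x : t \in `[0, T] -> H x -> ip (u t) x = ip x0 x + I 0 t (fun r => ip (w r) x).
  move=> tT Hx; rewrite /u; case: eqP => [->|_]; first by rewrite I_set0 addr0.
  by rewrite (ipDl pH)//; congr (_ + _); exact: (JP t).2.
have pu : primitive u w.
  move=> x s t Hx s0 st tT.
  have sT : s \in `[0, T] by rewrite in_itv/= s0 (le_trans st).
  have tT' : t \in `[0, T] by rewrite in_itv/= tT (le_trans s0).
  rewrite (uE t x tT' Hx) (uE s x sT Hx).
  by rewrite (I_add (iw x Hx) (lexx 0) s0 st tT) opprD addrACA subrr add0r addrAC subrr add0r.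
exists u; split; [|by rewrite /u eqxx|exact: pu].
exact: (primitive_ccont T0 pH wi pu (fun t _ => Hu t)).
Qed.

Section ode.
Variables (Phi : R -> E -> E) (L : R).
Hypothesis L0 : 0 < L.
Hypothesis Phi_wint : forall u, ccont u -> exists g, wint (fun t => Phi t (u t)) g.
Hypothesis Phi_lip : forall t x y, t \in `[0, T] -> H x -> H y ->
  nrm (Phi t x - Phi t y) <= L * nrm (x - y).

(** Weight for the supremum norm. Since L times the integral of e^(2Lr) over [0, t] is at most
    e^(2Lt) / 2, the Picard map contracts by 1/2 in the weighted norm on all of [0, T], so the
    interval is not subdivided. *)
Let wE t : R := expR (2 * L * t).

Let wE_ge0 t : 0 <= wE t. Proof. exact: expR_ge0. Qed.

Let wE_continuous : continuous wE.
Proof.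
move=> t; apply: continuous_comp; last exact: continuous_expR.
by apply: cvgM; [exact: cvg_cst|exact: cvg_id].
Qed.

Let wE_int : int wE.
Proof. by apply: continuous_int; exact: continuous_subspaceT. Qed.

Let wE_integral t : 0 <= t -> t <= T -> I 0 t wE = (2 * L)^-1 * (wE t - 1).
Proof.
move=> t0 tT; have L2 : 2 * L != 0 by rewrite gt_eqF// mulr_gt0.
have dE x : is_derive x (1:R) (fun y => (2 * L)^-1 * wE y) (wE x).
  have d1 : is_derive x (1:R) (fun y : R => 2 * L * y) (2 * L).
    have := is_deriveM (is_derive_cst (2 * L) x (1:R)) (is_derive_id x (1:R)).
    by rewrite scaler0 addr0 /GRing.scale/= mulr1.
  have d2 := is_derive1_comp (is_derive_expR (2 * L * x)) d1.
  have := is_deriveM (is_derive_cst ((2 * L)^-1) x (1:R)) d2.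
  by rewrite scaler0 addr0 /GRing.scale/= mulrCA mulVf// mulr1.
rewrite (@I_FTC _ T (fun y => (2 * L)^-1 * wE y) wE 0 t) //.
- by rewrite -mulrBr /wE mulr0 expR0.
- move=> x _ e e0; have cv : (h^-1 *: ((2 * L)^-1 * wE (h *: (1 : R) + x) - (2 * L)^-1 * wE x))
      @[h --> 0^'] --> wE x.
    by have [dx Dx] := dE x; rewrite -[X in _ --> X]Dx; exact: dx.
  have /cvgrPdist_le/(_ e e0) := cv.
  move=> /nbhs_ballP[D /= D0 hD]; exists D => // s _ sx sD.
  have := hD (s - x); rewrite /ball/= sub0r normrN => /(_ sD).
  by rewrite subr_eq0 => /(_ sx); rewrite /GRing.scale/= mulr1 subrK distrC.
- exact: continuous_subspaceT.
Qed.

Lemma ode_contraction u u' v v' K : ccont u -> ccont u' ->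
  (forall t, t \in `[0, T] -> H (v t)) -> (forall t, t \in `[0, T] -> H (v' t)) ->
  primitive v (fun t => Phi t (u t)) -> primitive v' (fun t => Phi t (u' t)) ->
  nrm (v 0 - v' 0) = 0 -> 0 <= K ->
  (forall t, t \in `[0, T] -> nrm (u t - u' t) <= K * wE t) ->
  forall t, t \in `[0, T] -> nrm (v t - v' t) <= K / 2 * wE t.
Proof.
move=> uc uc' Hv Hv' pv pv' v0 K0 uu' t tT.
have /andP[t0 tT'] : 0 <= t <= T by move: tT; rewrite in_itv.
have T01 : 0 \in `[0, T] by rewrite in_itv/= lexx ltW.
have [g wi] := Phi_wint uc; have [g' wi'] := Phi_wint uc'.
have [[[Hw _] _ _] [[Hw' _] _ _]] := (wi, wi').
have [Hu Hu'] := (uc.1, uc'.1).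
have Hd := HB (Hv _ tT) (Hv' _ tT).
apply: (nrm_le_dual pH Hd); first by rewrite mulr_ge0// divr_ge0.
move=> y Hy.
have iw := wint_int pH wi (ccont_cst T pH Hy).
have iw' := wint_int pH wi' (ccont_cst T pH Hy).
have -> : ip (v t - v' t) y = I 0 t (fun r => ip (Phi r (u r)) y - ip (Phi r (u' r)) y).
  rewrite (I_subB iw iw' (lexx 0) tT') -(pv _ _ _ Hy (lexx 0) t0 tT').
  rewrite -(pv' _ _ _ Hy (lexx 0) t0 tT') (ipBl pH (Hv _ tT) (Hv' _ tT) Hy).
  have := ip_eq0 pH (HB (Hv _ T01) (Hv' _ T01)) Hy v0.
  rewrite (ipBl pH (Hv _ T01) (Hv' _ T01) Hy).
  by move: (ip _ _) (ip _ _) (ip _ _) (ip _ _) => *; lra.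
apply: (@le_trans _ _ (I 0 t (fun r => (L * K * nrm y) * wE r))).
  apply: (I_norm_le _ _ (lexx 0) tT').
  - by apply: integrableD_fin => //; exact: integrableN_fin.
  - exact: integrableZ_fin.
  move=> r r0 rt; have rT := mem01 (lexx 0) tT' r0 rt.
  rewrite -(ipBl pH (Hw _ rT) (Hw' _ rT) Hy).
  apply: le_trans (cauchy_schwarz pH (HB (Hw _ rT) (Hw' _ rT)) Hy) _.
  rewrite mulrAC ler_wpM2r ?nrm_ge0// -mulrA.
  apply: le_trans (Phi_lip rT (Hu _ rT) (Hu' _ rT)) _.
  by rewrite ler_wpM2l ?(ltW L0)// uu'.
rewrite (I_Zl _ wE_int (lexx 0) tT') wE_integral//.
have -> : L * K * nrm y * ((2 * L)^-1 * (wE t - 1)) = K / 2 * (wE t - 1) * nrm y.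
  by field; rewrite gt_eqF.
rewrite ler_wpM2r ?nrm_ge0// ler_wpM2l ?divr_ge0//.
by rewrite gerBl.
Qed.

Lemma ode_unique u v : ccont u -> ccont v ->
  primitive u (fun t => Phi t (u t)) -> primitive v (fun t => Phi t (v t)) ->
  nrm (u 0 - v 0) = 0 -> forall t, t \in `[0, T] -> nrm (u t - v t) = 0.
Proof.
move=> uc vc pu pv u0.
have [B B0 hB] := ccont_bound pH (ccontB pH uc vc).
have key n t : t \in `[0, T] -> nrm (u t - v t) <= B * 2^-1 ^+ n * wE t.
  elim: n t => [|n ih] t tT.
    rewrite expr0 mulr1 (le_trans (hB t tT))// ler_peMr ?(ltW B0)//.
    rewrite /wE -expR0 ler_expR !mulr_ge0 ?(ltW L0)//.
    by move: tT; rewrite in_itv => /andP[].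
  have := ode_contraction uc vc uc.1 vc.1 pu pv u0 _ ih tT.
  rewrite exprSr mulrA; apply.
  by rewrite mulr_ge0 ?(ltW B0)// exprn_ge0// invr_ge0.
move=> t tT; apply/eqP; rewrite eq_le nrm_ge0 andbT.
apply: (@half_pow_le0 _ _ (B * wE t)) => n; rewrite mulrAC; exact: key.
Qed.

(** The iterates start exactly at x0, but their pointwise limit is picked by completeness of a
    seminormed space, so its initial value is determined only up to norm zero. *)
Lemma ode_exists x0 : H x0 -> exists u, [/\ ccont u, nrm (u 0 - x0) = 0 &
  primitive u (fun t => Phi t (u t))].
Proof.
move=> Hx0.
have /choice[nxt nxtP] : forall u, exists v, ccont u ->
    [/\ ccont v, v 0 = x0 & primitive v (fun t => Phi t (u t))].
  move=> u; have [uc|nu] := pselect (ccont u); last by exists u.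
  by have [g wi] := Phi_wint uc; have [v vP] := pettis wi Hx0; exists v.
pose U n := iter n nxt (fun=> x0).
have Uc n : ccont (U n).
  elim: n => [|n ih]; first exact: ccont_cst.
  by have [] := nxtP _ ih.
have U0 n : U n 0 = x0 by case: n => // n; have [] := nxtP _ (Uc n).
have Up n : primitive (U n.+1) (fun t => Phi t (U n t)) by have [] := nxtP _ (Uc n).
have HU n t : t \in `[0, T] -> H (U n t) by exact: (Uc n).1.
have [B B0 hB] := ccont_bound pH (ccontB pH (Uc 1%N) (Uc 0%N)).
have h2 n : 0 <= 2^-1 ^+ n :> R by rewrite exprn_ge0// invr_ge0.
have key n t : t \in `[0, T] -> nrm (U n.+1 t - U n t) <= B * 2^-1 ^+ n * wE t.
  elim: n t => [|n ih] t tT.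
    rewrite expr0 mulr1 (le_trans (hB t tT))// ler_peMr ?(ltW B0)//.
    rewrite /wE -expR0 ler_expR !mulr_ge0 ?(ltW L0)//.
    by move: tT; rewrite in_itv => /andP[].
  have nrm00 : nrm (U n.+2 0 - U n.+1 0) = 0 by rewrite !U0 subrr (nrm0 pH).
  have := ode_contraction (Uc n.+1) (Uc n) (Uc n.+2).1 (Uc n.+1).1 (Up _) (Up _)
    nrm00 _ ih tT.
  by rewrite exprSr mulrA; apply; rewrite mulr_ge0 ?(ltW B0).
pose C := B * wE T.
have C0 : 0 <= C by rewrite mulr_ge0// ltW.
have step n t : t \in `[0, T] -> nrm (U n.+1 t - U n t) <= C * 2^-1 ^+ n.
  move=> tT; apply: le_trans (key n t tT) _.
  rewrite /C mulrAC ler_wpM2r// ler_wpM2l ?(ltW B0)// /wE ler_expR.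
  rewrite ler_wpM2l ?mulr_ge0 ?(ltW L0)//.
  by move: tT; rewrite in_itv => /andP[].
(* The exact value of the geometric sum is kept on the right so that the induction on m closes; the
   weaker bound [tele'] would not be inductive. *)
have tele n m t : t \in `[0, T] ->
    nrm (U (n + m)%N t - U n t) <= C * 2 * (2^-1 ^+ n - 2^-1 ^+ (n + m)).
  move=> tT; elim: m => [|m ih]; first by rewrite addn0 !subrr (nrm0 pH) mulr0.
  have Hm := HU (n + m)%N t tT; have HSm := HU (n + m).+1 t tT; have Hn := HU n t tT.
  rewrite addnS; apply: le_trans (nrmB_trans pH HSm Hn Hm) _.
  apply: le_trans (lerD (step _ _ tT) ih) _; rewrite le_eqVlt; apply/orP; left.
  by apply/eqP; rewrite exprS; move: (2^-1 ^+ n) (2^-1 ^+ (n + m)) => a b; field.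
have tele' n m t : t \in `[0, T] -> nrm (U (n + m)%N t - U n t) <= C * 2 * 2^-1 ^+ n.
  by move=> tT; apply: le_trans (tele n m t tT) _; apply: ler_wpM2l; [exact: mulr_ge0|rewrite gerBl].
have /choice[u uP] : forall t, exists l, H l /\ (t \in `[0, T] ->
    forall n, nrm (U n t - l) <= C * 2 * 2^-1 ^+ n).
  move=> t; have [tT|tT] := boolP (t \in `[0, T]); last by exists x0.
  have [|l [Hl hl]] := cH (fun n => HU n t tT).
    move=> e e0; have [N hN] := half_pow_lt (C * 2 + C * 2) e0.
    exists N => m n Nm Nn; apply: le_trans (hN N (leqnn _)).
    apply: le_trans (nrmB_trans pH (HU m t tT) (HU n t tT) (HU N t tT)) _.
    rewrite mulrDl; apply: lerD; first by rewrite -(subnKC Nm) tele'.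
    by rewrite (nrmBC pH (HU N t tT) (HU n t tT)) -(subnKC Nn) tele'.
  exists l; split => // _ n; apply/ler_addgt0Pr => e e0.
  have [N hN] := hl e e0.
  apply: le_trans (nrmB_trans pH (HU n t tT) Hl (HU (n + N)%N t tT)) _.
  apply: lerD; last by apply: hN; exact: leq_addl.
  by rewrite (nrmBC pH (HU n t tT) (HU (n + N)%N t tT)) tele'.
have Hu t : H (u t) by case: (uP t).
have rate t n : t \in `[0, T] -> nrm (U n t - u t) <= C * 2 * 2^-1 ^+ n.
  by move=> tT; exact: (uP t).2.
have uc : ccont u.
  split => // t tT e e0; have e3 : 0 < e / 3 by rewrite divr_gt0.
  have [N hN] := half_pow_lt (C * 2) e3.
  have [D D0 hD] := (Uc N).2 t tT _ e3; exists D => // s sT st.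
  have hs := le_trans (rate s N sT) (hN N (leqnn _)).
  have ht := le_trans (rate t N tT) (hN N (leqnn _)).
  have hst := hD s sT st.
  apply: le_trans (nrmB_trans pH (Hu s) (Hu t) (HU N s sT)) _.
  have := nrmB_trans pH (HU N s sT) (Hu t) (HU N t tT).
  rewrite (nrmBC pH (Hu s) (HU N s sT)); move: hs ht hst.
  move: (nrm _) (nrm _) (nrm _) (nrm _) => a b c f; lra.
have T01 : 0 \in `[0, T] by rewrite in_itv/= lexx ltW.
exists u; split => //.
  apply/eqP; rewrite eq_le nrm_ge0 andbT; apply: (@half_pow_le0 _ _ (C * 2)) => n.
  by rewrite (nrmBC pH (Hu 0) Hx0) -(U0 n); exact: rate.
move=> y s t Hy s0 st tT.
have sT : s \in `[0, T] by rewrite in_itv/= s0 (le_trans st).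
have tT' : t \in `[0, T] by rewrite in_itv/= tT (le_trans s0).
have [g wi] := Phi_wint uc; have iw := wint_int pH wi (ccont_cst T pH Hy).
have [[Hw _] _ _] := wi.
apply/eqP; rewrite -subr_eq0 -normr_le0.
(* The defect of the limit in the integral equation is compared with iterate n: one error at t, one
   at s, and one under the integral, which picks up the Lipschitz constant and the length of the
   interval. *)
apply: (@half_pow_le0 _ _ ((C * 2 + C * 2 + L * (C * 2) * (t - s)) * nrm y)) => n.
have [g' wi'] := Phi_wint (Uc n); have iw' := wint_int pH wi' (ccont_cst T pH Hy).
have [[Hw' _] _ _] := wi'.
have E1 : ip (u t) y - ip (u s) y - I s t (fun r => ip (Phi r (u r)) y) =
    ip (u t - U n.+1 t) y - ip (u s - U n.+1 s) y +
    I s t (fun r => ip (Phi r (U n r)) y - ip (Phi r (u r)) y).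
  rewrite (I_subB iw' iw s0 tT) -(Up n _ _ _ Hy s0 st tT).
  rewrite (ipBl pH (Hu t) (HU n.+1 t tT') Hy) (ipBl pH (Hu s) (HU n.+1 s sT) Hy).
  ring.
have half r : r \in `[0, T] -> `|ip (u r - U n.+1 r) y| <= C * 2 * 2^-1 ^+ n * nrm y.
  move=> rT; apply: le_trans (cauchy_schwarz pH (HB (Hu r) (HU n.+1 r rT)) Hy) _.
  rewrite ler_wpM2r ?nrm_ge0// (nrmBC pH (Hu r) (HU n.+1 r rT)).
  apply: le_trans (rate r n.+1 rT) _; apply: ler_wpM2l; first exact: mulr_ge0.
  by rewrite exprS ler_piMl// invf_le1// ler1n.
have ick : int (fun=> L * (C * 2 * 2^-1 ^+ n) * nrm y).
  by apply: continuous_int; apply: continuous_subspaceT => x; exact: cvg_cst.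
have hI : `|I s t (fun r => ip (Phi r (U n r)) y - ip (Phi r (u r)) y)| <=
    L * (C * 2 * 2^-1 ^+ n) * nrm y * (t - s).
  rewrite -I_cst//; apply: (I_norm_le _ ick s0 tT).
    by apply: integrableD_fin => //; exact: integrableN_fin.
  move=> r sr rt; have rT := mem01 s0 tT sr rt.
  rewrite -(ipBl pH (Hw' _ rT) (Hw _ rT) Hy).
  apply: le_trans (cauchy_schwarz pH (HB (Hw' _ rT) (Hw _ rT)) Hy) _.
  rewrite ler_wpM2r ?nrm_ge0//; apply: le_trans (Phi_lip rT (HU n r rT) (Hu r)) _.
  by rewrite ler_wpM2l ?(ltW L0)// rate.
rewrite E1; apply: le_trans (ler_normD _ _) _.
apply: le_trans (lerD (le_trans (ler_normB _ _) (lerD (half t tT') (half s sT))) hI) _.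
rewrite le_eqVlt; apply/orP; left; apply/eqP; ring.
Qed.

End ode.

End primitives.

(** * Weak derivatives of scalar functions of time *)

Section weak_derivative_scalar.
Context {R : realType}.
Notation leb := (@lebesgue_measure R).
Implicit Types (s t r x : R).

(* The shift makes the derivative vanish outside ]0, 1[. *)
Definition sstep x : R := step (2 * x + - 2^-1).

Lemma smooth_sstep : smooth sstep.
Proof. exact: (smooth_affine 2 (- 2^-1) smooth_step). Qed.

Lemma sstep_eq0 x : x <= 4^-1 -> sstep x = 0.
Proof. by move=> h; apply: step_eq0; lra. Qed.

Lemma sstep_eq1 x : 3 / 4 <= x -> sstep x = 1.
Proof. by move=> h; apply: step_eq1; lra. Qed.

Lemma sstep_bound x : 0 <= sstep x <= 1.
Proof. by rewrite step_ge0 step_le1. Qed.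

Definition dsstep x : R := 'D_1 sstep x.

Lemma is_derive_sstep x : is_derive x (1:R) sstep (dsstep x).
Proof. by apply: DeriveDef => //; apply: smooth_derivable; exact: smooth_sstep. Qed.

Lemma dsstep_eq0 x : x <= 0 \/ 1 <= x -> dsstep x = 0.
Proof.
rewrite /dsstep => -[x0|x1].
  have -> : 'D_1 sstep x = 'D_1 (cst 0 : R -> R) x.
    apply: near_eq_derive; near=> y; apply: sstep_eq0; apply/ltW; near: y.
    by apply: lt_nbhsl; lra.
  exact: derive_cst.
have -> : 'D_1 sstep x = 'D_1 (cst 1 : R -> R) x.
  apply: near_eq_derive; near=> y; apply: sstep_eq1; apply/ltW; near: y.
  by apply: lt_nbhsr; lra.
exact: derive_cst.
Unshelve. all: by end_near. Qed.

Lemma dsstep_continuous : continuous dsstep.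
Proof. by apply: smooth_continuous; apply: smooth_derive; exact: smooth_sstep. Qed.

Lemma dsstep_bound : exists2 M, 0 < M & forall x, `|dsstep x| <= M.
Proof.
have [M M0 h] := @continuous_bounded R 1 dsstep (continuous_subspaceT dsstep_continuous).
exists M => // x; have [x0|x0] := leP x 0; first by rewrite dsstep_eq0; [rewrite normr0 ltW|left].
have [x1|x1] := leP 1 x; first by rewrite dsstep_eq0; [rewrite normr0 ltW|right].
by apply: h; rewrite in_itv/= (ltW x0) (ltW x1).
Qed.

Variable T : R.
Hypothesis T0 : 0 < T.
Local Notation int f := (leb.-integrable `[0, T] (EFin \o f)).
Local Notation I s t f := (\int[leb]_(x in `]s, t]) f x).
Local Notation I01 := (`[0, T]%classic : set R).

(** A smooth switch from 0 to 1 inside [s, s + 1/n]. Its derivative [dramp] is an approximate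
    identity that lives to the right of s. *)
Definition ramp (n : nat) s r : R := sstep (n%:R * r + - (n%:R * s)).
Definition dramp (n : nat) s r : R := n%:R * dsstep (n%:R * r + - (n%:R * s)).

Lemma smooth_ramp n s : smooth (ramp n s).
Proof. exact: (smooth_affine n%:R (- (n%:R * s)) smooth_sstep). Qed.

Lemma is_derive_ramp n s r : is_derive r (1:R) (ramp n s) (dramp n s r).
Proof.
have d1 : is_derive r (1:R) (fun r : R => n%:R * r + - (n%:R * s)) n%:R.
  have := is_deriveD (is_deriveM (is_derive_cst (n%:R : R) r (1:R)) (is_derive_id r (1:R)))
                     (is_derive_cst (- (n%:R * s)) r (1:R)).
  by rewrite scaler0 !addr0 /GRing.scale/= mulr1.
have := @is_derive1_comp _ sstep (fun r => n%:R * r - n%:R * s) r _ _ (is_derive_sstep _) d1.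
by rewrite [dsstep _ * _]mulrC.
Qed.

Lemma dramp_continuous n s : continuous (dramp n s).
Proof.
move=> x; apply: cvgM; first exact: cvg_cst.
apply: (@continuous_comp _ _ _ (fun r => n%:R * r + - (n%:R * s)) dsstep).
  by apply: cvgD; [apply: cvgM; [exact: cvg_cst|exact: cvg_id]|exact: cvg_cst].
exact: dsstep_continuous.
Qed.

Lemma derive_deriv_within (F f : R -> R) :
  (forall x, is_derive x (1:R) F (f x)) -> deriv_within T F f.
Proof.
move=> dF x _ e e0.
have cv : (h^-1 *: (F (h *: (1 : R) + x) - F x)) @[h --> 0^'] --> f x.
  by have [dx Dx] := dF x; rewrite -[X in _ --> X]Dx; exact: dx.
have /cvgrPdist_le/(_ e e0) := cv.
move=> /nbhs_ballP[D /= D0 hD]; exists D => // s _ sx sD.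
have := hD (s - x); rewrite /ball/= sub0r normrN => /(_ sD).
by rewrite subr_eq0 => /(_ sx); rewrite /GRing.scale/= mulr1 subrK distrC.
Qed.

Lemma I_dramp n s (y : R -> R) : (0 < n)%N -> 0 <= s -> s + n%:R^-1 <= T ->
  {within I01, continuous y} ->
  I 0 T (fun r => y r * dramp n s r) = I s (s + n%:R^-1) (fun r => y r * dramp n s r).
Proof.
move=> n0 s0 sT cy; have n0' : (0 : R) < n%:R by rewrite ltr0n.
have i0 : 0 < n%:R^-1 :> R by rewrite invr_gt0.
have iy : int (fun r => y r * dramp n s r).
  apply: continuous_int => x; apply: cvgM; first exact: cy.
  by apply: (continuous_subspaceT (@dramp_continuous n s)).
have z r : r <= s \/ s + n%:R^-1 <= r -> y r * dramp n s r = 0.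
  move=> h; rewrite /dramp dsstep_eq0 ?mulr0// -mulrBr.
  case: h => h; [left|right].
    by rewrite pmulr_rle0// subr_le0.
  by rewrite -ler_pdivrMl// mulr1 lerBrDl.
rewrite (I_add iy (lexx 0) s0 _ (lexx T)); last by rewrite (le_trans _ sT)// lerDl ltW.
rewrite (I_add iy s0 _ sT (lexx T)); last by rewrite lerDl ltW.
have Z a b : 0 <= a -> b <= T -> (forall r, a < r -> r <= b -> r <= s \/ s + n%:R^-1 <= r) ->
    I a b (fun r => y r * dramp n s r) = 0.
  move=> a0 bT h; rewrite /Rintegral -[RHS]/(fine 0) -[in RHS](integral0 leb `]a, b]).
  congr fine; apply: eq_integral => r; rewrite inE/= in_itv/= => /andP[ar rb].
  by rewrite z//; exact: h.
rewrite (Z 0 s) ?add0r//; last 2 first.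
  by rewrite (le_trans _ sT)// lerDl ltW.
  by move=> r _ rs; left.
rewrite (Z (s + n%:R^-1) T) ?addr0//; first by rewrite addr_ge0// ltW.
by move=> r sr _; right; exact: ltW.
Qed.

Lemma I_dramp1 n s : (0 < n)%N -> 0 <= s -> s + n%:R^-1 <= T ->
  I s (s + n%:R^-1) (fun r => dramp n s r) = 1.
Proof.
move=> n0 s0 sT; have n0' : (n%:R : R) != 0 by rewrite pnatr_eq0 -lt0n.
rewrite (@I_FTC _ T (ramp n s))//.
- rewrite /ramp mulrDr mulfV// addrAC subrr add0r sstep_eq1 ?sstep_eq0 ?subrr ?subr0//.
  lra.
- by apply: derive_deriv_within => x; exact: is_derive_ramp.
- by apply: continuous_subspaceT; exact: dramp_continuous.
- by rewrite lerDl invr_ge0.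
Qed.

(** [dramp n s] has integral 1 and is at most n M on an interval of length 1/n. It need not be
    nonnegative, so an oscillation of y below e / M is requested on that interval. *)
Lemma dramp_cvg s (y : R -> R) : 0 <= s -> s < T -> {within I01, continuous y} ->
  I 0 T (fun r => y r * dramp n s r) @[n --> \oo] --> y s.
Proof.
move=> s0 sT cy; have [M M0 HM] := dsstep_bound; apply/cvgrPdist_le => e e0.
have sT' : s \in `[0, T] by rewrite in_itv/= s0 ltW.
have [D D0 hD] := (continuous_epsP T y).1 cy s sT' (e / M) (divr_gt0 e0 M0).
have m0 : 0 < Num.min D (T - s) by rewrite lt_min D0 subr_gt0.
have [N hN] := ex_nat_gt (Num.min D (T - s))^-1.
exists N.+1 => // n /= Nn; have n0 : (0 < n)%N by exact: leq_trans Nn.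
have n0' : (0 : R) < n%:R by rewrite ltr0n.
have nm : n%:R^-1 < Num.min D (T - s).
  rewrite -[ltRHS]invrK ltf_pV2 ?posrE ?invr_gt0// (lt_le_trans hN)// ler_nat.
  exact: ltnW.
move: nm; rewrite lt_min => /andP[nD nT].
have snT : s + n%:R^-1 <= T by rewrite -lerBrDl ltW.
rewrite I_dramp//.
have -> : y s = y s * I s (s + n%:R^-1) (fun r => dramp n s r).
  by rewrite I_dramp1// mulr1.
have cd : {within I01, continuous (dramp n s)}.
  by apply: continuous_subspaceT; exact: dramp_continuous.
have id := continuous_int cd.
have iy : int (fun r => y r * dramp n s r).
  by apply: continuous_int => x; apply: cvgM; [exact: cy|exact: cd].
have ys : int (fun r => y s * dramp n s r) by exact: integrableZ_fin.
have -> : y s * I s (s + n%:R^-1) (fun r => dramp n s r) -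
    I s (s + n%:R^-1) (fun r => y r * dramp n s r) =
    I s (s + n%:R^-1) (fun r => y s * dramp n s r - y r * dramp n s r).
  by rewrite (I_subB ys iy s0 snT) (I_Zl _ id s0 snT).
have ic : int (fun=> e / M * (n%:R * M)).
  by apply: continuous_int; apply: continuous_subspaceT => x; exact: cvg_cst.
apply: (@le_trans _ _ (I s (s + n%:R^-1) (fun=> e / M * (n%:R * M)))).
  apply: (I_norm_le _ ic s0 snT).
    by apply: integrableD_fin => //; exact: integrableN_fin.
  move=> r sr rn; rewrite -mulrBl normrM; apply: ler_pM => //.
    rewrite distrC; apply: hD.
      by rewrite in_itv/= (le_trans s0 (ltW sr)) (le_trans rn).
    rewrite ger0_norm ?subr_ge0 ?(ltW sr)//; apply: le_lt_trans nD.
    by rewrite lerBlDl.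
  by rewrite /dramp normrM (gtr0_norm n0') ler_wpM2l.
rewrite I_cst ?lerDl ?invr_ge0//.
rewrite le_eqVlt; apply/orP; left; apply/eqP; rewrite [s + _]addrC addrK; field.
by rewrite !gt_eqF.
Qed.

(** The difference of a ramp at s and a ramp at t is an admissible test function when 0 < s <= t < T
    and n is large. Its derivative samples y at s and at t, while the function itself tends to the
    indicator of ]s, t]. The end points 0 and T are reached by continuity. *)
Lemma weak_deriv_primitive (y k : R -> R) : {within I01, continuous y} -> int k ->
  (forall psi : R -> R, test_function [set` `]0, T[] psi ->
    I 0 T (fun r => y r * 'D_1 psi r) = - I 0 T (fun r => k r * psi r)) ->
  forall s t, 0 <= s -> s <= t -> t <= T -> y t - y s = I s t k.
Proof.
move=> cy ik H.
have inner s t : 0 < s -> s <= t -> t < T -> y t - y s = I s t k.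
  move=> s0 st tT.
  pose psi n r := ramp n s r - ramp n t r.
  have dpsi n r : 'D_1 (psi n) r = dramp n s r - dramp n t r.
    by case: (is_deriveB (is_derive_ramp n s r) (is_derive_ramp n t r)).
  have Tt : 0 < T - t by rewrite subr_gt0.
  have [N hN] := ex_nat_gt (T - t)^-1.
  have tpsi n : (N < n)%N -> test_function [set` `]0, T[] (psi n).
    move=> Nn; have n0 : (0 < n)%N by exact: leq_trans Nn.
    have n0' : (0 : R) < n%:R by rewrite ltr0n.
    have nT : n%:R^-1 < T - t.
      rewrite -[ltRHS]invrK ltf_pV2 ?posrE ?invr_gt0// (lt_le_trans hN)// ler_nat.
      exact: ltnW.
    apply: (@test_function_sub _ _ _ _ `[s, t + n%:R^-1]%classic).
    - rewrite (_ : psi n = ramp n s + (-1) *: ramp n t); last first.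
        by apply/funext => r; rewrite /psi -[RHS]/(_ + _ * _) mulN1r.
      by apply: smoothD; [|apply: smoothZ]; exact: smooth_ramp.
    - exact: segment_compact.
    - exact: interval_closed.
    - move=> r /=; rewrite !in_itv/= => /andP[sr rt]; apply/andP; split.
        exact: lt_le_trans sr.
      by rewrite (le_lt_trans rt)// -ltrBrDl.
    - move=> r /negP; rewrite /= in_itv/= negb_and -!ltNge /psi /ramp -!mulrBr => /orP[rs|tr].
        have rs' : n%:R * (r - s) <= 0 by rewrite pmulr_rle0// subr_le0 ltW.
        have rt' : n%:R * (r - t) <= 0.
          by rewrite pmulr_rle0// subr_le0 (le_trans (ltW rs)).
        by rewrite !sstep_eq0 ?subrr//; lra.
      have rt' : 1 <= n%:R * (r - t).
        by rewrite -ler_pdivrMl// mulr1 lerBrDl ltW.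
      have rs' : 1 <= n%:R * (r - s).
        by apply: le_trans rt' _; rewrite ler_wpM2l ?ler0n// lerD2l lerN2.
      by rewrite !sstep_eq1 ?subrr//; lra.
  have cvL : I 0 T (fun r => y r * 'D_1 (psi n) r) @[n --> \oo] --> y s - y t.
    rewrite (_ : (fun n => I 0 T (fun r => y r * 'D_1 (psi n) r)) = (fun n => I 0 T (fun r => y r * dramp n s r) -
        I 0 T (fun r => y r * dramp n t r))).
      by apply: cvgB; apply: dramp_cvg => //; lra.
    apply/funext => n.
    have cd x : int (fun r => y r * dramp n x r).
      apply: continuous_int => z; apply: cvgM; first exact: cy.
      by apply: (continuous_subspaceT (@dramp_continuous n x)).
    rewrite -(I_subB (cd s) (cd t) (lexx 0) (lexx T)).
    by apply: eq_Rintegral => r _; rewrite dpsi mulrBr.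
  have mD : measurable (`]0, T]%classic : set R) by [].
  have mk : measurable_fun `]0, T] k.
    exact: (integrable_measurable (int_sub ik (lexx 0) (lexx T))).
  have [] := @Rintegral_dominated _ _ _ leb `]0, T] mD (fun n r => k r * psi n r)
    (fun r => k r * \1_(`]s, t]%classic) r) (fun r => `|k r|).
  - move=> n; apply: measurable_funM => //; apply: measurable_funB;
    by apply: measurable_funTS; apply: continuous_measurable_fun;
       apply: smooth_continuous; exact: smooth_ramp.
  - by apply: measurable_funM => //; exact: measurable_indic.
  - apply: aeW => r _; apply: cvgM; first exact: cvg_cst.
    rewrite indicE mem_setE in_itv/=.
    have ev x : x < r -> \forall n \near \oo, ramp n x r = 1.
      move=> xr; have [K hK] := ex_nat_gt (r - x)^-1; exists K.+1 => // n /= Kn.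
      rewrite /ramp -mulrBr; apply: sstep_eq1.
      have : 1 <= n%:R * (r - x).
        rewrite -ler_pdivrMr ?subr_gt0// mul1r (le_trans (ltW hK))// ler_nat.
        exact: ltnW.
      lra.
    have ev0 x : r <= x -> \forall n \near \oo, ramp n x r = 0.
      move=> rx; apply: nearW => n; rewrite /ramp -mulrBr; apply: sstep_eq0.
      have : n%:R * (r - x) <= 0 by rewrite mulr_ge0_le0 ?subr_le0.
      lra.
    apply: cvg_near_cst; rewrite /psi; case: (ltP s r) => sr /=; last first.
      have rt := le_trans sr st.
      by apply: filterS2 (ev0 s sr) (ev0 t rt) => n -> ->; rewrite subrr.
    case: (leP r t) => rt.
      by apply: filterS2 (ev s sr) (ev0 t rt) => n -> ->; rewrite subr0.
    by apply: filterS2 (ev s sr) (ev t rt) => n -> ->; rewrite subrr.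
  - have := int_sub ik (lexx 0) (lexx T); exact: integrable_norm_fin.
  - move=> n r _; rewrite normrM ler_piMr// /psi /ramp.
    have := sstep_bound (n%:R * r - n%:R * s); have := sstep_bound (n%:R * r - n%:R * t).
    by move=> /andP[? ?] /andP[? ?]; rewrite ler_norml; apply/andP; split; lra.
  move=> _ cvR.
  have E1 : I 0 T (fun r => k r * \1_(`]s, t]%classic) r) = I s t k.
    rewrite (@Rintegral_supp _ _ _ leb `]0, T] `]s, t])//.
    - by apply: eq_Rintegral => r rst; rewrite indicE rst mulr1.
    - by apply: subset_itv; rewrite bnd_simp ltW.
    - by move=> r _ nr; rewrite indicE memNset// mulr0.
  have cvL' : - I 0 T (fun r => k r * psi n r) @[n --> \oo] --> y s - y t.
    apply: cvg_trans cvL; apply: near_eq_cvg; exists N.+1 => // n /= Nn.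
    by rewrite H//; exact: tpsi.
  have cvR' : - I 0 T (fun r => k r * psi n r) @[n --> \oo] -->
      - I 0 T (fun r => k r * \1_(`]s, t]%classic) r) by exact: cvgN.
  have h : y s - y t = - I 0 T (fun r => k r * \1_(`]s, t]%classic) r).
    by rewrite -(cvg_lim (@Rhausdorff R) cvL'); exact: (cvg_lim (@Rhausdorff R) cvR').
  by rewrite E1 in h; apply/eqP; rewrite -eqr_opp opprB; apply/eqP.
(* By [inner] this continuous function is constant on the open interval, hence on the closed one. *)
pose Y r := y r - I 0 r k.
have cY : {within I01, continuous Y}.
  by move=> x; apply: cvgB; [exact: cy|exact: (I_continuous T0 ik)].
have T2 : 0 < T / 2 by rewrite divr_gt0.
have T2' : T / 2 < T by rewrite ltr_pdivrMr// ltr_pMr// ltr1n.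
have Yin r : 0 < r -> r < T -> Y r = Y (T / 2).
  move=> r0 rT; rewrite /Y; case: (leP r (T / 2)) => h.
    have := inner _ _ r0 h T2'; rewrite (I_add ik (lexx 0) (ltW r0) h (ltW T2')).
    by move: (I 0 r k) (I r _ k) => *; lra.
  have := inner _ _ T2 (ltW h) rT; rewrite (I_add ik (lexx 0) (ltW T2) (ltW h) (ltW rT)).
  by move: (I 0 _ k) (I _ _ k) => *; lra.
have Yc r : r \in `[0, T] -> Y r = Y (T / 2).
  move=> rT; apply/eqP; rewrite -subr_eq0 -normr_le0; apply/ler_addgt0Pr => e e0.
  have [D D0 hD] := (continuous_epsP T Y).1 cY r rT e e0.
  have D2 : 0 < D / (D + T) by rewrite divr_gt0// addr_gt0.
  have DT : 0 < D + T by rewrite addr_gt0.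
  (* A point strictly between r and T / 2, or r itself if r = T / 2: it is interior for every r in
     [0, T] and within D of r. *)
  pose q := r + (D / (D + T)) * (T / 2 - r).
  move: (rT); rewrite in_itv/= => /andP[r0 rT'].
  have c1 : D / (D + T) < 1 by rewrite ltr_pdivrMr// mul1r ltrDl.
  have q0 : 0 < q by rewrite /q; move: c1 D2; move: (D / _) => c c1 c0; nra.
  have qT : q < T by rewrite /q; move: c1 D2; move: (D / _) => c c1 c0; nra.
  rewrite add0r distrC -(Yin q q0 qT); apply: hD.
    by rewrite in_itv/= (ltW q0) (ltW qT).
  rewrite /q addrAC subrr add0r normrM (gtr0_norm D2) mulrAC ltr_pdivrMr//.
  rewrite ltr_pM2l// (@le_lt_trans _ _ T)// ?ltrDr//.
  by rewrite ler_norml; apply/andP; split; lra.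
move=> s t s0 st tT.
have sT : s \in `[0, T] by rewrite in_itv/= s0 (le_trans st).
have tT' : t \in `[0, T] by rewrite in_itv/= tT (le_trans s0).
have : Y t = Y s by rewrite (Yc s sT) (Yc t tT').
rewrite /Y (I_add ik (lexx 0) s0 st tT); move: (I 0 s k) (I s t k) => *; lra.
Qed.

End weak_derivative_scalar.

(** * Bochner integrals *)

(* No measurability is needed: the integral of a nonnegative function is a
   supremum over the simple functions below it. *)
Lemma integral_mono {disp} {T : measurableType disp} {R : realType}
    (mu : {measure set T -> \bar R}) (D D' : set T) (f g : T -> \bar R) :
  D `<=` D' -> (forall x, D x -> (0 <= f x <= g x)%E) ->
  (forall x, D' x -> (0 <= g x)%E) ->
  (\int[mu]_(x in D) f x <= \int[mu]_(x in D') g x)%E.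
Proof.
move=> DD' fg g0; rewrite integral_mkcond [leRHS]integral_mkcond.
have f0' x : (0 <= (f \_ D) x)%E.
  by rewrite patchE; case: ifPn => // /set_mem /fg /andP[].
have g0' x : (0 <= (g \_ D') x)%E.
  by rewrite patchE; case: ifPn => // /set_mem /g0.
rewrite ge0_integralTE// ge0_integralTE//; apply: ereal_sup_le => _ [h hf <-].
exists h => // x; apply: le_trans (hf x) _; rewrite !patchE.
case: ifPn => [xD|xD]; last by case: ifPn => // /set_mem /g0.
rewrite mem_set; last by apply: DD'; exact: set_mem.
by have /andP[] := fg x (set_mem xD).
Qed.

Section bochner.
Context {R : realType} {E : lmodType R}.
Variables (T : R) (X : snspace E) (ip : E -> E -> R).
Notation H := (scarrier X).
Notation leb := (@lebesgue_measure R).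
Notation I01 := (`[0, T]%classic : set R).
Implicit Types (u v w b : R -> E) (f g : R -> R) (s t r : R) (J x y : E).
Local Notation int f := (leb.-integrable `[0, T] (EFin \o f)).
Local Notation I s t f := (\int[leb]_(x in `]s, t]) f x).
Local Notation nrm := (nrm ip).
Local Notation ccont := (ccont T H ip).
Local Notation wint := (wint T H ip).

Hypothesis T0 : 0 < T.
Hypothesis pH : prehilbert H ip.
Hypothesis nX : forall x, H x -> snorm X x = (nrm x)%:E.

Let HD := phD pH.
Let HB := phB pH.
Let HZ := phZ pH.

Lemma I_open f : int f -> \int[leb]_(x in `]0, T[) f x = I 0 T f.
Proof.
move=> fi; apply: Rintegral_itv_bndo_bndc; apply: integrableS fi => //.
by apply: subset_itv; rewrite bnd_simp.
Qed.

Lemma int_open f : measurable_fun `[0, T] f ->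
  (\int[leb]_(r in `]0%R, T[) `|(f r)%:E| < +oo)%E -> int f.
Proof.
move=> mf fi; apply/integrableP; split; first exact/measurable_EFinP.
have mf1 : measurable_fun `[0, T[ (fun r => `|(f r)%:E|)%E.
  apply: measurableT_comp => //; apply/measurable_EFinP; apply: measurable_funS mf => //.
  by apply: subset_itv; rewrite bnd_simp.
have mf2 : measurable_fun `]0, T[ (fun r => `|(f r)%:E|)%E.
  by apply: measurable_funS mf1 => //; apply: subset_itv; rewrite bnd_simp.
rewrite /= -integral_itv_bndo_bndc; last exact: mf1.
by rewrite -integral_itv_obnd_cbnd; last exact: mf2.
Qed.

Lemma in_C0P u : in_C0 T X u <-> ccont u.
Proof.
have key (t : R) : t \in `[0, T] -> (forall t, t \in `[0, T] -> H (u t)) ->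
    \forall s \near within I01 (nbhs t), snorm X (u s - u t) = (nrm (u s - u t))%:E.
  move=> tT Hu; rewrite near_withinE; apply/nbhs_ballP; exists 1 => //= s _ sT.
  by rewrite nX//; apply: HB; exact: Hu.
split=> -[Hu cu]; split => // t tT.
  move=> e e0; have : \forall s \near within I01 (nbhs t), `|nrm (u s - u t)| <= e.
    exact: ((cvg_EFin0 (key t tT Hu)).1 (cu t tT) e e0).
  rewrite near_withinE => /nbhs_ballP[D /= D0 hD]; exists D => // s sT st.
  apply: le_trans (ler_norm _) _; apply: hD => //.
  by rewrite /ball/= distrC.
apply/(cvg_EFin0 (key t tT Hu)) => e e0; have [D D0 hD] := cu t tT e e0.
rewrite near_withinE; apply/nbhs_ballP; exists D => //= s ts sT; rewrite ger0_norm ?nrm_ge0//.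
by apply: hD => //; rewrite distrC.
Qed.

Local Notation SI := (simple_with_integral T X).

Lemma SI_mem u J t : SI u J -> H (u t).
Proof.
move=> [n [A [c [Ac -> _]]]]; apply: (ph_sum pH) => i; apply: HZ.
by have [] := Ac i.
Qed.

Lemma SI_wmeas u J : SI u J -> wmeas T H ip u.
Proof.
move=> h; split; first by move=> t _; exact: SI_mem h.
move: h => [n [A [c [Ac -> _]]]] b bc.
apply: (@eq_measurable_fun _ _ _ _ _ (fun t => \sum_(i < n) \1_(A i) t * ip (c i) (b t))).
  move=> t /set_mem tT; have Hb := bc.1 t tT.
  rewrite (ip_suml pH)//; last by move=> i; apply: HZ; have [] := Ac i.
  by apply: eq_bigr => i _; rewrite (ipZl pH)//; have [] := Ac i.
apply: measurable_sum => i; have [mA _ Hc] := Ac i.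
apply: measurable_funM; first by apply: measurable_funTS; exact: measurable_indic.
by have [_] := ccont_wmeas pH (ccont_cst T pH Hc); apply.
Qed.

Lemma SI_nrm_measurable u J : SI u J -> measurable_fun `[0, T] (fun t => nrm (u t)).
Proof.
move=> h; have [_ mu] := SI_wmeas h.
apply: (@measurableT_comp _ _ _ _ _ _ (@Num.sqrt R)).
  by apply: continuous_measurable_fun; exact: sqrt_continuous.
move: (h) mu => [n [A [c [Ac uE _]]]] mu.
apply: (@eq_measurable_fun _ _ _ _ _ (fun t => \sum_(i < n) \1_(A i) t * ip (u t) (c i))).
  move=> t /set_mem tT; have Hu := SI_mem t h.
  rewrite {2}uE (ip_suml pH)//; last by move=> i; apply: HZ; have [] := Ac i.
  apply: eq_bigr => i _; have [_ _ Hc] := Ac i.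
  by rewrite (ipZl pH)// (ipC pH).
apply: measurable_sum => i; have [mA _ Hc] := Ac i.
apply: measurable_funM; first by apply: measurable_funTS; exact: measurable_indic.
exact: mu (ccont_cst T pH Hc).
Qed.

Lemma SI_integral u J : SI u J -> H J /\ forall y, H y ->
  int (fun t => ip (u t) y) /\ ip J y = I 0 T (fun t => ip (u t) y).
Proof.
move=> [n [A [c [Ac -> ->]]]].
have Hc i : H (c i) by have [] := Ac i.
have mA i : measurable (A i) by have [] := Ac i.
split; first by apply: (ph_sum pH) => i; exact: HZ.
move=> y Hy.
have uE : (fun t => ip (\sum_(i < n) \1_(A i) t *: c i) y) =
          (fun t => \sum_(i < n) \1_(A i) t * ip (c i) y).
  apply/funext => t; rewrite (ip_suml pH)//; last by move=> i; exact: HZ.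
  by apply: eq_bigr => i _; rewrite (ipZl pH).
have iA i : int (\1_(A i) : R -> R).
  apply: measurable_bounded_integrable => //.
  - by rewrite [ltLHS]lebesgue_measure_itv/= lte_fin T0 ltry.
  - move: (mA i) => mAi; exact: measurable_indic.
  - apply: filterS (nbhs_pinfty_ge (num_real 1)) => r r1 x _ /=.
    by rewrite indicE ger0_norm//; apply: le_trans r1; case: (_ \in _).
have iAc i : int (fun t => \1_(A i) t * ip (c i) y).
  have : int (fun t => ip (c i) y * \1_(A i) t) by apply: integrableZ_fin => //; exact: iA.
  by congr (leb.-integrable _ (EFin \o _)); apply/funext => t; rewrite mulrC.
rewrite uE; split; first exact: integrable_sum_fin.
rewrite Rintegral_sum//; last by move=> i; exact: int_sub (iAc i) (lexx 0) (lexx T).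
rewrite (ip_suml pH)//; last by move=> i; exact: HZ.
apply: eq_bigr => i _; rewrite (ipZl pH)//.
rewrite RintegralZr//; last exact: int_sub (iA i) (lexx 0) (lexx T).
congr (_ * _); rewrite /Rintegral integral_indic//; [|exact: mA].
congr (fine (leb _)).
apply/esym/setIidPl => t tA; have [_ sA _] := Ac i; move: (sA t tA).
by rewrite /= !in_itv/= => /andP[-> /ltW ->].
Qed.

Lemma SI_add u v J J' : SI u J -> SI v J' -> SI (fun t => u t + v t) (J + J').
Proof.
move=> [n [A [c [Ac -> ->]]]] [m [B [k [Bk -> ->]]]].
have sl j : fintype.split (lshift m j) = inl j := unsplitK (inl j).
have sr j : fintype.split (rshift n j) = inr j := unsplitK (inr j).
exists (n + m)%N, (fun i => match fintype.split i with inl j => A j | inr j => B j end),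
  (fun i => match fintype.split i with inl j => c j | inr j => k j end); split.
- by move=> i; case: fintype.split.
- apply/funext => t; rewrite big_split_ord/=.
  by congr (_ + _); apply: eq_bigr => i _; rewrite ?sl ?sr.
- by rewrite big_split_ord/=; congr (_ + _); apply: eq_bigr => i _; rewrite ?sl ?sr.
Qed.

Lemma SI_indic (A : set R) x : measurable A -> A `<=` `]0, T[ -> H x ->
  exists J, SI (fun t => \1_A t *: x) J.
Proof.
move=> mA AT Hx; exists (fine (leb A) *: x).
exists 1%N, (fun=> A), (fun=> x); split => //.
  by apply/funext => t; rewrite big_ord1.
by rewrite big_ord1.
Qed.

Lemma SI_sum (S : Type) (l : seq S) (F : S -> R -> E) :
  (forall i, exists J, SI (F i) J) -> exists J, SI (fun t => \sum_(i <- l) F i t) J.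
Proof.
move=> hF; elim: l => [|i l [J hJ]].
  exists 0, 0%N, (fun=> set0), (fun=> 0); split.
  - by case.
  - by apply/funext => t; rewrite big_nil big_ord0.
  - by rewrite big_ord0.
have [J' hJ'] := hF i; exists (J' + J).
rewrite (_ : (fun t => _) = (fun t => F i t + \sum_(j <- l) F j t)).
  exact: SI_add.
by apply/funext => t; rewrite big_cons.
Qed.

End bochner.

(** * Scalar consequences and good representatives of Bochner measurable curves *)

Section strong_measurability.
Context {R : realType} {E : lmodType R}.
Variables (T : R) (X : snspace E) (ip : E -> E -> R).
Notation H := (scarrier X).
Notation leb := (@lebesgue_measure R).
Notation I01 := (`[0, T]%classic : set R).
Implicit Types (u v w b : R -> E) (f g : R -> R) (s t r : R) (J x y : E).
Local Notation int f := (leb.-integrable `[0, T] (EFin \o f)).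
Local Notation I s t f := (\int[leb]_(x in `]s, t]) f x).
Local Notation nrm := (nrm ip).
Local Notation ccont := (ccont T H ip).
Local Notation wint := (wint T H ip).
Local Notation SI := (simple_with_integral T X).

Hypothesis T0 : 0 < T.
Hypothesis pH : prehilbert H ip.
Hypothesis nX : forall x, H x -> snorm X x = (nrm x)%:E.
Hypothesis sX : forall x, (0 <= snorm X x)%E.

Let HD := phD pH.
Let HB := phB pH.
Let HZ := phZ pH.

Lemma ecvg0 (e : nat -> \bar R) (k : R) : (forall n, 0 <= e n)%E ->
  e @ \oo --> 0%E -> 0 < k -> exists N, forall n, (N <= n)%N -> (e n <= k%:E)%E.
Proof.
move=> e0 /fine_cvgP[[N _ hN] /cvgrPdist_le h] k0; have [N' _ hN'] := h k k0.
exists (maxn N N') => n; rewrite geq_max => /andP[Nn N'n].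
rewrite -(fineK (hN n Nn)) lee_fin; have := hN' n N'n.
by rewrite sub0r normrN; apply: le_trans; exact: ler_norm.
Qed.

(** Here g will be a seminorm along a curve that is only known to take values in the space off a
    null set, so it may fail to be measurable. The null set is removed on the side of the measurable
    f, and [integral_mono] does the comparison. *)
Lemma int_openN (N : set R) f (g : R -> \bar R) : measurable N -> leb N = 0%E ->
  measurable_fun I01 f -> (forall r, r \in `]0, T[ -> ~ N r -> (`|f r|%:E <= g r)%E) ->
  (forall r, 0 <= g r)%E -> (\int[leb]_(r in `]0%R, T[) g r < +oo)%E ->
  int f /\ ((I 0 T (fun r => `|f r|))%:E <= \int[leb]_(r in `]0%R, T[) g r)%E.
Proof.
move=> mN N0 mf fg g0 goo.
have mf1 : measurable_fun `]0, T[ (fun r => `|f r|%:E).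
  apply/measurable_EFinP; apply: measurableT_comp => //; apply: measurable_funS mf => //.
  by apply: subset_itv; rewrite bnd_simp.
have le : (\int[leb]_(r in `]0%R, T[) `|f r|%:E <= \int[leb]_(r in `]0%R, T[) g r)%E.
  have -> : (\int[leb]_(r in `]0%R, T[) `|f r|%:E =
      \int[leb]_(r in `]0%R, T[%classic `\` N) `|f r|%:E)%E.
    by apply: ge0_negligible_integral => // r _; rewrite lee_fin.
  apply: integral_mono => //.
  by move=> r [rT Nr]; rewrite lee_fin normr_ge0/=; exact: fg.
have fi : int f.
  by apply: int_open => //; apply: le_lt_trans goo.
split => //; rewrite -(I_open (integrable_norm_fin fi))// EFin_Rintegral//.
apply: integrableS (integrable_norm_fin fi) => //.
by apply: subset_itv; rewrite bnd_simp.
Qed.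

Lemma leb_aeS (P Q : R -> Prop) : (forall t, P t -> Q t) ->
  {ae leb, forall t, P t} -> {ae leb, forall t, Q t}.
Proof. by move=> PQ; apply: filterS; first exact: (ae_filter_ringOfSetsType leb). Qed.

Lemma leb_aeS2 (P Q S : R -> Prop) : (forall t, P t -> Q t -> S t) ->
  {ae leb, forall t, P t} -> {ae leb, forall t, Q t} -> {ae leb, forall t, S t}.
Proof. by move=> PQ; apply: filterS2; first exact: (ae_filter_ringOfSetsType leb). Qed.

Lemma ae_null (P : R -> Prop) : {ae leb, forall t, P t} ->
  exists N : set R, [/\ measurable N, leb N = 0%E & forall t, ~ N t -> P t].
Proof.
move=> [N [mN N0 PN]]; exists N; split => // t Nt.
by apply: contrapT => nP; exact/Nt/PN.
Qed.

(** A continuous functional commutes with the Bochner integral. The scalar k stands for the pairing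
    (u, y), which agrees with it almost everywhere but need not be measurable itself. *)
Lemma boch_scalar u J k y : bochner_integral T X u J -> measurable_fun I01 k ->
  H y -> {ae leb, forall t, t \in `]0, T[ -> k t = ip (u t) y} ->
  int k /\ ip J y = I 0 T k.
Proof.
move=> [HJ [s [j [hS ae1 L1 jJ]]]] mk Hy aek.
have [N [mN N0 hN]] : exists N : set R, [/\ measurable N, leb N = 0%E & forall t, ~ N t ->
    t \in `]0, T[ -> H (u t) /\ k t = ip (u t) y].
  apply: ae_null; apply: leb_aeS2 ae1 aek => t A B tT.
  by split; [case: (A tT)|exact: B].
(* Dividing by K instead of the norm of y makes the scalar error at most the seminorm error, and K
   is never zero. *)
pose K := nrm y + 1; have K0 : 0 < K by rewrite ltr_wpDl ?nrm_ge0.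
have yK : nrm y <= K by rewrite lerDl.
have ms n := (SI_wmeas pH (hS n)).2 _ (ccont_cst T pH Hy).
pose D n t := (k t - ip (s n t) y) / K.
have HJn n : H (j n) by case: (SI_integral T0 pH (hS n)).
have SIi n := (SI_integral T0 pH (hS n)).2 y Hy.
have kE n t : k t = K * D n t + ip (s n t) y.
  by rewrite /D mulrC divfK ?gt_eqF// subrK.
have key n e : (\int[leb]_(t in `]0%R, T[) snorm X (u t - s n t) <= e%:E)%E ->
    int (D n) /\ I 0 T (fun t => `|D n t|) <= e.
  move=> le; have [||||iD leD] := @int_openN N (D n) (fun t => snorm X (u t - s n t)) mN N0.
  - apply: measurable_funM => //; apply: measurable_funB => //; exact: ms.
  - move=> t tT Nt; have [Hu kE'] := hN t Nt tT.
    have Hs := SI_mem pH t (hS n); have Hd := HB Hu Hs.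
    have K10 : 0 < K^-1 by rewrite invr_gt0.
    rewrite nX// lee_fin /D kE' -(ipBl pH)// normrM (gtr0_norm K10).
    rewrite ler_pdivrMr//; apply: le_trans (cauchy_schwarz pH Hd Hy) _.
    by apply: ler_wpM2l => //; exact: nrm_ge0.
  - by [].
  - exact: le_lt_trans le (ltry _).
  by split => //; rewrite -lee_fin; exact: le_trans leD le.
have ik0 n : int (D n) -> int k.
  move=> iD; rewrite (_ : k = fun t => K * D n t + ip (s n t) y); last exact/funext/kE.
  by apply: integrableD_fin => //; [apply: integrableZ_fin|exact: (SIi n).1].
have int0 n : (0 <= \int[leb]_(t in `]0%R, T[) snorm X (u t - s n t))%E.
  exact: integral_ge0.
split.
  have [N1 h1] := ecvg0 int0 L1 ltr01.
  exact: ik0 (key N1 1 (h1 N1 (leqnn _))).1.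
apply/eqP; rewrite -subr_eq0 -normr_le0; apply/ler_addgt0Pr => e e0; rewrite add0r.
have e20 : 0 < e / (2 * K) by rewrite divr_gt0// mulr_gt0.
have [N1 h1] := ecvg0 int0 L1 e20.
have [N2 h2] := ecvg0 (fun n => sX _) jJ e20.
pose n := maxn N1 N2.
have [iD leD] := key n _ (h1 n (leq_maxl _ _)).
have := h2 n (leq_maxr _ _); rewrite nX ?lee_fin; last exact: HB.
move=> lej; have ie := (SIi n).1; have jE := (SIi n).2.
have HJj := HB HJ (HJn n).
have -> : I 0 T k = K * I 0 T (D n) + ip (j n) y.
  have -> : k = fun t => K * D n t + ip (s n t) y by exact/funext/kE.
  rewrite (@I_subD _ T (fun t => K * D n t) (fun t => ip (s n t) y))//; last by apply: integrableZ_fin.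
  by rewrite (I_Zl K iD)// jE.
have -> : ip J y - (K * I 0 T (D n) + ip (j n) y) = ip (J - j n) y - K * I 0 T (D n).
  by rewrite (ipBl pH)//; ring.
apply: le_trans (ler_normB _ _) _.
have A : `|ip (J - j n) y| <= e / 2.
  apply: le_trans (cauchy_schwarz pH HJj Hy) _.
  apply: le_trans (ler_pM (nrm_ge0 _ _) (nrm_ge0 _ _) lej yK) _.
  by rewrite invfM mulrA divfK ?gt_eqF.
have B : `|K * I 0 T (D n)| <= e / 2.
  rewrite normrM (gtr0_norm K0).
  have : `|I 0 T (D n)| <= e / (2 * K).
    by apply: le_trans leD; apply: (@I_norm_le _ T) => //; exact: integrable_norm_fin.
  move=> /(ler_wpM2l (ltW K0)) C; apply: le_trans C _.
  by rewrite invfM mulrA [K * _]mulrC -mulrA [K * _]mulrC divfK ?gt_eqF.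
by apply: le_trans (lerD A B) _; rewrite -splitr.
Qed.

(** Setting u to 0 on the exceptional null set gives a representative that is everywhere a limit of
    simple functions. The countably many vectors occurring in these simple functions detect it:
    whatever is orthogonal to all of them is orthogonal to every value of w. This replaces
    separability of the space. *)
Lemma strong_meas u (s : nat -> R -> E) (j : nat -> E) : (forall n, SI (s n) (j n)) ->
  {ae leb, forall t, t \in `]0, T[ -> H (u t)} ->
  {ae leb, forall t, t \in `]0, T[ -> snorm X (u t - s n t) @[n --> \oo] --> 0%E} ->
  exists w, [/\ wmeas T H ip w, measurable_fun I01 (fun t => nrm (w t)),
    {ae leb, forall t, t \in `]0, T[ -> u t = w t},
    (forall t, (snorm X (w t) <= snorm X (u t))%E \/ w t = 0) &
    exists c : nat -> nat -> E, (forall n i, H (c n i)) /\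
      forall x, H x -> (forall n i, ip x (c n i) = 0) -> forall t, ip x (w t) = 0].
Proof.
move=> hS ae1 ae2.
have [N [mN N0 hN]] : exists N : set R, [/\ measurable N, leb N = 0%E & forall t, ~ N t ->
    t \in `]0, T[ -> H (u t) /\ snorm X (u t - s n t) @[n --> \oo] --> 0%E].
  by apply: ae_null; apply: leb_aeS2 ae1 ae2 => t A B tT; split; [exact: A|exact: B].
pose A := `]0, T[%classic `\` N; have mA : measurable A by exact: measurableD.
pose w t := (\1_A t : R) *: u t.
have Hw t : H (w t).
  rewrite /w indicE; case: (boolP (t \in A)) => [/set_mem[tT Nt]|_]; last first.
    by rewrite scale0r; exact: (ph_mem0 pH).
  by rewrite scale1r; have [] := hN t Nt tT.
have Hs n t : H ((\1_A t : R) *: s n t) by apply: HZ; exact: (SI_mem pH t (hS n)).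
have cw t e : 0 < e -> exists M, forall n, (M <= n)%N -> nrm ((\1_A t : R) *: s n t - w t) <= e.
  move=> e0; rewrite /w indicE; case: (boolP (t \in A)) => [/set_mem[tT Nt]|_]; last first.
    by exists 0%N => n _; rewrite !scale0r subrr (nrm0 pH) ltW.
  have [Hu cu] := hN t Nt tT; have [M hM] := ecvg0 (fun n => sX _) cu e0.
  exists M => n Mn; have := hM n Mn; rewrite !scale1r; have Hsn := SI_mem pH t (hS n).
  by rewrite nX ?lee_fin; [rewrite (nrmBC pH)|exact: HB].
have mi : measurable_fun I01 (\1_A : R -> R) by move: mA => mA; exact: measurable_indic.
exists w; split.
- split=> [t _|b bc]; first exact: Hw.
  apply: (@measurable_fun_cvg _ _ _ _ (fun n t => \1_A t * ip (s n t) (b t))).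
    by move=> n; apply: measurable_funM => //; exact: ((SI_wmeas pH (hS n)).2 _ bc).
  move=> t tT; have Hb := bc.1 t tT.
  have := cvg_nrm_ip pH (fun n => Hs n t) (Hw t) Hb (cw t).
  rewrite (_ : (fun n => _) = (fun n => \1_A t * ip (s n t) (b t))) //.
  by apply/funext => n; rewrite (ipZl pH)//; exact: (SI_mem pH t (hS n)).
- apply: (@measurable_fun_cvg _ _ _ _ (fun n t => \1_A t * nrm (s n t))).
    by move=> n; apply: measurable_funM => //; exact: (SI_nrm_measurable pH (hS n)).
  move=> t tT; apply/cvgrPdist_le => e e0; have [M hM] := cw t e e0; exists M => // n Mn.
  rewrite distrC -{1}(@ger0_norm _ (\1_A t)) ?indicE ?ler0n// -(nrmZ pH); last exact: (SI_mem pH t (hS n)).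
  apply: le_trans (nrm_dist pH _ _) (hM n Mn) => //; exact: Hs.
- have : {ae leb, forall t, ~ N t} by exists N; split => // t /contrapT.
  apply: leb_aeS => t Nt tT; rewrite /w indicE mem_set ?scale1r//.
- move=> t; rewrite /w indicE; case: (boolP (t \in A)) => _; first by left; rewrite scale1r.
  by right; rewrite scale0r.
- have /choice[c cP] : forall n, exists c : nat -> E, (forall i, H (c i)) /\
      forall x, H x -> (forall i, ip x (c i) = 0) -> forall t, ip x (s n t) = 0.
    move=> n; have [m [B [k [Bk sE _]]]] := hS n.
    have Hk i : H (k i) by case: (Bk i).
    exists (fun i => if insub i is Some i' then k i' else 0); split.
      by move=> i; case: insubP => [i' _ _|_]; [exact: Hk|exact: (ph_mem0 pH)].
    move=> x Hx xk t; rewrite sE (ipC pH)//; last by apply: (ph_sum pH) => i; exact: HZ.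
    rewrite (ip_suml pH)//; last by move=> i; exact: HZ.
    apply: big1 => i _; rewrite (ipZl pH)// (ipC pH)//.
    by have := xk i; rewrite valK => ->; rewrite mulr0.
  exists c; split=> [n i|x Hx xc t]; first exact: (cP n).1.
  have cA := cvg_nrm_ip pH (fun n => Hs n t) (Hw t) Hx (cw t).
  rewrite (ipC pH)//; apply/esym.
  rewrite -(cvg_lim (@Rhausdorff R) cA); apply/esym/cvg_lim; first exact: Rhausdorff.
  rewrite (_ : (fun n => _) = cst 0); first exact: cvg_cst.
  apply/funext => n; rewrite (ipZl pH)//; last exact: (SI_mem pH t (hS n)).
  rewrite (ipC pH)//; last exact: (SI_mem pH t (hS n)).
  by rewrite (cP n).2// ?mulr0// => i; exact: xc.
Qed.

Lemma L2_boch_wint u : in_L2_bochner T X u -> exists w g, [/\ wint w g,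
  int (fun t => nrm (w t) ^+ 2),
  {ae leb, forall t, t \in `]0, T[ -> u t = w t} &
  exists c : nat -> nat -> E, (forall n i, H (c n i)) /\
      forall x, H x -> (forall n i, ip x (c n i) = 0) -> forall t, ip x (w t) = 0].
Proof.
move=> [ae1 [s [j [hS ae2]]] L2].
have [w [mw mn uw sw hc]] := strong_meas hS ae1 ae2.
have mn2 : measurable_fun I01 (fun t => nrm (w t) ^+ 2) by exact: measurable_funX.
have [|||i2 _] := @int_openN set0 (fun t => nrm (w t) ^+ 2) (fun t => snorm X (u t) ^+ 2)%E measurable0 (measure0 _) mn2.
- move=> r rT _; have rT' : r \in `[0, T].
    by move: rT; rewrite !in_itv/= => /andP[/ltW -> /ltW ->].
  rewrite ger0_norm ?sqr_ge0// EFin_expe.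
  case: (sw r) => [h|->]; last by rewrite (nrm0 pH) expe2 mule0 expe_ge0.
  by rewrite !expe2; apply: lee_pmul => //; rewrite ?lee_fin ?nrm_ge0// -nX//; exact: mw.1.
- by move=> r; rewrite expe_ge0.
- exact: L2.
(* The bound r <= 1 + r^2 turns square integrability into an integrable majorant of the norm. *)
exists w, (fun t => 1 + nrm (w t) ^+ 2); split => //; split => //.
  apply: integrableD_fin => //; apply: continuous_int.
  by apply: continuous_subspaceT => x; exact: cvg_cst.
by move=> t tT; have := sqr_ge0 (nrm (w t) - 1); nra.
Qed.

End strong_measurability.

Import HBSimple.

(** * Products of integrable scalars and continuous curves are Bochner integrable *)

Section approximation.
Context {R : realType} {E : lmodType R}.
Variables (T : R) (X : snspace E) (ip : E -> E -> R).
Notation H := (scarrier X).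
Notation leb := (@lebesgue_measure R).
Notation I01 := (`[0, T]%classic : set R).
Implicit Types (u v w b : R -> E) (c f g : R -> R) (s t r : R) (J x y : E).
Local Notation int f := (leb.-integrable `[0, T] (EFin \o f)).
Local Notation I s t f := (\int[leb]_(x in `]s, t]) f x).
Local Notation nrm := (nrm ip).
Local Notation ccont := (ccont T H ip).
Local Notation wint := (wint T H ip).
Local Notation SI := (simple_with_integral T X).

Hypothesis T0 : 0 < T.
Hypothesis pH : prehilbert H ip.
Hypothesis nX : forall x, H x -> snorm X x = (nrm x)%:E.
Hypothesis sX : forall x, (0 <= snorm X x)%E.

Let HD := phD pH.
Let HB := phB pH.
Let HZ := phZ pH.

(* The error is controlled by integrable functions [e n] because the norm of
   [w - s n] need not be measurable. *)
Definition appr w := (forall t, t \in `[0, T] -> H (w t)) /\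
  exists (s : nat -> R -> E) (j : nat -> E) (e : nat -> R -> R),
  [/\ forall n, SI (s n) (j n), forall n, int (e n),
     forall n t, t \in `]0, T[ -> nrm (w t - s n t) <= e n t,
     forall t, t \in `]0, T[ -> e n t @[n --> \oo] --> (0 : R) &
     I 0 T (e n) @[n --> \oo] --> (0 : R)].

Lemma mem_oo_cc t : t \in `]0, T[ -> t \in `[0, T].
Proof. by rewrite !in_itv/= => /andP[/ltW -> /ltW ->]. Qed.

Lemma apprD w w' : appr w -> appr w' -> appr (fun t => w t + w' t).
Proof.
move=> [Hw [s [j [e [hS ie le ce Ie]]]]] [Hw' [s' [j' [e' [hS' ie' le' ce' Ie']]]]].
split; first by move=> t tT; apply: HD; [exact: Hw|exact: Hw'].
exists (fun n t => s n t + s' n t), (fun n => j n + j' n), (fun n t => e n t + e' n t).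
split.
- by move=> n; exact: SI_add.
- by move=> n; exact: integrableD_fin.
- move=> n t tT; have tT' := mem_oo_cc tT.
  have Hs := SI_mem pH t (hS n); have Hs' := SI_mem pH t (hS' n).
  rewrite opprD addrACA; apply: le_trans (nrmD pH _ _) _.
  + by apply: HB => //; exact: Hw.
  + by apply: HB => //; exact: Hw'.
  + by apply: lerD; [exact: le|exact: le'].
- by move=> t tT; rewrite -[0]addr0; apply: cvgD; [exact: ce|exact: ce'].
- rewrite (_ : (fun n => _) = (fun n => I 0 T (e n) + I 0 T (e' n))).
    by rewrite -[0 in X in _ --> X]addr0; apply: cvgD.
  by apply/funext => n; rewrite (@I_subD _ T (e n) (e' n)).
Qed.

(** J is specified by its pairings alone, as delivered by [pettis]. Testing J - j_n against all
    vectors bounds its norm by the integral of e_n, so the integrals of the simple functions do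
    converge to this J. *)
Lemma appr_boch w J : appr w -> H J ->
  (forall y, H y -> int (fun t => ip (w t) y) /\ ip J y = I 0 T (fun t => ip (w t) y)) ->
  bochner_integral T X w J.
Proof.
move=> [Hw [s [j [e [hS ie le ce Ie]]]]] HJ Jy; split => //; exists s, j.
have HJn n : H (j n) by case: (SI_integral T0 pH (hS n)).
have Hd n t : t \in `]0, T[ -> H (w t - s n t).
  by move=> tT; apply: HB; [exact/Hw/mem_oo_cc|exact: (SI_mem pH t (hS n))].
have e0 n t : t \in `]0, T[ -> 0 <= e n t.
  by move=> tT; apply: le_trans (le n t tT); exact: nrm_ge0.
split => //.
- apply: aeW => t tT; split; first exact/Hw/mem_oo_cc.
  apply/(@cvg_EFin0 _ _ _ _ _ (fun n => nrm (w t - s n t))).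
    by apply: nearW => n; rewrite nX//; exact: Hd.
  move=> k k0; have /cvgrPdist_le/(_ k k0) := ce t tT; apply: filterS => n.
  rewrite sub0r normrN !ger0_norm ?nrm_ge0 ?e0//.
  by apply: le_trans; exact: le.
- apply: (@squeeze_cvge _ _ _ _ (cst 0%E) _ (fun n => (I 0 T (e n))%:E)).
  + apply: nearW => n; apply/andP; split; first exact: integral_ge0.
    rewrite -(I_open (ie n))// EFin_Rintegral//; last first.
      by apply: integrableS (ie n) => //; apply: subset_itv; rewrite bnd_simp.
    apply: integral_mono => //= t tT; last by rewrite lee_fin; exact: e0.
    by rewrite nX ?lee_fin ?nrm_ge0/=; [exact: le|exact: Hd].
  + exact: cvg_cst.
  + apply/fine_cvgP; split; [exact: nearW|exact: Ie].
- apply/(@cvg_EFin0 _ _ _ _ _ (fun n => nrm (J - j n))).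
    by apply: nearW => n; rewrite nX//; exact: HB.
  move=> k k0; have /cvgrPdist_le/(_ k k0) := Ie; apply: filterS => n.
  rewrite sub0r normrN; apply: le_trans.
  rewrite ger0_norm ?nrm_ge0//; apply: (nrm_le_dual pH (HB HJ (HJn n))) => // y Hy.
  have [iw Jw] := Jy y Hy; have [is_ js] := (SI_integral T0 pH (hS n)).2 y Hy.
  rewrite (ipBl pH)// Jw js -(I_subB iw is_)// -(ger0_norm (nrm_ge0 ip y)) -normrM mulrC.
  rewrite -(I_Zl _ (ie n))//; apply: le_trans (_ : _ <= I 0 T (fun t => nrm y * e n t)) (ler_norm _).
  have ien : int (fun t => nrm y * e n t) by exact: integrableZ_fin.
  rewrite -(I_open ien)// .
  have id : int (fun t => ip (w t) y - ip (s n t) y).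
    by apply: integrableD_fin => //; exact: integrableN_fin.
  rewrite -(I_open id)//; apply: le_trans (le_normr_Rintegral _ _) _ => //.
    by apply: integrableS id => //; apply: subset_itv; rewrite bnd_simp.
  apply: le_Rintegral => //.
  + by apply: integrableS (integrable_norm_fin id) => //; apply: subset_itv; rewrite bnd_simp.
  + by apply: integrableS ien => //; apply: subset_itv; rewrite bnd_simp.
  + move=> t tT; have tT' := mem_oo_cc tT; have Hs := SI_mem pH t (hS n).
    rewrite -(ipBl pH)//; last exact: Hw.
    apply: le_trans (cauchy_schwarz pH (Hd n t tT) Hy) _.
    by rewrite mulrC; apply: ler_wpM2l; [exact: nrm_ge0|exact: le].
Qed.

Lemma appr_L2_boch w g : appr w -> (forall t, t \in `[0, T] -> nrm (w t) <= g t) ->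
  int (fun t => g t ^+ 2) -> in_L2_bochner T X w.
Proof.
move=> [Hw [s [j [e [hS ie le ce Ie]]]]] wg ig.
have Hd n t : t \in `]0, T[ -> H (w t - s n t).
  by move=> tT; apply: HB; [exact/Hw/mem_oo_cc|exact: (SI_mem pH t (hS n))].
have e0 n t : t \in `]0, T[ -> 0 <= e n t.
  by move=> tT; apply: le_trans (le n t tT); exact: nrm_ge0.
split.
- by apply: aeW => t tT; exact/Hw/mem_oo_cc.
- exists s, j; split => //; apply: aeW => t tT.
  apply/(@cvg_EFin0 _ _ _ _ _ (fun n => nrm (w t - s n t))).
    by apply: nearW => n; rewrite nX//; exact: Hd.
  move=> k k0; have /cvgrPdist_le/(_ k k0) := ce t tT; apply: filterS => n.
  rewrite sub0r normrN !ger0_norm ?nrm_ge0 ?e0//.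
  by apply: le_trans; exact: le.
- have ig' : leb.-integrable `]0, T[ (EFin \o (fun t => g t ^+ 2)).
    by apply: integrableS ig => //; apply: subset_itv; rewrite bnd_simp.
  apply: (@le_lt_trans _ _ (\int[leb]_(t in `]0%R, T[) (g t ^+ 2)%:E)%E).
    apply: integral_mono => //= t tT; last by rewrite lee_fin sqr_ge0.
    have tT' := mem_oo_cc tT; rewrite nX; last exact: Hw.
    rewrite -EFinM -expr2 !lee_fin sqr_ge0/= lerXn2r ?nnegrE ?nrm_ge0//.
      by apply: le_trans (wg t tT'); exact: nrm_ge0.
    exact: wg.
  by rewrite -EFin_Rintegral// ltry.
Qed.

Lemma ccont_step (g : R -> E) (e : R) : ccont g -> 0 < e -> exists (m : nat) (A : 'I_m -> set R)
  (x : 'I_m -> E), [/\ forall i, measurable (A i), forall i, H (x i) &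
    forall t, t \in `]0, T[ -> nrm (g t - \sum_(i < m) \1_(A i) t *: x i) <= e].
Proof.
move=> gc e0; have [D D0 hD] := ccont_unif pH gc e0.
have [m hm] := ex_nat_gt (T / D).
have m0 : 0 < m%:R :> R by apply: lt_trans hm; rewrite divr_gt0.
pose h := T / m%:R; have h0 : 0 < h by rewrite divr_gt0.
have hD' : h < D by rewrite /h ltr_pdivrMr// mulrC -ltr_pdivrMr.
have memh (i : 'I_m) : i%:R * h \in `[0, T].
  rewrite in_itv/= mulr_ge0 ?ler0n ?(ltW h0)//= /h mulrA ler_pdivrMr// mulrC.
  by rewrite ler_wpM2l ?(ltW T0)// ler_nat ltnW.
exists m, (fun i => `[i%:R * h, i.+1%:R * h[%classic), (fun i => g (i%:R * h)); split.
- by move=> i; exact: measurable_itv.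
- by move=> i; exact: gc.1.
- move=> t tT; have tT' := mem_oo_cc tT; move: tT; rewrite in_itv/= => /andP[t0 tT].
  have th0 : 0 <= t / h by rewrite divr_ge0 ?ltW.
  (* The index of the only cell of the grid of step h that contains t; all other indicators vanish
     there. *)
  have /andP[k1 k2] := truncn_itv th0; set k := Num.truncn (t / h) in k1 k2.
  have km : (k < m)%N.
    rewrite -(ltr_nat R); apply: le_lt_trans k1 _; rewrite ltr_pdivrMr//.
    by rewrite /h mulrCA divff ?mulr1// gt_eqF.
  rewrite ler_pdivlMr// in k1; rewrite ltr_pdivrMr// in k2.
  rewrite (bigD1 (Ordinal km))//= big1 ?addr0; last first.
    move=> i; rewrite -val_eqE/= => ik; rewrite indicE memNset ?scale0r//= in_itv/= => /andP[a b].
    have : i%:R * h < k.+1%:R * h by exact: le_lt_trans a k2.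
    have : k%:R * h < i.+1%:R * h by exact: le_lt_trans k1 b.
    rewrite !ltr_pM2r// !ltr_nat !ltnS => ki ik'.
    by move: ik; rewrite eqn_leq ki ik'.
  rewrite indicE mem_set ?scale1r/= ?in_itv/= ?k1//.
  apply: hD => //; first exact: (memh (Ordinal km)).
  rewrite ger0_norm ?subr_ge0//; apply: lt_trans hD'.
  by rewrite ltrBlDr; move: k2; rewrite -addn1 natrD mulrDl mul1r addrC.
Qed.

(** The approximants are products of a real simple function close to c in L^1 and a step curve
    uniformly close to g. This is the source of strong measurability for every time derivative
    constructed in the proof. *)
Lemma appr_mul c (g : R -> E) : int c -> ccont g -> appr (fun t => c t *: g t).
Proof.
move=> ic gc; split; first by move=> t tT; apply: HZ; exact: gc.1.
have [B B0 hB] := ccont_bound pH gc.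
have [q [iq cq Iq]] := @approximation_sfun_integrable _ _ _ leb I01 (measurable_itv _) (EFin \o c) ic.
have /choice[G GP] : forall n : nat, exists G : R -> E,
    (forall t, t \in `]0, T[ -> nrm (g t - G t) <= n.+1%:R^-1 /\ H (G t)) /\
    exists j, SI (fun t => (\1_(`]0, T[) t * q n t) *: G t) j.
  move=> n; have n0 : 0 < n.+1%:R^-1 :> R by rewrite invr_gt0.
  have [m [A [x [mA Hx hA]]]] := ccont_step gc n0.
  exists (fun t => \sum_(i < m) \1_(A i) t *: x i); split.
    by move=> t tT; split; [exact: hA|apply: (ph_sum pH) => i; exact: HZ].
  (* The common refinement of the level sets of [q n] and the cells of the step curve. *)
  pose B0' r i := (q n @^-1` [set r] `&` A i) `&` `]0, T[.
  rewrite (_ : (fun t => _) = (fun t => \sum_(r <- finmap.enum_fset (fset_set (range (q n))))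
      \sum_(i < m) \1_(B0' r i) t *: (r *: x i))).
    apply: SI_sum => r; apply: SI_sum => i; apply: SI_indic.
    - have mq : measurable (q n @^-1` [set r]) by exact: measurable_sfunP.
      by apply: measurableI; [apply: measurableI; [exact: mq|exact: mA]|exact: measurable_itv].
    - by move=> t [].
    - exact: HZ.
  apply/funext => t; rewrite {1}(fimfunE (q n) t) fsbig_finite//=.
  rewrite mulr_sumr scaler_suml; apply: eq_bigr => r _.
  rewrite scaler_sumr; apply: eq_bigr => i _.
  rewrite !scalerA; congr (_ *: _); rewrite /B0' !indicI/=; ring.
have {}GP : forall n, exists j, (forall t, t \in `]0, T[ ->
    nrm (g t - G n t) <= n.+1%:R^-1 /\ H (G n t)) /\
    SI (fun t => (\1_(`]0, T[) t * q n t) *: G n t) j.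
  by move=> n; have [a [j b]] := GP n; exists j.
have /choice[j jP] := GP.
(* From c g - q G = (c - q) G + c (g - G), where G is within 1 of g and hence bounded by B + 1. *)
pose e n t := (B + 1) * `|c t - q n t| + n.+1%:R^-1 * `|c t|.
have id n : int (fun t => c t - q n t).
  apply: integrableD_fin => //.
  by apply: integrableN_fin => //; exact: iq.
have idn n : int (fun t => `|c t - q n t|) by exact: integrable_norm_fin.
have icn : int (fun t => `|c t|) by exact: integrable_norm_fin.
exists (fun n t => (\1_(`]0, T[) t * q n t) *: G n t), j, e; split.
- by move=> n; case: (jP n).
- by move=> n; apply: integrableD_fin => //; exact: integrableZ_fin.
- move=> n t tT; have tT' := mem_oo_cc tT; have [hG _] := jP n; have [nG HG] := hG t tT.
  have Hg := gc.1 t tT'; have hBt := hB t tT'.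
  rewrite indicE mem_set// mul1r.
  have -> : c t *: g t - q n t *: G n t =
     (c t - q n t) *: G n t + c t *: (g t - G n t).
    by rewrite scalerBl scalerBr [RHS]addrC subrKA.
  apply: le_trans (nrmD pH _ _) _; [exact: HZ|exact/HZ/HB|].
  rewrite !(nrmZ pH)//; last exact: HB.
  have n1 : n.+1%:R^-1 <= 1 :> R by rewrite invf_le1 ?ltr0n// ler1n.
  have GB : nrm (G n t) <= B + 1.
    have := nrmB pH Hg (HB Hg HG); rewrite opprB addrC subrK => h.
    apply: le_trans h _; apply: lerD => //; exact: le_trans nG n1.
  rewrite /e [in leRHS]mulrC [_^-1 * _]mulrC.
  by apply: lerD; apply: ler_wpM2l.
- move=> t tT; have tT' := mem_oo_cc tT; rewrite /e.
  have -> : (0 : R) = (B + 1) * 0 + 0 * `|c t| by ring.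
  apply: cvgD; apply: cvgM; try exact: cvg_cst.
    have /fine_cvgP[_ /cvgrPdist_le h] := cq t tT'.
    apply/cvgrPdist_le => k k0; move: (h k k0); apply: filterS => n.
    by rewrite sub0r normrN normr_id.
  exact: cvg_harmonic.
- have EI n : I 0 T (e n) = (B + 1) * fine (\int[leb]_(t in `[0%R, T]) `|(c t)%:E - (q n t)%:E|)%E
      + n.+1%:R^-1 * I 0 T (fun t => `|c t|).
    rewrite (@I_subD _ T (fun t => (B + 1) * `|c t - q n t|) (fun t => n.+1%:R^-1 * `|c t|))//;
      try exact: integrableZ_fin.
    rewrite (I_Zl _ (idn n))// (I_Zl _ icn)//; congr (_ * _ + _).
    rewrite Rintegral_itv_obnd_cbnd; last exact: int_sub (idn n) (lexx 0) (lexx T).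
    by rewrite /Rintegral; congr fine; apply: eq_integral.
  have -> : (fun n => I 0 T (e n)) = (fun n => (B + 1) *
      fine (\int[leb]_(t in `[0%R, T]) `|(c t)%:E - (q n t)%:E|)%E
      + n.+1%:R^-1 * I 0 T (fun t => `|c t|)) by exact/funext/EI.
  suff L : (fun n => (B + 1) *
      fine (\int[leb]_(t in `[0%R, T]) `|(c t)%:E - (q n t)%:E|)%E
      + n.+1%:R^-1 * I 0 T (fun t => `|c t|)) @ \oo -->
      (B + 1) * 0 + 0 * I 0 T (fun t => `|c t|) by rewrite mulr0 mul0r addr0 in L.
  apply: cvgD; apply: cvgM; try exact: cvg_cst; last exact: cvg_harmonic.
  by have /fine_cvgP[_] := Iq.
Qed.

(** The values of step approximations of w, one finite list per accuracy padded with 0. They provide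
    the countable detecting family for continuous curves. *)
Lemma ccont_family w : ccont w -> exists c : nat -> nat -> E, (forall n i, H (c n i)) /\
  forall x, H x -> (forall n i, ip x (c n i) = 0) -> forall t, t \in `]0, T[ -> ip x (w t) = 0.
Proof.
move=> wc; have /choice[c cP] : forall n : nat, exists c : nat -> E, (forall i, H (c i)) /\
    forall x, H x -> (forall i, ip x (c i) = 0) -> forall t, t \in `]0, T[ ->
      `|ip x (w t)| <= nrm x * n.+1%:R^-1.
  move=> n; have n0 : 0 < n.+1%:R^-1 :> R by rewrite invr_gt0.
  have [m [A [k [_ Hk hA]]]] := ccont_step wc n0.
  exists (fun i => if insub i is Some i' then k i' else 0); split.
    by move=> i; case: insubP => [i' _ _|_]; [exact: Hk|exact: (ph_mem0 pH)].
  move=> x Hx xk t tT; have Hw := wc.1 t (mem_oo_cc tT).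
  have HS : H (\sum_(i < m) \1_(A i) t *: k i) by apply: (ph_sum pH) => i; exact: HZ.
  have -> : ip x (w t) = ip x (w t - \sum_(i < m) \1_(A i) t *: k i).
    rewrite (ipBr pH)// [ip x (\sum_(i < m) _)](ipC pH)// (ip_suml pH)//; last by move=> i; exact: HZ.
    rewrite big1 ?subr0// => i _; rewrite (ipZl pH)// (ipC pH)//.
    by have := xk i; rewrite valK => ->; rewrite mulr0.
  apply: le_trans (cauchy_schwarz pH Hx (HB Hw HS)) _.
  by apply: ler_wpM2l; [exact: nrm_ge0|exact: hA].
exists c; split=> [n i|x Hx xc t tT]; first exact: (cP n).1.
apply/eqP; rewrite -normr_le0; apply/ler_addgt0Pr => e e0; rewrite add0r.
have n0 : 0 < nrm x + 1 by rewrite ltr_wpDl ?nrm_ge0.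
have [N _ hN] := near_infty_natSinv_lt (PosNum (divr_gt0 e0 n0)).
apply: le_trans ((cP N).2 x Hx (xc N) t tT) _; have /= := hN N (leqnn N).
rewrite ltr_pdivlMr// => /ltW; apply: le_trans; rewrite mulrC.
by apply: ler_wpM2l; [rewrite invr_ge0|rewrite lerDl].
Qed.

End approximation.

(** * Multipliers *)

Section multipliers.
Context {R : realType} {d : nat}.
Notation E := 'rV[R]_d.
Notation mu := (lebesgue_rV d).
Variables (Omega : set E) (T : R).
Hypotheses (oO : open Omega) (bO : bounded_set Omega).
Implicit Types (phi : E -> R) (i : 'I_d) (a b g u : R -> E -> R) (s t : R).
Notation L2 := (in_Lp mu 2%:E Omega).
Notation ip := (L2ip mu Omega).
Notation n2 := (nrm ip).
Notation cc2 := (ccont T L2 ip).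
Notation "'aeO' x , P" := ({ae mu, forall x, Omega x -> P}) (at level 200, x name).

Let mO : measurable Omega. Proof. exact: measurable_open. Qed.
Let finO : (mu Omega < +oo)%E. Proof. exact: bounded_lebesgue_fin. Qed.
Let pL2 : prehilbert L2 ip. Proof. exact: L2_prehilbert. Qed.

Lemma Loo_ae phi C : (Lp_norm mu +oo Omega phi <= C%:E)%E -> aeO x, `|phi x| <= C.
Proof.
rewrite /Lp_norm unlock; case: ifPn => [_ /ess_supP|].
  by apply: filterS => x /= + Ox; rewrite patchE mem_set.
(* On a space of measure zero the L^oo norm is 0 by convention, and every almost everywhere
   statement holds trivially. *)
rewrite -leNgt => mu0 _; exists setT; split => //.
by apply/eqP; rewrite eq_le mu0 measure_ge0.
Qed.

Lemma L2_mul phi psi C : measurable_fun Omega phi -> 0 <= C -> (aeO x, `|phi x| <= C) ->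
  L2 psi -> L2 (fun x => phi x * psi x) /\ n2 (fun x => phi x * psi x) <= C * n2 psi.
Proof.
move=> mphi C0 hC psi2; have [mpsi ipsi] := (L2P _ mO psi).1 psi2.
have mpp : measurable_fun Omega (fun x => phi x * psi x) by exact: measurable_funM.
(* Truncation gives a representative of phi whose bound holds everywhere, so that integrals can be
   compared pointwise. *)
pose phi1 x := Num.min C (Num.max (- C) (phi x)).
have pp1 : aeO x, phi x * psi x = phi1 x * psi x.
  apply: filterS hC => x h Ox; move: (h Ox); rewrite ler_norml => /andP[h1 h2].
  by rewrite /phi1 max_r// min_r.
have mphi1 : measurable_fun Omega phi1.
  by apply: measurable_minr => //; exact: measurable_maxr.
have phi1C x : `|phi1 x| <= C.
  by rewrite ler_norml /phi1 ge_min lexx/= le_min le_max lexx andbT ge0_cp.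
have sq x : (phi1 x * psi x) ^+ 2 <= C ^+ 2 * psi x ^+ 2.
  rewrite exprMn ler_wpM2r ?sqr_ge0// -[leLHS]real_normK ?num_real//.
  by rewrite lerXn2r ?nnegrE.
have i1 : mu.-integrable Omega (EFin \o (fun x => C ^+ 2 * psi x ^+ 2)).
  exact: integrableZ_fin.
have i2 : mu.-integrable Omega (EFin \o (fun x => (phi1 x * psi x) ^+ 2)).
  apply: (integrable_le mO _ i1) => [|x _]; last by rewrite ger0_norm ?sqr_ge0.
  by apply: measurable_funX; exact: measurable_funM.
have p1 : L2 (fun x => phi1 x * psi x).
  by apply/(L2P _ mO); split => //; exact: measurable_funM.
have pp2 : L2 (fun x => phi x * psi x).
  by apply: (L2_nrm_ae mO p1 mpp); apply: filterS pp1 => x h Ox; rewrite h.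
split => //; rewrite (nrm_L2_ae oO pp2 p1 pp1).
rewrite -(@ler_pXn2r _ 2)// ?nnegrE ?mulr_ge0 ?nrm_ge0// exprMn !(nrm_sqr pL2)//.
rewrite /L2ip.
have -> : \int[mu]_(x in Omega) (phi1 x * psi x * (phi1 x * psi x)) =
  \int[mu]_(x in Omega) ((phi1 x * psi x) ^+ 2) by apply: eq_Rintegral => x _; rewrite expr2.
have -> : \int[mu]_(x in Omega) (psi x * psi x) =
  \int[mu]_(x in Omega) (psi x ^+ 2) by apply: eq_Rintegral => x _; rewrite expr2.
by rewrite -RintegralZl//; apply: le_Rintegral => // x _; exact: sq.
Qed.

(** Continuity into L^oo phrased through almost everywhere bounds, the form in which multiplication
    on L^2 and inversion use it. *)
Definition bcont a :=
  (forall t, t \in `[0, T] -> measurable_fun Omega (a t) /\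
    exists2 C, 0 <= C & aeO x, `|a t x| <= C) /\
  forall t, t \in `[0, T] -> forall e, 0 < e -> exists2 D, 0 < D &
    forall s, s \in `[0, T] -> `|s - t| < D -> aeO x, `|a s x - a t x| <= e.

Lemma Loo_C0 a : in_C0 T (Loo_space Omega) a -> bcont a.
Proof.
move=> [Ha ca]; split=> [t tT|t tT e e0].
  have [ma fa] := Ha t tT; split => //.
  exists (fine (Lp_norm mu +oo Omega (a t))); first by rewrite fine_ge0// Lnorm_ge0.
  by apply: Loo_ae; rewrite fineK// ge0_fin_numE// Lnorm_ge0.
have /fine_cvgP[fn /cvgrPdist_le/(_ e e0)] := ca t tT.
move=> h; have /nbhs_ballP[D /= D0 hD] : nbhs t (fun s => `[0, T]%classic s ->
    Lp_norm mu +oo Omega (a s - a t) \is a fin_num /\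
    `|0 - fine (Lp_norm mu +oo Omega (a s - a t))| <= e) by exact: (filterI fn h).
exists D => // s sT st; have [|f1 f2] := hD s _ sT; first by rewrite /ball/= distrC.
apply: Loo_ae; rewrite -(fineK f1) lee_fin; apply: le_trans f2.
by rewrite sub0r normrN ler_norm.
Qed.

Lemma ccont_mul a g : bcont a -> cc2 g -> cc2 (fun t x => a t x * g t x).
Proof.
move=> [Ha ca] gc; have [Hg cg] := gc.
split=> [t tT|t tT e e0].
  have [ma [C C0 hC]] := Ha t tT; exact: (L2_mul ma C0 hC (Hg t tT)).1.
have [B B0 hB] := ccont_bound pL2 gc; have [ma [C C0 hC]] := Ha t tT.
have eB : 0 < e / 2 / B by rewrite !divr_gt0.
have eC : 0 < e / 2 / (C + 1) by rewrite !divr_gt0// ltr_wpDl.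
have [D1 D10 h1] := ca t tT _ eB; have [D2 D20 h2] := cg t tT _ eC.
exists (Num.min D1 D2); first by rewrite lt_min D10.
move=> s sT; rewrite lt_min => /andP[s1 s2].
have mD : measurable_fun Omega (fun x => a s x - a t x).
  by apply: measurable_funB => //; case: (Ha s sT).
have gst := phB pL2 (Hg s sT) (Hg t tT).
have [A1 A2] := L2_mul mD (ltW eB) (h1 s sT s1) (Hg s sT).
have [B1 B2] := L2_mul ma C0 hC gst.
have -> : (fun x => a s x * g s x) - (fun x => a t x * g t x) =
    (fun x => (a s x - a t x) * g s x) + (fun x => a t x * (g s - g t) x).
  by apply/funext => x; rewrite !fctE; ring.
apply: le_trans (nrmD pL2 A1 B1) _; rewrite [leRHS]splitr; apply: lerD.
  apply: le_trans A2 _; apply: le_trans (ler_wpM2l (ltW eB) (hB s sT)) _.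
  by rewrite divfK// gt_eqF.
apply: le_trans B2 _; apply: le_trans (ler_wpM2l C0 (h2 s sT s2)) _.
have C1 : 0 < C + 1 by rewrite ltr_wpDl.
rewrite mulrA ler_pdivrMr// mulrC; apply: ler_wpM2l; first by rewrite divr_ge0 ?ltW.
by rewrite lerDl.
Qed.

Lemma cderiv_mul a a' phi : in_C1 T (Loo_space Omega) a a' -> L2 phi ->
  cderiv T L2 ip (fun t x => a t x * phi x) (fun t x => a' t x * phi x).
Proof.
move=> [/Loo_C0 ac /Loo_C0 a'c da] phi2.
have pc := ccont_cst T pL2 phi2.
split; [exact: ccont_mul ac pc|exact: ccont_mul a'c pc|].
move=> t tT e e0; have n0 : 0 < n2 phi + 1 by rewrite ltr_wpDl ?nrm_ge0.
have /fine_cvgP[fn /cvgrPdist_le/(_ _ (divr_gt0 e0 n0))] := da t tT.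
move=> h; have /nbhs_ballP[D /= D0 hD] : nbhs t (fun s => (`[0, T] `\ t)%classic s ->
    Lp_norm mu +oo Omega ((s - t)^-1 *: (a s - a t) - a' t) \is a fin_num /\
    `|0 - fine (Lp_norm mu +oo Omega ((s - t)^-1 *: (a s - a t) - a' t))| <=
      e / (n2 phi + 1)) by exact: (filterI fn h).
exists D => // s sT st sD; have [||f1 f2] := hD s; first by rewrite /ball/= distrC.
  by split => //; exact/eqP.
have -> : (s - t)^-1 *: ((fun x => a s x * phi x) - (fun x => a t x * phi x)) -
    (fun x => a' t x * phi x) = (fun x => ((s - t)^-1 *: (a s - a t) - a' t) x * phi x).
  by apply/funext => x; rewrite !fctE /GRing.scale/=; ring.
have md : measurable_fun Omega ((s - t)^-1 *: (a s - a t) - a' t).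
  apply: measurable_funB; last by case: (a'c.1 t tT).
  apply: measurable_funM; first exact: measurable_cst.
  by apply: measurable_funB; [case: (ac.1 s sT)|case: (ac.1 t tT)].
have [] := @L2_mul _ phi (e / (n2 phi + 1)) md _ _ phi2.
- exact: ltW (divr_gt0 e0 n0).
- apply: Loo_ae; rewrite -(fineK f1) lee_fin; apply: le_trans f2.
  by rewrite sub0r normrN ler_norm.
move=> _ le; apply: le_trans le _; rewrite mulrAC ler_pdivrMr// .
by apply: ler_wpM2l; [exact: ltW|rewrite lerDl].
Qed.

Lemma measurable_inv : measurable_fun setT (@GRing.inv R).
Proof.
have -> : setT = [set 0 : R] `|` ~` [set 0] by rewrite setUv.
apply/measurable_funU => //; first exact: measurableC.
split; first exact: measurable_fun_set1.
apply: open_continuous_measurable_fun.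
  by apply: closed_openC; apply: (@accessible_closed_set1 R); exact: hausdorff_accessible (@Rhausdorff R).
by move=> x /set_mem/= /eqP x0; exact: inv_continuous.
Qed.

Lemma bcont_inv a k : bcont a -> 0 < k -> (forall t, t \in `[0, T] -> aeO x, k <= a t x) ->
  bcont (fun t x => (a t x)^-1).
Proof.
move=> [Ha ca] k0 ka; split=> [t tT|t tT e e0].
  have [ma _] := Ha t tT; split.
    exact: (measurableT_comp measurable_inv).
  exists k^-1; first by rewrite invr_ge0 ltW.
  apply: filterS (ka t tT) => x h Ox; have kx := h Ox.
  by rewrite ger0_norm ?lef_pV2 ?posrE ?invr_ge0 ?(lt_le_trans k0)// ltW// (lt_le_trans k0).
have ek : 0 < e * k ^+ 2 by rewrite mulr_gt0 ?exprn_gt0.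
have [D D0 hD] := ca t tT _ ek; exists D => // s sT st.
apply: filterS3 (hD s sT st) (ka s sT) (ka t tT) => x h hs ht Ox.
have xs := hs Ox; have xt := ht Ox.
have s0 := lt_le_trans k0 xs; have t0 := lt_le_trans k0 xt.
have -> : (a s x)^-1 - (a t x)^-1 = - (a s x - a t x) / (a s x * a t x).
  by field; rewrite !gt_eqF.
rewrite normrM normrN normfV (gtr0_norm (mulr_gt0 s0 t0)) ler_pdivrMr ?mulr_gt0//.
apply: le_trans (h Ox) _; apply: ler_wpM2l; first exact: ltW.
by rewrite expr2; apply: ler_pM => //; exact: ltW.
Qed.

Lemma lipschitz_comp (f : R -> R) (L : R) (phi psi : E -> R) : 0 <= L ->
  (forall r s, `|f r - f s| <= L * `|r - s|) -> L2 phi -> L2 psi ->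
  L2 (f \o phi) /\ n2 ((f \o phi) - (f \o psi)) <= L * n2 (phi - psi).
Proof.
move=> L0 fL phi2 psi2.
have fc : continuous f.
  move=> r; apply/cvgrPdist_le => e e0; have L1 : 0 < L + 1 by rewrite ltr_wpDl.
  apply/nbhs_ballP; exists (e / (L + 1)); first by rewrite /= divr_gt0.
  move=> s; rewrite /ball/= => rs; apply: le_trans (fL r s) _.
  rewrite ltr_pdivlMr// in rs; apply: le_trans (ltW rs); rewrite mulrC.
  by apply: ler_wpM2l => //; rewrite lerDl.
have f2 (g : E -> R) : L2 g -> L2 (f \o g).
  move=> g2; have [mg ig] := (L2P _ mO g).1 g2.
  have mfg : measurable_fun Omega (f \o g).
    by apply: measurableT_comp => //; exact: continuous_measurable_fun.
  (* The majorant (L + 1) |g| + |f(0)| of |f(g)|, written as a multiple of one L^2 function; L + 1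
     avoids dividing by zero. *)
  have := phD pL2 (L2_norm_fun mO g2) (L2_cst mO finO (`|f 0| / (L + 1))).
  move=> /(phZ pL2 (L + 1)) /(L2P _ mO)[mh ih]; apply/(L2P _ mO); split => //.
  apply: (integrable_le mO _ ih) => [|x _]; first exact: measurable_funX.
  have L1 : 0 < L + 1 by rewrite ltr_wpDl.
  rewrite ger0_norm ?sqr_ge0// -[leLHS]real_normK ?num_real// lerXn2r ?nnegrE//.
    by apply: mulr_ge0; [exact: ltW|apply: addr_ge0 => //; exact: divr_ge0 (normr_ge0 _) (ltW L1)].
  rewrite [leRHS]mulrDr [_ * (_ / _)]mulrC divfK ?gt_eqF//.
  have := fL (g x) 0; rewrite subr0 /= => h.
  have := ler_normD (f (g x) - f 0) (f 0); rewrite subrK => h'.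
  apply: le_trans h' _; rewrite lerD2r; apply: le_trans h _.
  by apply: ler_wpM2r => //; rewrite lerDl.
split; first exact: f2.
have d2 := phB pL2 phi2 psi2; have fd2 := phB pL2 (f2 _ phi2) (f2 _ psi2).
rewrite -[L](ger0_norm L0) -(nrmZ pL2)//; rewrite /nrm ler_wsqrtr// /L2ip.
have Ld2 := phZ pL2 L d2.
apply: le_Rintegral => //; [exact: L2_int|exact: L2_int|].
move=> x _; rewrite -!expr2 -(real_normK (num_real _)) -[leRHS]real_normK ?num_real//.
rewrite lerXn2r ?nnegrE// [leRHS]normrM (ger0_norm L0); exact: fL.
Qed.

End multipliers.

(** * Weak measurability of the gradient of the weight *)

Section riesz_dense.
Context {R : realType} {E : lmodType R} (H S : set E) (ip : E -> E -> R).
Hypotheses (pH : prehilbert H ip) (cH : nrm_complete H ip) (pS : prehilbert S ip).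
Hypothesis SH : S `<=` H.
Hypothesis dS : forall x e, H x -> 0 < e -> exists y, S y /\ nrm ip (y - x) <= e.
Notation n := (nrm ip).

(* The value of the extension at [y] is any number within [C * n (s - y)] of
   every [F s]; such numbers exist because the intervals meet pairwise. *)
Lemma riesz_dense (F : E -> R) C :
  (forall x y, S x -> S y -> F (x + y) = F x + F y) ->
  (forall k x, S x -> F (k *: x) = k * F x) -> 0 <= C ->
  (forall x, S x -> `|F x| <= C * n x) ->
  exists x, H x /\ forall y, S y -> ip x y = F y.
Proof.
move=> FD FZ C0 FC.
have FB x y : S x -> S y -> F (x - y) = F x - F y.
  by move=> Sx Sy; rewrite FD//; [rewrite -[- y]scaleN1r FZ// mulN1r|exact: (phN pS)].
have /choice[r rP] : forall y, exists r, H y -> forall s, S s -> `|F s - r| <= C * n (s - y).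
  move=> y; have [Hy|nHy] := pselect (H y); last by exists 0.
  pose A := [set F s - C * n (s - y) | s in S].
  have A0 : A !=set0 by exists (F 0 - C * n (0 - y)), 0 => //; exact: ph0 pS.
  have key s s' : S s -> S s' -> F s - C * n (s - y) <= F s' + C * n (s' - y).
    move=> Ss Ss'; have Hs := SH Ss; have Hs' := SH Ss'.
    have := FC _ (phB pS Ss Ss'); rewrite FB// => h.
    have h2 : C * n (s - s') <= C * n (s - y) + C * n (s' - y).
      rewrite -mulrDr; apply: ler_wpM2l => //.
      by rewrite [n (s' - y)](nrmBC pH)//; exact: (nrmB_trans pH Hs Hs' Hy).
    have := le_trans (ler_norm _) (le_trans h h2).
    move: (F s) (F s') (C * _) (C * _) => a b c e; lra.
  have ubA s : S s -> ubound A (F s + C * n (s - y)).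
    by move=> Ss _ [s' Ss' <-]; exact: key.
  exists (sup A) => _ s Ss; rewrite ler_norml; apply/andP; split.
    rewrite lerBrDl -lerBrDr opprK; apply: ge_sup => //; exact: ubA.
  rewrite lerBlDr addrC -lerBlDr; apply: ub_le_sup; last by exists s.
  by exists (F s + C * n (s - y)); exact: ubA.
have eq0 (a K : R) : (forall e, 0 < e -> `|a| <= K * e) -> a = 0.
  move=> h; apply/eqP; rewrite -normr_le0; apply/ler_addgt0Pr => e e0; rewrite add0r.
  have K0 : 0 < `|K| + 1 by rewrite ltr_wpDl.
  apply: le_trans (h _ (divr_gt0 e0 K0)) _; rewrite mulrA ler_pdivrMr// mulrC.
  by apply: ler_wpM2l; [exact: ltW|rewrite (le_trans (ler_norm K))// lerDl].
have rS s : S s -> r s = F s.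
  move=> Ss; apply/esym/eqP; rewrite -subr_eq0 -normr_le0.
  by have := rP s (SH Ss) s Ss; rewrite subrr (nrm0 pH) mulr0.
have [|||x [Hx xr]] := riesz pH cH (F := r) (C := C); last first.
- by exists x; split => // y Sy; rewrite xr ?rS//; exact: SH.
- move=> y Hy; have := rP y Hy 0 (ph0 pS).
  have := FZ 0 0 (ph0 pS); rewrite scale0r mul0r => ->.
  by rewrite !sub0r normrN (nrmN pH).
- move=> k x Hx; apply/eqP; rewrite -subr_eq0; apply/eqP.
  apply: (eq0 _ (2 * C * `|k|)) => e e0; have [s [Ss sx]] := dS Hx e0.
  have Hs := SH Ss.
  have := rP _ (phZ pH k Hx) _ (phZ pS k Ss); rewrite -scalerBr (nrmZ pH k (phB pH Hs Hx)) FZ// => h1.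
  have h2 := rP _ Hx _ Ss.
  have k2 : `|k * (F s - r x)| <= `|k| * (C * e).
    by rewrite normrM; apply: ler_wpM2l => //; apply: le_trans h2 _; exact: ler_wpM2l.
  have k1 : `|k * F s - r (k *: x)| <= `|k| * (C * e).
    apply: le_trans h1 _; rewrite mulrCA; apply: ler_wpM2l => //; exact: ler_wpM2l.
  have -> : r (k *: x) - k * r x = k * (F s - r x) - (k * F s - r (k *: x)) by ring.
  by apply: le_trans (ler_normB _ _) _; apply: le_trans (lerD k2 k1) _; rewrite le_eqVlt; apply/orP; left; apply/eqP; ring.
- move=> x y Hx Hy; apply/eqP; rewrite -subr_eq0; apply/eqP.
  apply: (eq0 _ (4 * C)) => e e0; have [s [Ss sx]] := dS Hx e0; have [q [Sq qy]] := dS Hy e0.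
  have Hs := SH Ss; have Hq := SH Sq.
  have h := rP _ (phD pH Hx Hy) _ (phD pS Ss Sq).
  have h1 := rP _ Hx _ Ss; have h2 := rP _ Hy _ Sq.
  have k1 := le_trans h1 (ler_wpM2l C0 sx); have k2 := le_trans h2 (ler_wpM2l C0 qy).
  have k3 : `|F (s + q) - r (x + y)| <= C * (e + e).
    apply: le_trans h _; apply: ler_wpM2l => //; rewrite opprD addrACA.
    by apply: le_trans (nrmD pH (phB pH Hs Hx) (phB pH Hq Hy)) _; exact: lerD.
  have -> : r (x + y) - (r x + r y) =
    (F s - r x) + (F q - r y) - (F (s + q) - r (x + y)) by rewrite FD//; ring.
  apply: le_trans (ler_normB _ _) _; apply: le_trans (lerD (ler_normD _ _) (lexx _)) _.
  by apply: le_trans (lerD (lerD k1 k2) k3) _; rewrite le_eqVlt; apply/orP; left; apply/eqP; ring.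
Qed.

End riesz_dense.

Lemma normB4_le {R : realType} (x y z w e : R) : `|x| <= e / 4 -> `|y| <= e / 4 ->
  `|z| <= e / 4 -> `|w| <= e / 4 -> `|x - y - z - w| <= e.
Proof.
move=> h1 h2 h3 h4; have a1 := ler_normB (x - y - z) w.
have a2 := ler_normB (x - y) z; have a3 := ler_normB x y.
apply: (le_trans a1); apply: (le_trans (lerD (le_trans a2 (lerD a3 h3)) h4)).
by apply: (le_trans (lerD (lerD (lerD h1 h2) (lexx _)) (lexx _))); lra.
Qed.

Section weak_gradient.
Context {R : realType} {d : nat}.
Notation E := 'rV[R]_d.
Notation mu := (lebesgue_rV d).
Variables (Omega : set E) (T : R).
Hypotheses (oO : open Omega) (bO : bounded_set Omega).
Implicit Types (phi : E -> R) (i : 'I_d) (a b u : R -> E -> R) (s t : R).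
Notation L2 := (in_Lp mu 2%:E Omega).
Notation ip := (L2ip mu Omega).
Notation n2 := (nrm ip).
Notation cc2 := (ccont T L2 ip).
Notation I01 := (`[0, T]%classic : set R).

Let mO : measurable Omega. Proof. exact: measurable_open. Qed.
Let finO : (mu Omega < +oo)%E. Proof. exact: bounded_lebesgue_fin. Qed.
Let pL2 : prehilbert L2 ip. Proof. exact: L2_prehilbert. Qed.
Let cL2 : nrm_complete L2 ip. Proof. exact: L2_complete. Qed.

Lemma test_prehilbert : prehilbert (test_function Omega) ip.
Proof.
apply: (sub_prehilbert pL2); [exact: test_L2 oO bO|exact: test_function0|].
by move=> k x y tx ty; apply: test_functionD => //; exact: test_functionZ.
Qed.

(** Density by duality, without mollifiers: the closure V of the test functions is complete, so (g,
    .) has a representer z in V. Then g - z is orthogonal to all test functions and vanishes almost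
    everywhere by the fundamental lemma. *)
Lemma test_dense g e : L2 g -> 0 < e -> exists phi, test_function Omega phi /\ n2 (phi - g) <= e.
Proof.
pose V := [set g | L2 g /\ forall e, 0 < e ->
  exists phi, test_function Omega phi /\ n2 (phi - g) <= e].
have V2 : V `<=` L2 by move=> ? [].
have tV phi : test_function Omega phi -> V phi.
  move=> tp; split=> [|e' e0]; first exact: test_L2.
  by exists phi; rewrite subrr (nrm0 pL2) ltW.
have pV : prehilbert V ip.
  apply: (sub_prehilbert pL2) => //; first by apply/tV/test_function0.
  move=> k x y [x2 hx] [y2 hy]; split=> [|e' e0]; first exact: (phD pL2 (phZ pL2 k x2) y2).
  have k0 : 0 < `|k| + 1 by rewrite ltr_wpDl.
  have [p [tp px]] := hx _ (divr_gt0 (divr_gt0 e0 (ltr0n _ 2)) k0).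
  have [q [tq qy]] := hy _ (divr_gt0 e0 (ltr0n _ 2)).
  exists (k *: p + q); split; first by apply: test_functionD => //; exact: test_functionZ.
  have p2 := test_L2 oO bO tp; have q2 := test_L2 oO bO tq.
  have px2 := phB pL2 p2 x2; have qy2 := phB pL2 q2 y2.
  rewrite opprD addrACA -scalerBr; apply: le_trans (nrmD pL2 (phZ pL2 k px2) qy2) _.
  rewrite (nrmZ pL2)// [leRHS]splitr; apply: lerD => //.
  apply: le_trans (ler_wpM2l (normr_ge0 k) px) _.
  rewrite mulrA ler_pdivrMr// mulrC; apply: ler_wpM2l; first by rewrite divr_ge0// ltW.
  by rewrite lerDl.
have cV : nrm_complete V ip.
  apply: (sub_complete V2 cL2) => l l2 hl; split => // e' e0.
  have e2 : 0 < e' / 2 by rewrite divr_gt0.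
  have [v [[v2 hv] vl]] := hl _ e2; have [p [tp pv]] := hv _ e2.
  exists p; split => //; apply: le_trans (nrmB_trans pL2 (test_L2 oO bO tp) l2 v2) _.
  by rewrite [leRHS]splitr; exact: lerD.
move=> g2 e0.
have [|||z [Vz zg]] := riesz pV cV (F := ip g) (C := n2 g).
- by move=> x y /V2 x2 /V2 y2; rewrite (ipDr pL2).
- by move=> k x /V2 x2; rewrite (ipZr pL2).
- by move=> x /V2 x2; exact: (cauchy_schwarz pL2 g2 x2).
have z2 := V2 _ Vz; have gz2 := phB pL2 g2 z2.
have gz0 : {ae mu, forall x, Omega x -> (g - z) x = 0}.
  apply: (L1loc_eq0 oO (L2_L1loc oO bO gz2)) => phi tp.
  have p2 := test_L2 oO bO tp; rewrite -[LHS]/(ip (g - z) phi) (ipBl pL2)//.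
  by rewrite (zg phi (tV phi tp)) subrr.
have [p [tp pz]] := Vz.2 e e0; exists p; split => //.
have p2 := test_L2 oO bO tp.
apply: le_trans (nrmB_trans pL2 p2 g2 z2) _.
suff -> : n2 (z - g) = 0 by rewrite addr0.
rewrite (nrmBC pL2)// -[RHS](nrm0 pL2); apply: (nrm_L2_ae oO) => //; exact: (ph0 pL2).
Qed.

Variables (W : R -> E -> R) (M : R) (i : 'I_d).
Hypothesis Wc : cc2 W.
Notation G t := (grad Omega (W t) i).
Hypothesis G2 : forall t, t \in `[0, T] -> L2 (G t) /\ n2 (G t) <= M.
(** Off Z the chosen gradient is the default 0, and the bound [G2] says nothing about W(t). The two
    sets of times have to be treated separately, which requires Z to be measurable. *)
Let Z := [set t | t \in `[0, T] /\ exists g, weak_partial Omega i (W t) g].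
Notation D phi := ('D_(delta_mx 0 i) phi).

Let D2 phi : test_function Omega phi -> L2 (D phi).
Proof. by move=> tp; apply: test_L2 => //; exact: test_function_derive. Qed.

Let GE t phi : Z t -> test_function Omega phi -> ip (G t) phi = - ip (W t) (D phi).
Proof. by move=> [tT [g /grad_weak_partial[_ _ h]]] tp; rewrite /L2ip h// opprK. Qed.

Let M0 t : t \in `[0, T] -> 0 <= M.
Proof. by move=> /G2[_]; apply: le_trans; exact: nrm_ge0. Qed.

Let G0 t : ~ Z t -> t \in `[0, T] -> G t = cst 0.
Proof.
Transparent grad.
move=> nZ tT; rewrite /grad; case: xgetP => // g _ wg.
by exfalso; apply: nZ; split => //; exists g.
Opaque grad.
Qed.

(* Along t_n -> t in Z the functionals phi |-> (G(t_n), phi) converge on test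
   functions and stay bounded by M, so the limit is represented by Riesz. *)
Let Zclosed : closed Z.
Proof.
move=> t clt.
have tT : t \in `[0, T].
  have cI : closed I01 by apply: interval_closed.
  by apply: cI; apply: closureS clt => s [].
have near e : 0 < e -> exists s, Z s /\ n2 (W t - W s) <= e.
  move=> e0; have [D' D'0 hD] := Wc.2 t tT e e0.
  have [s [Zs]] := clt _ (nbhsx_ballx t _ D'0); rewrite /ball/= => ts.
  exists s; split => //; rewrite (nrmBC pL2); [|exact: Wc.1|by apply: Wc.1; case: Zs].
  by apply: hD; [case: Zs|rewrite distrC].
have W2 := Wc.1 t tT.
have DD x y : test_function Omega x -> test_function Omega y -> D (x + y) = D x + D y.
  move=> [sx _ _] [sy _ _]; apply/funext => r.
  by rewrite deriveD//; exact: smooth_derivable.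
have DZ k x : test_function Omega x -> D (k *: x) = k *: D x.
  by move=> [sx _ _]; apply/funext => r; rewrite deriveZ//; exact: smooth_derivable.
have SH : test_function Omega `<=` L2 by exact: test_L2 oO bO.
have [||||x [x2 xF]] := @riesz_dense _ _ L2 (test_function Omega) ip pL2 cL2 test_prehilbert SH test_dense
   (fun phi => - ip (W t) (D phi)) M.
- move=> x y tx ty; rewrite DD// (ipDr pL2) ?opprD//; exact: D2.
- move=> k x tx; rewrite DZ// (ipZr pL2) ?mulrN//; exact: D2.
- exact: M0 tT.
- move=> x tx; rewrite normrN; apply/ler_addgt0Pr => e e0.
  have n0 : 0 < n2 (D x) + 1 by rewrite ltr_wpDl ?nrm_ge0.
  have [s [Zs Ws]] := near _ (divr_gt0 e0 n0); have sT := Zs.1; have [Gs2 GsM] := G2 sT.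
  have Ws2 := Wc.1 s sT; have x2 := test_L2 oO bO tx.
  have -> : ip (W t) (D x) = ip (W t - W s) (D x) - ip (G s) x.
    by rewrite GE// (ipBl pL2) ?opprK ?subrK//; exact: D2.
  rewrite [leRHS]addrC; apply: le_trans (ler_normB _ _) _; apply: lerD.
    apply: le_trans (cauchy_schwarz pL2 (phB pL2 W2 Ws2) (D2 tx)) _.
    apply: le_trans (ler_wpM2r (nrm_ge0 _ _) Ws) _.
    by rewrite mulrAC ler_pdivrMr//; apply: ler_wpM2l; [exact: ltW|rewrite lerDl].
  apply: le_trans (cauchy_schwarz pL2 Gs2 x2) _.
  by apply: ler_wpM2r => //; exact: nrm_ge0.
split => //; exists x; split; [exact: L2_L1loc|exact: L2_L1loc|].
move=> phi tp; have := xF phi tp; rewrite /L2ip => ->; by rewrite opprK.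
Qed.

(** On Z the pairing with a continuous curve is continuous in t: the curve is approximated in L^2 by
    a test function, uniformly harmlessly because of the bound M, and against the test function the
    derivative moves off W, which is continuous. Off Z the pairing is 0. *)
Lemma grad_wmeas : wmeas T L2 ip (fun t => G t).
Proof.
split=> [t tT|b bc]; first exact: (G2 tT).1.
pose k t := ip (G t) (b t).
have mZ : measurable Z by exact: closed_measurable.
have -> : I01 = Z `|` (I01 `\` Z).
  apply/seteqP; split=> t; first by move=> tT; have [|] := pselect (Z t); [left|right].
  by case=> -[].
apply/measurable_funU => //; first exact: measurableD.
split; last first.
  apply: (@eq_measurable_fun _ _ _ _ _ (cst 0 : R -> R)) => //.
  move=> t /set_mem[tT nZ]; rewrite (G0 nZ tT) -[LHS](ip0l pL2 (bc.1 t tT)).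
  by [].
apply: (@subspace_continuous_measurable_fun _ Z k mZ).
apply/subspace_continuousP => t Zt; have tT := Zt.1.
apply/cvgrPdist_le => e e0.
have MM : 0 < M + 1 by rewrite ltr_wpDl//; exact: M0 tT.
have e3 : 0 < e / 4 / (M + 1) by rewrite !divr_gt0.
have [phi [tp pb]] := test_dense (bc.1 t tT) e3.
have p2 := test_L2 oO bO tp; have b2 := bc.1 t tT; have [Gt2 GtM] := G2 tT.
have [D1 D10 h1] := bc.2 t tT _ e3.
have n0 : 0 < n2 (D phi) + 1 by rewrite ltr_wpDl ?nrm_ge0.
have [D2' D20 h2] := Wc.2 t tT _ (divr_gt0 (divr_gt0 e0 (ltr0n _ 4)) n0).
apply/nbhs_ballP; exists (Num.min D1 D2'); first by rewrite /= lt_min D10.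
move=> s; rewrite /ball/= lt_min => /andP[s1 s2] Zs; have sT := Zs.1.
have [Gs2 GsM] := G2 sT; have bs2 := bc.1 s sT.
have A := h1 s sT; have B := h2 s sT; rewrite distrC in A; rewrite distrC in B.
(* The remaining term (G(t) - G(s), phi) equals - (W(t) - W(s), D phi); each of the four summands is
   at most e / 4. *)
have -> : k t - k s = ip (G t) (b t - phi) - ip (G s) (b t - phi) - ip (G s) (b s - b t)
   - ip (W t - W s) (D phi).
  rewrite !(ipBr pL2) ?(ipBl pL2)//; try exact: D2; try exact: Wc.1.
  have e1 := GE Zt tp; have e2 := GE Zs tp; rewrite /k; move: e1 e2.
  move: (ip (G t) phi) (ip (G s) phi) (ip (W t) (D phi)) (ip (W s) (D phi))
    (ip (G t) (b t)) (ip (G s) (b t)) (ip (G s) (b s)) => x1 x2 x3 x4 x5 x6 x7 -> ->.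
  by ring.
have CS x y : L2 x -> L2 y -> n2 x <= M -> n2 y <= e / 4 / (M + 1) -> `|ip x y| <= e / 4.
  move=> x2 y2 xM ye; apply: le_trans (cauchy_schwarz pL2 x2 y2) _.
  apply: le_trans (ler_pM (nrm_ge0 _ _) (nrm_ge0 _ _) xM ye) _.
  rewrite mulrC mulrAC ler_pdivrMr//; apply: ler_wpM2l; first by rewrite divr_ge0// ltW.
  by rewrite lerDl.
have bp2 := phB pL2 b2 p2; rewrite (nrmBC pL2)// in pb.
have c1 := CS _ _ Gt2 bp2 GtM pb; have c2 := CS _ _ Gs2 bp2 GsM pb.
have c3 := CS _ _ Gs2 (phB pL2 bs2 b2) GsM (A s1).
have c4 : `|ip (W t - W s) (D phi)| <= e / 4.
  have Wt2 := Wc.1 t tT; have Ws2 := Wc.1 s sT.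
  apply: le_trans (cauchy_schwarz pL2 (phB pL2 Wt2 Ws2) (D2 tp)) _.
  have := B s2; rewrite (nrmBC pL2)// => h; apply: le_trans (ler_wpM2r (nrm_ge0 _ _) h) _.
  rewrite mulrAC ler_pdivrMr//; apply: ler_wpM2l; first by rewrite divr_ge0// ltW.
  by rewrite lerDl.
exact: normB4_le c1 c2 c3 c4.
Qed.

End weak_gradient.

(** * The Lax-Milgram theorem with parameters *)

Section lax_milgram.
Context {R : realType} {E : lmodType R} {d : nat}.
Variables (T : R) (H L : set E) (ip ip2 : E -> E -> R) (D : 'I_d -> E -> E).
Implicit Types (x y z g : E) (G : 'I_d -> E) (s t : R) (i : 'I_d) (M : R -> E -> E).
Local Notation nV := (nrm ip).
Local Notation n2 := (nrm ip2).
Local Notation ccV := (ccont T H ip).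
Local Notation cc2 := (ccont T L ip2).

(* For V = H^1_0 and L = L^2, [D i] is the [i]-th weak partial derivative, which
   is linear only almost everywhere; hence the linearity tested against [g]. *)
Record gelfand : Prop := Gelfand {
  gf_pH : prehilbert H ip ;
  gf_cH : nrm_complete H ip ;
  gf_pL : prehilbert L ip2 ;
  gf_cL : nrm_complete L ip2 ;
  gf_HL : forall x, H x -> L x ;
  gf_DL : forall i x, H x -> L (D i x) ;
  gf_Dlin : forall i k x y g, H x -> H y -> L g ->
    ip2 (D i (k *: x + y)) g = k * ip2 (D i x) g + ip2 (D i y) g ;
  gf_ipE : forall x y, H x -> H y ->
    ip x y = ip2 x y + \sum_(i < d) ip2 (D i x) (D i y) }.

(* The properties of the multiplication by a coefficient rho(t), eta(t) or
   kappa(t); the lower bound [c] is negative for the multiplication by rho'(t). *)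
Record mult (c C : R) M : Prop := Mult {
  mu_C0 : 0 <= C ;
  mu_cc : forall g : R -> E, cc2 g -> cc2 (fun t => M t (g t)) ;
  mu_L : forall t x, t \in `[0, T] -> L x -> L (M t x) ;
  mu_lin : forall t k x y, t \in `[0, T] -> L x -> L y ->
    M t (k *: x + y) = k *: M t x + M t y ;
  mu_sym : forall t x y, t \in `[0, T] -> L x -> L y -> ip2 (M t x) y = ip2 x (M t y) ;
  mu_le : forall t x, t \in `[0, T] -> L x -> n2 (M t x) <= C * n2 x ;
  mu_ge : forall t x, t \in `[0, T] -> L x -> c * ip2 x x <= ip2 (M t x) x }.

Hypothesis gf : gelfand.
Let pH := gf_pH gf.
Let pL := gf_pL gf.
Let HL := gf_HL gf.
Let DL := gf_DL gf.

Lemma DlinE i k x y : H x -> H y -> n2 (D i (k *: x + y) - (k *: D i x + D i y)) = 0.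
Proof.
move=> Hx Hy; have Hxy : H (k *: x + y) by apply: (phD pH) => //; exact: (phZ pH).
have kx := phZ pL k (DL i Hx); have l1 := phD pL kx (DL i Hy).
have l2 := phB pL (DL i Hxy) l1.
apply/eqP; rewrite eq_le nrm_ge0 andbT; apply: (nrm_le_dual pL l2) => // g Lg.
rewrite (ipBl pL (DL i Hxy) l1 Lg) (gf_Dlin gf)// (ipDl pL kx (DL i Hy) Lg) (ipZl pL k (DL i Hx) Lg).
by rewrite subrr normr0 mul0r.
Qed.

Lemma n2_le x : H x -> n2 x <= nV x.
Proof.
move=> Hx; rewrite /nrm ler_wsqrtr// (gf_ipE gf Hx Hx) lerDl sumr_ge0// => i _.
exact: (ip_ge0 pL (DL i Hx)).
Qed.

Lemma nD_le i x : H x -> n2 (D i x) <= nV x.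
Proof.
move=> Hx; rewrite /nrm ler_wsqrtr// (gf_ipE gf Hx Hx) (bigD1 i)//= addrCA lerDl.
rewrite addr_ge0 ?(ip_ge0 pL (HL Hx))// sumr_ge0// => j _.
exact: (ip_ge0 pL (DL j Hx)).
Qed.

Lemma nDB i x y : H x -> H y -> n2 (D i x - D i y) <= nV (x - y).
Proof.
move=> Hx Hy; have Hxy := phB pH Hx Hy; apply: le_trans (nD_le i Hxy).
have := DlinE i (-1) Hy Hx; rewrite !scaleN1r ![- _ + _]addrC => h.
have l1 := phB pL (DL i Hx) (DL i Hy).
have := nrmB_trans pL l1 (ph0 pL) (DL i Hxy); rewrite !subr0 (nrmBC pL l1 (DL i Hxy)).
by rewrite h add0r.
Qed.

Lemma ccV_cc2 u : ccV u -> cc2 u.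
Proof.
move=> [Hu cu]; split=> [t tT|t tT e e0]; first exact/HL/Hu.
have [D' D0 h] := cu t tT e e0; exists D' => // s sT st.
by apply: le_trans (n2_le (phB pH (Hu s sT) (Hu t tT))) (h s sT st).
Qed.

Lemma ccV_D i u : ccV u -> cc2 (fun t => D i (u t)).
Proof.
move=> [Hu cu]; split=> [t tT|t tT e e0]; first exact/DL/Hu.
have [D' D0 h] := cu t tT e e0; exists D' => // s sT st.
by apply: le_trans (nDB i (Hu s sT) (Hu t tT)) (h s sT st).
Qed.

(** The functional g - div G in H^-1, represented by its L^2 components; [dualn] dominates its dual
    norm. *)
Definition dualp g G y : R := ip2 g y + \sum_(i < d) ip2 (G i) (D i y).
Definition dualn g G : R := n2 g + \sum_(i < d) n2 (G i).

Lemma dualn_ge0 g G : 0 <= dualn g G.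
Proof. by rewrite addr_ge0 ?nrm_ge0 ?sumr_ge0// => i _; exact: nrm_ge0. Qed.

Lemma dualp_le g G y : L g -> (forall i, L (G i)) -> H y -> `|dualp g G y| <= dualn g G * nV y.
Proof.
move=> Lg LG Hy; apply: le_trans (ler_normD _ _) _; rewrite mulrDl; apply: lerD.
  apply: le_trans (cauchy_schwarz pL Lg (HL Hy)) _.
  by apply: ler_wpM2l; [exact: nrm_ge0|exact: n2_le].
apply: le_trans (ler_norm_sum _ _ _) _; rewrite mulr_suml; apply: ler_sum => i _.
apply: le_trans (cauchy_schwarz pL (LG i) (DL i Hy)) _.
by apply: ler_wpM2l; [exact: nrm_ge0|exact: nD_le].
Qed.

Lemma dualp_linr g G k x y : L g -> (forall i, L (G i)) -> H x -> H y ->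
  dualp g G (k *: x + y) = k * dualp g G x + dualp g G y.
Proof.
move=> Lg LG Hx Hy; rewrite /dualp (ipDr pL (phZ pL k (HL Hx)) (HL Hy) Lg) (ipZr pL k Lg (HL Hx)).
have -> : \sum_(i < d) ip2 (G i) (D i (k *: x + y)) =
    k * \sum_(i < d) ip2 (G i) (D i x) + \sum_(i < d) ip2 (G i) (D i y).
  rewrite mulr_sumr -big_split/=; apply: eq_bigr => i _.
  have Hxy : H (k *: x + y) by apply: (phD pH) => //; exact: (phZ pH).
  rewrite (ipC pL (LG i) (DL i Hxy)) (gf_Dlin gf)// (ipC pL (DL i Hx) (LG i)).
  by rewrite (ipC pL (DL i Hy) (LG i)).
by rewrite mulrDr addrACA.
Qed.

Lemma dualp_linl g G g' G' k y : L g -> (forall i, L (G i)) -> L g' -> (forall i, L (G' i)) ->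
  H y -> dualp (k *: g + g') (fun i => k *: G i + G' i) y = k * dualp g G y + dualp g' G' y.
Proof.
move=> Lg LG Lg' LG' Hy; rewrite /dualp (ipDl pL (phZ pL k Lg) Lg' (HL Hy)) (ipZl pL k Lg (HL Hy)).
have -> : \sum_(i < d) ip2 (k *: G i + G' i) (D i y) =
    k * \sum_(i < d) ip2 (G i) (D i y) + \sum_(i < d) ip2 (G' i) (D i y).
  rewrite mulr_sumr -big_split/=; apply: eq_bigr => i _.
  by rewrite (ipDl pL (phZ pL k (LG i)) (LG' i) (DL i Hy)) (ipZl pL k (LG i) (DL i Hy)).
by rewrite mulrDr addrACA.
Qed.

Lemma dualpB g G g' G' y : L g -> (forall i, L (G i)) -> L g' -> (forall i, L (G' i)) ->
  H y -> dualp (g - g') (fun i => G i - G' i) y = dualp g G y - dualp g' G' y.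
Proof.
move=> Lg LG Lg' LG' Hy; have := dualp_linl (-1) Lg' LG' Lg LG Hy.
rewrite scaleN1r mulN1r addrC [RHS]addrC => <-; congr (dualp _ _ _).
by apply/funext => i; rewrite scaleN1r addrC.
Qed.

Lemma fin_delta (t : R) (Q : 'I_d -> R -> Prop) :
  (forall i, exists2 e, 0 < e & forall s, `|s - t| < e -> Q i s) ->
  exists2 e, 0 < e & forall s, `|s - t| < e -> forall i, Q i s.
Proof.
move=> h; suff [e e0 he] : exists2 e, 0 < e & forall s, `|s - t| < e ->
    forall i, i \in enum 'I_d -> Q i s.
  by exists e => // s st i; apply: (he s st); rewrite mem_enum.
elim: (enum 'I_d) => [|i l [e e0 he]]; first by exists 1.
have [e' e'0 he'] := h i; exists (Num.min e e'); first by rewrite lt_min e0.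
move=> s; rewrite lt_min => /andP[h1 h2] j; rewrite in_cons => /orP[/eqP ->|]; first exact: he'.
exact: he.
Qed.

Lemma dualn_cc (g : R -> E) (G : R -> 'I_d -> E) t e : cc2 g -> (forall i, cc2 (fun t => G t i)) ->
  t \in `[0, T] -> 0 < e -> exists2 D', 0 < D' & forall s, s \in `[0, T] -> `|s - t| < D' ->
    dualn (g s - g t) (fun i => G s i - G t i) <= e.
Proof.
move=> gc Gc tT e0; have ed : 0 < e / d.+1%:R by rewrite divr_gt0.
have [D1 D10 h1] := gc.2 t tT _ ed.
have [D2 D20 h2] := @fin_delta t (fun i s => s \in `[0, T] -> n2 (G s i - G t i) <= e / d.+1%:R)
  (fun i => let: ex_intro2 D' D0 h := (Gc i).2 t tT _ ed in ex_intro2 _ _ D' D0 (fun s st sT => h s sT st)).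
exists (Num.min D1 D2); first by rewrite lt_min D10.
move=> s sT; rewrite lt_min => /andP[s1 s2].
apply: (@le_trans _ _ (e / d.+1%:R + \sum_(i < d) e / d.+1%:R)).
  by apply: lerD; [exact: h1|apply: ler_sum => i _; exact: h2].
by rewrite sumr_const card_ord -mulrS -[leLHS]mulr_natr divfK// pnatr_eq0.
Qed.

Section form.
Variables (r0 r1 e0 e1 : R) (Mr Me : R -> E -> E).
Hypotheses (hr : mult r0 r1 Mr) (he : mult e0 e1 Me) (r00 : 0 < r0) (e00 : 0 < e0).

Definition aform t x y := dualp (Mr t x) (fun i => Me t (D i x)) y.
Let c := Num.min r0 e0.

Lemma aform_c0 : 0 < c. Proof. by rewrite /c lt_min r00. Qed.

Lemma aform_C t x y : t \in `[0, T] -> H x -> H y -> aform t x y = aform t y x.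
Proof.
move=> tT Hx Hy; rewrite /aform /dualp; congr (_ + _).
  by rewrite (mu_sym hr)// ?(ipC pL (HL Hx))//; [exact: (mu_L hr tT (HL Hy))|exact: HL|exact: HL].
apply: eq_bigr => i _; rewrite (mu_sym he tT (DL i Hx) (DL i Hy)).
exact: (ipC pL (DL i Hx) (mu_L he tT (DL i Hy))).
Qed.

Lemma aform_linr t k x y z : t \in `[0, T] -> H x -> H y -> H z ->
  aform t z (k *: x + y) = k * aform t z x + aform t z y.
Proof.
move=> tT Hx Hy Hz; apply: dualp_linr => //; first exact: (mu_L hr tT (HL Hz)).
by move=> i; exact: (mu_L he tT (DL i Hz)).
Qed.

Lemma aform_linl t k x y z : t \in `[0, T] -> H x -> H y -> H z ->
  aform t (k *: x + y) z = k * aform t x z + aform t y z.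
Proof.
move=> tT Hx Hy Hz; have Hxy : H (k *: x + y) by apply: (phD pH) => //; exact: (phZ pH).
by rewrite aform_C// aform_linr// (aform_C tT Hz Hx) (aform_C tT Hz Hy).
Qed.

Lemma aform_ge t x : t \in `[0, T] -> H x -> c * nV x ^+ 2 <= aform t x x.
Proof.
move=> tT Hx; rewrite (nrm_sqr pH Hx) (gf_ipE gf Hx Hx) mulrDr; apply: lerD.
  apply: le_trans (mu_ge hr tT (HL Hx)); apply: ler_wpM2r; first exact: (ip_ge0 pL (HL Hx)).
  by rewrite /c ge_min lexx.
rewrite mulr_sumr; apply: ler_sum => i _.
apply: le_trans (mu_ge he tT (DL i Hx)); apply: ler_wpM2r; first exact: (ip_ge0 pL (DL i Hx)).
by rewrite /c ge_min lexx orbT.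
Qed.

Lemma aform_le t x y : t \in `[0, T] -> H x -> H y ->
  `|aform t x y| <= (r1 + d%:R * e1) * nV x * nV y.
Proof.
move=> tT Hx Hy; apply: le_trans (dualp_le _ _ Hy) _; [exact: (mu_L hr tT (HL Hx))| |].
  by move=> i; exact: (mu_L he tT (DL i Hx)).
apply: ler_wpM2r; first exact: nrm_ge0.
rewrite mulrDl; apply: lerD.
  apply: le_trans (mu_le hr tT (HL Hx)) _; apply: ler_wpM2l; [exact: mu_C0 hr|exact: n2_le].
have -> : d%:R * e1 * nV x = \sum_(i < d) (e1 * nV x).
  by rewrite sumr_const card_ord -mulrA mulr_natl.
apply: ler_sum => i _; apply: le_trans (mu_le he tT (DL i Hx)) _.
by apply: ler_wpM2l; [exact: mu_C0 he|exact: nD_le].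
Qed.

(** The form is symmetric, so the Lax-Milgram theorem is Riesz's theorem for A_t taken as inner
    product; [aform_nrm] makes its norm equivalent to that of H and transfers completeness. *)
Lemma aform_prehilbert t : t \in `[0, T] -> prehilbert H (aform t).
Proof.
move=> tT; have H0 := ph0 pH.
have f0 y : H y -> aform t 0 y = 0.
  move=> Hy; have := aform_linl 1 tT H0 H0 Hy; rewrite scaler0 addr0 mul1r => h.
  by apply/eqP; rewrite -[X in X == _](addrK (aform t 0 y)) -{1}h subrr.
split.
- exact: H0.
- exact: phD pH.
- by move=> k x; exact: (phZ pH).
- by move=> x y; exact: aform_C.
- by move=> x y z Hx Hy Hz; have := aform_linl 1 tT Hx Hy Hz; rewrite scale1r mul1r.
- by move=> k x y Hx Hy; have := aform_linl k tT Hx H0 Hy; rewrite addr0 f0// addr0.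
- move=> x Hx; apply: le_trans (aform_ge tT Hx); rewrite mulr_ge0 ?sqr_ge0//.
  exact: ltW aform_c0.
Qed.

Lemma aform_nrm t x : t \in `[0, T] -> H x ->
  Num.sqrt c * nV x <= nrm (aform t) x /\
  nrm (aform t) x <= Num.sqrt (r1 + d%:R * e1) * nV x.
Proof.
move=> tT Hx; have c0 := ltW aform_c0; have K0 : 0 <= r1 + d%:R * e1.
  by rewrite addr_ge0 ?(mu_C0 hr)// mulr_ge0// (mu_C0 he).
have sq K : 0 <= K -> Num.sqrt K * nV x = Num.sqrt (K * nV x ^+ 2).
  by move=> K0'; rewrite sqrtrM// sqrtr_sqr ger0_norm ?nrm_ge0.
rewrite !sq// /nrm; split; apply: ler_wsqrtr; first exact: aform_ge.
by apply: le_trans (ler_norm _) _; rewrite expr2 mulrA; exact: aform_le.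
Qed.

Lemma aform_complete t : t \in `[0, T] -> nrm_complete H (aform t).
Proof.
move=> tT u Hu Cu; have sc : 0 < Num.sqrt c by rewrite sqrtr_gt0 aform_c0.
have [|l [Hl ul]] := gf_cH gf Hu.
  move=> e ep; have [N hN] := Cu _ (mulr_gt0 sc ep); exists N => m n Nm Nn.
  have [h _] := aform_nrm tT (phB pH (Hu m) (Hu n)).
  by have := le_trans h (hN m n Nm Nn); rewrite ler_pM2l.
exists l; split => // e ep; set K := Num.sqrt (r1 + d%:R * e1).
have K1 : 0 < K + 1 by rewrite ltr_wpDl// sqrtr_ge0.
have [N hN] := ul _ (divr_gt0 ep K1); exists N => n Nn.
have [_ h] := aform_nrm tT (phB pH (Hu n) Hl); apply: le_trans h _.
apply: le_trans (ler_wpM2l (sqrtr_ge0 _) (hN n Nn)) _; rewrite -/K mulrA ler_pdivrMr// mulrC.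
by apply: ler_wpM2l; [exact: ltW|rewrite lerDl].
Qed.

Definition lm t g G := xget 0 [set x | H x /\ forall y, H y -> aform t x y = dualp g G y].

Lemma lmP t g G : t \in `[0, T] -> L g -> (forall i, L (G i)) ->
  H (lm t g G) /\ forall y, H y -> aform t (lm t g G) y = dualp g G y.
Proof.
move=> tT Lg LG; rewrite /lm; case: xgetP => [x _ //|nx]; exfalso.
have sc : 0 < Num.sqrt c by rewrite sqrtr_gt0 aform_c0.
have [|||x [Hx xF]] := riesz (aform_prehilbert tT) (aform_complete tT) (F := dualp g G)
    (C := dualn g G / Num.sqrt c).
- by move=> x y Hx Hy; have := dualp_linr 1 Lg LG Hx Hy; rewrite scale1r mul1r.
- move=> k x Hx; have F0 : dualp g G 0 = 0.
    have := dualp_linr 1 Lg LG (ph0 pH) (ph0 pH); rewrite scaler0 addr0 mul1r => h.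
    by apply/eqP; rewrite -[X in X == _](addrK (dualp g G 0)) -{1}h subrr.
  by have := dualp_linr k Lg LG Hx (ph0 pH); rewrite !addr0 F0 addr0.
- move=> x Hx; apply: le_trans (dualp_le Lg LG Hx) _; rewrite -mulrA.
  apply: ler_wpM2l; first exact: dualn_ge0.
  by rewrite mulrC ler_pdivlMr// mulrC; case: (aform_nrm tT Hx).
by apply: (nx x).
Qed.

Lemma lm_le t g G x : t \in `[0, T] -> L g -> (forall i, L (G i)) -> H x ->
  (forall y, H y -> aform t x y = dualp g G y) -> nV x <= dualn g G / c.
Proof.
move=> tT Lg LG Hx h; have [->|x0] := eqVneq (nV x) 0.
  by rewrite divr_ge0 ?dualn_ge0// ltW// aform_c0.
have xp : 0 < nV x by rewrite lt_neqAle eq_sym x0 nrm_ge0.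
rewrite ler_pdivlMr ?aform_c0// -(ler_pM2r xp) -mulrA [nV x * _]mulrC -mulrA -expr2 mulrC.
apply: le_trans (le_trans (ler_norm _) (dualp_le Lg LG Hx)); rewrite -(h x Hx).
by rewrite mulrC; exact: aform_ge.
Qed.

Lemma aformB t x y z : t \in `[0, T] -> H x -> H y -> H z ->
  aform t (x - y) z = aform t x z - aform t y z.
Proof.
by move=> tT Hx Hy Hz; have := aform_linl (-1) tT Hy Hx Hz; rewrite scaleN1r mulN1r addrC [RHS]addrC.
Qed.

Lemma lmB_le t g G g' G' : t \in `[0, T] -> L g -> (forall i, L (G i)) ->
  L g' -> (forall i, L (G' i)) ->
  nV (lm t g G - lm t g' G') <= dualn (g - g') (fun i => G i - G' i) / c.
Proof.
move=> tT Lg LG Lg' LG'; have [H1 h1] := lmP tT Lg LG; have [H2 h2] := lmP tT Lg' LG'.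
apply: (lm_le tT) => //; [exact: (phB pL)|by move=> i; exact: (phB pL)|exact: (phB pH)|].
by move=> y Hy; rewrite aformB// h1// h2// dualpB.
Qed.

(** With x the solution at time t, the difference of the solutions at s and t solves the problem at
    time s with data g(s) - Mr(s) x and G(s) - Me(s) D x. These data are continuous in s and give
    the zero functional at s = t. The coefficients are thus only applied to fixed vectors. *)
Lemma lm_cc (g : R -> E) (G : R -> 'I_d -> E) : cc2 g -> (forall i, cc2 (fun t => G t i)) ->
  ccV (fun t => lm t (g t) (G t)).
Proof.
move=> gc Gc; have LG t : t \in `[0, T] -> forall i, L (G t i).
  by move=> tT i; exact: ((Gc i).1 t tT).
split=> [t tT|t tT e ep]; first exact: (lmP tT (gc.1 t tT) (LG t tT)).1.
have c0 := aform_c0.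
have [Hx hx] := lmP tT (gc.1 t tT) (LG t tT); set x := lm t (g t) (G t) in Hx hx *.
pose r s := g s - Mr s x; pose Q s i := G s i - Me s (D i x).
have rc : cc2 r by apply: (ccontB pL gc); exact: (mu_cc hr (ccont_cst T pL (HL Hx))).
have Qc i : cc2 (fun s => Q s i).
  by apply: (ccontB pL (Gc i)); exact: (mu_cc he (ccont_cst T pL (DL i Hx))).
have [D' D0 hD] := dualn_cc rc Qc tT (mulr_gt0 ep c0); exists D' => // s sT st.
have [Hs hs] := lmP sT (gc.1 s sT) (LG s sT); set y := lm s (g s) (G s) in Hs hs *.
have Hyx := phB pH Hs Hx.
have l1 := rc.1 s sT; have l2 := rc.1 t tT.
have l3 i : L (Q s i) := (Qc i).1 s sT; have l4 i : L (Q t i) := (Qc i).1 t tT.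
rewrite -(ler_pM2r c0); apply: le_trans (hD s sT st); rewrite -ler_pdivlMr//.
apply: (lm_le sT) => //; [exact: (phB pL)|by move=> i; exact: (phB pL)|].
move=> z Hz; rewrite aformB// hs// dualpB//.
have mx1 := mu_L hr sT (HL Hx); have mx2 := mu_L hr tT (HL Hx).
have -> : dualp (r s) (Q s) z = dualp (g s) (G s) z - aform s x z.
  by rewrite dualpB//; [exact: (gc.1 s sT)|exact: (LG s sT)|move=> i; exact: (mu_L he sT (DL i Hx))].
have -> : dualp (r t) (Q t) z = dualp (g t) (G t) z - aform t x z.
  by rewrite dualpB//; [exact: (gc.1 t tT)|exact: (LG t tT)|move=> i; exact: (mu_L he tT (DL i Hx))].
by rewrite (hx z Hz) subrr subr0.
Qed.

End form.

Lemma mult_id : mult 1 1 (fun _ x => x).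
Proof. by split=> // t x; rewrite mul1r. Qed.

(** The Riesz map for the inner product of H itself: with identity multipliers the form is that
    inner product, and the time 0 is a dummy. It converts pairings in L, also with components of
    [D], into pairings in H. *)
Definition rz g G := lm (fun _ x => x) (fun _ x => x) 0 g G.

Hypothesis T0 : 0 <= T.

Lemma rzP g G : L g -> (forall i, L (G i)) ->
  H (rz g G) /\ forall y, H y -> ip (rz g G) y = dualp g G y.
Proof.
move=> Lg LG; have z0 : 0 \in `[0, T] by rewrite in_itv/= lexx.
have [Hx hx] := lmP mult_id mult_id ltr01 ltr01 z0 Lg LG; split => // y Hy.
by rewrite -hx// /aform /dualp -(gf_ipE gf).
Qed.

Lemma rz_cc (g : R -> E) (G : R -> 'I_d -> E) : cc2 g -> (forall i, cc2 (fun t => G t i)) ->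
  ccV (fun t => rz (g t) (G t)).
Proof. by move=> gc Gc; exact: (lm_cc mult_id mult_id ltr01 ltr01 gc Gc). Qed.

End lax_milgram.

(** * The abstract inverse problem *)

Section wint_lin.
Context {R : realType} {E : lmodType R}.
Variables (T : R) (H : set E) (ip : E -> E -> R).
Hypothesis pH : prehilbert H ip.
Notation leb := (@lebesgue_measure R).
Local Notation int f := (leb.-integrable `[0, T] (EFin \o f)).
Local Notation ccont := (ccont T H ip).

Lemma wint_lin (a b : R -> E) (h : R -> R) : ccont a -> ccont b -> int h ->
  exists A B, [/\ 0 <= A, 0 <= B, wint T H ip (fun t => a t + h t *: b t) (fun t => A + B * `|h t|) &
    forall t, t \in `[0, T] -> nrm ip (b t) <= B].
Proof.
move=> ac bc ih; have [A A0 hA] := ccont_bound pH ac; have [B B0 hB] := ccont_bound pH bc.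
exists A, B; split; [exact: ltW|exact: ltW| |exact: hB].
split.
- split=> [t tT|c cc].
    by apply: (phD pH); [exact: ac.1|apply: (phZ pH); exact: bc.1].
  apply: (@eq_measurable_fun _ _ _ _ _ (fun t => ip (a t) (c t) + h t * ip (b t) (c t))).
    move=> t /set_mem tT; have Ha := ac.1 t tT; have Hb := bc.1 t tT; have Hc := cc.1 t tT.
    by rewrite (ipDl pH Ha (phZ pH _ Hb) Hc) (ipZl pH _ Hb Hc).
  apply: measurable_funD; first exact: (ccont_wmeas pH ac).2 cc.
  apply: measurable_funM; first exact: (integrable_measurable ih).
  exact: (ccont_wmeas pH bc).2 cc.
- apply: integrableD_fin => //.
    by apply: continuous_int; apply: continuous_subspaceT => x; exact: cvg_cst.
  by apply: integrableZ_fin => //; exact: integrable_norm_fin.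
- move=> t tT; have Ha := ac.1 t tT; have Hb := bc.1 t tT.
  apply: le_trans (nrmD pH Ha (phZ pH _ Hb)) _; rewrite (nrmZ pH _ Hb) [B * _]mulrC.
  by apply: lerD; [exact: hA|apply: ler_wpM2l => //; exact: hB].
Qed.

End wint_lin.

Lemma sum_cauchy_schwarz {R : realType} (d : nat) (a b : 'I_d -> R) :
  (\sum_(i < d) a i * b i) ^+ 2 <= (\sum_(i < d) a i ^+ 2) * \sum_(i < d) b i ^+ 2.
Proof.
pose ip (x y : 'I_d -> R^o) : R := \sum_(i < d) x i * y i.
have pS : prehilbert setT ip.
  split=> //.
  - by move=> x y _ _; apply: eq_bigr => i _; rewrite mulrC.
  - by move=> x y z _ _ _; rewrite /ip -big_split/=; apply: eq_bigr => i _; rewrite mulrDl.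
  - by move=> k x y _ _; rewrite /ip mulr_sumr; apply: eq_bigr => i _; rewrite mulrA.
  - by move=> x _; apply: sumr_ge0 => i _; rewrite -expr2 sqr_ge0.
have := @ip_sqr_le _ _ _ _ pS a b Logic.I Logic.I.
by rewrite /ip; congr (_ <= _ * _); apply: eq_bigr => i _; rewrite expr2.
Qed.

(** The indefinite integral of h is identically 0 on [0, T], and its derivative is h almost
    everywhere by Lebesgue's differentiation theorem. *)
Lemma I_zero_ae {R : realType} (T : R) (h : R -> R) :
  lebesgue_measure.-integrable `[0, T] (EFin \o h) ->
  (forall t, 0 <= t -> t <= T -> \int[lebesgue_measure]_(x in `]0, t]) h x = 0) ->
  {ae lebesgue_measure, forall t, t \in `]0, T[ -> h t = 0}.
Proof.
move=> hi h0; pose f := h \_ `[0, T].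
have fi : lebesgue_measure.-integrable setT (EFin \o f).
  by rewrite /f -restrict_EFin; apply/integrable_restrict => //; rewrite setTI.
have fS (A : set R) : measurable A -> lebesgue_measure.-integrable A (EFin \o f).
  by move=> mA; apply: integrableS fi.
have lf : locally_integrable setT f.
  split; [exact: integrable_measurable fi|exact: openT|].
  move=> K _ cK; have /integrableP[_] := fS K (compact_measurable cK).
  by [].
have := @FTC1 R f (BLeft 0) (fun y => fS _ (measurable_itv _)) lf.
apply: filterS; first exact: (ae_filter_ringOfSetsType lebesgue_measure).
move=> t ft; rewrite in_itv/= => /andP[t0 tT].
have [|_] := ft.
  by rewrite /= lte_fin.
have F0 x : 0 <= x -> x <= T -> \int[lebesgue_measure]_(r in `[0, x]) f r = 0.
  move=> x0 xT; apply: etrans (h0 x x0 xT); rewrite Rintegral_itv_obnd_cbnd; last first.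
    apply: integrableS hi => //; apply: subset_itv; rewrite ?bnd_simp//.
  apply: eq_Rintegral => r; rewrite inE/= in_itv/= => /andP[r0 rx].
  by rewrite /f patchE mem_set//= in_itv/= r0 (le_trans rx).
have -> : f t = h t by rewrite /f patchE mem_set//= in_itv/= !ltW.
move=> <-; rewrite derive1E; apply: cvg_lim; first exact: Rhausdorff.
apply: cvg_near_cst; apply/nbhs_ballP; exists (Num.min t (T - t)).
  by rewrite /= lt_min t0 subr_gt0.
move=> k; rewrite /ball/= sub0r normrN lt_min ltr_norml ltr_norml => /andP[/andP[k1 k2] /andP[k3 k4]] _.
rewrite /GRing.scale/= mulr1 !F0 ?subrr ?mulr0//; lra.
Qed.

Lemma I_eq_ae {R : realType} (T : R) (f g : R -> R) :
  lebesgue_measure.-integrable `[0, T] (EFin \o f) ->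
  lebesgue_measure.-integrable `[0, T] (EFin \o g) ->
  (forall t, 0 <= t -> t <= T ->
    \int[lebesgue_measure]_(x in `]0, t]) f x = \int[lebesgue_measure]_(x in `]0, t]) g x) ->
  {ae lebesgue_measure, forall t, t \in `]0, T[ -> f t = g t}.
Proof.
move=> fi gi fg; have := @I_zero_ae R T (fun t => f t - g t).
have di : lebesgue_measure.-integrable `[0, T] (EFin \o (fun t => f t - g t)).
  by apply: integrableD_fin => //; exact: integrableN_fin.
move=> /(_ di) h; have {h} : {ae lebesgue_measure, forall t, t \in `]0, T[ -> f t - g t = 0}.
  by apply: h => t t0 tT; rewrite (I_subB fi gi)// fg// subrr.
apply: filterS; first exact: (ae_filter_ringOfSetsType lebesgue_measure).
by move=> t h tT; apply/eqP; rewrite -subr_eq0; apply/eqP; exact: h.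
Qed.

Lemma ae_neq {R : realType} (T : R) : {ae @lebesgue_measure R, forall t, t != T}.
Proof.
exists [set T]; split; [exact: measurable_set1|exact: lebesgue_measure_set1|].
by move=> t /= /negP; rewrite negbK => /eqP.
Qed.

Section core.
Context {R : realType} {E : lmodType R} {d : nat}.
Variables (T : R) (H L : set E) (ip ip2 : E -> E -> R) (D : 'I_d -> E -> E).
Implicit Types (x y z : E) (s t : R) (i : 'I_d).
Notation leb := (@lebesgue_measure R).
Notation I01 := (`[0, T]%classic : set R).
Local Notation int f := (leb.-integrable `[0, T] (EFin \o f)).
Local Notation nV := (nrm ip).
Local Notation n2 := (nrm ip2).
Local Notation ccV := (ccont T H ip).
Local Notation cc2 := (ccont T L ip2).

Hypothesis T0 : 0 < T.
Hypothesis gf : gelfand H L ip ip2 D.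
Let pH := gf_pH gf.
Let pL := gf_pL gf.
Let HL := gf_HL gf.
Let DL := gf_DL gf.

Variables (r0 r1 r0' r1' e0 e1 k0 k1 : R) (Mr Mr' Me Mk : R -> E -> E).
Hypotheses (hr : mult T L ip2 r0 r1 Mr) (hr' : mult T L ip2 r0' r1' Mr').
Hypotheses (he : mult T L ip2 e0 e1 Me) (hk : mult T L ip2 k0 k1 Mk).
Hypotheses (r00 : 0 < r0) (e00 : 0 < e0).
Variables (F : E -> E) (Lf : R).
Hypotheses (Lf0 : 0 <= Lf) (FL : forall x, L x -> L (F x)).
Hypothesis Flip : forall x y, L x -> L y -> n2 (F x - F y) <= Lf * n2 (x - y).
Variables (p wt q : R -> E) (G : R -> 'I_d -> E) (M wm P zeta : R) (m' : R -> R).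
Hypotheses (pc : cc2 p) (wtc : cc2 wt) (qc : cc2 q).
Hypothesis Gw : forall i, wmeas T L ip2 (fun t => G t i).
Hypothesis M0 : 0 <= M.
Hypothesis GM : forall t, t \in `[0, T] -> \sum_(i < d) n2 (G t i) ^+ 2 <= M ^+ 2.
Hypothesis wm0 : 0 < wm.
Hypothesis wbm : forall t, t \in `[0, T] -> wm <= `|ip2 (p t) (wt t)|.
Hypothesis pP : forall t, t \in `[0, T] -> n2 (p t) <= P.
Hypothesis zeta01 : 0 < zeta < 1.
Hypothesis small : P ^+ 2 * ((M ^+ 2 * e1 ^+ 2) / (4 * wm ^+ 2 * e0 * r0)) < zeta.
Hypotheses (im : int m') (im2 : int (fun t => m' t ^+ 2)).

Local Notation lmA := (lm H ip2 D Mr Me).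
Local Notation A := (aform ip2 D Mr Me).
Let c := Num.min r0 e0.
Let c0 : 0 < c. Proof. by rewrite /c lt_min r00. Qed.

(* Since du = aa + h bb, the formula for h is affine in h; solving it for h gives
   [hh] = [num] / [den], and [den] <> 0 by the smallness condition. *)
Definition wb t : R := ip2 (p t) (wt t).
Definition ell t x : R := \sum_(i < d) ip2 (Me t (D i x)) (G t i).
Definition elk t x : R := \sum_(i < d) ip2 (Mk t (D i x)) (G t i).
Definition aa t x : E := lmA t (F x - Mr' t x) (fun i => - Mk t (D i x)).
Definition bb t : E := lmA t (p t) (fun=> 0).
Definition num t x : R :=
  m' t + ip2 x (q t) + ell t (aa t x) + elk t x - ip2 (F x) (wt t).
Definition den t : R := wb t - ell t (bb t).
Definition hh t x : R := num t x / den t.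
Definition Phi t x : E := aa t x + hh t x *: bb t.

Lemma G_L t i : t \in `[0, T] -> L (G t i).
Proof. exact: (Gw i).1. Qed.

Lemma G_le t i : t \in `[0, T] -> n2 (G t i) <= M.
Proof.
move=> tT; rewrite -(@ler_pXn2r _ 2)// ?nnegrE ?nrm_ge0//; apply: le_trans (GM tT).
by rewrite (bigD1 i)//= lerDl sumr_ge0// => j _; exact: sqr_ge0.
Qed.

Lemma F_cc u : cc2 u -> cc2 (F \o u).
Proof.
move=> [Hu cu]; split=> [t tT|t tT e ep]; first exact/FL/Hu.
have L1 : 0 < Lf + 1 by rewrite ltr_wpDl.
have [D' D0 hD] := cu t tT _ (divr_gt0 ep L1); exists D' => // s sT st.
apply: le_trans (Flip (Hu s sT) (Hu t tT)) _.
apply: le_trans (ler_wpM2l Lf0 (hD s sT st)) _; rewrite mulrA ler_pdivrMr// mulrC.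
by apply: ler_wpM2l; [exact: ltW|rewrite lerDl].
Qed.

Lemma fa_L t x : t \in `[0, T] -> H x -> L (F x - Mr' t x).
Proof. by move=> tT Hx; apply: (phB pL); [exact/FL/HL|exact: (mu_L hr' tT (HL Hx))]. Qed.

Lemma ga_L t x i : t \in `[0, T] -> H x -> L (- Mk t (D i x)).
Proof. by move=> tT Hx; apply: (phN pL); exact: (mu_L hk tT (DL i Hx)). Qed.

Lemma aaP t x : t \in `[0, T] -> H x -> H (aa t x) /\ forall y, H y ->
  A t (aa t x) y = dualp ip2 D (F x - Mr' t x) (fun i => - Mk t (D i x)) y.
Proof.
by move=> tT Hx; apply: (lmP gf hr he r00 e00 tT (fa_L tT Hx)) => i; exact: ga_L.
Qed.

Lemma bbP t : t \in `[0, T] -> H (bb t) /\ forall y, H y -> A t (bb t) y = ip2 (p t) y.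
Proof.
move=> tT; have [|Hb hb] := lmP gf hr he r00 e00 tT (pc.1 t tT) (G := fun=> 0).
  by move=> i; exact: (ph0 pL).
split => // y Hy; rewrite hb// /dualp big1 ?addr0// => i _; exact: (ip0l pL (DL i Hy)).
Qed.

Lemma aa_cc u : ccV u -> ccV (fun t => aa t (u t)).
Proof.
move=> uc; have u2 := ccV_cc2 gf uc.
apply: (lm_cc gf hr he r00 e00 (g := fun t => F (u t) - Mr' t (u t))
  (G := fun t i => - Mk t (D i (u t)))).
  by apply: (ccontB pL); [exact: F_cc|exact: (mu_cc hr')].
by move=> i; apply: (ccontN pL); apply: (mu_cc hk); exact: (ccV_D gf).
Qed.

Lemma bb_cc : ccV bb.
Proof.
apply: (lm_cc gf hr he r00 e00 (g := p) (G := fun t i => 0)) => // i.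
exact: (ccont_cst T pL (ph0 pL)).
Qed.

Lemma ell_lin t k x y : t \in `[0, T] -> H x -> H y ->
  ell t (k *: x + y) = k * ell t x + ell t y.
Proof.
move=> tT Hx Hy; rewrite /ell mulr_sumr -big_split/=; apply: eq_bigr => i _.
have Hxy : H (k *: x + y) by apply: (phD pH) => //; exact: (phZ pH).
have Gi := G_L i tT; have MG := mu_L he tT Gi.
rewrite !(mu_sym he tT (DL i _) Gi)//; exact: (gf_Dlin gf).
Qed.

Lemma elk_lin t k x y : t \in `[0, T] -> H x -> H y ->
  elk t (k *: x + y) = k * elk t x + elk t y.
Proof.
move=> tT Hx Hy; rewrite /elk mulr_sumr -big_split/=; apply: eq_bigr => i _.
have Hxy : H (k *: x + y) by apply: (phD pH) => //; exact: (phZ pH).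
have Gi := G_L i tT; have MG := mu_L hk tT Gi.
rewrite !(mu_sym hk tT (DL i _) Gi)//; exact: (gf_Dlin gf).
Qed.

Lemma ell_le t x : t \in `[0, T] -> H x -> `|ell t x| <= d%:R * (e1 * M) * nV x.
Proof.
move=> tT Hx; apply: le_trans (ler_norm_sum _ _ _) _.
have -> : d%:R * (e1 * M) * nV x = \sum_(i < d) (e1 * nV x * M).
  by rewrite sumr_const card_ord -mulrA mulr_natl; congr (_ *+ _); ring.
apply: ler_sum => i _; apply: le_trans (cauchy_schwarz pL (mu_L he tT (DL i Hx)) (G_L i tT)) _.
apply: ler_pM; [exact: nrm_ge0|exact: nrm_ge0| |exact: G_le].
apply: le_trans (mu_le he tT (DL i Hx)) _.
by apply: ler_wpM2l; [exact: mu_C0 he|exact: (nD_le gf)].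
Qed.

Lemma elk_le t x : t \in `[0, T] -> H x -> `|elk t x| <= d%:R * (k1 * M) * nV x.
Proof.
move=> tT Hx; apply: le_trans (ler_norm_sum _ _ _) _.
have -> : d%:R * (k1 * M) * nV x = \sum_(i < d) (k1 * nV x * M).
  by rewrite sumr_const card_ord -mulrA mulr_natl; congr (_ *+ _); ring.
apply: ler_sum => i _; apply: le_trans (cauchy_schwarz pL (mu_L hk tT (DL i Hx)) (G_L i tT)) _.
apply: ler_pM; [exact: nrm_ge0|exact: nrm_ge0| |exact: G_le].
apply: le_trans (mu_le hk tT (DL i Hx)) _.
by apply: ler_wpM2l; [exact: mu_C0 hk|exact: (nD_le gf)].
Qed.

(** With n the L^2 norm of the solution, the energy inequality reads r0 n^2 + e0 S <= P n.
    Completing the square, P n - r0 n^2 <= P^2 / (4 r0), which is the origin of the factor 4 in the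
    smallness condition. *)
Lemma bb_grad t : t \in `[0, T] ->
  \sum_(i < d) n2 (D i (bb t)) ^+ 2 <= P ^+ 2 / (4 * r0 * e0).
Proof.
move=> tT; have [Hb hb] := bbP tT; set S := \sum_(i < d) _.
have h1 : r0 * n2 (bb t) ^+ 2 + e0 * S <= A t (bb t) (bb t).
  rewrite /aform /dualp; apply: lerD.
    by rewrite (nrm_sqr pL (HL Hb)); exact: (mu_ge hr tT (HL Hb)).
  rewrite mulr_sumr; apply: ler_sum => i _.
  by rewrite (nrm_sqr pL (DL i Hb)); exact: (mu_ge he tT (DL i Hb)).
have h2 : A t (bb t) (bb t) <= P * n2 (bb t).
  rewrite hb//; apply: le_trans (ler_norm _) _.
  apply: le_trans (cauchy_schwarz pL (pc.1 t tT) (HL Hb)) _.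
  by apply: ler_wpM2r; [exact: nrm_ge0|exact: pP].
have re : 0 < 4 * r0 * e0 by rewrite !mulr_gt0.
rewrite ler_pdivlMr//.
have h3 : 0 <= (P - 2 * r0 * n2 (bb t)) ^+ 2 by exact: sqr_ge0.
have h4 : 4 * r0 * (r0 * n2 (bb t) ^+ 2 + e0 * S) <= 4 * r0 * (P * n2 (bb t)).
  by apply: ler_wpM2l; [rewrite mulr_ge0// ltW|exact: le_trans h1 h2].
have -> : S * (4 * r0 * e0) = 4 * r0 * (r0 * n2 (bb t) ^+ 2 + e0 * S) - 4 * r0 ^+ 2 * n2 (bb t) ^+ 2 by ring.
apply: le_trans (lerD h4 (lexx _)) _; rewrite -subr_ge0; apply: le_trans h3 _.
by rewrite le_eqVlt; apply/orP; left; apply/eqP; ring.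
Qed.

Lemma ell_bb t : t \in `[0, T] -> `|ell t (bb t)| <= Num.sqrt zeta * wm.
Proof.
move=> tT; have [Hb hb] := bbP tT; have /andP[z0 z1] := zeta01.
rewrite -(@ler_pXn2r _ 2)// ?nnegrE ?mulr_ge0 ?sqrtr_ge0 ?(ltW wm0)//.
rewrite exprMn sqr_sqrtr ?(ltW z0)//.
have h1 : `|ell t (bb t)| <= e1 * \sum_(i < d) n2 (D i (bb t)) * n2 (G t i).
  apply: le_trans (ler_norm_sum _ _ _) _; rewrite mulr_sumr; apply: ler_sum => i _.
  apply: le_trans (cauchy_schwarz pL (mu_L he tT (DL i Hb)) (G_L i tT)) _.
  by rewrite mulrA; apply: ler_wpM2r; [exact: nrm_ge0|exact: (mu_le he tT (DL i Hb))].
(* Cauchy-Schwarz over the components keeps the constant independent of d; the cruder bound [ell_le]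
   would lose a factor d. *)
have h2 := sum_cauchy_schwarz (fun i => n2 (D i (bb t))) (fun i => n2 (G t i)).
have h3 : `|ell t (bb t)| ^+ 2 <= e1 ^+ 2 * (P ^+ 2 / (4 * r0 * e0) * M ^+ 2).
  apply: (@le_trans _ _ ((e1 * \sum_(i < d) n2 (D i (bb t)) * n2 (G t i)) ^+ 2)).
    rewrite lerXn2r ?nnegrE//; exact: le_trans (normr_ge0 _) h1.
  rewrite exprMn; apply: ler_wpM2l; first exact: sqr_ge0.
  apply: le_trans h2 _; apply: ler_pM; [| |exact: bb_grad|exact: GM].
    by apply: sumr_ge0 => i _; exact: sqr_ge0.
  by apply: sumr_ge0 => i _; exact: sqr_ge0.
apply: le_trans h3 _; have w2 : 0 < wm ^+ 2 by rewrite exprn_gt0.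
rewrite -ler_pdivrMr//; apply: ltW; apply: le_lt_trans small.
rewrite le_eqVlt; apply/orP; left; apply/eqP; field.
by rewrite !gt_eqF.
Qed.

(** The uniform lower bound for |[den]| left over by the smallness condition: |[wb]| is at least wm,
    and the subtracted term is at most sqrt(zeta) wm. *)
Let dm := wm * (1 - Num.sqrt zeta).

Lemma dm0 : 0 < dm.
Proof.
have /andP[z0 z1] := zeta01; rewrite /dm mulr_gt0// subr_gt0.
by rewrite -sqrtr1 ltr_sqrt.
Qed.

Lemma den_ge t : t \in `[0, T] -> dm <= `|den t|.
Proof.
move=> tT; have h1 := wbm tT; have h2 := ell_bb tT.
have := ler_normD (den t) (ell t (bb t)); rewrite /den subrK -/(wb t) => h3.
rewrite /dm; move: h1 h2 h3; rewrite -/(wb t).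
move: `|wb t| `|ell t (bb t)| `|wb t - _| (Num.sqrt zeta) => x1 x2 x3 x4 h1 h2 h3.
by apply: (@le_trans _ _ (x1 - x2)); [nra|lra].
Qed.

Lemma den_neq0 t : t \in `[0, T] -> den t != 0.
Proof. by move=> tT; rewrite -normr_gt0; exact: lt_le_trans dm0 (den_ge tT). Qed.

Lemma pair_G_meas i (g : R -> E) : cc2 g -> measurable_fun I01 (fun t => ip2 (g t) (G t i)).
Proof.
move=> gc; apply: (@eq_measurable_fun _ _ _ _ _ (fun t => ip2 (G t i) (g t))).
  by move=> t /set_mem tT; rewrite (ipC pL (G_L i tT) (gc.1 t tT)).
exact: (Gw i).2 gc.
Qed.

Lemma ell_meas u : ccV u -> measurable_fun I01 (fun t => ell t (u t)).
Proof.
move=> uc; apply: measurable_sum => i; apply: pair_G_meas; apply: (mu_cc he).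
exact: (ccV_D gf).
Qed.

Lemma elk_meas u : ccV u -> measurable_fun I01 (fun t => elk t (u t)).
Proof.
move=> uc; apply: measurable_sum => i; apply: pair_G_meas; apply: (mu_cc hk).
exact: (ccV_D gf).
Qed.

Lemma cc2_meas (f g : R -> E) : cc2 f -> cc2 g -> measurable_fun I01 (fun t => ip2 (f t) (g t)).
Proof. by move=> fc gc; exact: (ccont_wmeas pL fc).2 gc. Qed.

Lemma hh_meas u : ccV u -> measurable_fun I01 (fun t => hh t (u t)).
Proof.
move=> uc; have u2 := ccV_cc2 gf uc.
apply: measurable_funM.
  apply: measurable_funB; last exact: cc2_meas (F_cc u2) wtc.
  apply: measurable_funD; last exact: elk_meas.
  apply: measurable_funD; last exact: ell_meas (aa_cc uc).
  apply: measurable_funD; last exact: cc2_meas.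
  exact: (integrable_measurable im).
apply: (measurableT_comp measurable_inv).
apply: measurable_funB; first exact: cc2_meas.
exact: ell_meas bb_cc.
Qed.

Lemma aa_lip t x y : t \in `[0, T] -> H x -> H y ->
  nV (aa t x - aa t y) <= (Lf + r1' + d%:R * k1) / c * nV (x - y).
Proof.
move=> tT Hx Hy; have Hxy := phB pH Hx Hy; have L1 := HL Hx; have L2 := HL Hy.
have h := lmB_le gf hr he r00 e00 tT (fa_L tT Hx) (fun i => ga_L i tT Hx)
  (fa_L tT Hy) (fun i => ga_L i tT Hy).
apply: le_trans h _; rewrite mulrAC ler_pdivlMr// divfK ?gt_eqF//.
rewrite /dualn mulrDl; apply: lerD.
  have E1 : F x - Mr' t x - (F y - Mr' t y) = (F x - F y) - Mr' t (x - y).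
    have := mu_lin hr' (-1) tT L2 L1; rewrite !scaleN1r ![- _ + _]addrC => ->.
    by rewrite !opprB addrACA [RHS]addrACA; congr (_ + _); rewrite addrC.
  have l1 := phB pL (FL L1) (FL L2); have l2 := phB pL L1 L2.
  rewrite E1 mulrDl; apply: le_trans (nrmB pL l1 (mu_L hr' tT l2)) _; apply: lerD.
    apply: le_trans (Flip L1 L2) _; apply: ler_wpM2l => //; exact: (n2_le gf).
  apply: le_trans (mu_le hr' tT l2) _; apply: ler_wpM2l; [exact: mu_C0 hr'|exact: (n2_le gf)].
have -> : d%:R * k1 * nV (x - y) = \sum_(i < d) (k1 * nV (x - y)).
  by rewrite sumr_const card_ord -mulrA mulr_natl.
apply: ler_sum => i _.
have l2 := phB pL (DL i Hx) (DL i Hy).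
have E1 : - Mk t (D i x) - - Mk t (D i y) = - (Mk t (D i x - D i y)).
  have := mu_lin hk (-1) tT (DL i Hy) (DL i Hx).
  rewrite !scaleN1r [- D i y + _]addrC [- Mk t (D i y) + _]addrC => ->.
  by rewrite opprB opprK addrC.
rewrite E1 (nrmN pL (mu_L hk tT l2)); apply: le_trans (mu_le hk tT l2) _.
by apply: ler_wpM2l; [exact: mu_C0 hk|exact: (nDB gf)].
Qed.

Lemma num_lip : exists2 K, 0 <= K & forall t x y, t \in `[0, T] -> H x -> H y ->
  `|num t x - num t y| <= K * nV (x - y).
Proof.
have [Q Q0 hQ] := ccont_bound pL qc; have [W W0 hW] := ccont_bound pL wtc.
pose La := (Lf + r1' + d%:R * k1) / c.
have La0 : 0 <= La.
  by rewrite /La divr_ge0 ?(ltW c0)// !addr_ge0// ?(mu_C0 hr')// mulr_ge0// (mu_C0 hk).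
exists (Q + d%:R * (e1 * M) * La + d%:R * (k1 * M) + Lf * W).
  have e10 := mu_C0 he; have k10 := mu_C0 hk.
  apply: addr_ge0; last by apply: mulr_ge0 => //; exact: ltW.
  apply: addr_ge0; last by apply: mulr_ge0 => //; exact: mulr_ge0.
  apply: addr_ge0; first exact: ltW.
  by apply: mulr_ge0 => //; apply: mulr_ge0 => //; exact: mulr_ge0.
move=> t x y tT Hx Hy; have Hxy := phB pH Hx Hy; have L1 := HL Hx; have L2 := HL Hy.
have [Ha _] := aaP tT Hx; have [Hb _] := aaP tT Hy; have Hab := phB pH Ha Hb.
have E1 : num t x - num t y = ip2 (x - y) (q t) + ell t (aa t x - aa t y) +
    elk t (x - y) - ip2 (F x - F y) (wt t).
  have := ell_lin (-1) tT Hb Ha; have := elk_lin (-1) tT Hy Hx.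
  rewrite !scaleN1r ![- _ + _]addrC !mulN1r => -> ->.
  rewrite (ipBl pL L1 L2 (qc.1 t tT)) (ipBl pL (FL L1) (FL L2) (wtc.1 t tT)) /num.
  by ring.
have a1 : `|ip2 (x - y) (q t)| <= Q * nV (x - y).
  apply: le_trans (cauchy_schwarz pL (HL Hxy) (qc.1 t tT)) _; rewrite mulrC.
  by apply: ler_pM; [exact: nrm_ge0|exact: nrm_ge0|exact: hQ|exact: (n2_le gf)].
have a2 : `|ell t (aa t x - aa t y)| <= d%:R * (e1 * M) * La * nV (x - y).
  apply: le_trans (ell_le tT Hab) _; rewrite -[leRHS]mulrA; apply: ler_wpM2l.
    by apply: mulr_ge0 => //; apply: mulr_ge0 => //; exact: mu_C0 he.
  exact: aa_lip.
have a3 := elk_le tT Hxy.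
have a4 : `|ip2 (F x - F y) (wt t)| <= Lf * W * nV (x - y).
  apply: le_trans (cauchy_schwarz pL (phB pL (FL L1) (FL L2)) (wtc.1 t tT)) _.
  rewrite [Lf * W * _]mulrAC; apply: ler_pM; [exact: nrm_ge0|exact: nrm_ge0| |exact: hW].
  by apply: le_trans (Flip L1 L2) _; apply: ler_wpM2l => //; exact: (n2_le gf).
rewrite E1 !mulrDl; apply: le_trans (ler_normB _ _) _; apply: lerD => //.
apply: le_trans (ler_normD _ _) _; apply: lerD => //.
by apply: le_trans (ler_normD _ _) _; apply: lerD.
Qed.

Lemma hh_lip : exists2 K, 0 <= K & forall t x y, t \in `[0, T] -> H x -> H y ->
  `|hh t x - hh t y| <= K * nV (x - y).
Proof.
have [K K0 hK] := num_lip; exists (K / dm); first by rewrite divr_ge0// ltW// dm0.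
move=> t x y tT Hx Hy; rewrite /hh -mulrBl normrM normfV.
have d0 := dm0; have dn := den_ge tT; have dp := lt_le_trans d0 dn.
rewrite ler_pdivrMr//; apply: le_trans (hK t x y tT Hx Hy) _.
rewrite -!mulrA; apply: ler_wpM2l => //.
rewrite mulrCA -[leLHS]mulr1; apply: ler_wpM2l; first exact: nrm_ge0.
by rewrite mulrC ler_pdivlMr// mul1r.
Qed.

(** Lipschitz continuity reduces the estimate to the zero vector, where every term other than [m']
    is bounded in time. Thus h inherits the square integrability of [m']. *)
Lemma hh_bound u : ccV u -> exists2 C, 0 <= C & forall t, t \in `[0, T] ->
  `|hh t (u t)| <= C + `|m' t| / dm.
Proof.
move=> uc; have [K K0 hK] := num_lip; have [B B0 hB] := ccont_bound pH uc.
have cz := ccont_cst T pH (ph0 pH).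
have [Ba Ba0 hBa] := ccont_bound pH (aa_cc cz).
have [W W0 hW] := ccont_bound pL wtc.
pose C0 := d%:R * (e1 * M) * Ba + n2 (F 0) * W.
have C00 : 0 <= C0.
  by rewrite addr_ge0// ?mulr_ge0 ?nrm_ge0 ?(mu_C0 he)// ltW.
exists ((K * B + C0) / dm).
  by rewrite divr_ge0 ?(ltW dm0)// addr_ge0// mulr_ge0// ltW.
move=> t tT; have H0 := ph0 pH; have Hu := uc.1 t tT.
have d0 := dm0; have dn := den_ge tT; have dp := lt_le_trans d0 dn.
rewrite -mulrDl /hh normrM normfV ler_pdivrMr//.
have z2 : elk t 0 = 0.
  have := elk_lin 1 tT H0 H0; rewrite scaler0 addr0 mul1r => h.
  by apply/eqP; rewrite -[X in X == _](addrK (elk t 0)) -{1}h subrr.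
have [Ha _] := aaP tT H0.
have n0 : `|num t 0| <= C0 + `|m' t|.
  have L0 := ph0 pL; rewrite /num z2 (ip0l pL (qc.1 t tT)) !addr0.
  apply: le_trans (ler_normB _ _) _; rewrite /C0 [leRHS]addrC addrA; apply: lerD.
    apply: le_trans (ler_normD _ _) _; apply: lerD => //.
    apply: le_trans (ell_le tT Ha) _; apply: ler_wpM2l; last exact: hBa.
    by rewrite !mulr_ge0// (mu_C0 he).
  apply: le_trans (cauchy_schwarz pL (FL L0) (wtc.1 t tT)) _.
  by apply: ler_wpM2l; [exact: nrm_ge0|exact: hW].
have n1 : `|num t (u t)| <= K * B + C0 + `|m' t|.
  have := hK t _ _ tT Hu H0; rewrite subr0 => h.
  have := ler_normD (num t (u t) - num t 0) (num t 0); rewrite subrK => h'.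
  apply: le_trans h' _; rewrite -[leRHS]addrA; apply: lerD => //.
  by apply: le_trans h _; apply: ler_wpM2l => //; exact: hB.
apply: le_trans n1 _; rewrite mulrAC ler_pdivlMr//; apply: ler_wpM2l => //.
by do 2 apply: addr_ge0 => //; apply: mulr_ge0 => //; exact: ltW.
Qed.

Lemma hh_int u : ccV u -> int (fun t => hh t (u t)) /\ int (fun t => hh t (u t) ^+ 2).
Proof.
move=> uc; have [C C0 hC] := hh_bound uc; have mh := hh_meas uc.
have d0 := dm0.
have ic (k : R) : int (fun=> k).
  by apply: continuous_int; apply: continuous_subspaceT => x; exact: cvg_cst.
have i1 : int (fun t => C + dm^-1 * `|m' t|).
  apply: integrableD_fin => //; apply: integrableZ_fin => //.
  exact: integrable_norm_fin.
have i2 : int (fun t => 2 * C ^+ 2 + 2 * dm^-1 ^+ 2 * m' t ^+ 2).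
  by apply: integrableD_fin => //; exact: integrableZ_fin.
split.
  apply: (@integrable_le _ _ _ leb `[0, T] _ _ (fun t => C + dm^-1 * `|m' t|)) => //.
  by move=> t tT; rewrite [_^-1 * _]mulrC; exact: hC.
apply: (@integrable_le _ _ _ leb `[0, T] _ _
  (fun t => 2 * C ^+ 2 + 2 * dm^-1 ^+ 2 * m' t ^+ 2)) => //; first exact: measurable_funX.
move=> t tT.
rewrite ger0_norm ?sqr_ge0// -[leLHS]real_normK ?num_real//.
have h := hC t tT; have m0 : 0 <= `|m' t| / dm by rewrite divr_ge0// ltW.
apply: (@le_trans _ _ ((C + `|m' t| / dm) ^+ 2)).
  by rewrite lerXn2r ?nnegrE// addr_ge0.
have -> : 2 * dm^-1 ^+ 2 * m' t ^+ 2 = 2 * (`|m' t| / dm) ^+ 2.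
  by rewrite exprMn -(real_normK (num_real (m' t))); ring.
have := sqr_ge0 (C - `|m' t| / dm); move: (`|m' t| / dm) => y hy.
by rewrite -subr_ge0; apply: le_trans hy _; rewrite le_eqVlt; apply/orP; left; apply/eqP; ring.
Qed.

Lemma Phi_wint u : ccV u -> exists g, wint T H ip (fun t => Phi t (u t)) g.
Proof.
move=> uc; have [ih _] := hh_int uc.
by have [A' [B' [_ _ wi _]]] := wint_lin pH (aa_cc uc) bb_cc ih; exists (fun t => A' + B' * `|hh t (u t)|).
Qed.

Lemma Phi_lip : exists2 K, 0 < K & forall t x y, t \in `[0, T] -> H x -> H y ->
  nV (Phi t x - Phi t y) <= K * nV (x - y).
Proof.
have [K K0 hK] := hh_lip; have [B B0 hB] := ccont_bound pH bb_cc.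
set La := (Lf + r1' + d%:R * k1) / c.
have La0 : 0 <= La.
  by rewrite /La divr_ge0 ?(ltW c0)// !addr_ge0// ?(mu_C0 hr')// mulr_ge0// (mu_C0 hk).
exists (La + K * B + 1); first by rewrite ltr_wpDl// addr_ge0// mulr_ge0// ltW.
move=> t x y tT Hx Hy; have [Ha _] := aaP tT Hx; have [Hb _] := aaP tT Hy.
have [Hbb _] := bbP tT.
have -> : Phi t x - Phi t y = (aa t x - aa t y) + (hh t x - hh t y) *: bb t.
  by rewrite /Phi opprD addrACA scalerBl.
apply: le_trans (nrmD pH (phB pH Ha Hb) (phZ pH _ Hbb)) _.
rewrite (nrmZ pH _ Hbb) 2!mulrDl mul1r -[leLHS]addr0; apply: lerD; last exact: nrm_ge0.
apply: lerD; first exact: aa_lip.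
rewrite mulrAC; apply: ler_pM => //; [exact: nrm_ge0|exact: hK|exact: hB].
Qed.

Lemma core_exists u0 : H u0 -> exists u, [/\ ccV u, nV (u 0 - u0) = 0 &
  primitive T H ip u (fun t => Phi t (u t))].
Proof.
have [K K0 hK] := Phi_lip.
exact: (ode_exists T0 pH (gf_cH gf) K0 Phi_wint hK).
Qed.

Lemma core_aform t x k y : t \in `[0, T] -> H x -> H y ->
  A t (aa t x + k *: bb t) y =
  dualp ip2 D (F x - Mr' t x) (fun i => - Mk t (D i x)) y + k * ip2 (p t) y.
Proof.
move=> tT Hx Hy; have [Ha ha] := aaP tT Hx; have [Hb hb] := bbP tT.
by rewrite addrC (aform_linl gf hr he)// ha// hb// addrC.
Qed.

Lemma dualpE t x y : t \in `[0, T] -> H x -> H y ->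
  dualp ip2 D (F x - Mr' t x) (fun i => - Mk t (D i x)) y =
  ip2 (F x) y - ip2 (Mr' t x) y - \sum_(i < d) ip2 (Mk t (D i x)) (D i y).
Proof.
move=> tT Hx Hy; have Lx := HL Hx; rewrite /dualp.
rewrite (ipBl pL (FL Lx) (mu_L hr' tT Lx) (HL Hy)); congr (_ + _).
rewrite -sumrN; apply: eq_bigr => i _.
exact: (ipNl pL (mu_L hk tT (DL i Hx)) (DL i Hy)).
Qed.

Lemma core_eq t x y : t \in `[0, T] -> H x -> H y ->
  ip2 (Mr' t x + Mr t (Phi t x)) y + \sum_(i < d) ip2 (Me t (D i (Phi t x))) (D i y)
    + \sum_(i < d) ip2 (Mk t (D i x)) (D i y) = hh t x * ip2 (p t) y + ip2 (F x) y.
Proof.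
move=> tT Hx Hy; have := core_aform (hh t x) tT Hx Hy; rewrite dualpE// -/(Phi t x).
have [Ha ha] := aaP tT Hx; have [Hb hb] := bbP tT.
have HP : H (Phi t x) by apply: (phD pH) => //; exact: (phZ pH).
rewrite (ipDl pL (mu_L hr' tT (HL Hx)) (mu_L hr tT (HL HP)) (HL Hy)) /aform /dualp.
move: (ip2 _ y) => z1.
move: (\sum_(i < d) _) (\sum_(i < d) _) (ip2 (Mr' t x) y) (ip2 (F x) y) (_ * _) => z2 z3 z4 z5 z6 h.
have -> : z4 + z1 + z3 + z2 = z1 + z3 + z4 + z2 by ring.
by rewrite h; ring.
Qed.

Lemma wb_neq0 t : t \in `[0, T] -> wb t != 0.
Proof. by move=> tT; rewrite -normr_gt0; exact: lt_le_trans wm0 (wbm tT). Qed.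

(** [ell] does not see vectors of norm zero, so w may be replaced by [aa] + k [bb], and the formula
    becomes k [wb] = [num] + k [ell]([bb]). As [den] and [wb] are nonzero, it can be solved for k
    and undone: one direction serves uniqueness, the other existence. *)
Lemma core_h_uniq t x w k : t \in `[0, T] -> H x -> H w ->
  nV (w - (aa t x + k *: bb t)) = 0 ->
  k = (wb t)^-1 * (m' t + ip2 x (q t) + ell t w + elk t x - ip2 (F x) (wt t)) <->
  k = hh t x.
Proof.
move=> tT Hx Hw w0; have [Ha ha] := aaP tT Hx; have [Hb hb] := bbP tT.
have HP : H (aa t x + k *: bb t) by apply: (phD pH) => //; exact: (phZ pH).
have -> : ell t w = ell t (aa t x) + k * ell t (bb t).
  have := ell_le tT (phB pH Hw HP); rewrite w0 mulr0 normr_le0 => /eqP h.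
  have := ell_lin (-1) tT HP Hw; rewrite scaleN1r addrC h mulN1r addrC => /esym/eqP.
  rewrite subr_eq0 => /eqP ->.
  by rewrite addrC (ell_lin k tT Hb Ha) addrC.
have w1 := wb_neq0 tT; have d1 := den_neq0 tT.
have E1 : m' t + ip2 x (q t) + (ell t (aa t x) + k * ell t (bb t)) + elk t x - ip2 (F x) (wt t)
    = num t x + k * ell t (bb t) by rewrite /num; ring.
rewrite E1 /hh; split => h.
  have : k * wb t = num t x + k * ell t (bb t) by rewrite {1}h mulrC mulrA divff// mul1r.
  move=> h'; rewrite -[LHS](mulfK d1); congr (_ / _).
  by rewrite /den mulrBr h' addrK.
have h' : k * den t = num t x by rewrite h divfK.
by rewrite -h' /den mulrBr subrK mulrC mulfK.
Qed.

Hypothesis hdr : forall x, L x -> cderiv T L ip2 (fun t => Mr t x) (fun t => Mr' t x).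
Let T0' : 0 <= T := ltW T0.

(** Pairing in L with a continuous curve b is pairing in H with its Riesz image, which is again a
    continuous curve by [rz_cc]. *)
Lemma wint_L w g : wint T H ip w g -> wint T L ip2 w g.
Proof.
move=> [[Hw mw] ig wg]; split => //.
- split=> [t tT|b bc]; first exact/HL/Hw.
  have zc : forall i, cc2 (fun=> 0) by move=> i; exact: (ccont_cst T pL (ph0 pL)).
  have rc := rz_cc gf (G := fun _ _ => 0) bc zc.
  apply: (@eq_measurable_fun _ _ _ _ _ (fun t => ip (w t) (rz H ip2 D (b t) (fun=> 0)))).
    move=> t /set_mem tT; have [Hz hz] := rzP gf T0' (bc.1 t tT) (fun i => ph0 pL).
    have Hwt := Hw t tT.
    rewrite (ipC pH Hwt Hz) hz// /dualp big1 ?addr0 ?(ipC pL (bc.1 t tT) (HL Hwt))//.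
    by move=> i _; exact: (ip0l pL (DL i Hwt)).
  exact: mw.
- by move=> t tT; apply: le_trans (wg t tT); apply: (n2_le gf); exact: Hw.
Qed.

Lemma primitive_L u w : ccV u -> (forall t, t \in `[0, T] -> H (w t)) ->
  primitive T H ip u w -> primitive T L ip2 u w.
Proof.
move=> uc Hw pu y s t Ly s0 st tT.
have [Hz hz] := rzP gf T0' Ly (fun i => ph0 pL).
have E1 x : H x -> ip2 x y = ip x (rz H ip2 D y (fun=> 0)).
  move=> Hx; rewrite (ipC pH Hx Hz) hz// /dualp big1 ?addr0 ?(ipC pL Ly (HL Hx))//.
  by move=> i _; exact: (ip0l pL (DL i Hx)).
have sT : s \in `[0, T] by rewrite in_itv/= s0 (le_trans st).
have tT' : t \in `[0, T] by rewrite in_itv/= tT (le_trans s0).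
rewrite !E1; [|exact: uc.1|exact: uc.1]; rewrite (pu _ s t Hz s0 st tT).
by apply: (I_eq s0 tT) => r rT; rewrite E1//; apply: Hw; rewrite in_itv.
Qed.

(** The product rule for rho u. By symmetry the multiplier moves onto y, where t |-> rho(t) y is
    continuously differentiable in L, so u only needs to be a primitive. *)
Lemma core_product u w g y : ccV u -> wint T H ip w g -> primitive T H ip u w -> L y ->
  int (fun r => ip2 (Mr' r (u r) + Mr r (w r)) y) /\
  forall s t, 0 <= s -> s <= t -> t <= T ->
  ip2 (Mr t (u t)) y - ip2 (Mr s (u s)) y =
  \int[leb]_(r in `]s, t]) ip2 (Mr' r (u r) + Mr r (w r)) y.
Proof.
move=> uc wi pu Ly; have u2 := ccV_cc2 gf uc; have wiL := wint_L wi.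
have [[Hw _] _ _] := wi; have puL := primitive_L uc Hw pu; have db := hdr Ly.
have [bc b'c _] := db.
have E1 r : r \in `[0, T] ->
    ip2 (Mr' r (u r) + Mr r (w r)) y = ip2 (w r) (Mr r y) + ip2 (u r) (Mr' r y).
  move=> rT; have Lu := u2.1 r rT; have Lw := HL (Hw r rT).
  rewrite (ipDl pL (mu_L hr' rT Lu) (mu_L hr rT Lw) Ly) (mu_sym hr' rT Lu Ly).
  by rewrite (mu_sym hr rT Lw Ly) addrC.
split.
  have : int (fun r => ip2 (w r) (Mr r y) + ip2 (u r) (Mr' r y)).
    apply: integrableD_fin => //; first exact: (wint_int pL wiL bc).
    by apply: continuous_int; exact: (ccont_ip pL).
  by apply: eq_integrable => // r /set_mem rT; rewrite /= E1.
move=> s t s0 st tT.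
have sT : s \in `[0, T] by rewrite in_itv/= s0 (le_trans st).
have tT' : t \in `[0, T] by rewrite in_itv/= tT (le_trans s0).
rewrite (mu_sym hr tT' (u2.1 t tT') Ly) (mu_sym hr sT (u2.1 s sT) Ly).
rewrite (primitive_product pL wiL u2 puL db s0 st tT).
by apply/esym/(I_eq s0 tT) => r rT; apply: E1; rewrite in_itv.
Qed.

Section uniqueness.
Variables (v w : R -> E) (g k : R -> R).
Hypotheses (vc : ccV v) (wi : wint T H ip w g) (pv : primitive T H ip v w) (ik : int k).
Hypothesis fam : exists b : nat -> nat -> E, (forall n j, H (b n j)) /\
  forall x, H x -> (forall n j, ip x (b n j) = 0) -> forall t, t \in `]0, T[ -> ip x (w t) = 0.
Hypothesis weak : forall y, H y -> forall s t, 0 <= s -> s <= t -> t <= T ->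
  ip2 (Mr t (v t)) y - ip2 (Mr s (v s)) y = \int[leb]_(r in `]s, t])
    (k r * ip2 (p r) y + ip2 (F (v r)) y - \sum_(i < d) ip2 (Me r (D i (w r))) (D i y)
     - \sum_(i < d) ip2 (Mk r (D i (v r))) (D i y)).

Let Hw : forall t, t \in `[0, T] -> H (w t). Proof. by case: wi => -[]. Qed.

Lemma cc2_int (f1 f2 : R -> E) : cc2 f1 -> cc2 f2 -> int (fun t => ip2 (f1 t) (f2 t)).
Proof. by move=> fc gc; apply: continuous_int; exact: (ccont_ip pL). Qed.

Lemma core_rhs_int y : H y -> int (fun r => k r * ip2 (p r) y + ip2 (F (v r)) y
     - \sum_(i < d) ip2 (Me r (D i (w r))) (D i y)
     - \sum_(i < d) ip2 (Mk r (D i (v r))) (D i y)).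
Proof.
move=> Hy; have Ly := HL Hy; have v2 := ccV_cc2 gf vc.
have cy := ccont_cst T pL Ly; have cD i := ccont_cst T pL (DL i Hy).
have iS1 : int (fun r => \sum_(i < d) ip2 (Me r (D i (w r))) (D i y)).
  apply: integrable_sum_fin => // i.
  have MDc := mu_cc he (cD i).
  (* Data concentrated in component i, so that a Riesz image represents the functional x |-> (D_i x,
     Me D_i y) on H and the weak measurability of w in H applies. *)
  have zc : forall j, cc2 (fun t => if j == i then Me t (D i y) else 0).
    by move=> j; case: eqP => _ //; exact: (ccont_cst T pL (ph0 pL)).
  have rc := rz_cc gf (g := fun=> 0) (G := fun t j => if j == i then Me t (D i y) else 0)
    (ccont_cst T pL (ph0 pL)) zc.
  have := wint_int pH wi rc; apply: eq_integrable => // r /set_mem rT; rewrite /=; congr EFin.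
  have Hwr := Hw rT; have LM : forall j, L (if j == i then Me r (D i y) else 0).
    by move=> j; exact: (zc j).1 rT.
  have [Hz hz] := rzP gf T0' (ph0 pL) LM.
  rewrite (ipC pH Hwr Hz) hz// /dualp (ip0l pL (HL Hwr)) add0r (bigD1 i)//= eqxx big1 ?addr0.
    by rewrite (mu_sym he rT (DL i Hwr) (DL i Hy)) (ipC pL (mu_L he rT (DL i Hy)) (DL i Hwr)).
  by move=> j /negbTE ->; exact: (ip0l pL (DL j Hwr)).
have iS2 : int (fun r => \sum_(i < d) ip2 (Mk r (D i (v r))) (D i y)).
  apply: integrable_sum_fin => // i; apply: cc2_int => //.
  by apply: (mu_cc hk); exact: (ccV_D gf).
have ikp : int (fun r => k r * ip2 (p r) y).
  have [a [b [_ _ kw _]]] := wint_lin pL (ccont_cst T pL (ph0 pL)) pc ik.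
  have := wint_int pL kw cy; apply: eq_integrable => // r /set_mem rT; rewrite /= add0r.
  by congr EFin; exact: (ipZl pL _ (pc.1 r rT) Ly).
apply: integrableD_fin => //; last exact: integrableN_fin.
apply: integrableD_fin => //; last exact: integrableN_fin.
by apply: integrableD_fin => //; apply: cc2_int => //; exact: F_cc.
Qed.

(* The weak formulation and the product rule give two primitives of (rho v, y). *)
Lemma core_residual y : H y -> {ae leb, forall t, t \in `]0, T[ ->
  A t (w t - (aa t (v t) + k t *: bb t)) y = 0}.
Proof.
move=> Hy; have Ly := HL Hy; have v2 := ccV_cc2 gf vc.
have [i1 h1] := core_product vc wi pv Ly.
have i2 := core_rhs_int Hy.
have EI (t : R) : 0 <= t -> t <= T ->
    \int[leb]_(x in `]0, t]) ip2 (Mr' x (v x) + Mr x (w x)) y = \int[leb]_(r in `]0, t])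
      (k r * ip2 (p r) y + ip2 (F (v r)) y - \sum_(i < d) ip2 (Me r (D i (w r))) (D i y)
       - \sum_(i < d) ip2 (Mk r (D i (v r))) (D i y)).
  by move=> t0 tT; rewrite -h1//; apply: weak.
have := I_eq_ae i1 i2 EI.
apply: filterS; first exact: (ae_filter_ringOfSetsType leb).
move=> t h tT; have tT' : t \in `[0, T] by move: tT; rewrite !in_itv/= => /andP[/ltW -> /ltW ->].
have {}h := h tT; have Hv := vc.1 t tT'; have Hwt := Hw tT'.
have [Ha _] := aaP tT' Hv; have [Hb _] := bbP tT'.
have HP : H (aa t (v t) + k t *: bb t) by apply: (phD pH) => //; exact: (phZ pH).
rewrite (aformB gf hr he)// core_aform// dualpE// /aform /dualp.
have Lv := HL Hv; have Lw := HL Hwt.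
move: h; rewrite (ipDl pL (mu_L hr' tT' Lv) (mu_L hr tT' Lw) Ly).
move: (\sum_(i < d) _) (\sum_(i < d) _) => z1 z2 h.
rewrite -[ip2 (Mr t (w t)) y](addKr (ip2 (Mr' t (v t)) y)) h; ring.
Qed.

(** Off one null set the residual x is A_t-orthogonal to three countable families, detecting w, [aa]
    and [bb]. The Riesz image z of A_t(x, .) is then orthogonal to all three curves, hence to their
    combination x, so A_t(x, x) = 0 and coercivity concludes. *)
Lemma core_residual0 : {ae leb, forall t, t \in `]0, T[ ->
  nV (w t - (aa t (v t) + k t *: bb t)) = 0}.
Proof.
(* [ccont_family] is stated for a seminormed space; this one carries the Hilbert norm. *)
pose X := SNSpace H (fun x => (nV x)%:E).
have [cw [Hcw hcw]] := fam.
have [ca [Hca hca]] := @ccont_family _ _ T X ip T0 pH _ (aa_cc vc).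
have [cb [Hcb hcb]] := @ccont_family _ _ T X ip T0 pH _ bb_cc.
have all3 (c' : nat -> nat -> E) : (forall n j, H (c' n j)) ->
    {ae leb, forall t, forall n j, t \in `]0, T[ ->
      A t (w t - (aa t (v t) + k t *: bb t)) (c' n j) = 0}.
  by move=> Hc; apply/ae_foralln => n; apply/ae_foralln => j; exact: core_residual.
have A1 := all3 _ Hcw; have A2 := all3 _ Hca; have A3 := all3 _ Hcb.
apply: filterS3 A1 A2 A3; first exact: (ae_filter_ringOfSetsType leb).
move=> t h1 h2 h3 tT.
have tT' : t \in `[0, T] by move: tT; rewrite !in_itv/= => /andP[/ltW -> /ltW ->].
have Hv := vc.1 t tT'; have Hwt := Hw tT'.
have [Ha _] := aaP tT' Hv; have [Hb _] := bbP tT'.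
have HP : H (aa t (v t) + k t *: bb t) by apply: (phD pH) => //; exact: (phZ pH).
set x := w t - _ in h1 h2 h3 *; have Hx : H x by exact: (phB pH).
have [Hz hz] := rzP gf T0' (mu_L hr tT' (HL Hx)) (fun i => mu_L he tT' (DL i Hx)).
set z := rz _ _ _ _ _ in Hz hz.
have ez1 : ip z (w t) = 0 by apply: hcw => // n j; rewrite hz//; exact: h1.
have ez2 : ip z (aa t (v t)) = 0 by apply: (hca z) => // n j; rewrite hz; [exact: h2|exact: Hca].
have ez3 : ip z (bb t) = 0 by apply: (hcb z) => // n j; rewrite hz; [exact: h3|exact: Hcb].
have ez4 : ip z x = 0.
  rewrite /x (ipBr pH Hwt HP Hz) (ipDr pH Ha (phZ pH _ Hb) Hz) (ipZr pH _ Hz Hb).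
  by rewrite ez1 ez2 ez3 mulr0 addr0 subrr.
have := aform_ge gf hr he tT' Hx; rewrite /aform -hz// ez4 => le.
have : nV x ^+ 2 <= 0 by rewrite -(pmulr_rle0 _ c0).
by rewrite real_exprn_even_le0 ?num_real//= => /eqP.
Qed.

Hypothesis heq : {ae leb, forall t, t \in `]0, T[ -> k t = (wb t)^-1 *
  (m' t + ip2 (v t) (q t) + ell t (w t) + elk t (v t) - ip2 (F (v t)) (wt t))}.

Lemma core_k : {ae leb, forall t, t \in `]0, T[ -> k t = hh t (v t)}.
Proof.
apply: filterS2 heq core_residual0; first exact: (ae_filter_ringOfSetsType leb).
move=> t h1 h2 tT.
have tT' : t \in `[0, T] by move: tT; rewrite !in_itv/= => /andP[/ltW -> /ltW ->].
exact: (core_h_uniq tT' (vc.1 t tT') (Hw tT') (h2 tT)).1 (h1 tT).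
Qed.

Lemma core_unique u : ccV u -> primitive T H ip u (fun t => Phi t (u t)) ->
  nV (v 0 - u 0) = 0 ->
  (forall t, t \in `[0, T] -> nV (v t - u t) = 0) /\
  {ae leb, forall t, t \in `]0, T[ -> k t = hh t (u t)}.
Proof.
move=> uc pu vu0.
have pv' : primitive T H ip v (fun t => Phi t (v t)).
  move=> y s t Hy s0 st tT; rewrite (pv Hy s0 st tT).
  have cy := ccont_cst T pH Hy; have [g' wi'] := Phi_wint vc.
  apply: ae_eq_Rintegral => //.
  - exact: integrable_measurable (int_sub (wint_int pH wi cy) s0 tT).
  - exact: integrable_measurable (int_sub (wint_int pH wi' cy) s0 tT).
  (* The identities are known on the open interval, while ]s, t] may contain T, hence the extra null
     set. *)
  apply: filterS3 core_residual0 core_k (ae_neq T); first exact: (ae_filter_ringOfSetsType leb).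
  move=> r h1 h2 rneq; rewrite /= in_itv/= => /andP[sr rt].
  have rT : r \in `]0, T[ by rewrite in_itv/= (le_lt_trans s0 sr) lt_neqAle rneq (le_trans rt).
  have rT' : r \in `[0, T] by move: rT; rewrite !in_itv/= => /andP[/ltW -> /ltW ->].
  have Hv := vc.1 r rT'; have [Ha _] := aaP rT' Hv; have [Hb _] := bbP rT'.
  have HP : H (Phi r (v r)) by apply: (phD pH) => //; exact: (phZ pH).
  have := h1 rT; rewrite h2// -/(Phi r (v r)) => n0.
  have := cauchy_schwarz pH (phB pH (Hw rT') HP) Hy; rewrite n0 mul0r normr_le0.
  by rewrite (ipBl pH (Hw rT') HP Hy) subr_eq0 => /eqP.
have [K K0 hK] := Phi_lip.
have uq := ode_unique T0 pH K0 Phi_wint hK vc uc pv' pu vu0.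
split => //; have [K' K'0 hK'] := hh_lip.
apply: filterS core_k; first exact: (ae_filter_ringOfSetsType leb).
move=> t h tT; rewrite h//.
have tT' : t \in `[0, T] by move: tT; rewrite !in_itv/= => /andP[/ltW -> /ltW ->].
have := hK' t _ _ tT' (vc.1 t tT') (uc.1 t tT'); rewrite uq// mulr0 normr_le0.
by rewrite subr_eq0 => /eqP.
Qed.

End uniqueness.

(** The derivative is exposed as a + h b with a and b continuous, because this decomposition, and
    not mere weak measurability, is what gives its Bochner integrability later. *)
Theorem core_main u0 : H u0 -> exists (u a b : R -> E) (h : R -> R),
  let du t := a t + h t *: b t in
  [/\ ccV u, nV (u 0 - u0) = 0, ccV a, ccV b & primitive T H ip u du] /\
  [/\ int h, int (fun t => h t ^+ 2),
    (forall t y, t \in `[0, T] -> H y ->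
      ip2 (Mr' t (u t) + Mr t (du t)) y + \sum_(i < d) ip2 (Me t (D i (du t))) (D i y)
      + \sum_(i < d) ip2 (Mk t (D i (u t))) (D i y) = h t * ip2 (p t) y + ip2 (F (u t)) y),
    (forall t, t \in `[0, T] -> h t = (ip2 (p t) (wt t))^-1 *
      (m' t + ip2 (u t) (q t) + \sum_(i < d) ip2 (Me t (D i (du t))) (G t i)
       + \sum_(i < d) ip2 (Mk t (D i (u t))) (G t i) - ip2 (F (u t)) (wt t))) &
    (forall y s t, L y -> 0 <= s -> s <= t -> t <= T ->
      ip2 (Mr t (u t)) y - ip2 (Mr s (u s)) y =
      \int[leb]_(r in `]s, t]) ip2 (Mr' r (u r) + Mr r (du r)) y)] /\
  forall (v w : R -> E) (g k : R -> R),
    ccV v -> nV (v 0 - u0) = 0 -> wint T H ip w g -> primitive T H ip v w -> int k ->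
    (exists c : nat -> nat -> E, (forall n j, H (c n j)) /\
      forall x, H x -> (forall n j, ip x (c n j) = 0) ->
      forall t, t \in `]0, T[ -> ip x (w t) = 0) ->
    (forall y, H y -> forall s t, 0 <= s -> s <= t -> t <= T ->
      ip2 (Mr t (v t)) y - ip2 (Mr s (v s)) y = \int[leb]_(r in `]s, t])
      (k r * ip2 (p r) y + ip2 (F (v r)) y - \sum_(i < d) ip2 (Me r (D i (w r))) (D i y)
       - \sum_(i < d) ip2 (Mk r (D i (v r))) (D i y))) ->
    {ae leb, forall t, t \in `]0, T[ -> k t = (ip2 (p t) (wt t))^-1 *
      (m' t + ip2 (v t) (q t) + \sum_(i < d) ip2 (Me t (D i (w t))) (G t i)
       + \sum_(i < d) ip2 (Mk t (D i (v t))) (G t i) - ip2 (F (v t)) (wt t))} ->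
    (forall t, t \in `[0, T] -> nV (v t - u t) = 0) /\
    {ae leb, forall t, t \in `]0, T[ -> k t = h t}.
Proof.
move=> Hu0; have [u [uc u00 pu]] := core_exists Hu0; have [ih ih2] := hh_int uc.
have HP t : t \in `[0, T] -> H (Phi t (u t)).
  move=> tT; have [Ha _] := aaP tT (uc.1 t tT); have [Hb _] := bbP tT.
  by apply: (phD pH) => //; exact: (phZ pH).
exists u, (fun t => aa t (u t)), bb, (fun t => hh t (u t)) => du.
split; [by split => //; [exact: aa_cc|exact: bb_cc]|split].
  split => //.
  - by move=> t y tT Hy; exact: (core_eq tT (uc.1 t tT) Hy).
  - move=> t tT; apply: (core_h_uniq tT (uc.1 t tT) (HP t tT) _).2 => //.
    by rewrite subrr (nrm0 pH).
  - move=> y s t Ly; have [g wi] := Phi_wint uc.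
    exact: ((core_product uc wi pu Ly).2 s t).
move=> v w g k vc v00 wi pv ik fam weak heq.
apply: (core_unique vc wi pv ik fam weak heq uc pu).
have z0 : 0 \in `[0, T] by rewrite in_itv/= lexx ltW.
apply/eqP; rewrite eq_le nrm_ge0 andbT.
apply: le_trans (nrmB_trans pH (vc.1 0 z0) (uc.1 0 z0) Hu0) _.
by rewrite v00 add0r (nrmBC pH Hu0 (uc.1 0 z0)) u00.
Qed.

End core.

(** * Weak time derivatives of curves *)

Lemma int_cmul {R : realType} (T : R) (c k : R -> R) :
  {within `[0, T], continuous c} -> lebesgue_measure.-integrable `[0, T] (EFin \o k) ->
  lebesgue_measure.-integrable `[0, T] (EFin \o (fun t => c t * k t)).
Proof.
move=> cc ik; have [B B0 hB] := continuous_bounded cc.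
apply: (@integrable_le _ _ _ (@lebesgue_measure R) `[0, T] _ _ (fun t => B * `|k t|)) => //.
- apply: measurable_funM; first exact: (integrable_measurable (continuous_int cc)).
  exact: (integrable_measurable ik).
- by apply: integrableZ_fin => //; exact: integrable_norm_fin.
- by move=> t tT; rewrite normrM; apply: ler_wpM2r => //; exact: hB.
Qed.

Lemma test_within {R : realType} (T : R) (psi : R -> R) :
  test_function [set` `]0, T[] psi ->
  [/\ {within `[0, T], continuous psi}, {within `[0, T], continuous 'D_1 psi},
    deriv_within T psi ('D_1 psi), psi 0 = 0 & psi T = 0].
Proof.
move=> tp; have [sp _ _] := tp; have sd := smooth_derive (1 : R) sp.
split.
- by apply: continuous_subspaceT => x; exact: smooth_continuous.
- by apply: continuous_subspaceT => x; exact: smooth_continuous.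
- by apply: derive_deriv_within => x; apply/derivableP; exact: smooth_derivable.
- apply/eqP/negPn/negP => /(test_function_supp tp) /=.
  by rewrite in_itv/= ltxx.
- apply/eqP/negPn/negP => /(test_function_supp tp) /=.
  by rewrite in_itv/= ltxx andbF.
Qed.

Section scalar_parts.
Context {R : realType} (T : R).
Hypothesis T0 : 0 < T.
Notation leb := (@lebesgue_measure R).
Notation I01 := (`[0, T]%classic : set R).
Local Notation int f := (leb.-integrable `[0, T] (EFin \o f)).
Local Notation I s t f := (\int[leb]_(x in `]s, t]) f x).
Let ip (x y : R^o) : R := x * y.

Let pR : prehilbert setT ip.
Proof.
split=> //.
- by move=> x y _ _; exact: mulrC.
- by move=> x y z _ _ _; exact: mulrDl.
- by move=> k x y _ _; rewrite /ip /GRing.scale/= mulrA.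
- by move=> x _; rewrite /ip -expr2 sqr_ge0.
Qed.

Let nR x : nrm ip x = `|x|.
Proof. by rewrite /nrm /ip -expr2 sqrtr_sqr. Qed.

Let ccR (f : R -> R) : {within I01, continuous f} <-> ccont T setT ip f.
Proof.
split=> [/continuous_epsP h|[_ h]].
  split=> // t tT e e0; have [D D0 hD] := h t tT e e0; exists D => // s sT st.
  by rewrite nR; exact: hD.
apply/continuous_epsP => t tT e e0; have [D D0 hD] := h t tT e e0; exists D => // s sT st.
by rewrite -nR; exact: hD.
Qed.

(** Integration by parts for an absolutely continuous y is [primitive_product] in the
    one-dimensional Hilbert space [R^o]; the boundary terms vanish with psi. *)
Lemma scalar_parts (y k psi : R -> R) : {within I01, continuous y} -> int k ->
  (forall s t, 0 <= s -> s <= t -> t <= T -> y t - y s = I s t k) ->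
  test_function [set` `]0, T[] psi ->
  I 0 T (fun t => 'D_1 psi t * y t) = I 0 T (fun t => - psi t * k t).
Proof.
move=> yc ik yk tp; have [pc dc dpsi p0 pT] := test_within tp.
have mk := integrable_measurable ik.
have wi : wint T setT ip (k : R -> R^o) (fun t => `|k t|).
  split; last by move=> t tT; rewrite nR.
    split=> // b /ccR bc; apply: measurable_funM => //.
    exact: (integrable_measurable (continuous_int bc)).
  exact: integrable_norm_fin.
have pr : primitive T setT ip (y : R -> R^o) (k : R -> R^o).
  move=> b s t _ s0 st tT; rewrite /ip -mulrBl yk// mulrC -(I_Zl b ik s0 tT).
  by apply: eq_Rintegral => r _; rewrite mulrC.
have dd : cderiv T setT ip (psi : R -> R^o) ('D_1 psi : R -> R^o).
  split; [exact/ccR|exact/ccR|].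
  move=> t tT e e0; have [D D0 hD] := dpsi t tT e e0; exists D => // s sT st sD.
  by rewrite nR; exact: hD.
have h := primitive_product pR wi ((ccR y).1 yc) pr dd (lexx 0) (ltW T0) (lexx T).
rewrite /ip p0 pT !mulr0 subrr in h.
have i1 : int (fun t => k t * psi t).
  have := int_cmul pc ik; congr (leb.-integrable _ (EFin \o _)); apply/funext => t.
  by rewrite mulrC.
have i2 : int (fun t => y t * 'D_1 psi t).
  have := int_cmul dc (continuous_int yc); congr (leb.-integrable _ (EFin \o _)).
  by apply/funext => t; rewrite mulrC.
rewrite (I_subD i1 i2 (lexx 0) (lexx T)) in h.
have -> : I 0 T (fun t => 'D_1 psi t * y t) = I 0 T (fun t => y t * 'D_1 psi t).
  by apply: eq_Rintegral => t _; rewrite mulrC.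
have -> : I 0 T (fun t => - psi t * k t) = I 0 T (fun t => (-1) * (k t * psi t)).
  by apply: eq_Rintegral => t _; rewrite mulN1r mulrC mulrN.
rewrite (I_Zl _ i1 (lexx 0) (lexx T)) mulN1r.
by apply/eqP; rewrite -subr_eq0 opprK addrC -h.
Qed.

End scalar_parts.

Section weak_derivative.
Context {R : realType} {E : lmodType R}.
Variables (T : R) (X : snspace E) (ip : E -> E -> R).
Notation H := (scarrier X).
Notation leb := (@lebesgue_measure R).
Notation I01 := (`[0, T]%classic : set R).
Local Notation int f := (leb.-integrable `[0, T] (EFin \o f)).
Local Notation I s t f := (\int[leb]_(x in `]s, t]) f x).
Local Notation nrm := (nrm ip).
Local Notation ccont := (ccont T H ip).

Hypothesis T0 : 0 < T.
Hypothesis pH : prehilbert H ip.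
Hypothesis cH : nrm_complete H ip.
Hypothesis nX : forall x, H x -> snorm X x = (nrm x)%:E.
Hypothesis sX : forall x, (0 <= snorm X x)%E.

Lemma weak_deriv_scalar u v K y : ccont u -> weak_time_derivative T X u v -> H y ->
  int K -> {ae leb, forall t, t \in `]0, T[ -> K t = ip (v t) y} ->
  forall s t, 0 <= s -> s <= t -> t <= T -> ip (u t) y - ip (u s) y = I s t K.
Proof.
move=> uc wd Hy iK aeK; have cy := ccont_cst T pH Hy.
apply: (weak_deriv_primitive T0 (ccont_ip pH uc cy) iK) => psi tp.
have [J [b1 b2]] := wd psi tp; have [pc dc dpsi p0 pT] := test_within tp.
have i1 : int (fun t => 'D_1 psi t * ip (u t) y).
  exact: (int_cmul dc (continuous_int (ccont_ip pH uc cy))).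
have ae1 : {ae leb, forall t, t \in `]0, T[ -> 'D_1 psi t * ip (u t) y = ip ('D_1 psi t *: u t) y}.
  by apply: aeW => t tT; rewrite (ipZl pH)//; exact: (uc.1 t (mem_oo_cc tT)).
have [_ e1] := boch_scalar T0 pH nX sX b1 (integrable_measurable i1) Hy ae1.
have i2 : int (fun t => psi t * K t) by exact: int_cmul.
have i3 : int (fun t => - (psi t * K t)) by exact: integrableN_fin.
have ae3 : {ae leb, forall t, t \in `]0, T[ -> - (psi t * K t) = ip (- psi t *: v t) y}.
  have [_ [s [j [_ aeH _ _]]]] := b2.
  apply: leb_aeS2 aeK aeH => t hK hH tT; rewrite (hK tT).
  (* Only psi(t) v(t) is known to lie in the space. Where psi(t) is nonzero, dividing recovers v(t);
     where it is zero, both sides vanish. *)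
  have [Hv _] := hH tT; have [p00|p00] := eqVneq (psi t) 0.
    by rewrite p00 mul0r oppr0 scale0r (ip0l pH Hy).
  have Hvt : H (v t).
    have := phZ pH (- psi t)^-1 Hv; rewrite scalerA mulVf ?scale1r// oppr_eq0//.
  by rewrite (ipZl pH _ Hvt Hy) mulNr.
have [_ e2] := boch_scalar T0 pH nX sX b2 (integrable_measurable i3) Hy ae3.
have -> : I 0 T (fun r => ip (u r) y * 'D_1 psi r) = ip J y.
  by rewrite e1; apply: eq_Rintegral => r _; rewrite mulrC.
rewrite e2 -mulN1r -(I_Zl _ _ (lexx 0) (lexx T)); last first.
  by move: i2; congr (leb.-integrable _ (EFin \o _)); apply/funext => r; rewrite mulrC.
by apply: eq_Rintegral => r _; rewrite mulN1r mulrC.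
Qed.

Lemma weak_deriv_elim u v : ccont u -> weak_time_derivative T X u v ->
  in_L2_bochner T X v -> exists w g, [/\ wint T H ip w g,
    {ae leb, forall t, t \in `]0, T[ -> v t = w t}, primitive T H ip u w &
    exists c : nat -> nat -> E, (forall n i, H (c n i)) /\
      forall x, H x -> (forall n i, ip x (c n i) = 0) ->
      forall t, t \in `]0, T[ -> ip x (w t) = 0].
Proof.
move=> uc wd /(L2_boch_wint pH nX sX)[w [g [wi _ vw [c [Hc hc]]]]].
exists w, g; split => //; last by exists c; split => // x Hx h t _; exact: hc.
move=> y s t Hy; apply: (weak_deriv_scalar uc wd Hy).
  exact: (wint_int pH wi (ccont_cst T pH Hy)).
by apply: leb_aeS vw => r h rT; rewrite h.
Qed.

(** The common integral J is the value at T of the Pettis primitive of psi' u. Scalar integration by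
    parts shows that it has the pairings required of the integral of - psi (a + h b), and
    [appr_boch] upgrades both to Bochner integrals. *)
Lemma weak_deriv_intro u a b h : ccont u -> ccont a -> ccont b -> int h ->
  primitive T H ip u (fun t => a t + h t *: b t) ->
  weak_time_derivative T X u (fun t => a t + h t *: b t).
Proof.
move=> uc ac bc ih pu psi tp; have [pc dc dpsi p0 pT] := test_within tp.
have wc : ccont (fun t => 'D_1 psi t *: u t) by exact: ccontZ.
have [B B0 hB] := ccont_bound pH wc.
have wi : wint T H ip (fun t => 'D_1 psi t *: u t) (fun=> B).
  split; [exact: (ccont_wmeas pH wc)| |exact: hB].
  by apply: continuous_int; apply: continuous_subspaceT => x; exact: cvg_cst.
have [U [Uc U0 pU]] := pettis T0 pH cH wi (ph0 pH).
have TT : T \in `[0, T] by rewrite in_itv/= lexx ltW.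
have HJ := Uc.1 T TT.
have JE y : H y -> ip (U T) y = I 0 T (fun r => ip ('D_1 psi r *: u r) y).
  by move=> Hy; rewrite -(pU y 0 T Hy (lexx 0) (ltW T0) (lexx T)) U0 (ip0l pH Hy) subr0.
exists (U T); split.
  apply: (appr_boch T0 pH nX sX) => //.
    exact: (appr_mul T0 pH (continuous_int dc) uc).
  move=> y Hy; split; last exact: JE.
  exact: (wint_int pH wi (ccont_cst T pH Hy)).
have pcN : {within I01, continuous (fun t => - psi t)}.
  by move=> t; apply: cvgN; exact: pc.
have E1 : (fun t => - psi t *: (a t + h t *: b t)) =
    (fun t => - psi t *: a t + (- psi t * h t) *: b t).
  by apply/funext => t; rewrite scalerDr scalerA.
rewrite E1; apply: (appr_boch T0 pH nX sX) => //.
  apply: (apprD pH); apply: (appr_mul T0 pH) => //; first exact: continuous_int.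
  exact: int_cmul.
move=> y Hy; have cy := ccont_cst T pH Hy.
have [A' [B' [_ _ w2 _]]] := wint_lin pH ac bc ih.
have ik := wint_int pH w2 cy.
have E2 t : t \in `[0, T] -> ip (- psi t *: a t + (- psi t * h t) *: b t) y =
    - psi t * ip (a t + h t *: b t) y.
  move=> tT; rewrite -scalerA -scalerDr (ipZl pH)//.
  by apply: (phD pH); [exact: ac.1|apply: (phZ pH); exact: bc.1].
split.
  have := int_cmul pcN ik; apply: eq_integrable => // t /set_mem tT; rewrite /= E2//.
rewrite JE//.
have -> : I 0 T (fun r => ip ('D_1 psi r *: u r) y) = I 0 T (fun r => 'D_1 psi r * ip (u r) y).
  by apply: (I_eq (lexx 0) (lexx T)) => r rT; rewrite (ipZl pH)//; apply: uc.1; rewrite in_itv.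
have -> : I 0 T (fun r => ip (- psi r *: a r + (- psi r * h r) *: b r) y) =
   I 0 T (fun r => - psi r * ip (a r + h r *: b r) y).
  by apply: (I_eq (lexx 0) (lexx T)) => r rT; rewrite E2// in_itv.
by apply: (scalar_parts T0 (ccont_ip pH uc cy) ik) => // s t s0 st tT; exact: pu.
Qed.

Lemma L2_boch_intro a b h : ccont a -> ccont b -> int h -> int (fun t => h t ^+ 2) ->
  in_L2_bochner T X (fun t => a t + h t *: b t).
Proof.
move=> ac bc ih ih2; have [A' [B' [A0 B0 [_ _ wg] _]]] := wint_lin pH ac bc ih.
have ic (k : R) : int (fun=> k).
  by apply: continuous_int; apply: continuous_subspaceT => x; exact: cvg_cst.
have aw : appr T X ip (fun t => a t + h t *: b t).
  have h1 := appr_mul T0 pH (ic 1) ac; have h2 := appr_mul T0 pH ih bc.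
  have := apprD pH h1 h2.
  by congr (appr _ _ _ _); apply/funext => t; rewrite scale1r.
apply: (appr_L2_boch pH nX aw wg).
apply: (@integrable_le _ _ _ leb `[0, T] _ _ (fun t => 2 * A' ^+ 2 + 2 * B' ^+ 2 * h t ^+ 2)) => //.
- apply: measurable_funX; apply: measurable_funD => //; apply: measurable_funM => //.
  by apply: measurableT_comp => //; exact: (integrable_measurable ih).
- by apply: integrableD_fin => //; exact: integrableZ_fin.
- move=> t tT; rewrite ger0_norm ?sqr_ge0//.
  have -> : 2 * B' ^+ 2 * h t ^+ 2 = 2 * (B' * `|h t|) ^+ 2.
    by rewrite exprMn real_normK ?num_real//; ring.
  move: (B' * `|h t|) => z; have hy := sqr_ge0 (A' - z); rewrite -subr_ge0.
  by apply: le_trans hy _; rewrite le_eqVlt; apply/orP; left; apply/eqP; ring.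
Qed.

End weak_derivative.

(** * Instances on the domain *)

Section instances.
Context {R : realType} {d : nat}.
Notation E := 'rV[R]_d.
Notation mu := (lebesgue_rV d).
Variables (Omega : set E) (T : R).
Hypotheses (oO : open Omega) (bO : bounded_set Omega).
Implicit Types (i : 'I_d) (s t : R).
Notation L2 := (in_Lp mu 2%:E Omega).
Notation ip := (L2ip mu Omega).
Notation n2 := (nrm ip).
Notation hip := (h1ip Omega).

Let mO : measurable Omega. Proof. exact: measurable_open. Qed.
Let finO : (mu Omega < +oo)%E. Proof. exact: bounded_lebesgue_fin. Qed.
Let pL2 : prehilbert L2 ip. Proof. exact: L2_prehilbert. Qed.

Lemma H10_gelfand : gelfand (in_H10 Omega) L2 hip ip (fun i x => grad Omega x i).
Proof.
have G2 x i : in_H10 Omega x -> L2 (grad Omega x i).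
  by move=> Hx; exact: (H1_grad oO i Hx.1).1.
split.
- exact: H10_prehilbert.
- exact: H10_complete.
- exact: pL2.
- exact: L2_complete mO finO.
- by move=> x Hx; exact: (H1_L2 Hx.1).
- by move=> i x; exact: G2.
- move=> i k x y g Hx Hy g2.
  have gx := G2 x i Hx; have gy := G2 y i Hy; have kx := phZ pL2 k gx.
  have [l1 le] := H1_lin oO bO k Hx.1 Hy.1.
  have gxy := (H1_grad oO i l1).1.
  apply: (@etrans _ _ (ip (k *: grad Omega x i + grad Omega y i) g)).
    exact: (L2ip_ae mO (L2_measurable gxy) (L2_measurable (phD pL2 kx gy))
      (L2_measurable g2) (L2_measurable g2) (le i) (aeW _ (fun _ _ => erefl))).
  by rewrite (ipDl pL2 kx gy g2) (ipZl pL2 k gx g2).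
- by move=> x y _ _; exact: h1ipE.
Qed.

Lemma bcont_mult (a : R -> E -> R) c C : bcont Omega T a -> 0 <= C ->
  (forall t, t \in `[0, T] ->
    {ae mu, forall x, Omega x -> c <= a t x /\ `|a t x| <= C}) ->
  mult T L2 ip c C (fun t g x => a t x * g x).
Proof.
move=> ac C0 hC.
have ma t : t \in `[0, T] -> measurable_fun Omega (a t) by move=> tT; case: (ac.1 t tT).
have aC t : t \in `[0, T] -> {ae mu, forall x, Omega x -> `|a t x| <= C}.
  by move=> tT; apply: filterS (hC t tT) => x h Ox; case: (h Ox).
split=> //.
- by move=> g gc; exact: (ccont_mul oO ac gc).
- by move=> t x tT x2; case: (L2_mul oO (ma t tT) C0 (aC t tT) x2).
- by move=> t k x y _ _ _; apply/funext => r; rewrite !fctE /GRing.scale/=; ring.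
- by move=> t x y _ _ _; apply: eq_Rintegral => r _; ring.
- by move=> t x tT x2; case: (L2_mul oO (ma t tT) C0 (aC t tT) x2).
- move=> t x tT x2; have [ax2 _] := L2_mul oO (ma t tT) C0 (aC t tT) x2.
  have cx2 := phZ pL2 c x2; have dx2 := phB pL2 ax2 cx2.
  rewrite -(ipZl pL2 c x2 x2) -subr_ge0 -(ipBl pL2 ax2 cx2 x2).
  (* Replacing a - c by its positive part changes nothing almost everywhere and makes the integrand
     nonnegative everywhere. *)
  pose g y := Num.max 0 (a t y - c) * x y.
  have mg : measurable_fun Omega g.
    apply: measurable_funM; last exact: L2_measurable x2.
    by apply: measurable_maxr => //; apply: measurable_funB => //; exact: ma.
  have -> : ip ((fun y => a t y * x y) - c *: x) x = ip g x.
    apply: (L2ip_ae mO (L2_measurable dx2) mg (L2_measurable x2) (L2_measurable x2));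
      last exact: aeW.
    apply: filterS (hC t tT) => y h Oy; have [h1 _] := h Oy.
    by rewrite /g max_r ?subr_ge0// mulrBl.
  apply: Rintegral_ge0 => y _; rewrite /g -mulrA -expr2.
  by apply: mulr_ge0; [rewrite le_max lexx|exact: sqr_ge0].
Qed.

Lemma innervE (A B : 'I_d -> E -> R) : (forall i, L2 (A i)) -> (forall i, L2 (B i)) ->
  innerv Omega A B = \sum_(i < d) ip (A i) (B i).
Proof. by move=> A2 B2; rewrite /innerv Rintegral_sum// => i; exact: L2_int. Qed.

Lemma grad_measurable (f : E -> R) i : measurable_fun Omega (grad Omega f i).
Proof.
have [[g wg]|n] := pselect (exists g, weak_partial Omega i f g).
  by have [_ [mg _] _] := grad_weak_partial wg.
Transparent grad.
rewrite /grad; case: xgetP => [g _ wg|_]; first by exfalso; apply: n; exists g.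
Opaque grad.
exact: measurable_cst.
Qed.

Lemma Lp_normv_le (G : 'I_d -> E -> R) M : (forall i, measurable_fun Omega (G i)) ->
  0 <= M -> (Lp_normv Omega G <= M%:E)%E ->
  (forall i, L2 (G i)) /\ \sum_(i < d) n2 (G i) ^+ 2 <= M ^+ 2.
Proof.
move=> mG M0 le; pose S x := \sum_(i < d) G i x ^+ 2.
have S0 x : 0 <= S x by apply: sumr_ge0 => i _; exact: sqr_ge0.
have mS : measurable_fun Omega S by apply: measurable_sum => i; exact: measurable_funX.
have mq : measurable_fun Omega (fun x => Num.sqrt (S x)).
  apply: (@measurableT_comp _ _ _ _ _ _ (@Num.sqrt R)) => //.
  by apply: continuous_measurable_fun; exact: sqrt_continuous.
have q2 : L2 (fun x => Num.sqrt (S x)).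
  by split => //; exact: le_lt_trans le (ltry _).
have [_ iq] := (L2P _ mO _).1 q2.
have iS : mu.-integrable Omega (EFin \o S).
  by move: iq; congr (_.-integrable _ (EFin \o _)); apply/funext => x; rewrite sqr_sqrtr.
have G2 i : L2 (G i).
  apply/(L2P _ mO); split => //; apply: (integrable_le mO _ iS); first exact: measurable_funX.
  move=> x _; rewrite ger0_norm ?sqr_ge0// /S (bigD1 i)//= lerDl.
  by apply: sumr_ge0 => j _; exact: sqr_ge0.
split => //; move: le; rewrite /Lp_normv (L2_norm mO q2) lee_fin => le.
apply: (@le_trans _ _ (n2 (fun x => Num.sqrt (S x)) ^+ 2)); last first.
  by rewrite lerXn2r ?nnegrE ?nrm_ge0.
rewrite (nrm_sqr pL2 q2) le_eqVlt; apply/orP; left; apply/eqP.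
have -> : ip (fun x => Num.sqrt (S x)) (fun x => Num.sqrt (S x)) = \int[mu]_(x in Omega) S x.
  by apply: eq_Rintegral => x _; rewrite -expr2 sqr_sqrtr.
rewrite /S Rintegral_sum//; last by move=> i; case: ((L2P _ mO _).1 (G2 i)).
apply: eq_bigr => i _; rewrite (nrm_sqr pL2 (G2 i)).
by apply: eq_Rintegral => x _; rewrite expr2.
Qed.

End instances.

Section time_L2.
Context {R : realType} (T : R).
Hypothesis T0 : 0 < T.
Notation leb := (@lebesgue_measure R).

Lemma L2_time (f : R -> R) : in_Lp leb 2%:E [set` `]0, T[] f <->
  measurable_fun `]0, T[ f /\ leb.-integrable `]0, T[ (EFin \o (fun t => f t ^+ 2)).
Proof. exact: (L2P leb (measurable_itv _) f). Qed.

(** The data are functions on the open interval, whereas the abstract problem integrates over the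
    closed one; extension by zero reconciles the two. *)
Lemma L2_time_patch (f : R -> R) : in_Lp leb 2%:E [set` `]0, T[] f ->
  leb.-integrable `[0, T] (EFin \o (f \_ `]0, T[)) /\
  leb.-integrable `[0, T] (EFin \o (fun t => (f \_ `]0, T[) t ^+ 2)).
Proof.
move=> f2; have [mf if2] := (L2_time f).1 f2.
have fin : (leb (`]0%R, T[%classic : set R) < +oo)%E.
  by rewrite [ltLHS]lebesgue_measure_itv/= lte_fin T0 ltry.
have if1 := @L2_int1 _ _ _ leb (`]0%R, T[%classic) (measurable_itv _) fin f f2.
have sub : `[0, T]%classic `&` `]0, T[%classic = `]0, T[%classic :> set R.
  by apply/setIidr; apply: subset_itv; rewrite bnd_simp.
split.
  by rewrite -restrict_EFin; apply/integrable_restrict => //; rewrite sub.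
have -> : (fun t => (f \_ `]0, T[) t ^+ 2) = (fun t => f t ^+ 2) \_ `]0, T[.
  by apply/funext => t; rewrite !patchE; case: ifPn => // _; rewrite expr0n.
by rewrite -restrict_EFin; apply/integrable_restrict => //; rewrite sub.
Qed.

End time_L2.

(** * The inverse problem on the domain *)

Unset Implicit Arguments.
Set Strict Implicit.
Set Printing Implicit Defensive.

Theorem theorem3p6 (R : realType) (d : nat) (Omega : set 'rV[R]_d) (T : R)
  (rho rho' eta kappa kappa' p : R -> 'rV[R]_d -> R) (f : R -> R)
  (u0 omega : 'rV[R]_d -> R) (m m' : R -> R)
  (rho_0 rho_1 rho'_1 eta_0 eta_1 kappa_0 kappa_1 kappa'_1 L_f zeta : R) :
  (0 < d)%N -> lipschitz_domain Omega -> 0 < T ->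
  in_C1 T (Loo_space Omega) rho rho' ->
  in_C0 T (H1_space Omega) rho ->
  0 < rho_0 ->
  (forall t, t \in `[0, T] -> {ae lebesgue_rV d, forall x, Omega x ->
    rho_0 <= rho t x <= rho_1 /\ `|rho' t x| <= rho'_1}) ->
  in_C0 T (Loo_space Omega) eta ->
  0 < eta_0 ->
  (forall t, t \in `[0, T] -> {ae lebesgue_rV d, forall x, Omega x ->
    eta_0 <= eta t x <= eta_1}) ->
  in_C1 T (Loo_space Omega) kappa kappa' ->
  0 < kappa_0 ->
  (forall t, t \in `[0, T] -> {ae lebesgue_rV d, forall x, Omega x ->
    kappa_0 <= kappa t x <= kappa_1 /\ `|kappa' t x| <= kappa'_1}) ->
  L_f.-lipschitz f ->
  in_H10 Omega u0 -> in_H10 Omega omega ->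
  in_C0 T (L2_space Omega) p ->
  {within [set` `[0, T]], continuous (pairing Omega p rho omega)} ->
  (forall t, t \in `[0, T] -> pairing Omega p rho omega t != 0) ->
  in_H1_time T m m' ->
  (sup_grad_weight Omega T rho omega < +oo)%E ->
  0 < zeta < 1 ->
  fine (C0_L2_norm Omega T p) ^+ 2 *
    ((fine (sup_grad_weight Omega T rho omega) ^+ 2 * eta_1 ^+ 2) /
     (4 * min_abs_pairing Omega T p rho omega ^+ 2 * eta_0 * rho_0)) < zeta ->
  exists (u : R -> 'rV[R]_d -> R) (h : R -> R),
    weak_solution Omega T rho rho' eta kappa f u0 omega p m' u h /\
    forall (v : R -> 'rV[R]_d -> R) (k : R -> R),
      weak_solution Omega T rho rho' eta kappa f u0 omega p m' v k ->
      (forall t, t \in `[0, T] ->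
         {ae lebesgue_rV d, forall x, Omega x -> v t x = u t x}) /\
      {ae lebesgue_measure, forall t, t \in `]0, T[ -> k t = h t}.
Proof.
move=> _ [oO bO _ _ _] T0 rC1 _ r00 rb eC0 e00 eb kC1 k00 kb fL u0H omH pC0 pwc pw0 [_ m'2 _] Mfin z01 small.
have mO := measurable_open oO; have finO := bounded_lebesgue_fin mO bO.
pose ip := L2ip (lebesgue_rV d) Omega; pose L2 := in_Lp (lebesgue_rV d) 2%:E Omega.
have pL2 : prehilbert L2 ip by exact: L2_prehilbert.
have cL2 : nrm_complete L2 ip by exact: L2_complete.
have gf := H10_gelfand oO bO; have pH1 := gf_pH gf; have cH1 := gf_cH gf.
have nX2 x : L2 x -> snorm (L2_space Omega) x = (nrm ip x)%:E by exact: L2_norm.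
have sX2 x : (0 <= snorm (L2_space Omega) x)%E by exact: Lnorm_ge0.
have nX1 x : in_H10 Omega x -> snorm (H10_space Omega) x = (nrm (h1ip Omega) x)%:E.
  by move=> Hx; exact: (H1_normE oO Hx.1).
have sX1 x : (0 <= snorm (H10_space Omega) x)%E by exact: Lnorm_ge0.
have [rC0 r'C0 _] := rC1; have rc := Loo_C0 rC0; have r'c := Loo_C0 r'C0.
have [kC0 _ _] := kC1; have kc := Loo_C0 kC0; have ec := Loo_C0 eC0.
(* [mult] asks for a nonnegative bound C, so the upper bounds enter through their absolute values;
   only the square of that of eta occurs in the smallness condition. *)
have absb (c0 y c1 : R) : 0 < c0 -> c0 <= y <= c1 -> `|y| <= `|c1|.
  move=> c00 /andP[h1 h2]; rewrite ger0_norm ?(le_trans (ltW c00) h1)//.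
  exact: le_trans h2 (ler_norm _).
have hr : mult T L2 ip rho_0 `|rho_1| (fun t g x => rho t x * g x).
  apply: bcont_mult => // t tT; apply: filterS (rb t tT) => x h Ox.
  have [h1 _] := h Ox; split; [by case/andP: h1|exact: absb h1].
have hr' : mult T L2 ip (- `|rho'_1|) `|rho'_1| (fun t g x => rho' t x * g x).
  apply: bcont_mult => // t tT; apply: filterS (rb t tT) => x h Ox.
  have [_ h1] := h Ox; have h2 := le_trans h1 (ler_norm _); split => //.
  by move: h2; rewrite ler_norml => /andP[].
have he : mult T L2 ip eta_0 `|eta_1| (fun t g x => eta t x * g x).
  apply: bcont_mult => // t tT; apply: filterS (eb t tT) => x h Ox.
  have h1 := h Ox; split; [by case/andP: h1|exact: absb h1].
have hk : mult T L2 ip kappa_0 `|kappa_1| (fun t g x => kappa t x * g x).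
  apply: bcont_mult => // t tT; apply: filterS (kb t tT) => x h Ox.
  have [h1 _] := h Ox; split; [by case/andP: h1|exact: absb h1].
have hdr x : L2 x -> cderiv T L2 ip (fun t y => rho t y * x y) (fun t y => rho' t y * x y).
  exact: cderiv_mul.
have fL' r s : `|f r - f s| <= L_f * `|r - s| by exact: (fL (r, s)).
have Lf0 : 0 <= L_f.
  have := fL' 1 0; rewrite subr0 normr1 mulr1; exact: le_trans.
have FL x : L2 x -> L2 (f \o x) by move=> x2; case: (lipschitz_comp oO bO Lf0 fL' x2 x2).
have Flip x y : L2 x -> L2 y -> nrm ip ((f \o x) - (f \o y)) <= L_f * nrm ip (x - y).
  by move=> x2 y2; case: (lipschitz_comp oO bO Lf0 fL' x2 y2).
have pc : ccont T L2 ip p by exact: (@in_C0P R _ T (L2_space Omega) ip pL2 nX2 p).1 pC0.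
have om2 : L2 omega by exact: H1_L2 omH.1.
pose wt := weight rho omega.
have rlow t : t \in `[0, T] -> {ae lebesgue_rV d, forall x, Omega x -> rho_0 <= rho t x}.
  by move=> tT; apply: filterS (rb t tT) => x h Ox; have [/andP[]] := h Ox.
have wtc : ccont T L2 ip wt.
  have -> : wt = fun t x => (rho t x)^-1 * omega x.
    by apply/funext => t; apply/funext => x; rewrite /wt /weight mulrC.
  exact: (ccont_mul oO (bcont_inv rc r00 rlow) (ccont_cst T pL2 om2)).
have qc : ccont T L2 ip (fun t x => omega x * rho' t x / rho t x).
  have -> : (fun t x => omega x * rho' t x / rho t x) = fun t x => rho' t x * wt t x.
    by apply/funext => t; apply/funext => x; rewrite /wt /weight mulrA [rho' t x * _]mulrC.
  exact: (ccont_mul oO r'c wtc).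
have z0 : 0 \in `[0, T] by rewrite in_itv/= lexx ltW.
pose G t i := grad Omega (wt t) i.
set M := fine (sup_grad_weight Omega T rho omega) in small.
have supM t : t \in `[0, T] -> (Lp_normv Omega (G t) <= M%:E)%E.
  have le t' : t' \in `[0, T] -> (Lp_normv Omega (G t') <= sup_grad_weight Omega T rho omega)%E.
    by move=> tT; apply: ereal_sup_ubound; exists t'.
  move=> tT; rewrite /M fineK; first exact: le.
  by rewrite ge0_fin_numE//; apply: le_trans (le 0 z0); exact: Lnorm_ge0.
have M0 : 0 <= M by rewrite -lee_fin; apply: le_trans (supM 0 z0); exact: Lnorm_ge0.
have GM2 t (tT : t \in `[0, T]) := Lp_normv_le oO (fun i => grad_measurable (wt t) i) M0 (supM t tT).
have GM t : t \in `[0, T] -> \sum_(i < d) nrm ip (G t i) ^+ 2 <= M ^+ 2.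
  by move=> tT; exact: (GM2 t tT).2.
have Gw i : wmeas T L2 ip (fun t => G t i).
  apply: (grad_wmeas oO bO wtc (M := M)) => t tT; split; first exact: (GM2 t tT).1.
  rewrite -(@ler_pXn2r _ 2)// ?nnegrE ?nrm_ge0//; apply: le_trans (GM t tT).
  by rewrite (bigD1 i)//= lerDl sumr_ge0// => j _; exact: sqr_ge0.
set wm := min_abs_pairing Omega T p rho omega in small.
have wbm t : t \in `[0, T] -> wm <= `|ip (p t) (wt t)|.
  move=> tT; apply: ge_inf; last by exists t.
  by exists 0 => _ [s _ <-].
(* Continuity makes the infimum a minimum, which is positive because the pairing does not vanish. *)
have wm0 : 0 < wm.
  have pwc' : {within `[0, T], continuous (fun t => `|pairing Omega p rho omega t|)}.
    by move=> t; apply: cvg_norm; exact: pwc.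
  have [c cT hc] := EVT_min (ltW T0) pwc'.
  apply: (@lt_le_trans _ _ `|pairing Omega p rho omega c|); first by rewrite normr_gt0 pw0.
  apply: lb_le_inf; first by exists `|pairing Omega p rho omega 0|, 0.
  by move=> _ [t tT <-]; exact: hc.
set P := fine (C0_L2_norm Omega T p) in small.
(* A continuous curve is bounded, so the supremum is finite and [fine] does not collapse it to 0. *)
have pP t : t \in `[0, T] -> nrm ip (p t) <= P.
  move=> tT; have [B B0 hB] := ccont_bound pL2 pc.
  have pE s : s \in `[0, T] -> Lp_norm (lebesgue_rV d) 2%:E Omega (p s) = (nrm ip (p s))%:E.
    by move=> sT; apply: (L2_norm mO); exact: pc.1.
  have le1 s : s \in `[0, T] -> ((nrm ip (p s))%:E <= C0_L2_norm Omega T p)%E.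
    by move=> sT; rewrite -pE//; apply: ereal_sup_ubound; exists s.
  rewrite -lee_fin /P fineK; first exact: le1.
  rewrite ge0_fin_numE; last by apply: le_trans (le1 0 z0); rewrite lee_fin nrm_ge0.
  apply: (@le_lt_trans _ _ B%:E); last exact: ltry.
  by apply: ge_ereal_sup => _ [s sT <-]; rewrite pE// lee_fin hB.
have small' : P ^+ 2 * ((M ^+ 2 * `|eta_1| ^+ 2) / (4 * wm ^+ 2 * eta_0 * rho_0)) < zeta.
  by rewrite real_normK ?num_real.
have [im im2] := L2_time_patch T0 m'2; set m0 := m' \_ _ in im im2.
have m0E t : t \in `]0, T[ -> m0 t = m' t by move=> tT; rewrite /m0 patchE mem_set.
have [u [a [b [h [[uc u00 ac bc pu] [[ih ih2 equ hform pru] uniq]]]]]] := core_main T0 gf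
  hr hr' he hk r00 e00 Lf0 FL Flip pc wtc qc (G := G) Gw M0 GM wm0 wbm pP z01 small' im im2 hdr u0H.
pose du t := a t + h t *: b t.
have Hdu t : t \in `[0, T] -> in_H10 Omega (du t).
  by move=> tT; apply: (phD pH1); [exact: ac.1|apply: (phZ pH1); exact: bc.1].
have ipv (A : R -> 'rV[R]_d -> R) (c C : R) (w z : 'rV[R]_d -> R) t :
    mult T L2 ip c C (fun t g x => A t x * g x) -> t \in `[0, T] -> in_H10 Omega w ->
    (forall i, L2 (grad Omega z i)) ->
    innerv Omega (fun i x => A t x * grad Omega w i x) (grad Omega z) =
    \sum_(i < d) ip (fun x => A t x * grad Omega w i x) (grad Omega z i).
  move=> hA tT Hw Lz; apply: innervE => // i.
  exact: (mu_L hA tT (gf_DL gf i Hw)).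
have Ly y i : in_H10 Omega y -> L2 (grad Omega y i) by move=> Hy; exact: (gf_DL gf i Hy).
have LG t i : t \in `[0, T] -> L2 (grad Omega (wt t) i) by move=> tT; exact: (GM2 t tT).1.
have u2 := ccV_cc2 gf uc; have a2 := ccV_cc2 gf ac; have b2 := ccV_cc2 gf bc.
have sub : (`]0, T[%classic : set R) `<=` `[0, T] by apply: subset_itv; rewrite bnd_simp.
exists u, h; split.
  split.
  - exact: (@in_C0P R _ T (H10_space Omega) (h1ip Omega) pH1 nX1 u).2 uc.
  - apply/L2_time; split; last by apply: integrableS ih2.
    by apply: measurable_funS (integrable_measurable ih).
  - have d2 := phB pL2 (u2.1 0 z0) (H1_L2 u0H.1).
    have n0 : nrm ip (u 0 - u0) = 0.
      apply/eqP; rewrite eq_le nrm_ge0 andbT.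
      by apply: le_trans (n2_le gf (phB pH1 (uc.1 0 z0) u0H)) _; rewrite u00.
    apply: filterS (L2_nrm_eq0 mO d2 n0) => x hx Ox.
    by apply/eqP; rewrite -subr_eq0; apply/eqP; exact: hx.
  (* The derivative of rho u is given by the product rule; regrouped as (rho' u + rho a) + h (rho
     b), it has again the form required by [weak_deriv_intro], now in L^2. *)
  exists du, (fun t => (fun x => rho' t x * u t x) + (fun x => rho t x * du t x)); split.
  - exact: (weak_deriv_intro (X := H10_space Omega) T0 pH1 cH1 nX1 sX1 uc ac bc ih pu).
  - exact: (L2_boch_intro (X := H10_space Omega) T0 pH1 nX1 ac bc ih ih2).
  - have ac' : ccont T L2 ip (fun t => (fun x => rho' t x * u t x) + (fun x => rho t x * a t x)).
      by apply: (ccontD pL2); [exact: (mu_cc hr' u2)|exact: (mu_cc hr a2)].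
    have bc' : ccont T L2 ip (fun t x => rho t x * b t x) by exact: (mu_cc hr b2).
    have E t : (fun x => rho' t x * u t x) + (fun x => rho t x * du t x) =
      ((fun x => rho' t x * u t x) + (fun x => rho t x * a t x)) + h t *: (fun x => rho t x * b t x).
      apply/funext => x.
      rewrite -[LHS]/(rho' t x * u t x + rho t x * (a t x + h t * b t x)).
      rewrite -[RHS]/(rho' t x * u t x + rho t x * a t x + h t * (rho t x * b t x)).
      by ring.
    rewrite (_ : (fun t => _ + _) = fun t => ((fun x => rho' t x * u t x) +
        (fun x => rho t x * a t x)) + h t *: (fun x => rho t x * b t x)); last exact/funext/E.
    apply: (weak_deriv_intro (X := L2_space Omega) T0 pL2 cL2 nX2 sX2 (mu_cc hr u2) ac' bc' ih).
    move=> y s t L2y s0 st tT; rewrite (pru y s t L2y s0 st tT).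
    by apply: eq_Rintegral => r _; rewrite -E.
  apply: aeW => t tT; have tT' := mem_oo_cc tT; split.
    move=> phi Hphi; have Lphi i := Ly phi i Hphi.
    rewrite (ipv eta _ _ _ _ t he tT' (Hdu t tT') Lphi).
    rewrite (ipv kappa _ _ _ _ t hk tT' (uc.1 t tT') Lphi).
    exact: (equ t phi tT' Hphi).
  have LGt i := LG t i tT'.
  rewrite (ipv eta _ _ _ _ t he tT' (Hdu t tT') LGt).
  rewrite (ipv kappa _ _ _ _ t hk tT' (uc.1 t tT') LGt) -(m0E t tT).
  exact: (hform t tT').
move=> v k [vC0 k2 v0 [dv [drv [wd1 bo1 wd2 aev]]]].
have vc : ccont T (in_H10 Omega) (h1ip Omega) v.
  exact: (@in_C0P R _ T (H10_space Omega) (h1ip Omega) pH1 nX1 v).1 vC0.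
have [w [g [wi vw pv fam]]] := weak_deriv_elim (X := H10_space Omega) T0 pH1 nX1 sX1 vc wd1 bo1.
have [[Hw _] _ _] := wi; have v2 := ccV_cc2 gf vc.
have [ik _] := L2_time_patch T0 k2; set k0 := k \_ _ in ik.
have k0E t : t \in `]0, T[ -> k0 t = k t by move=> tT; rewrite /k0 patchE mem_set.
(* The initial condition holds only almost everywhere in x, yet it determines the class in H^1. *)
have v00 : nrm (h1ip Omega) (v 0 - u0) = 0.
  exact: (H10_ae oO bO (vc.1 0 z0) (L2_measurable (H1_L2 u0H.1)) v0).2.
have aew : {ae @lebesgue_measure R, forall t, t \in `]0, T[ ->
    (forall phi, in_H10 Omega phi -> ip (drv t) phi
      + \sum_(i < d) ip (fun x => eta t x * grad Omega (w t) i x) (grad Omega phi i)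
      + \sum_(i < d) ip (fun x => kappa t x * grad Omega (v t) i x) (grad Omega phi i)
      = k0 t * ip (p t) phi + ip (f \o v t) phi) /\
    k0 t = (ip (p t) (wt t))^-1 * (m0 t + ip (v t) (fun x => omega x * rho' t x / rho t x)
      + \sum_(i < d) ip (fun x => eta t x * grad Omega (w t) i x) (G t i)
      + \sum_(i < d) ip (fun x => kappa t x * grad Omega (v t) i x) (G t i)
      - ip (f \o v t) (wt t))}.
  apply: leb_aeS2 aev vw => t h1 h2 tT; have tT' := mem_oo_cc tT.
  have [h3 h4] := h1 tT; rewrite (h2 tT) in h3 h4; rewrite (k0E t tT) (m0E t tT); split.
    move=> phi Hphi; have Lphi i := Ly phi i Hphi; have := h3 phi Hphi.
    rewrite (ipv eta _ _ _ _ t he tT' (Hw t tT') Lphi).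
    by rewrite (ipv kappa _ _ _ _ t hk tT' (vc.1 t tT') Lphi).
  have LGt i := LG t i tT'; move: h4.
  rewrite (ipv eta _ _ _ _ t he tT' (Hw t tT') LGt).
  by rewrite (ipv kappa _ _ _ _ t hk tT' (vc.1 t tT') LGt).
have [|||vu kh] := uniq v w g k0 vc v00 wi pv ik.
- exact: fam.
(* The definition of a solution puts no integrability on the derivative of rho v. The weak equation
   expresses its pairing with y, almost everywhere in time, by an integrable function, whose
   integral is then the increment of (rho v, y). *)
- move=> y Hy s t s0 st tT.
  have iK := core_rhs_int T0 gf he hk Lf0 FL Flip pc vc wi ik Hy.
  apply: (weak_deriv_scalar (X := L2_space Omega) T0 pL2 nX2 sX2 (mu_cc hr v2) wd2
    (gf_HL gf Hy) iK _ s0 st tT).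
  apply: leb_aeS aew => r h1 rT; have [h2 _] := h1 rT; rewrite -(h2 y Hy).
  by rewrite -[LHS]addrA -opprD -[X in X - _]addrA; exact: addrK.
- by apply: leb_aeS aew => r h1 rT; case: (h1 rT).
split; last by apply: leb_aeS kh => t h1 tT; rewrite -(k0E t tT) h1.
move=> t tT; have d2 := phB pL2 (v2.1 t tT) (u2.1 t tT).
have n0 : nrm ip (v t - u t) = 0.
  apply/eqP; rewrite eq_le nrm_ge0 andbT.
  by apply: le_trans (n2_le gf (phB pH1 (vc.1 t tT) (uc.1 t tT))) _; rewrite vu.
apply: filterS (L2_nrm_eq0 mO d2 n0) => x hx Ox.
by apply/eqP; rewrite -subr_eq0; apply/eqP; exact: hx.
Qed.
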